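(* For any open chain linkage $\mathcal L$, the space $\mathrm{NCConf}_0(\mathcal L)$ of noncrossing configurations is connected. For any closed chain linkage $\mathcal L$, $\mathrm{NCConf}_0(\mathcal L)$ has at most two connected components.
   Context: A linkage is a pair $\mathcal L=(G,\ell)$ with $G=(V,E)$ a finite graph and $\ell:E\to\mathbb R_{\ge0}$ (edges are bars; zero lengths allowed). It is an open chain if $G$ is a path and a closed chain if $G$ is a cycle. A configuration is a map $C:V\to\mathbb R^2$ with $|C(v)-C(w)|=\ell(v,w)$ for every bar; $\mathrm{Conf}_0(\mathcal L)$ is the set of configurations. Two linkages $(G_1,\ell_1),(G_2,\ell_2)$ are $\epsilon$-related if $G_1=G_2$ and $|\ell_1(e)-\ell_2(e)|\le\epsilon$ for all $e$. A configuration $C$ of a linkage $\mathcal L'=(G,\ell')$ is nontouching if no two bars intersect except at endpoints, and two vertices have the same position iff they are joined in $G$ by a path of bars of $\ell'$-length zero (such vertices are regarded as merged). $\mathrm{NConf}_\epsilon(\mathcal L)$ is the set of nontouching configurations of linkages $\epsilon$-related to $\mathcal L$. Order function: for oriented segments $e_1,e_2$, in coordinates where $e_1$ runs from $(0,0)$ to $(l,0)$, $d_\pm(e_1,e_2)=\mathrm{len}\{x\in[0,l]:\exists y,\ \pm y\ge0,\ (x,y)\in e_2\}$ and $\mathrm{Ord}(e_1,e_2)=d_+-d_-$. Edges carry fixed canonical orientations; $\mathrm{Annot}_{\mathcal L}(C)=(C,A)$ with $A_{i,j}=\mathrm{Ord}(C(e_i),C(e_j))$. Noncrossing configurations: $\mathrm{NCConf}_0(\mathcal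 L)=\big(\mathrm{Conf}_0(\mathcal L)\times\mathbb R^{E\times E}\big)\cap\overline{\mathrm{Annot}_{\mathcal L}(\mathrm{NConf}_1(\mathcal L))}$, the closure taken in $(\mathbb R^2)^V\times\mathbb R^{E\times E}$ with its usual topology. *)

(* Defs.v *)
From Stdlib Require Import Reals Relations ClassicalEpsilon Arith.
Open Scope R_scope.

(* Vertices are 0..nV-1, edges are 0..nE-1; edge k joins src k to tgt k
   and carries the fixed canonical orientation src k -> tgt k. *)
Record lgraph := LGraph { nV : nat; nE : nat; src : nat -> nat; tgt : nat -> nat }.

Definition open_chain (n : nat) : lgraph := LGraph (S n) n (fun k => k) (fun k => S k).
Definition closed_chain (n : nat) : lgraph :=
  LGraph n n (fun k => k) (fun k => (S k) mod n).

Definition pt := (R * R)%type.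

Definition dist (p q : pt) : R :=
  sqrt ((fst p - fst q) ^ 2 + (snd p - snd q) ^ 2).

Definition on_seg (a b z : pt) : Prop :=
  exists t, 0 <= t <= 1 /\
    z = (fst a + t * (fst b - fst a), snd a + t * (snd b - snd a)).

(* ---------- Length of a subset of R ----------
   The sets measured below are always intervals, for which Lebesgue measure
   equals the diameter sup{x - y | x,y in S} (0 for the empty set). *)
Definition len (S : R -> Prop) : R :=
  epsilon (inhabits 0)
    (fun d => is_lub (fun r => r = 0 \/ exists x y, S x /\ S y /\ r = x - y) d).

(* ---------- The order function ----------
   e1 = (p,q), e2 = (a,b). In coordinates where e1 runs from (0,0) to (l,0)
   (orientation-preserving), z has coordinates
   x(z) = (z-p).u, y(z) = (z-p).w, u = (q-p)/l, w = u rotated by +90 deg. *)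
Definition xcoord (p q z : pt) : R :=
  ((fst z - fst p) * (fst q - fst p) + (snd z - snd p) * (snd q - snd p)) / dist p q.
Definition ycoord (p q z : pt) : R :=
  ((fst q - fst p) * (snd z - snd p) - (snd q - snd p) * (fst z - fst p)) / dist p q.

Definition dpm (sgn : R) (p q a b : pt) : R :=
  len (fun x => 0 <= x <= dist p q /\
         exists z, on_seg a b z /\ xcoord p q z = x /\ 0 <= sgn * ycoord p q z).

(* When l = 0 the interval [0,l] is {0}, of length 0. *)
Definition Ord (p q a b : pt) : R :=
  if Req_EM_T (dist p q) 0 then 0 else dpm 1 p q a b - dpm (-1) p q a b.

Definition Conf0 (G : lgraph) (l : nat -> R) (C : nat -> pt) : Prop :=
  (forall i, (nV G <= i)%nat -> C i = (0, 0)) /\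
  (forall k, (k < nE G)%nat -> dist (C (src G k)) (C (tgt G k)) = l k).

Definition zero_adj (G : lgraph) (l : nat -> R) (v w : nat) : Prop :=
  exists k, (k < nE G)%nat /\ l k = 0 /\
    ((src G k = v /\ tgt G k = w) \/ (src G k = w /\ tgt G k = v)).
Definition zero_conn (G : lgraph) (l : nat -> R) : relation nat :=
  clos_refl_trans nat (zero_adj G l).

Definition nontouching (G : lgraph) (l : nat -> R) (C : nat -> pt) : Prop :=
  (forall k m, (k < nE G)%nat -> (m < nE G)%nat -> k <> m ->
     forall z, on_seg (C (src G k)) (C (tgt G k)) z ->
               on_seg (C (src G m)) (C (tgt G m)) z ->
       (z = C (src G k) \/ z = C (tgt G k)) /\
       (z = C (src G m) \/ z = C (tgt G m))) /\
  (forall v w, (v < nV G)%nat -> (w < nV G)%nat ->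
     (C v = C w <-> zero_conn G l v w)).

Definition NConf (eps : R) (G : lgraph) (l : nat -> R) (C : nat -> pt) : Prop :=
  exists l' : nat -> R,
    (forall k, (k < nE G)%nat -> 0 <= l' k /\ Rabs (l' k - l k) <= eps) /\
    Conf0 G l' C /\ nontouching G l' C.

(* ---------- The ambient space (R^2)^V x R^{E x E} ----------
   Represented by pairs (C, A); coordinates outside V (resp. E x E) are 0. *)
Definition space := ((nat -> pt) * (nat -> nat -> R))%type.

Definition Annot (G : lgraph) (C : nat -> pt) : space :=
  (C, fun k m => if andb (Nat.ltb k (nE G)) (Nat.ltb m (nE G))
                 then Ord (C (src G k)) (C (tgt G k)) (C (src G m)) (C (tgt G m))
                 else 0).

(* sup-metric ball on the finitely many relevant coordinates
   (generates the usual product topology) *)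
Definition near (G : lgraph) (eps : R) (P Q : space) : Prop :=
  (forall i, (i < nV G)%nat ->
     Rabs (fst (fst P i) - fst (fst Q i)) < eps /\
     Rabs (snd (fst P i) - snd (fst Q i)) < eps) /\
  (forall k m, (k < nE G)%nat -> (m < nE G)%nat ->
     Rabs (snd P k m - snd Q k m) < eps).

Definition closure (G : lgraph) (S : space -> Prop) (P : space) : Prop :=
  forall eps, 0 < eps -> exists Q, S Q /\ near G eps P Q.

Definition is_open (G : lgraph) (U : space -> Prop) : Prop :=
  forall P, U P -> exists eps, 0 < eps /\ forall Q, near G eps P Q -> U Q.

Definition connected (G : lgraph) (S : space -> Prop) : Prop :=
  ~ exists U V, is_open G U /\ is_open G V /\
      (forall P, S P -> U P \/ V P) /\
      (exists P, S P /\ U P) /\ (exists P, S P /\ V P) /\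
      (forall P, S P -> U P -> V P -> False).

(* S has at most two connected components: among any three points of S,
   two lie in a common connected subset of S (i.e. in the same component). *)
Definition at_most_two_components (G : lgraph) (S : space -> Prop) : Prop :=
  forall P1 P2 P3, S P1 -> S P2 -> S P3 ->
    exists T : space -> Prop, (forall P, T P -> S P) /\ connected G T /\
      ((T P1 /\ T P2) \/ (T P2 /\ T P3) \/ (T P1 /\ T P3)).

Definition NCConf0 (G : lgraph) (l : nat -> R) (P : space) : Prop :=
  Conf0 G l (fst P) /\
  (forall k m, ((nE G <= k)%nat \/ (nE G <= m)%nat) -> snd P k m = 0) /\
  closure G (fun Q => exists C, NConf 1 G l C /\ Q = Annot G C) P.

(* Main.v *)
(** Fix a chain and let [e] tend to 0. The space [NCConf0] is compact up to translations, so by compactness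
    it is enough to join nontouching configurations whose lengths are within [e] of [l] by finite
    sequences of such configurations with annotated steps smaller than [e]. Merged vertices may first be
    separated slightly, so that all bars have positive length.

    Minimise over the class of configurations reachable by such sequences an energy which penalises
    changes of bar lengths and contains the elliptic barrier 1/(|va|+|vb|-|ab|) for every vertex [v] off a
    bar [ab]. Since lengths are allowed to vary, the minimiser is a critical point, and the gradient
    of the energy is an equilibrium stress which is repulsive on all pairs not joined by a bar.
    Its Maxwell-Cremona lifting (the torque about a point of the stresses crossing an upward ray) is
    piecewise linear, vanishes far away and is locally convex off the bars and along the bars. A positive
    maximum would sit at a vertex and contradict the presence of only two bars there; so the lifting is
    nonpositive and vanishes at hull vertices, where its second differences force all other vertices into
    the angle of the two incident bars. Hence an open chain is straight and a closed chain is a convex polygon.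

    Straight chains are joined directly. A convex polygon is given by its edge lengths and its cyclically
    ordered edge directions, a tuple on the projective line modulo the affine maps [t |-> (t-x)/y]
    fixing the first direction. Lengths and directions are interpolated linearly, and for each tuple
    there is exactly one affine map for which the polygon closes up (a conformal barycentre). *)
From Stdlib Require Import Reals Lra Lia Psatz Arith ClassicalEpsilon Classical Relations.
Require Import Defs.
Open Scope R_scope.

(** * Finite sums and real sequences *)

(** [Ord] can jump when bars come to overlap, so no path inside [NCConf0] is built: steps are taken
    between simple configurations, where [Ord] is continuous, and only limits with vanishing error
    land in [NCConf0]. Compactness turns such finite sequences into connectedness.

    The barrier has this form because its gradient repels [v] from [a] and [b] and attracts only the
    pair [ab], which is a bar, where a stress of either sign is harmless.

    Stereographic coordinates centred at the first edge direction turn the cyclic order of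
    directions into a chain of linear inequalities, which linear interpolation preserves. Closing up
    is two equations, matched by the two parameters of the affine group. That each length is less
    than half of the perimeter is exactly what makes them solvable, and this condition is convex as
    well. The two orientations of a convex polygon account for the two components. *)

Lemma choice (A B : Type) (P : A -> B -> Prop) :
  (forall x, exists y, P x y) -> exists f, forall x, P x (f x).
Proof.
  intros H. exists (fun x => proj1_sig (constructive_indefinite_description _ (H x))).
  intros x. exact (proj2_sig (constructive_indefinite_description _ (H x))).
Qed.

Fixpoint Rsum (n : nat) (f : nat -> R) : R :=
  match n with O => 0 | S k => Rsum k f + f k end.

Lemma Rsum_ext n f g : (forall i, (i < n)%nat -> f i = g i) -> Rsum n f = Rsum n g.
Proof.
  induction n as [|n IH]; intros H; simpl; [reflexivity|].
  rewrite IH, H; auto.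
Qed.

Lemma Rsum_0 n f : (forall i, (i < n)%nat -> f i = 0) -> Rsum n f = 0.
Proof.
  induction n as [|n IH]; intros H; simpl; [reflexivity|].
  rewrite IH, H; auto; lra.
Qed.

Lemma Rsum_plus n f g : Rsum n (fun i => f i + g i) = Rsum n f + Rsum n g.
Proof. induction n as [|n IH]; simpl; [|rewrite IH]; lra. Qed.

Lemma Rsum_minus n f g : Rsum n (fun i => f i - g i) = Rsum n f - Rsum n g.
Proof. induction n as [|n IH]; simpl; [|rewrite IH]; lra. Qed.

Lemma Rsum_scal n c f : Rsum n (fun i => c * f i) = c * Rsum n f.
Proof. induction n as [|n IH]; simpl; [|rewrite IH]; lra. Qed.

Lemma Rsum_le n f g : (forall i, (i < n)%nat -> f i <= g i) -> Rsum n f <= Rsum n g.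
Proof.
  induction n as [|n IH]; intros H; simpl; [lra|].
  assert (Rsum n f <= Rsum n g) by (apply IH; auto).
  assert (f n <= g n) by auto. lra.
Qed.

Lemma Rsum_nonneg n f : (forall i, (i < n)%nat -> 0 <= f i) -> 0 <= Rsum n f.
Proof.
  intros H. rewrite <- (Rsum_0 n (fun _ => 0)) by auto. now apply Rsum_le.
Qed.

Lemma Rsum_term_le n f i0 : (forall i, (i < n)%nat -> 0 <= f i) -> (i0 < n)%nat ->
  f i0 <= Rsum n f.
Proof.
  induction n as [|n IH]; intros H Hi; simpl; [lia|].
  assert (0 <= f n) by auto.
  destruct (Nat.eq_dec i0 n) as [->|Hn].
  - assert (0 <= Rsum n f) by (apply Rsum_nonneg; auto). lra.
  - assert (f i0 <= Rsum n f) by (apply IH; auto; lia). lra.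
Qed.

Lemma Rsum_pos n f i0 : (forall i, (i < n)%nat -> 0 <= f i) -> (i0 < n)%nat ->
  0 < f i0 -> 0 < Rsum n f.
Proof. intros H Hi Hp. pose proof (Rsum_term_le n f i0 H Hi). lra. Qed.

Lemma Rsum_single n f i0 : (i0 < n)%nat ->
  (forall i, (i < n)%nat -> i <> i0 -> f i = 0) -> Rsum n f = f i0.
Proof.
  induction n as [|n IH]; intros Hi H; simpl; [lia|].
  destruct (Nat.eq_dec i0 n) as [->|Hn].
  - rewrite Rsum_0; [lra|]. intros i Hi'. apply H; lia.
  - rewrite IH; [|lia|intros; apply H; lia]. rewrite (H n); [lra|lia|auto].
Qed.

Lemma Rsum_swap n m (f : nat -> nat -> R) :
  Rsum n (fun i => Rsum m (fun j => f i j)) = Rsum m (fun j => Rsum n (fun i => f i j)).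
Proof.
  induction n as [|n IH]; simpl.
  - symmetry. now apply Rsum_0.
  - rewrite IH, <- Rsum_plus. reflexivity.
Qed.

Lemma Rsum_antisym n (f : nat -> nat -> R) :
  (forall i j, (i < n)%nat -> (j < n)%nat -> f i j = - f j i) ->
  Rsum n (fun i => Rsum n (fun j => f i j)) = 0.
Proof.
  intros H.
  assert (E : Rsum n (fun i => Rsum n (fun j => f i j)) =
    - Rsum n (fun i => Rsum n (fun j => f i j))).
  { rewrite Rsum_swap at 1.
    replace (- Rsum n (fun i => Rsum n (fun j => f i j)))
      with ((-1) * Rsum n (fun i => Rsum n (fun j => f i j))) by lra.
    rewrite <- Rsum_scal. apply Rsum_ext; intros i Hi.
    rewrite <- Rsum_scal. apply Rsum_ext; intros j Hj. rewrite H by auto. lra. }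
  lra.
Qed.

Lemma Rsum_cv n (u : nat -> nat -> R) (L : nat -> R) :
  (forall i, (i < n)%nat -> Un_cv (fun k => u k i) (L i)) ->
  Un_cv (fun k => Rsum n (u k)) (Rsum n L).
Proof.
  induction n as [|n IH]; intros H; simpl.
  - intros e He. exists O. intros. unfold Rdist. rewrite Rminus_diag, Rabs_R0. lra.
  - apply (CV_plus (fun k => Rsum n (u k)) (fun k => u k n)); auto.
Qed.

Lemma Rsum_derivable n (u : nat -> R -> R) (L : nat -> R) x :
  (forall i, (i < n)%nat -> derivable_pt_lim (u i) x (L i)) ->
  derivable_pt_lim (fun t => Rsum n (fun i => u i t)) x (Rsum n L).
Proof.
  induction n as [|n IH]; intros H; simpl.
  - apply derivable_pt_lim_const.
  - apply (derivable_pt_lim_plus (fun t => Rsum n (fun i => u i t)) (u n)); auto.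
Qed.

(** * Eventual properties, subsequences and limits *)

Definition ev (P : nat -> Prop) : Prop := exists N, forall n, (N <= n)%nat -> P n.

Lemma ev_and P Q : ev P -> ev Q -> ev (fun n => P n /\ Q n).
Proof.
  intros [N HN] [M HM]. exists (max N M). intros n Hn. split; [apply HN|apply HM]; lia.
Qed.

Lemma ev_mono (P Q : nat -> Prop) : (forall n, P n -> Q n) -> ev P -> ev Q.
Proof. intros H [N HN]. exists N. auto. Qed.

Lemma ev_exists P : ev P -> exists n, P n.
Proof. intros [N HN]. exists N. auto. Qed.

Lemma ev_forall m (P : nat -> nat -> Prop) :
  (forall i, (i < m)%nat -> ev (P i)) -> ev (fun k => forall i, (i < m)%nat -> P i k).
Proof.
  induction m as [|m IH]; intros H.
  - exists O. intros. lia.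
  - assert (E1 : ev (fun k => forall i, (i < m)%nat -> P i k)) by (apply IH; auto).
    assert (E2 : ev (P m)) by auto.
    apply (ev_mono _ _ (fun k H => H)) in E1. generalize (ev_and _ _ E1 E2).
    apply ev_mono. intros k [A B] i Hi. destruct (Nat.eq_dec i m) as [->|]; auto.
    apply A; lia.
Qed.

Lemma not_ev P : ~ ev P -> forall N, exists n, (N <= n)%nat /\ ~ P n.
Proof.
  intros H N. apply NNPP; intros C. apply H. exists N. intros n Hn.
  apply NNPP; intros D. apply C. exists n; auto.
Qed.

Definition extr (phi : nat -> nat) : Prop := forall n, (phi n < phi (S n))%nat.

Lemma extr_ge phi : extr phi -> forall n, (n <= phi n)%nat.
Proof. intros H n. induction n as [|n IH]; [lia|]. specialize (H n). lia. Qed.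

Lemma extr_lt phi : extr phi -> forall n m, (n < m)%nat -> (phi n < phi m)%nat.
Proof.
  intros H n m Hm. induction Hm as [|m Hm IH]; [apply H|]. specialize (H m). lia.
Qed.

Lemma extr_comp phi psi : extr phi -> extr psi -> extr (fun n => phi (psi n)).
Proof. intros H1 H2 n. apply extr_lt; auto. Qed.

Lemma not_ev_extr P : ~ ev P -> exists phi, extr phi /\ forall n, ~ P (phi n).
Proof.
  intros H. pose proof (not_ev P H) as H'.
  destruct (choice _ _ (fun N n => (N <= n)%nat /\ ~ P n) H') as [g Hg].
  exists (fix phi n := match n with O => g O | S k => g (S (phi k)) end).
  split.
  - intros n. simpl. destruct (Hg (S ((fix phi n := match n with O => g O | S k => g (S (phi k)) end) n))). lia.
  - intros [|n]; apply Hg.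
Qed.

Lemma cv_subseq u l phi : extr phi -> Un_cv u l -> Un_cv (fun n => u (phi n)) l.
Proof.
  intros H Hu e He. destruct (Hu e He) as [N HN]. exists N. intros n Hn. apply HN.
  pose proof (extr_ge phi H n). lia.
Qed.

Lemma cv_const c : Un_cv (fun _ => c) c.
Proof. intros e He. exists O. intros. unfold Rdist. rewrite Rminus_diag, Rabs_R0. lra. Qed.

Lemma cv_ev u l e : Un_cv u l -> 0 < e -> ev (fun n => Rabs (u n - l) < e).
Proof. intros H He. destruct (H e He) as [N HN]. exists N. exact HN. Qed.

Lemma cv_intro u l : (forall e, 0 < e -> ev (fun n => Rabs (u n - l) < e)) -> Un_cv u l.
Proof. intros H e He. destruct (H e He) as [N HN]. exists N. exact HN. Qed.

Lemma cv_ext u v l : (forall n, u n = v n) -> Un_cv u l -> Un_cv v l.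
Proof. intros E H e He. destruct (H e He) as [N HN]. exists N. intros. rewrite <- E. auto. Qed.

Lemma cv_ev_lt u l c : Un_cv u l -> l < c -> ev (fun n => u n < c).
Proof.
  intros H Hc. generalize (cv_ev u l (c - l) H ltac:(lra)). apply ev_mono.
  intros n Hn. apply Rabs_def2 in Hn. lra.
Qed.

Lemma cv_ev_gt u l c : Un_cv u l -> c < l -> ev (fun n => c < u n).
Proof.
  intros H Hc. generalize (cv_ev u l (l - c) H ltac:(lra)). apply ev_mono.
  intros n Hn. apply Rabs_def2 in Hn. lra.
Qed.

Lemma cv_le_ev u v l m : Un_cv u l -> Un_cv v m -> ev (fun n => u n <= v n) -> l <= m.
Proof.
  intros Hu Hv He. apply Rnot_lt_le; intros C.
  pose proof (cv_ev_gt u l ((l + m) / 2) Hu ltac:(lra)) as A.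
  pose proof (cv_ev_lt v m ((l + m) / 2) Hv ltac:(lra)) as B.
  destruct (ev_exists _ (ev_and _ _ He (ev_and _ _ A B))) as [n [? [? ?]]]. lra.
Qed.

Lemma cv_le u v l m : Un_cv u l -> Un_cv v m -> (forall n, u n <= v n) -> l <= m.
Proof. intros. eapply cv_le_ev; eauto. exists O; auto. Qed.

Lemma cv_squeeze0 u v l : Un_cv v 0 -> ev (fun n => Rabs (u n - l) <= v n) -> Un_cv u l.
Proof.
  intros Hv H. apply cv_intro. intros e He.
  generalize (ev_and _ _ H (cv_ev v 0 e Hv He)). apply ev_mono.
  intros n [A B]. apply Rabs_def2 in B. lra.
Qed.

Lemma cv_sqrt u l : (0 <= l) -> Un_cv u l -> Un_cv (fun n => sqrt (u n)) (sqrt l).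
Proof. intros Hl H. apply continuity_seq; auto. now apply continuity_pt_sqrt. Qed.

Lemma cv_inv u l : l <> 0 -> Un_cv u l -> Un_cv (fun n => / u n) (/ l).
Proof.
  intros Hl H. apply (continuity_seq Rinv); auto.
  apply (continuity_pt_inv (fun x => x)); auto. apply derivable_continuous_pt, derivable_pt_id.
Qed.

Lemma cv_abs u l : Un_cv u l -> Un_cv (fun n => Rabs (u n)) (Rabs l).
Proof. intros H. apply (continuity_seq Rabs); auto. apply Rcontinuity_abs. Qed.

Lemma Rmax_abs a b : Rmax a b = (a + b + Rabs (a - b)) / 2.
Proof. unfold Rmax, Rabs. destruct (Rle_dec a b), (Rcase_abs (a - b)); lra. Qed.

Lemma Rmin_abs a b : Rmin a b = (a + b - Rabs (a - b)) / 2.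
Proof. unfold Rmin, Rabs. destruct (Rle_dec a b), (Rcase_abs (a - b)); lra. Qed.

Lemma cv_max u v l m : Un_cv u l -> Un_cv v m -> Un_cv (fun n => Rmax (u n) (v n)) (Rmax l m).
Proof.
  intros Hu Hv. rewrite Rmax_abs.
  apply (cv_ext (fun n => (u n + v n + Rabs (u n - v n)) / 2)).
  { intros; now rewrite Rmax_abs. }
  apply (CV_mult (fun n => u n + v n + Rabs (u n - v n)) (fun _ => / 2)); [|apply cv_const].
  apply (CV_plus (fun n => u n + v n)); [now apply CV_plus|].
  apply (cv_abs (fun n => u n - v n)). now apply CV_minus.
Qed.

Lemma cv_min u v l m : Un_cv u l -> Un_cv v m -> Un_cv (fun n => Rmin (u n) (v n)) (Rmin l m).
Proof.
  intros Hu Hv. rewrite Rmin_abs.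
  apply (cv_ext (fun n => (u n + v n - Rabs (u n - v n)) / 2)).
  { intros; now rewrite Rmin_abs. }
  apply (CV_mult (fun n => u n + v n - Rabs (u n - v n)) (fun _ => / 2)); [|apply cv_const].
  apply (CV_minus (fun n => u n + v n)); [now apply CV_plus|].
  apply (cv_abs (fun n => u n - v n)). now apply CV_minus.
Qed.

Lemma cv_inv_S : Un_cv (fun n => / INR (S n)) 0.
Proof.
  apply cv_intro. intros e He. destruct (archimed_cor1 e He) as [N [H1 H2]].
  exists N. intros n Hn. rewrite Rminus_0_r, Rabs_pos_eq.
  2: { left. apply Rinv_0_lt_compat. apply lt_0_INR. lia. }
  apply Rle_lt_trans with (/ INR N); auto.
  apply Rinv_le_contravar; [apply lt_0_INR; lia|]. apply le_INR. lia.
Qed.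

(* Goals [Un_cv (fun k => e k) e'] where [e'] is [e] with sequences replaced by limits. *)
Ltac cvt :=
  repeat (cbv beta; first
    [ eassumption
    | apply cv_const
    | apply CV_plus | apply CV_minus | apply CV_mult | apply CV_opp
    | apply cv_max | apply cv_min | apply cv_abs ]).

(** * Compactness: convergent subsequences, connectedness of the interval, maxima *)

Lemma BW1 (u : nat -> R) B : (forall n, Rabs (u n) <= B) ->
  exists phi l, extr phi /\ Un_cv (fun n => u (phi n)) l.
Proof.
  intros H.
  destruct (Bolzano_Weierstrass u (fun x => -B <= x <= B) (compact_P3 (-B) B)) as [l Hl].
  { intros n. specialize (H n). unfold Rabs in H; destruct (Rcase_abs (u n)); lra. }
  assert (G : forall N, exists n, (N <= n)%nat /\ Rabs (u n - l) < / INR (S N)).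
  { intros N.
    assert (Hp : 0 < / INR (S N)) by (apply Rinv_0_lt_compat, lt_0_INR; lia).
    destruct (Hl (fun x => Rabs (x - l) < / INR (S N)) N) as [p [Hp1 Hp2]].
    - exists (mkposreal _ Hp). intros x Hx. exact Hx.
    - exists p; auto. }
  destruct (choice _ _ _ G) as [g Hg].
  pose (phi := fix phi n := match n with O => g O | S k => g (S (phi k)) end).
  exists phi, l.
  assert (He : extr phi).
  { intros n. simpl. destruct (Hg (S (phi n))). unfold phi in *. lia. }
  split; auto.
  apply (cv_squeeze0 _ (fun n => / INR (S n))); [apply cv_inv_S|].
  exists O. intros n _. left.
  destruct n as [|n]; [apply Hg|]. 
  change (phi (S n)) with (g (S (phi n))).
  destruct (Hg (S (phi n))) as [_ A]. eapply Rlt_le_trans; [exact A|].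
  apply Rinv_le_contravar; [apply lt_0_INR; lia|]. apply le_INR.
  pose proof (extr_ge phi He n). lia.
Qed.

Lemma BW_family n (f : nat -> nat -> R) B :
  (forall k i, (i < n)%nat -> Rabs (f k i) <= B) ->
  exists phi L, extr phi /\ forall i, (i < n)%nat -> Un_cv (fun k => f (phi k) i) (L i).
Proof.
  induction n as [|n IH]; intros H.
  - exists (fun k => k), (fun _ => 0). split; [intros k; lia|]. intros; lia.
  - destruct IH as [phi [L [He HL]]]; [intros; apply H; lia|].
    destruct (BW1 (fun k => f (phi k) n) B) as [psi [l [Hp Hl]]]; [intros; apply H; lia|].
    exists (fun k => phi (psi k)), (fun i => if Nat.eq_dec i n then l else L i).
    split; [now apply extr_comp|]. intros i Hi.
    destruct (Nat.eq_dec i n) as [->|Hn]; [exact Hl|].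
    apply (cv_subseq (fun k => f (phi k) i) (L i) psi); auto. apply HL. lia.
Qed.

Lemma finite_pos_min n (f : nat -> R) : (forall i, (i < n)%nat -> 0 < f i) ->
  exists r, 0 < r /\ forall i, (i < n)%nat -> r <= f i.
Proof.
  induction n as [|n IH]; intros H.
  - exists 1. split; [lra|]. intros; lia.
  - destruct IH as [r [Hr1 Hr2]]; [intros; apply H; lia|].
    exists (Rmin r (f n)). split.
    + apply Rmin_glb_lt; auto.
    + intros i Hi. destruct (Nat.eq_dec i n) as [->|]; [apply Rmin_r|].
      eapply Rle_trans; [apply Rmin_l|]. apply Hr2; lia.
Qed.

Lemma finite_max n (f : nat -> R) : exists B, 0 <= B /\ forall i, (i < n)%nat -> f i <= B.
Proof.
  induction n as [|n IH].
  - exists 0. split; [lra|]. intros; lia.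
  - destruct IH as [B [H1 H2]]. exists (Rmax B (f n)). split.
    + eapply Rle_trans; [exact H1|apply Rmax_l].
    + intros i Hi. destruct (Nat.eq_dec i n) as [->|]; [apply Rmax_r|].
      eapply Rle_trans; [|apply Rmax_l]. apply H2; lia.
Qed.

(** The supremum of the points joined to 0 is itself joined to 0, because [Q] holds in both
    directions near it, and it cannot lie below 1. *)
Lemma interval_chain (Q : R -> R -> Prop) :
  (forall t, 0 <= t <= 1 -> Q t t) ->
  (forall s t r, Q s t -> Q t r -> Q s r) ->
  (forall t, 0 <= t <= 1 -> exists r, 0 < r /\
     forall s, 0 <= s <= 1 -> Rabs (s - t) < r -> Q t s /\ Q s t) ->
  Q 0 1.
Proof.
  intros Href Htr Hloc.
  pose (E := fun t => 0 <= t <= 1 /\ Q 0 t).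
  destruct (completeness E) as [s [Hs1 Hs2]].
  - exists 1. intros x [Hx _]. lra.
  - exists 0. split; [lra|]. apply Href. lra.
  - assert (Hs : 0 <= s <= 1).
    { split; [apply Hs1; split; [lra|apply Href; lra]|]. apply Hs2. intros x [Hx _]. lra. }
    destruct (Hloc s Hs) as [r [Hr Hb]].
    assert (HQ : Q 0 s).
    { apply NNPP; intros C. 
      assert (Hub : is_upper_bound E (s - r)).
      { intros x Hx. apply Rnot_lt_le; intros D. apply C.
        destruct Hx as [Hx1 Hx2]. apply Htr with x; auto.
        apply Hb; auto. apply Rabs_def1; [|lra].
        assert (x <= s) by (apply Hs1; split; auto). lra. }
      apply Hs2 in Hub. lra. }
    destruct (Req_dec s 1) as [->|Hne]; auto.
    pose (s' := Rmin 1 (s + r / 2)).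
    assert (Hs' : s < s' /\ s' <= 1 /\ s' <= s + r / 2).
    { unfold s'. split; [apply Rmin_glb_lt; lra|]. split; [apply Rmin_l|apply Rmin_r]. }
    assert (E s').
    { split; [lra|]. apply Htr with s; auto. apply Hb; [lra|]. apply Rabs_def1; lra. }
    apply Hs1 in H. lra.
Qed.

(** Continuity is asked only along sequences inside the rectangle, so that the lemma also serves
    [potential], which is controlled only for positive [y]. *)
Lemma rect_max (F : R -> R -> R) a b c d : a <= b -> c <= d ->
  (forall u v x y, (forall k, a <= u k <= b /\ c <= v k <= d) -> Un_cv u x -> Un_cv v y ->
     Un_cv (fun k => F (u k) (v k)) (F x y)) ->
  exists x1 y1, a <= x1 <= b /\ c <= y1 <= d /\
    forall x2 y2, a <= x2 <= b -> c <= y2 <= d -> F x2 y2 <= F x1 y1.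
Proof.
  intros Hab Hcd HF.
  set (B := Rabs a + Rabs b + Rabs c + Rabs d).
  assert (Hsub : forall q : nat -> R * R,
    (forall k, a <= fst (q k) <= b /\ c <= snd (q k) <= d) ->
    exists phi x y, extr phi /\ a <= x <= b /\ c <= y <= d /\
      Un_cv (fun k => F (fst (q (phi k))) (snd (q (phi k)))) (F x y)).
  { intros q Hq.
    destruct (BW_family 2 (fun k i => if Nat.eq_dec i 0 then fst (q k) else snd (q k)) B)
      as [phi [L [Hphi HL]]].
    { intros k i _. destruct (Hq k) as [A1 A2]. unfold B, Rabs.
      destruct (Nat.eq_dec i 0); repeat destruct (Rcase_abs _); lra. }
    assert (C1 := HL 0%nat ltac:(lia)). assert (C2 := HL 1%nat ltac:(lia)). simpl in C1, C2.
    exists phi, (L 0%nat), (L 1%nat). split; [exact Hphi|]. split; [|split].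
    - split; [apply (cv_le (fun _ => a) _ _ _ (cv_const _) C1)|
              apply (cv_le _ (fun _ => b) _ _ C1 (cv_const _))]; intros; apply Hq.
    - split; [apply (cv_le (fun _ => c) _ _ _ (cv_const _) C2)|
              apply (cv_le _ (fun _ => d) _ _ C2 (cv_const _))]; intros; apply Hq.
    - apply HF; auto. }
  set (E := fun v => exists x y, a <= x <= b /\ c <= y <= d /\ v = F x y).
  destruct (classic (bound E)) as [Hb|Hunb].
  - destruct (completeness E Hb) as [s [Hs1 Hs2]].
    { exists (F a c), a, c. repeat split; lra. }
    assert (Hk : forall k, exists q : R * R, (a <= fst q <= b /\ c <= snd q <= d) /\
       s - / INR (S k) < F (fst q) (snd q)).
    { intros k. apply NNPP. intros C.
      assert (0 < / INR (S k)) by (apply Rinv_0_lt_compat, lt_0_INR; lia).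
      assert (s <= s - / INR (S k)); [|lra]. apply Hs2. intros v [x [y [Hx [Hy ->]]]].
      apply Rnot_lt_le. intros D. apply C. exists (x, y). auto. }
    destruct (choice _ _ _ Hk) as [q Hq].
    destruct (Hsub q) as [phi [x [y [Hphi [Hx [Hy CF]]]]]]; [apply Hq|].
    exists x, y. split; [|split]; auto. intros x2 y2 Hx2 Hy2.
    apply Rle_trans with s; [apply Hs1; now exists x2, y2|].
    apply (cv_le (fun k => s - / INR (S (phi k))) (fun k => F (fst (q (phi k))) (snd (q (phi k)))));
      auto.
    + replace s with (s - 0) at 1 by lra. apply CV_minus; [apply cv_const|].
      apply (cv_subseq (fun k => / INR (S k)) 0 phi); auto. apply cv_inv_S.
    + intros k. left. apply Hq.
  (* If [F] were unbounded, its values would exceed every [k] along a sequence, and a convergent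
     subsequence would contradict continuity. *)
  - exfalso.
    assert (Hk : forall k, exists q : R * R, (a <= fst q <= b /\ c <= snd q <= d) /\
       INR k < F (fst q) (snd q)).
    { intros k. apply NNPP. intros C. apply Hunb. exists (INR k). intros v [x [y [Hx [Hy ->]]]].
      apply Rnot_lt_le. intros D. apply C. exists (x, y). auto. }
    destruct (choice _ _ _ Hk) as [q Hq].
    destruct (Hsub q) as [phi [x [y [Hphi [Hx [Hy CF]]]]]]; [apply Hq|].
    pose proof (cv_ev_lt _ _ (F x y + 1) CF ltac:(lra)) as [n0 Hn0].
    destruct (INR_unbounded (F x y + 1)) as [n1 Hn1].
    specialize (Hn0 (max n0 n1) ltac:(lia)).
    destruct (Hq (phi (max n0 n1))) as [_ A].
    pose proof (extr_ge phi Hphi (max n0 n1)).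
    assert (INR n1 <= INR (phi (max n0 n1))) by (apply le_INR; lia). lra.
Qed.

(** * The Maxwell-Cremona lifting *)

Lemma finite_unif n (P : nat -> R -> Prop) :
  (forall i, (i < n)%nat -> exists r, 0 < r /\ forall t, 0 < t < r -> P i t) ->
  exists r, 0 < r /\ forall t, 0 < t < r -> forall i, (i < n)%nat -> P i t.
Proof.
  induction n as [|n IH]; intros H.
  - exists 1. split; [lra|]. intros; lia.
  - destruct IH as [r [Hr1 Hr2]]; [intros; apply H; lia|].
    destruct (H n) as [s [Hs1 Hs2]]; [lia|].
    exists (Rmin r s). split; [now apply Rmin_glb_lt|]. intros t Ht i Hi.
    pose proof (Rmin_l r s). pose proof (Rmin_r r s).
    destruct (Nat.eq_dec i n) as [->|]; [apply Hs2; lra|]. apply Hr2; [lra|lia].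
Qed.

Definition pos (r : R) : R := Rmax 0 r.

Lemma pos_ge r : 0 <= r -> pos r = r.
Proof. intros. unfold pos. now rewrite Rmax_right. Qed.
Lemma pos_le r : r <= 0 -> pos r = 0.
Proof. intros. unfold pos. now rewrite Rmax_left. Qed.
Lemma pos_nonneg r : 0 <= pos r.
Proof. apply Rmax_l. Qed.
Lemma pos_scal t r : 0 <= t -> pos (t * r) = t * pos r.
Proof.
  intros Ht. destruct (Rle_dec 0 r).
  - rewrite !pos_ge; auto. nra.
  - rewrite !pos_le; nra.
Qed.
Lemma pos_convex u h : 0 <= pos (u + h) + pos (u - h) - 2 * pos u.
Proof. unfold pos, Rmax. repeat destruct (Rle_dec _ _); lra. Qed.
Lemma pos_opp r : pos r = r + pos (- r).
Proof. unfold pos, Rmax. repeat destruct (Rle_dec _ _); lra. Qed.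

Section Stress.

Variable N : nat.
Variables X Y : nat -> R.
Variable nu : nat -> nat -> R.
Variable bar : nat -> nat -> Prop.

(** Cross product of the vectors from (x,y) to the vertices [j] and [i]. For [X i < x < X j] it is
    positive exactly when (x,y) lies below the segment; times [nu i j] it is the torque about (x,y)
    of the stress in that segment. *)
Definition area2 (i j : nat) (x y : R) : R :=
  (X j - x) * (Y i - y) - (X i - x) * (Y j - y).

Hypothesis nu_sym : forall i j, nu i j = nu j i.
Hypothesis eqX : forall i, (i < N)%nat -> Rsum N (fun j => nu i j * (X j - X i)) = 0.
Hypothesis eqY : forall i, (i < N)%nat -> Rsum N (fun j => nu i j * (Y j - Y i)) = 0.
(** Genericity: no segment is vertical. [stress_hull] arranges this by a shear. *)
Hypothesis Xinj : forall i j, (i < N)%nat -> (j < N)%nat -> i <> j -> X i <> X j.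
Hypothesis bar_sym : forall i j, bar i j -> bar j i.
Hypothesis strut_pos : forall i j, (i < N)%nat -> (j < N)%nat -> i <> j -> ~ bar i j -> 0 < nu i j.
Hypothesis deg2 : forall i, (i < N)%nat -> exists a b, (a < N)%nat /\ (b < N)%nat /\
  forall j, bar i j -> j = a \/ j = b.
Hypothesis bar_off : forall i j k, (i < N)%nat -> (j < N)%nat -> (k < N)%nat -> bar i j ->
  X i < X k < X j -> area2 i j (X k) (Y k) <> 0.
Hypothesis bar_disj : forall i j k l x y,
  (i < N)%nat -> (j < N)%nat -> (k < N)%nat -> (l < N)%nat -> bar i j -> bar k l ->
  X i < x < X j -> X k < x < X l -> area2 i j x y = 0 -> area2 k l x y = 0 -> i = k /\ j = l.

(* The segments seen from the right, resp. left, of the vertical at [x0]: the sums [ZR] and [ZL] over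
   them give the lifting on either side of [x0]. *)
Definition chR (x0 : R) (i j : nat) : R :=
  if Rle_dec (X i) x0 then if Rlt_dec x0 (X j) then 1 else 0 else 0.
Definition chL (x0 : R) (i j : nat) : R :=
  if Rlt_dec (X i) x0 then if Rle_dec x0 (X j) then 1 else 0 else 0.
Definition ZR (x0 x y : R) : R :=
  Rsum N (fun i => Rsum N (fun j => nu i j * (chR x0 i j * pos (area2 i j x y)))).
Definition ZL (x0 x y : R) : R :=
  Rsum N (fun i => Rsum N (fun j => nu i j * (chL x0 i j * pos (area2 i j x y)))).
(* The Maxwell-Cremona lifting: the torque about (x,y) of the stresses crossing the upward
   vertical ray from (x,y). *)
Definition lift (x y : R) : R := ZR x x y.

Lemma area2_affine i j x y x0 y0 :
  area2 i j x y = area2 i j x0 y0 + (Y j - Y i) * (x - x0) + (X i - X j) * (y - y0).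
Proof. unfold area2. ring. Qed.

Lemma area2_anti i j x y : area2 i j x y = - area2 j i x y.
Proof. unfold area2. ring. Qed.

Lemma area2_near i j x0 y0 : area2 i j x0 y0 <> 0 ->
  exists r, 0 < r /\ forall x y, Rabs (x - x0) < r -> Rabs (y - y0) < r ->
    0 < area2 i j x0 y0 * area2 i j x y.
Proof.
  intros H. set (c := area2 i j x0 y0) in *.
  set (M := 1 + Rabs (Y j - Y i) + Rabs (X i - X j)).
  pose proof (Rabs_pos (Y j - Y i)) as P1. pose proof (Rabs_pos (X i - X j)) as P2.
  assert (Hc : 0 < Rabs c) by now apply Rabs_pos_lt.
  exists (Rabs c / M). split; [apply Rdiv_lt_0_compat; unfold M; lra|].
  intros x y Hx Hy. rewrite (area2_affine i j x y x0 y0). fold c.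
  set (e := (Y j - Y i) * (x - x0) + (X i - X j) * (y - y0)).
  assert (He : Rabs e < Rabs c).
  { unfold e. eapply Rle_lt_trans; [apply Rabs_triang|]. rewrite !Rabs_mult.
    assert (E : Rabs c = Rabs c / M * M) by (field; unfold M; lra).
    pose proof (Rabs_pos (x - x0)). pose proof (Rabs_pos (y - y0)).
    assert (0 < Rabs c / M) by (apply Rdiv_lt_0_compat; unfold M; lra).
    rewrite E at 1. unfold M at 2. nra. }
  rewrite Rplus_assoc. fold e.
  unfold Rabs in He, Hc. destruct (Rcase_abs e), (Rcase_abs c); nra.
Qed.

(** The stress forces at vertex [i] balance and act at the same point, so they have no torque. *)
Lemma torque_zero i x y : (i < N)%nat -> Rsum N (fun j => nu i j * area2 i j x y) = 0.
Proof.
  intros Hi.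
  rewrite (Rsum_ext _ _ (fun j => (Y i - y) * (nu i j * (X j - X i)) -
    (X i - x) * (nu i j * (Y j - Y i)))).
  - rewrite Rsum_minus, !Rsum_scal, eqX, eqY by auto. lra.
  - intros j _. unfold area2. ring.
Qed.

(* Total torque across the vertical line at abscissa [x]. *)
Lemma cut_zero x y :
  Rsum N (fun i => Rsum N (fun j => nu i j * (chR x i j * area2 i j x y))) = 0.
Proof.
  (* [c] selects the vertices on or left of the vertical. In the sum of their zero torques, segments
     with both ends selected cancel by antisymmetry, and the segments counted by [chR] remain. *)
  set (c := fun i => if Rle_dec (X i) x then 1 else 0).
  assert (E : Rsum N (fun i => c i * Rsum N (fun j => nu i j * area2 i j x y)) = 0).
  { apply Rsum_0. intros i Hi. rewrite torque_zero by auto. lra. }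
  rewrite <- E.
  replace (Rsum N (fun i => c i * Rsum N (fun j => nu i j * area2 i j x y))) with
    (Rsum N (fun i => Rsum N (fun j => nu i j * (chR x i j * area2 i j x y))) +
     Rsum N (fun i => Rsum N (fun j => c i * c j * (nu i j * area2 i j x y)))).
  - rewrite (Rsum_antisym N (fun i j => c i * c j * (nu i j * area2 i j x y))); [lra|].
    intros i j _ _. rewrite (nu_sym j i), (area2_anti j i). ring.
  - rewrite <- Rsum_plus. apply Rsum_ext. intros i Hi.
    rewrite <- Rsum_scal, <- Rsum_plus. apply Rsum_ext. intros j Hj.
    unfold chR, c. destruct (Rle_dec (X i) x), (Rlt_dec x (X j)), (Rle_dec (X j) x); lra.
Qed.

(** The set of segments crossing a vertical changes only at abscissas of vertices, so it is constant
    up to the next one. *)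
Lemma lift_right x0 : exists r, 0 < r /\ forall x y, x0 <= x < x0 + r -> lift x y = ZR x0 x y.
Proof.
  destruct (finite_pos_min N (fun i => if Rlt_dec x0 (X i) then X i - x0 else 1)) as [r [Hr H]].
  { intros i _. destruct (Rlt_dec x0 (X i)); lra. }
  exists r. split; auto. intros x y Hx. unfold lift, ZR.
  apply Rsum_ext; intros i Hi. apply Rsum_ext; intros j Hj.
  assert (E : chR x i j = chR x0 i j); [|now rewrite E].
  pose proof (H i Hi). pose proof (H j Hj). unfold chR.
  destruct (Rle_dec (X i) x), (Rle_dec (X i) x0), (Rlt_dec x (X j)), (Rlt_dec x0 (X j)), (Rlt_dec x0 (X i));
    lra.
Qed.

Lemma lift_left x0 : exists r, 0 < r /\ forall x y, x0 - r < x < x0 -> lift x y = ZL x0 x y.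
Proof.
  destruct (finite_pos_min N (fun i => if Rlt_dec (X i) x0 then x0 - X i else 1)) as [r [Hr H]].
  { intros i _. destruct (Rlt_dec (X i) x0); lra. }
  exists r. split; auto. intros x y Hx. unfold lift, ZR, ZL.
  apply Rsum_ext; intros i Hi. apply Rsum_ext; intros j Hj.
  assert (E : chR x i j = chL x0 i j); [|now rewrite E].
  pose proof (H i Hi). pose proof (H j Hj). unfold chR, chL.
  destruct (Rle_dec (X i) x), (Rlt_dec (X i) x0), (Rlt_dec x (X j)), (Rle_dec x0 (X j)),
    (Rlt_dec (X j) x0); lra.
Qed.

Definition gt01 (x0 : R) (j : nat) : R := if Rlt_dec x0 (X j) then 1 else 0.
Definition lt01 (x0 : R) (j : nat) : R := if Rlt_dec (X j) x0 then 1 else 0.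

Lemma chR_chL_off x0 i j : X i <> x0 -> X j <> x0 -> chR x0 i j = chL x0 i j.
Proof.
  intros. unfold chR, chL.
  destruct (Rle_dec (X i) x0), (Rlt_dec (X i) x0), (Rlt_dec x0 (X j)), (Rle_dec x0 (X j)); lra.
Qed.

Lemma chR_K K j : chR (X K) K j = gt01 (X K) j.
Proof. unfold chR, gt01. destruct (Rle_dec (X K) (X K)); lra. Qed.
Lemma chL_K K j : chL (X K) K j = 0.
Proof. unfold chL. destruct (Rlt_dec (X K) (X K)); lra. Qed.
Lemma chR_K' K i : chR (X K) i K = 0.
Proof. unfold chR. destruct (Rle_dec (X i) (X K)), (Rlt_dec (X K) (X K)); lra. Qed.
Lemma chL_K' K i : chL (X K) i K = lt01 (X K) i.
Proof. unfold chL, lt01. destruct (Rlt_dec (X i) (X K)), (Rle_dec (X K) (X K)); lra. Qed.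

Lemma Rsum2_cross K (f : nat -> nat -> R) : (K < N)%nat -> f K K = 0 ->
  (forall i j, (i < N)%nat -> (j < N)%nat -> i <> K -> j <> K -> f i j = 0) ->
  Rsum N (fun i => Rsum N (fun j => f i j)) = Rsum N (fun j => f K j + f j K).
Proof.
  intros HK H0 H.
  rewrite (Rsum_ext N (fun i => Rsum N (fun j => f i j))
    (fun i => (if Nat.eq_dec i K then Rsum N (fun j => f K j) else 0) + f i K)).
  - rewrite !Rsum_plus. f_equal. rewrite (Rsum_single N _ K); auto.
    + now destruct (Nat.eq_dec K K).
    + intros i Hi Hn. now destruct (Nat.eq_dec i K).
  - intros i Hi. destruct (Nat.eq_dec i K) as [->|Hn]; [rewrite H0; lra|].
    rewrite (Rsum_single N _ K); auto; lra.
Qed.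

(** Only segments ending at [K] are seen on one side of the vertical through [K] and not on the
    other. *)
Lemma ZR_ZL_vertex K x y : (K < N)%nat ->
  ZR (X K) x y - ZL (X K) x y =
  Rsum N (fun j => nu K j * (gt01 (X K) j * pos (area2 K j x y) - lt01 (X K) j * pos (area2 j K x y))).
Proof.
  intros HK. unfold ZR, ZL. rewrite <- Rsum_minus.
  rewrite (Rsum_ext N _ (fun i => Rsum N (fun j =>
    nu i j * ((chR (X K) i j - chL (X K) i j) * pos (area2 i j x y))))).
  2: { intros i _. rewrite <- Rsum_minus. apply Rsum_ext. intros; ring. }
  rewrite (Rsum2_cross K); auto.
  - apply Rsum_ext. intros j Hj.
    rewrite chR_K, chL_K, chR_K', chL_K', (nu_sym j K). ring.
  - rewrite chR_K, chL_K. unfold gt01. destruct (Rlt_dec (X K) (X K)); lra.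
  - intros i j Hi Hj Hi' Hj'. rewrite chR_chL_off by (apply Xinj; auto). ring.
Qed.

Lemma ZR_ZL_novertex x0 x y : (forall i, (i < N)%nat -> X i <> x0) -> ZR x0 x y = ZL x0 x y.
Proof.
  intros H. apply Rsum_ext; intros i Hi. apply Rsum_ext; intros j Hj.
  rewrite chR_chL_off by auto. ring.
Qed.

Lemma gt_lt_K K j : (K < N)%nat -> (j < N)%nat -> j <> K -> gt01 (X K) j + lt01 (X K) j = 1.
Proof.
  intros HK Hj Hn. pose proof (Xinj j K Hj HK Hn). unfold gt01, lt01.
  destruct (Rlt_dec (X K) (X j)), (Rlt_dec (X j) (X K)); lra.
Qed.

(** Continuity across a vertical: on the vertical through [K] the two sums differ by
    [pos (Y K - y0)] times the horizontal force at [K], which vanishes. *)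
Lemma ZL_at x0 y0 : ZL x0 x0 y0 = ZR x0 x0 y0.
Proof.
  destruct (classic (exists K, (K < N)%nat /\ X K = x0)) as [[K [HK <-]]|H].
  - enough (ZR (X K) (X K) y0 - ZL (X K) (X K) y0 = 0) by lra.
    rewrite ZR_ZL_vertex by auto.
    rewrite (Rsum_ext N _ (fun j => pos (Y K - y0) * (nu K j * (X j - X K)))).
    + rewrite Rsum_scal, eqX by auto. lra.
    + intros j Hj. unfold gt01, lt01.
      replace (area2 K j (X K) y0) with ((X j - X K) * (Y K - y0)) by (unfold area2; ring).
      replace (area2 j K (X K) y0) with ((X K - X j) * (Y K - y0)) by (unfold area2; ring).
      destruct (Rlt_dec (X K) (X j)), (Rlt_dec (X j) (X K)); [lra| | |].
      * rewrite pos_scal by lra. ring.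
      * rewrite (pos_scal (X K - X j)) by lra. ring.
      * replace (X j) with (X K) by lra. ring.
  - symmetry. apply ZR_ZL_novertex. intros i Hi E. apply H. now exists i.
Qed.

(** Away from the vertices both sums define the same function near the point. Above [K] every
    segment from [K] contributes 0; below [K] every positive part is the area itself, and the sum is
    the torque at [K]. *)
Lemma ZR_ZL_near x0 y0 :
  (forall i, (i < N)%nat -> ~ (X i = x0 /\ Y i = y0)) ->
  exists r, 0 < r /\ forall x y, Rabs (x - x0) < r -> Rabs (y - y0) < r -> ZL x0 x y = ZR x0 x y.
Proof.
  intros Hq.
  destruct (classic (exists K, (K < N)%nat /\ X K = x0)) as [[K [HK <-]]|H].
  2: { exists 1. split; [lra|]. intros. symmetry. apply ZR_ZL_novertex.
       intros i Hi E. apply H. now exists i. }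
  assert (HY : Y K <> y0) by (intros E; apply (Hq K); auto).
  assert (Hr : exists r, 0 < r /\ forall t, 0 < t < r -> forall j, (j < N)%nat -> j <> K ->
     forall x y, Rabs (x - X K) < t -> Rabs (y - y0) < t ->
     0 < area2 K j (X K) y0 * area2 K j x y).
  { apply finite_unif. intros j Hj. destruct (Nat.eq_dec j K) as [->|Hn].
    - exists 1. split; [lra|]. tauto.
    - destruct (area2_near K j (X K) y0) as [r [Hr1 Hr2]].
      + unfold area2. replace (_ - _) with ((X j - X K) * (Y K - y0)) by ring.
        apply Rmult_integral_contrapositive_currified; [|lra].
        pose proof (Xinj j K Hj HK Hn). lra.
      + exists r. split; auto. intros t Ht _ x y Hx Hy. apply Hr2; lra. }
  destruct Hr as [r [Hr1 Hr2]]. exists (r / 2). split; [lra|]. intros x y Hx Hy.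
  enough (ZR (X K) x y - ZL (X K) x y = 0) by lra. rewrite ZR_ZL_vertex by auto.
  assert (S : forall j, (j < N)%nat -> j <> K -> 0 < (X j - X K) * (Y K - y0) * area2 K j x y).
  { intros j Hj Hn. generalize (Hr2 (r / 2) ltac:(lra) j Hj Hn x y Hx Hy).
    unfold area2 at 1. replace ((X j - X K) * (Y K - y0) - (X K - X K) * (Y j - y0))
      with ((X j - X K) * (Y K - y0)) by ring. auto. }
  destruct (Rlt_dec (Y K) y0) as [Hlt|Hge].
  - apply Rsum_0. intros j Hj. rewrite (area2_anti j K).
    destruct (Nat.eq_dec j K) as [->|Hn].
    { unfold gt01, lt01. destruct (Rlt_dec (X K) (X K)); lra. }
    specialize (S j Hj Hn). unfold gt01, lt01.
    destruct (Rlt_dec (X K) (X j)), (Rlt_dec (X j) (X K)); try lra.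
    + rewrite pos_le; [lra|]. assert ((X j - X K) * (Y K - y0) < 0) by nra. nra.
    + rewrite (pos_le (- _)); [lra|]. assert (0 < (X j - X K) * (Y K - y0)) by nra. nra.
  - rewrite <- (torque_zero K x y HK). apply Rsum_ext. intros j Hj.
    rewrite (area2_anti j K).
    destruct (Nat.eq_dec j K) as [->|Hn].
    { unfold gt01, lt01. destruct (Rlt_dec (X K) (X K)); [lra|]. unfold area2. ring. }
    specialize (S j Hj Hn). unfold gt01, lt01.
    destruct (Rlt_dec (X K) (X j)), (Rlt_dec (X j) (X K)); try lra.
    + rewrite pos_ge; [lra|]. assert (0 < (X j - X K) * (Y K - y0)) by nra. nra.
    + rewrite (pos_ge (- _)); [lra|]. assert ((X j - X K) * (Y K - y0) < 0) by nra. nra.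
    + pose proof (Xinj j K Hj HK Hn). lra.
Qed.

(** Near the vertical at [x0] the lift coincides with [ZR x0] or [ZL x0], and by [ZL_at] both tend
    to [lift x0 y0]. *)
Lemma lift_cv u v x0 y0 : Un_cv u x0 -> Un_cv v y0 ->
  Un_cv (fun k => lift (u k) (v k)) (lift x0 y0).
Proof.
  intros Hu Hv.
  assert (CR : Un_cv (fun k => ZR x0 (u k) (v k)) (lift x0 y0)).
  { apply (Rsum_cv N (fun k i => Rsum N (fun j => nu i j * (chR x0 i j * pos (area2 i j (u k) (v k)))))).
    intros i _. apply (Rsum_cv N (fun k j => nu i j * (chR x0 i j * pos (area2 i j (u k) (v k))))).
    intros j _. unfold area2, pos. cvt. }
  assert (CL : Un_cv (fun k => ZL x0 (u k) (v k)) (lift x0 y0)).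
  { unfold lift. rewrite <- ZL_at.
    apply (Rsum_cv N (fun k i => Rsum N (fun j => nu i j * (chL x0 i j * pos (area2 i j (u k) (v k)))))).
    intros i _. apply (Rsum_cv N (fun k j => nu i j * (chL x0 i j * pos (area2 i j (u k) (v k))))).
    intros j _. unfold area2, pos. cvt. }
  destruct (lift_right x0) as [r1 [Hr1 H1]]. destruct (lift_left x0) as [r2 [Hr2 H2]].
  apply cv_intro. intros e He.
  assert (Hr : 0 < Rmin r1 r2) by now apply Rmin_glb_lt.
  generalize (ev_and _ _ (cv_ev _ _ _ Hu Hr) (ev_and _ _ (cv_ev _ _ _ CR He) (cv_ev _ _ _ CL He))).
  apply ev_mono. intros k [A [B C]]. apply Rabs_def2 in A.
  pose proof (Rmin_l r1 r2). pose proof (Rmin_r r1 r2).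
  destruct (Rle_dec x0 (u k)); [rewrite H1|rewrite H2]; auto; lra.
Qed.

(** Left and right of the box no segment crosses the vertical; above the box the ray meets none;
    below it the ray meets a whole cut, whose torque is zero by [cut_zero]. *)
Lemma lift_out_box B x y : (forall i, (i < N)%nat -> Rabs (X i) < B /\ Rabs (Y i) < B) ->
  ~ (- B < x < B /\ - B < y < B) -> lift x y = 0.
Proof.
  intros HB Hout.
  assert (HB' : forall i, (i < N)%nat -> -B < X i < B /\ - B < Y i < B).
  { intros i Hi. destruct (HB i Hi) as [H1 H2]. apply Rabs_def2 in H1, H2. lra. }
  destruct (Rlt_dec (- B) x) as [A1|A1]; [destruct (Rlt_dec x B) as [A2|A2];
    [destruct (Rlt_dec (- B) y) as [A3|A3]; [destruct (Rlt_dec y B) as [A4|A4]|]|]|].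
  - tauto.
  - apply Rsum_0; intros i Hi. apply Rsum_0; intros j Hj.
    pose proof (HB' i Hi). pose proof (HB' j Hj). unfold chR.
    destruct (Rle_dec (X i) x), (Rlt_dec x (X j)); try lra.
    rewrite pos_le; [lra|]. unfold area2. nra.
  - rewrite <- (cut_zero x y). apply Rsum_ext; intros i Hi. apply Rsum_ext; intros j Hj.
    pose proof (HB' i Hi). pose proof (HB' j Hj). unfold chR.
    destruct (Rle_dec (X i) x), (Rlt_dec x (X j)); try lra.
    rewrite pos_ge; [lra|]. unfold area2. nra.
  - apply Rsum_0; intros i Hi. apply Rsum_0; intros j Hj.
    pose proof (HB' i Hi). pose proof (HB' j Hj). unfold chR.
    destruct (Rle_dec (X i) x), (Rlt_dec x (X j)); lra.
  - apply Rsum_0; intros i Hi. apply Rsum_0; intros j Hj.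
    pose proof (HB' i Hi). pose proof (HB' j Hj). unfold chR.
    destruct (Rle_dec (X i) x), (Rlt_dec x (X j)); lra.
Qed.

(** A strut has positive stress and [pos] is convex. A bar may have stress of either sign, so [pos]
    of its area must be affine along the step: either the point is off the line of the bar, or the
    step is parallel to it. *)
Lemma second_diff_pair i j x0 y0 m : (i < N)%nat -> (j < N)%nat -> i <> j ->
  (bar i j -> area2 i j x0 y0 <> 0 \/ Y j - Y i = m * (X j - X i)) ->
  exists r, 0 < r /\ forall t, 0 < t < r ->
    0 <= nu i j * (pos (area2 i j (x0 + t) (y0 + t * m)) + pos (area2 i j (x0 - t) (y0 - t * m))
       - 2 * pos (area2 i j x0 y0)).
Proof.
  intros Hi Hj Hn Hb.
  assert (E1 : forall t, area2 i j (x0 + t) (y0 + t * m) =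
     area2 i j x0 y0 + t * ((Y j - Y i) - m * (X j - X i))) by (intros; unfold area2; ring).
  assert (E2 : forall t, area2 i j (x0 - t) (y0 - t * m) =
     area2 i j x0 y0 - t * ((Y j - Y i) - m * (X j - X i))) by (intros; unfold area2; ring).
  destruct (classic (bar i j)) as [B|B].
  - destruct (Hb B) as [C|C].
    + destruct (area2_near i j x0 y0 C) as [r [Hr1 Hr2]].
      (* Keeps both coordinates of the displacement, [t] and [t * m], within [r]. *)
      exists (r / (1 + Rabs m)). pose proof (Rabs_pos m) as Pm.
      split; [apply Rdiv_lt_0_compat; lra|]. intros t [Ht1 Ht2].
      assert (Ht3 : t * (1 + Rabs m) < r).
      { apply (Rmult_lt_compat_r (1 + Rabs m)) in Ht2; [|lra].
        replace (r / (1 + Rabs m) * (1 + Rabs m)) with r in Ht2 by (field; lra). lra. }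
      assert (T1 : Rabs t = t) by (apply Rabs_pos_eq; lra).
      assert (S1 := Hr2 (x0 + t) (y0 + t * m)). assert (S2 := Hr2 (x0 - t) (y0 - t * m)).
      replace (x0 + t - x0) with t in S1 by ring. replace (y0 + t * m - y0) with (t * m) in S1 by ring.
      replace (x0 - t - x0) with (- t) in S2 by ring.
      replace (y0 - t * m - y0) with (- (t * m)) in S2 by ring.
      rewrite Rabs_Ropp in S2. rewrite Rabs_Ropp in S2. rewrite Rabs_mult, T1 in S1, S2.
      specialize (S1 ltac:(nra) ltac:(nra)). specialize (S2 ltac:(nra) ltac:(nra)).
      rewrite E1 in S1 |- *. rewrite E2 in S2 |- *.
      set (w := t * (Y j - Y i - m * (X j - X i))) in *. set (c := area2 i j x0 y0) in *.
      destruct (Rlt_dec 0 c).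
      * rewrite !pos_ge; [|lra|nra|nra]. nra.
      * rewrite !pos_le; [|lra|nra|nra]. nra.
    + exists 1. split; [lra|]. intros t _. rewrite E1, E2, C.
      replace (m * (X j - X i) - m * (X j - X i)) with 0 by ring.
      rewrite Rmult_0_r, Rplus_0_r, Rminus_0_r. lra.
  - exists 1. split; [lra|]. intros t _. rewrite E1, E2.
    pose proof (strut_pos i j Hi Hj Hn B).
    pose proof (pos_convex (area2 i j x0 y0) (t * (Y j - Y i - m * (X j - X i)))). nra.
Qed.

(** The slope [m] is that of the bar through the point, if there is one. [ZR_ZL_near] lets all three
    values of [lift] be computed with the same set of segments. *)
Lemma second_diff_nonvertex x0 y0 m :
  (forall i, (i < N)%nat -> ~ (X i = x0 /\ Y i = y0)) ->
  (forall i j, (i < N)%nat -> (j < N)%nat -> bar i j -> X i < x0 < X j -> area2 i j x0 y0 = 0 ->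
     Y j - Y i = m * (X j - X i)) ->
  exists r, 0 < r /\ forall t, 0 < t < r ->
    0 <= lift (x0 + t) (y0 + t * m) + lift (x0 - t) (y0 - t * m) - 2 * lift x0 y0.
Proof.
  intros Hq Hm.
  destruct (ZR_ZL_near x0 y0 Hq) as [r0 [Hr0 H0]].
  destruct (lift_right x0) as [r1 [Hr1 H1]]. destruct (lift_left x0) as [r2 [Hr2 H2]].
  assert (HP : exists r, 0 < r /\ forall t, 0 < t < r -> forall i, (i < N)%nat ->
     forall j, (j < N)%nat -> 0 <= nu i j * (chR x0 i j *
       (pos (area2 i j (x0 + t) (y0 + t * m)) + pos (area2 i j (x0 - t) (y0 - t * m))
       - 2 * pos (area2 i j x0 y0)))).
  { apply finite_unif. intros i Hi. apply finite_unif. intros j Hj.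
    unfold chR. destruct (Rle_dec (X i) x0) as [A|A];
      [destruct (Rlt_dec x0 (X j)) as [B|B]|]; try (exists 1; split; [lra|]; intros; lra).
    destruct (second_diff_pair i j x0 y0 m Hi Hj) as [r [Hr Hr']].
    - intros ->. lra.
    - intros Hb. destruct (Req_dec (area2 i j x0 y0) 0) as [E|E]; [right|now left].
      (* [X i = x0] together with zero area would put vertex [i] at the point itself. *)
      apply Hm; auto. split; auto. destruct A as [A|A]; auto. exfalso.
      apply (Hq i Hi). split; auto. unfold area2 in E. rewrite A in E.
      assert (E' : (X j - x0) * (Y i - y0) = 0) by lra.
      apply Rmult_integral in E'. lra.
    - exists r. split; auto. intros t Ht. specialize (Hr' t Ht). lra. }
  destruct HP as [r3 [Hr3 H3]].
  pose proof (Rabs_pos m) as Pm.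
  set (r0' := r0 / (1 + Rabs m)).
  assert (Hr0' : 0 < r0') by (apply Rdiv_lt_0_compat; lra).
  exists (Rmin (Rmin r0' r1) (Rmin r2 r3)). split; [repeat apply Rmin_glb_lt; auto|].
  intros t [Ht1 Ht2].
  assert (Ht : t < r0' /\ t < r1 /\ t < r2 /\ t < r3).
  { pose proof (Rmin_l (Rmin r0' r1) (Rmin r2 r3)). pose proof (Rmin_r (Rmin r0' r1) (Rmin r2 r3)).
    pose proof (Rmin_l r0' r1). pose proof (Rmin_r r0' r1).
    pose proof (Rmin_l r2 r3). pose proof (Rmin_r r2 r3). lra. }
  rewrite (H1 (x0 + t)) by lra. rewrite (H2 (x0 - t)) by lra. rewrite H0.
  - unfold lift, ZR. rewrite <- Rsum_scal, <- Rsum_plus, <- Rsum_minus.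
    apply Rsum_nonneg. intros i Hi. rewrite <- Rsum_scal, <- Rsum_plus, <- Rsum_minus.
    apply Rsum_nonneg. intros j Hj. pose proof (H3 t ltac:(lra) i Hi j Hj). lra.
  - replace (x0 - t - x0) with (- t) by ring. rewrite Rabs_Ropp, Rabs_pos_eq by lra.
    assert (r0' <= r0). { unfold r0'. apply Rmult_le_reg_r with (1 + Rabs m); [lra|].
      replace (r0 / (1 + Rabs m) * (1 + Rabs m)) with r0 by (field; lra). nra. } lra.
  - replace (y0 - t * m - y0) with (- (t * m)) by ring.
    rewrite Rabs_Ropp, Rabs_mult, (Rabs_pos_eq t) by lra.
    assert (t * (1 + Rabs m) < r0).
    { destruct Ht as [Ht _]. apply (Rmult_lt_compat_r (1 + Rabs m)) in Ht; [|lra].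
      unfold r0' in Ht. replace (r0 / (1 + Rabs m) * (1 + Rabs m)) with r0 in Ht by (field; lra). lra. }
    lra.
Qed.

(** Height of vertex [j] above the line of slope [m] through vertex [v]. *)
Definition side (v : nat) (m : R) (j : nat) : R := (Y j - Y v) - m * (X j - X v).

(** Segments ending at [K] are met on one side only and start from area 0, so each contributes [t]
    times the positive part of its side. The other segments behave as at an ordinary point, since by
    [bar_off] no bar passes through [K]. *)
Lemma second_diff_vertex K m : (K < N)%nat ->
  exists r, 0 < r /\ forall t, 0 < t < r ->
    t * Rsum N (fun j => nu K j * pos (side K m j)) <=
    lift (X K + t) (Y K + t * m) + lift (X K - t) (Y K - t * m) - 2 * lift (X K) (Y K).
Proof.
  intros HK. set (x0 := X K). set (y0 := Y K).
  destruct (lift_right x0) as [r1 [Hr1 H1]]. destruct (lift_left x0) as [r2 [Hr2 H2]].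
  (* Contribution of the segments ending at [K]: those to the right count at the forward point,
     those to the left at the backward point. *)
  set (cr := fun i j t => (if Nat.eq_dec i K then nu K j * (gt01 x0 j * (t * pos (side K m j))) else 0)
    + (if Nat.eq_dec j K then nu i K * (lt01 x0 i * (t * pos (side K m i))) else 0)).
  assert (HP : exists r, 0 < r /\ forall t, 0 < t < r -> forall i, (i < N)%nat ->
     forall j, (j < N)%nat -> cr i j t <= nu i j * (chR x0 i j *
       (pos (area2 i j (x0 + t) (y0 + t * m)) - pos (area2 i j x0 y0)) + chL x0 i j *
       (pos (area2 i j (x0 - t) (y0 - t * m)) - pos (area2 i j x0 y0)))).
  { apply finite_unif. intros i Hi. apply finite_unif. intros j Hj.
    unfold cr. destruct (Nat.eq_dec i K) as [->|Hni]; destruct (Nat.eq_dec j K) as [->|Hnj].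
    - exists 1. split; [lra|]. intros t Ht. unfold x0. rewrite chR_K, chL_K.
      unfold gt01, lt01. destruct (Rlt_dec (X K) (X K)); lra.
    - exists 1. split; [lra|]. intros t Ht. unfold x0, y0. rewrite chR_K, chL_K.
      replace (area2 K j (X K + t) (Y K + t * m)) with (t * side K m j) by (unfold area2, side; ring).
      replace (area2 K j (X K) (Y K)) with 0 by (unfold area2; ring).
      rewrite pos_scal, (pos_le 0) by lra. lra.
    - exists 1. split; [lra|]. intros t Ht. unfold x0, y0. rewrite chR_K', chL_K'.
      replace (area2 i K (X K - t) (Y K - t * m)) with (t * side K m i) by (unfold area2, side; ring).
      replace (area2 i K (X K) (Y K)) with 0 by (unfold area2; ring).
      rewrite pos_scal, (pos_le 0) by lra. lra.
    - unfold x0 at 1 3. rewrite <- chR_chL_off by (apply Xinj; auto). fold x0.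
      unfold chR. destruct (Rle_dec (X i) x0) as [A|A];
      [destruct (Rlt_dec x0 (X j)) as [B|B]|]; try (exists 1; split; [lra|]; intros; lra).
      destruct (second_diff_pair i j x0 y0 m Hi Hj) as [r [Hr Hr']].
      + intros ->. lra.
      + intros Hb. left. apply bar_off; auto. unfold x0 in *. 
        pose proof (Xinj i K Hi HK Hni). lra.
      + exists r. split; auto. intros t Ht. specialize (Hr' t Ht). lra. }
  destruct HP as [r3 [Hr3 H3]].
  exists (Rmin r1 (Rmin r2 r3)). split; [repeat apply Rmin_glb_lt; auto|].
  intros t [Ht1 Ht2].
  assert (Ht : t < r1 /\ t < r2 /\ t < r3).
  { pose proof (Rmin_l r1 (Rmin r2 r3)). pose proof (Rmin_r r1 (Rmin r2 r3)).
    pose proof (Rmin_l r2 r3). pose proof (Rmin_r r2 r3). lra. }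
  rewrite (H1 (x0 + t)) by lra. rewrite (H2 (x0 - t)) by lra.
  assert (E : 2 * lift x0 y0 = ZR x0 x0 y0 + ZL x0 x0 y0) by (rewrite ZL_at; unfold lift; lra).
  rewrite E.
  apply Rle_trans with (Rsum N (fun i => Rsum N (fun j => cr i j t))).
  - right. rewrite (Rsum2_cross K); auto.
    + rewrite <- Rsum_scal. apply Rsum_ext. intros j Hj. unfold cr.
      destruct (Nat.eq_dec K K) as [_|]; [|tauto].
      destruct (Nat.eq_dec j K) as [->|Hn].
      * unfold gt01, lt01, x0. destruct (Rlt_dec (X K) (X K)); [lra|].
        unfold side. replace (Y K - Y K - m * (X K - X K)) with 0 by ring. rewrite pos_le by lra. lra.
      * rewrite (nu_sym j K). pose proof (gt_lt_K K j HK Hj Hn) as G. fold x0 in G.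
        rewrite Rplus_0_r, Rplus_0_l.
        replace (gt01 x0 j) with (1 - lt01 x0 j) by lra. ring.
    + unfold cr, gt01, lt01, x0. destruct (Nat.eq_dec K K); [|tauto].
      destruct (Rlt_dec (X K) (X K)); lra.
    + intros i j _ _ Hi Hj. unfold cr.
      destruct (Nat.eq_dec i K), (Nat.eq_dec j K); tauto || lra.
  - assert (G : forall a b c d, a - b + (c - d) = a + c - (b + d)) by (intros; ring).
    rewrite <- G. unfold ZR, ZL. rewrite <- !Rsum_minus, <- Rsum_plus.
    apply Rsum_le. intros i Hi. rewrite <- !Rsum_minus, <- Rsum_plus. apply Rsum_le. intros j Hj.
    pose proof (H3 t ltac:(lra) i Hi j Hj). lra.
Qed.

Lemma side_balance K m : (K < N)%nat -> Rsum N (fun j => nu K j * side K m j) = 0.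
Proof.
  intros HK. rewrite (Rsum_ext _ _ (fun j => nu K j * (Y j - Y K) - m * (nu K j * (X j - X K)))).
  - rewrite Rsum_minus, Rsum_scal, eqX, eqY by auto. lra.
  - intros. unfold side. ring.
Qed.

Lemma side_terms K m : (K < N)%nat -> (forall j, (j < N)%nat -> bar K j -> side K m j <= 0) ->
  forall j, (j < N)%nat -> 0 <= nu K j * pos (side K m j).
Proof.
  intros HK H j Hj. destruct (Nat.eq_dec j K) as [->|Hn].
  - unfold side. replace (Y K - Y K - m * (X K - X K)) with 0 by ring. rewrite pos_le by lra. lra.
  - destruct (classic (bar K j)) as [B|B].
    + rewrite pos_le by auto. lra.
    + pose proof (strut_pos K j HK Hj (not_eq_sym Hn) B). pose proof (pos_nonneg (side K m j)). nra.
Qed.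

(** Force balance across the line: positive and negative parts of the sides have the same weighted
    sum, so the case of bars below the line transfers to bars above it. *)
Lemma side_flip K m : (K < N)%nat ->
  Rsum N (fun j => nu K j * pos (side K m j)) = Rsum N (fun j => nu K j * pos (- side K m j)).
Proof.
  intros HK. rewrite (Rsum_ext N _ (fun j => nu K j * side K m j + nu K j * pos (- side K m j))).
  - rewrite Rsum_plus, side_balance by auto. lra.
  - intros j _. rewrite (pos_opp (side K m j)) at 1. ring.
Qed.

Lemma side_terms_ge K m : (K < N)%nat -> (forall j, (j < N)%nat -> bar K j -> 0 <= side K m j) ->
  forall j, (j < N)%nat -> 0 <= nu K j * pos (- side K m j).
Proof.
  intros HK H j Hj. destruct (Nat.eq_dec j K) as [->|Hn].
  - unfold side. replace (Y K - Y K - m * (X K - X K)) with 0 by ring. rewrite pos_le by lra. lra.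
  - destruct (classic (bar K j)) as [B|B].
    + rewrite pos_le by (specialize (H j Hj B); lra). lra.
    + pose proof (strut_pos K j HK Hj (not_eq_sym Hn) B). pose proof (pos_nonneg (- side K m j)). nra.
Qed.

(** Degree two enters here: the line along one bar at [K] has the other bar on one closed side. The
    cases [a = K] and [b = K] cover dummy entries of [deg2]. *)
Lemma exists_good_slope K : (K < N)%nat -> exists m,
  (forall j, (j < N)%nat -> bar K j -> side K m j <= 0) \/
  (forall j, (j < N)%nat -> bar K j -> 0 <= side K m j).
Proof.
  intros HK. destruct (deg2 K HK) as [a [b [Ha [Hb Hab]]]].
  destruct (Nat.eq_dec a K) as [Ea|Na]; [|destruct (Nat.eq_dec b K) as [Eb|Nb]].
  - subst a. destruct (Nat.eq_dec b K) as [Eb|Nb].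
    + subst b. exists 0. left. intros j _ Hj. destruct (Hab j Hj) as [->| ->]; unfold side; lra.
    + exists ((Y b - Y K) / (X b - X K)). left.
      pose proof (Xinj b K Hb HK Nb).
      intros j _ Hj. destruct (Hab j Hj) as [->| ->]; unfold side; right; field; lra.
  - subst b. exists ((Y a - Y K) / (X a - X K)). left.
    pose proof (Xinj a K Ha HK Na).
    intros j _ Hj. destruct (Hab j Hj) as [->| ->]; unfold side; right; field; lra.
  - pose proof (Xinj a K Ha HK Na) as Xa. pose proof (Xinj b K Hb HK Nb) as Xb.
    set (m := (Y a - Y K) / (X a - X K)).
    assert (Sa : side K m a = 0) by (unfold side, m; field; lra).
    exists m. destruct (Rle_dec (side K m b) 0) as [C|C]; [left|right];
    intros j _ Hj; destruct (Hab j Hj) as [->| ->]; lra.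
Qed.

Lemma side_sum_nonneg K : (K < N)%nat -> exists m,
  0 <= Rsum N (fun j => nu K j * pos (side K m j)).
Proof.
  intros HK. destruct (exists_good_slope K HK) as [m [H|H]]; exists m.
  - apply Rsum_nonneg. now apply side_terms.
  - rewrite side_flip by auto. apply Rsum_nonneg. now apply side_terms_ge.
Qed.

(** By [bar_disj] at most one bar passes through the point, and its slope is taken. *)
Lemma nonvertex_slope x0 y0 : exists m,
  forall i j, (i < N)%nat -> (j < N)%nat -> bar i j -> X i < x0 < X j -> area2 i j x0 y0 = 0 ->
     Y j - Y i = m * (X j - X i).
Proof.
  destruct (classic (exists i j, (i < N)%nat /\ (j < N)%nat /\ bar i j /\ X i < x0 < X j /\
    area2 i j x0 y0 = 0)) as [[i [j [Hi [Hj [B [Hx E]]]]]]|H].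
  - exists ((Y j - Y i) / (X j - X i)). intros k l Hk Hl B' Hx' E'.
    destruct (bar_disj i j k l x0 y0) as [-> ->]; auto. field. lra.
  - exists 0. intros i j Hi Hj B Hx E. exfalso. apply H. exists i, j. auto.
Qed.

(* A positive maximum of [lift] is impossible; the term [e * x^2] makes the local convexity
   of [lift] along a suitable line through the maximiser strict. *)
Lemma lift_nonpos x y : lift x y <= 0.
Proof.
  apply Rnot_lt_le. intros Hpos.
  destruct (finite_max N (fun i => Rabs (X i))) as [B1 [HB1 HX]].
  destruct (finite_max N (fun i => Rabs (Y i))) as [B2 [HB2 HY]].
  set (B := B1 + B2 + 1).
  assert (HB : forall i, (i < N)%nat -> Rabs (X i) < B /\ Rabs (Y i) < B).
  { intros i Hi. specialize (HX i Hi). specialize (HY i Hi). unfold B. lra. }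
  (* On the box the term [e * (x * x)] is at most [M / 2], so the maximiser of [F] still has
     positive lift and lies inside the box. *)
  set (M := lift x y) in *. set (e := M / (2 * (B * B))).
  assert (BB : 0 < B) by (unfold B; lra).
  assert (He : 0 < e) by (unfold e; apply Rdiv_lt_0_compat; nra).
  assert (HeB : e * (B * B) = M / 2) by (unfold e; field; lra).
  set (F := fun x y => lift x y + e * (x * x)).
  assert (Hmax : exists x1 y1, -B <= x1 <= B /\ - B <= y1 <= B /\
     forall x2 y2, -B <= x2 <= B -> - B <= y2 <= B -> F x2 y2 <= F x1 y1).
  { apply rect_max; try lra. intros u w a b _ Hu Hw.
    unfold F. apply CV_plus; [now apply lift_cv|]. cvt. }
  destruct Hmax as [x1 [y1 [Hx1 [Hy1 Hmax]]]].
  assert (Hin : -B < x <B /\ -B < y < B).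
  { apply NNPP. intros C. pose proof (lift_out_box B x y HB C). unfold M in Hpos. lra. }
  assert (Hz : 0 < lift x1 y1).
  { pose proof (Hmax x y ltac:(lra) ltac:(lra)) as H. unfold F in H. fold M in H.
    assert (e * (x1 * x1) <= e * (B * B)) by (apply Rmult_le_compat_l; nra).
    assert (0 <= e * (x * x)) by nra. lra. }
  assert (Hin1 : -B < x1 <B /\ -B < y1 < B).
  { apply NNPP. intros C. pose proof (lift_out_box B x1 y1 HB C). lra. }
  assert (Hsd : exists m r, 0 < r /\ forall t, 0 < t < r ->
     0 <= lift (x1 + t) (y1 + t * m) + lift (x1 - t) (y1 - t * m) - 2 * lift x1 y1).
  { destruct (classic (exists K, (K < N)%nat /\ X K = x1 /\ Y K = y1)) as [[K [HK [<- <-]]]|Hn].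
    - destruct (side_sum_nonneg K HK) as [m Hm]. exists m.
      destruct (second_diff_vertex K m HK) as [r [Hr Hr']]. exists r. split; auto.
      intros t Ht. specialize (Hr' t Ht). eapply Rle_trans; [|exact Hr']. nra.
    - destruct (nonvertex_slope x1 y1) as [m Hm]. exists m. apply second_diff_nonvertex; auto.
      intros i Hi [C1 C2]. apply Hn. now exists i. }
  destruct Hsd as [m [r [Hr Hsd]]].
  assert (Hrr : exists t, 0 < t < r /\ t < B - x1 /\ t < x1 + B /\ t * Rabs m < B - y1 /\
    t * Rabs m < y1 + B).
  { pose proof (Rabs_pos m).
    set (d := Rmin r (Rmin (Rmin (B - x1) (x1 + B)) (Rmin (B - y1) (y1 + B)))).
    assert (Hd : 0 < d) by (unfold d; repeat apply Rmin_glb_lt; lra).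
    assert (Hd' : d <= r /\ d <= B - x1 /\ d <= x1 + B /\ d <= B - y1 /\ d <= y1 + B).
    { assert (D1 : d <= r) by apply Rmin_l.
      assert (D2 : d <= Rmin (Rmin (B - x1) (x1 + B)) (Rmin (B - y1) (y1 + B))) by apply Rmin_r.
      pose proof (Rmin_l (Rmin (B - x1) (x1 + B)) (Rmin (B - y1) (y1 + B))).
      pose proof (Rmin_r (Rmin (B - x1) (x1 + B)) (Rmin (B - y1) (y1 + B))).
      pose proof (Rmin_l (B - x1) (x1 + B)). pose proof (Rmin_r (B - x1) (x1 + B)).
      pose proof (Rmin_l (B - y1) (y1 + B)). pose proof (Rmin_r (B - y1) (y1 + B)). lra. }
    exists (d / (2 + Rabs m)).
    assert (T1 : 0 < d / (2 + Rabs m)) by (apply Rdiv_lt_0_compat; lra).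
    assert (T2 : d / (2 + Rabs m) * (2 + Rabs m) = d) by (field; lra).
    repeat split; nra. }
  destruct Hrr as [t [Ht [T1 [T2 [T3 T4]]]]]. specialize (Hsd t Ht).
  assert (Hm : - (t * Rabs m) <= t * m <= t * Rabs m).
  { pose proof (Rle_abs m). pose proof (Rle_abs (- m)). rewrite Rabs_Ropp in *. nra. }
  pose proof (Hmax (x1 + t) (y1 + t * m) ltac:(lra) ltac:(lra)).
  pose proof (Hmax (x1 - t) (y1 - t * m) ltac:(lra) ltac:(lra)).
  unfold F in *.
  assert (0 < e * (t * t)) by (apply Rmult_lt_0_compat; nra).
  assert (e * ((x1 + t) * (x1 + t)) + e * ((x1 - t) * (x1 - t)) =
    2 * (e * (x1 * x1)) + 2 * (e * (t * t))) by ring.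
  lra.
Qed.

(** All vertices lie on or below a line through [v], so no segment passes above [v]. *)
Lemma lift_hull_le v m : (forall j, (j < N)%nat -> side v m j <= 0) -> lift (X v) (Y v) = 0.
Proof.
  intros H. apply Rsum_0; intros i Hi. apply Rsum_0; intros j Hj.
  pose proof (H i Hi). pose proof (H j Hj). unfold side, chR in *.
  destruct (Rle_dec (X i) (X v)), (Rlt_dec (X v) (X j)); try lra.
  rewrite pos_le; [lra|]. unfold area2. nra.
Qed.

(** Every segment crossing the vertical passes on or above [v], so the lift is the torque of the
    whole cut. *)
Lemma lift_hull_ge v m : (forall j, (j < N)%nat -> 0 <= side v m j) -> lift (X v) (Y v) = 0.
Proof.
  intros H. rewrite <- (cut_zero (X v) (Y v)).
  apply Rsum_ext; intros i Hi. apply Rsum_ext; intros j Hj.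
  pose proof (H i Hi). pose proof (H j Hj). unfold side, chR in *.
  destruct (Rle_dec (X i) (X v)), (Rlt_dec (X v) (X j)); try lra.
  rewrite pos_ge; [lra|]. unfold area2. nra.
Qed.

(** A zero of the nonpositive function [lift] is a maximum, so second differences there are
    nonpositive. *)
Lemma hull_side_sum v m : (v < N)%nat -> lift (X v) (Y v) = 0 ->
  Rsum N (fun j => nu v j * pos (side v m j)) <= 0.
Proof.
  intros Hv H. destruct (second_diff_vertex v m Hv) as [r [Hr Hr']].
  specialize (Hr' (r / 2) ltac:(lra)).
  pose proof (lift_nonpos (X v + r / 2) (Y v + r / 2 * m)).
  pose proof (lift_nonpos (X v - r / 2) (Y v - r / 2 * m)). nra.
Qed.

(** A vertex strictly above the line is joined to [v] by a strut, whose positive stress would make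
    the sum in [hull_side_sum] positive. *)
Lemma hull_side_le v m : (v < N)%nat -> lift (X v) (Y v) = 0 ->
  (forall j, (j < N)%nat -> bar v j -> side v m j <= 0) ->
  forall j, (j < N)%nat -> side v m j <= 0.
Proof.
  intros Hv H Hb j Hj. apply Rnot_lt_le. intros C.
  pose proof (hull_side_sum v m Hv H) as S.
  assert (Hn : v <> j) by (intros ->; unfold side in C; lra).
  assert (B : ~ bar v j) by (intros B; specialize (Hb j Hj B); lra).
  pose proof (Rsum_term_le N _ j (side_terms v m Hv Hb) Hj) as T.
  pose proof (strut_pos v j Hv Hj Hn B). cbv beta in T.
  rewrite (pos_ge (side v m j)) in T by lra. nra.
Qed.

Lemma hull_side_ge v m : (v < N)%nat -> lift (X v) (Y v) = 0 ->
  (forall j, (j < N)%nat -> bar v j -> 0 <= side v m j) ->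
  forall j, (j < N)%nat -> 0 <= side v m j.
Proof.
  intros Hv H Hb j Hj. apply Rnot_lt_le. intros C.
  pose proof (hull_side_sum v m Hv H) as S. rewrite side_flip in S by auto.
  assert (Hn : v <> j) by (intros ->; unfold side in C; lra).
  assert (B : ~ bar v j) by (intros B; specialize (Hb j Hj B); lra).
  pose proof (Rsum_term_le N _ j (side_terms_ge v m Hv Hb) Hj) as T.
  pose proof (strut_pos v j Hv Hj Hn B). cbv beta in T.
  rewrite (pos_ge (- side v m j)) in T by lra. nra.
Qed.

End Stress.

(** * Simple configurations and equilibrium stresses *)

Definition orient (a b c : pt) : R :=
  (fst b - fst a) * (snd c - snd a) - (snd b - snd a) * (fst c - fst a).

Definition proper_cross (a b c d : pt) : Prop :=
  orient a b c * orient a b d < 0 /\ orient c d a * orient c d b < 0.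

(** Cross product of the direction [d] with the vector from [u] to [v]; nonpositive when [v] is not
    to the left of the line through [u] directed by [d]. *)
Definition det (d u v : pt) : R := fst d * (snd v - snd u) - snd d * (fst v - fst u).

(** The properties shared by open chains and by closed chains with at least three vertices. [g_path]
    bounds a configuration once vertex 0 is bounded; [g_deg2] may repeat a neighbour or name a dummy
    one. *)
Record good_graph (G : lgraph) : Prop := GoodGraph {
  g_src : forall k, (k < nE G)%nat -> (src G k < nV G)%nat;
  g_tgt : forall k, (k < nE G)%nat -> (tgt G k < nV G)%nat;
  g_ne : forall k, (k < nE G)%nat -> src G k <> tgt G k;
  g_path : forall i, (S i < nV G)%nat -> exists k, (k < nE G)%nat /\ src G k = i /\ tgt G k = S i;
  g_simple : forall k m, (k < nE G)%nat -> (m < nE G)%nat -> k <> m ->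
    ~ ((src G m = src G k \/ src G m = tgt G k) /\ (tgt G m = src G k \/ tgt G m = tgt G k));
  g_deg2 : forall v, (v < nV G)%nat -> exists a b, (a < nV G)%nat /\ (b < nV G)%nat /\
    forall k, (k < nE G)%nat -> (src G k = v -> tgt G k = a \/ tgt G k = b) /\
      (tgt G k = v -> src G k = a \/ src G k = b) }.

Lemma g_inc G : good_graph G -> forall v, (v < nV G)%nat -> nV G = 1%nat \/
    exists k, (k < nE G)%nat /\ (src G k = v \/ tgt G k = v).
Proof.
  intros HG v Hv. destruct v as [|v].
  - destruct (Nat.eq_dec (nV G) 1) as [|N]; [now left|right].
    destruct (g_path G HG 0) as [k [Hk [A _]]]; [lia|]. exists k. auto.
  - right. destruct (g_path G HG v Hv) as [k [Hk [_ A]]]. exists k. auto.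
Qed.

Definition bar (G : lgraph) (i j : nat) : Prop :=
  exists k, (k < nE G)%nat /\ ((src G k = i /\ tgt G k = j) \/ (src G k = j /\ tgt G k = i)).

Definition off_edges (G : lgraph) (C : nat -> pt) : Prop :=
  forall k v, (k < nE G)%nat -> (v < nV G)%nat -> v <> src G k -> v <> tgt G k ->
    ~ on_seg (C (src G k)) (C (tgt G k)) (C v).

Definition no_cross (G : lgraph) (C : nat -> pt) : Prop :=
  forall k m, (k < nE G)%nat -> (m < nE G)%nat ->
    ~ proper_cross (C (src G k)) (C (tgt G k)) (C (src G m)) (C (tgt G m)).

(** Nontouching configurations with positive bar lengths, in a form suited to limits: the barrier
    controls vertices on bars, and proper crossing is an open condition. *)
Definition simple_conf (G : lgraph) (C : nat -> pt) : Prop :=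
  (forall k, (k < nE G)%nat -> C (src G k) <> C (tgt G k)) /\ off_edges G C /\ no_cross G C.

Lemma pt_eq (a b : pt) : fst a = fst b -> snd a = snd b -> a = b.
Proof. destruct a, b; simpl; intros; subst; reflexivity. Qed.

Lemma pt_neq (a b : pt) : a <> b -> fst a <> fst b \/ snd a <> snd b.
Proof.
  intros H. destruct (Req_dec (fst a) (fst b)); [right|left]; auto.
  intros E. apply H. now apply pt_eq.
Qed.

Lemma on_seg_sym a b z : on_seg a b z -> on_seg b a z.
Proof.
  intros [t [Ht ->]]. exists (1 - t). split; [lra|]. apply pt_eq; simpl; ring.
Qed.

Lemma on_seg_src a b : on_seg a b a.
Proof. exists 0. split; [lra|]. apply pt_eq; simpl; ring. Qed.

Lemma on_seg_tgt a b : on_seg a b b.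
Proof. exists 1. split; [lra|]. apply pt_eq; simpl; ring. Qed.

Lemma orient_param a b c : a <> b -> orient a b c = 0 ->
  exists t, c = (fst a + t * (fst b - fst a), snd a + t * (snd b - snd a)).
Proof.
  intros H E. unfold orient in E. destruct (pt_neq a b H) as [D|D].
  - exists ((fst c - fst a) / (fst b - fst a)). apply pt_eq; simpl.
    + field. lra.
    + replace ((fst c - fst a) / (fst b - fst a) * (snd b - snd a))
        with (((snd b - snd a) * (fst c - fst a)) / (fst b - fst a)) by (field; lra).
      replace ((snd b - snd a) * (fst c - fst a)) with ((fst b - fst a) * (snd c - snd a)) by lra.
      field. lra.
  - exists ((snd c - snd a) / (snd b - snd a)). apply pt_eq; simpl.
    + replace ((snd c - snd a) / (snd b - snd a) * (fst b - fst a))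
        with (((fst b - fst a) * (snd c - snd a)) / (snd b - snd a)) by (field; lra).
      replace ((fst b - fst a) * (snd c - snd a)) with ((snd b - snd a) * (fst c - fst a)) by lra.
      field. lra.
    + field. lra.
Qed.

(** Unless there is a single vertex, every vertex ends a bar, so coinciding vertices would collapse
    a bar or put a vertex on a foreign bar. *)
Lemma simple_inj G C : good_graph G -> simple_conf G C ->
  forall v w, (v < nV G)%nat -> (w < nV G)%nat -> C v = C w -> v = w.
Proof.
  intros HG [H1 [H2 _]] v w Hv Hw E.
  destruct (g_inc G HG w Hw) as [D|[k [Hk Hi]]]; [lia|].
  destruct (Nat.eq_dec v (src G k)) as [A|A]; [|destruct (Nat.eq_dec v (tgt G k)) as [B|B]].
  - destruct Hi as [Hi|Hi]; [congruence|]. exfalso. apply (H1 k Hk). congruence.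
  - destruct Hi as [Hi|Hi]; [|congruence]. exfalso. apply (H1 k Hk). congruence.
  - exfalso. apply (H2 k v Hk Hv A B). rewrite E.
    destruct Hi as [<-|<-]; [apply on_seg_src|apply on_seg_tgt].
Qed.

Lemma between_on_seg (a b c d : pt) (s t u : R) :
  c = (fst a + s * (fst b - fst a), snd a + s * (snd b - snd a)) ->
  d = (fst a + t * (fst b - fst a), snd a + t * (snd b - snd a)) ->
  s <= u <= t -> s < t ->
  on_seg c d (fst a + u * (fst b - fst a), snd a + u * (snd b - snd a)).
Proof.
  intros -> -> H H'. exists ((u - s) / (t - s)). split.
  - split.
    + apply Rmult_le_pos; [lra|]. left. apply Rinv_0_lt_compat. lra.
    + apply Rmult_le_reg_r with (t - s); [lra|]. 
      replace ((u - s) / (t - s) * (t - s)) with (u - s) by (field; lra). lra.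
  - apply pt_eq; simpl; field; lra.
Qed.

(* [g] and [d] are the positions of the ends of [m] on the line of [k], and [t] is a common point
   interior to [k]. *)
Lemma simple_no_overlap G C k ic id :
  simple_conf G C -> (k < nE G)%nat ->
  forall m, (m < nE G)%nat -> ((src G m = ic /\ tgt G m = id) \/ (src G m = id /\ tgt G m = ic)) ->
  (src G k < nV G)%nat -> (tgt G k < nV G)%nat -> (ic < nV G)%nat -> (id < nV G)%nat ->
  ~ ((ic = src G k \/ ic = tgt G k) /\ (id = src G k \/ id = tgt G k)) ->
  forall g t d, g < t < d -> 0 < t < 1 ->
  let a := C (src G k) in let b := C (tgt G k) in
  C ic = (fst a + g * (fst b - fst a), snd a + g * (snd b - snd a)) ->
  C id = (fst a + d * (fst b - fst a), snd a + d * (snd b - snd a)) -> False.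
Proof.
  intros [H1 [H2 _]] Hk m Hm Hcd Va Vb Vc Vd Hns g t d Hgd Ht a b Ec Ed.
  assert (Pa : a = (fst a + 0 * (fst b - fst a), snd a + 0 * (snd b - snd a)))
    by (apply pt_eq; simpl; ring).
  assert (Pb : b = (fst a + 1 * (fst b - fst a), snd a + 1 * (snd b - snd a)))
    by (apply pt_eq; simpl; ring).
  assert (Hab : a <> b) by now apply H1.
  assert (U : forall s u, (fst a + s * (fst b - fst a), snd a + s * (snd b - snd a)) =
     (fst a + u * (fst b - fst a), snd a + u * (snd b - snd a)) -> s = u).
  { intros s u E. injection E as E1 E2. destruct (pt_neq a b Hab) as [D|D].
    - apply Rmult_eq_reg_r with (fst b - fst a); lra.
    - apply Rmult_eq_reg_r with (snd b - snd a); lra. }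
  assert (Hm' : forall v, (v < nV G)%nat -> on_seg (C ic) (C id) (C v) -> v = ic \/ v = id).
  { intros v Hv Hs. destruct Hcd as [[E1 E2]|[E1 E2]]; apply NNPP; intros N.
    - apply (H2 m v Hm Hv); rewrite ?E1, ?E2; auto.
    - apply (H2 m v Hm Hv); rewrite ?E1, ?E2; auto. now apply on_seg_sym. }
  assert (Hk' : forall v, (v < nV G)%nat -> on_seg a b (C v) -> v = src G k \/ v = tgt G k).
  { intros v Hv Hs. apply NNPP; intros N. apply (H2 k v Hk Hv); auto. }
  destruct (Rle_dec 0 g) as [G0|G0].
  - assert (Cc : ic = src G k \/ ic = tgt G k).
    { apply Hk'; auto. rewrite Ec. apply (between_on_seg a b a b 0 1 g); auto; lra. }
    destruct (Rle_dec d 1) as [D1|D1].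
    + apply Hns. split; auto. apply Hk'; auto. rewrite Ed.
      apply (between_on_seg a b a b 0 1 d); auto; lra.
    + assert (B : tgt G k = ic \/ tgt G k = id).
      { apply Hm'; auto. change (C (tgt G k)) with b. rewrite Pb.
        apply (between_on_seg a b _ _ g d 1); auto; lra. }
      destruct B as [B|B].
      * assert (g = 1); [|lra]. apply U. rewrite <- Ec, <- Pb. unfold b. now rewrite B.
      * assert (d = 1); [|lra]. apply U. rewrite <- Ed, <- Pb. unfold b. now rewrite B.
  - assert (B : src G k = ic \/ src G k = id).
    { apply Hm'; auto. change (C (src G k)) with a. rewrite Pa.
      apply (between_on_seg a b _ _ g d 0); auto; lra. }
    destruct B as [B|B].
    + assert (g = 0); [|lra]. apply U. rewrite <- Ec, <- Pa. unfold a. now rewrite B.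
    + assert (d = 0); [|lra]. apply U. rewrite <- Ed, <- Pa. unfold a. now rewrite B.
Qed.

(** A common point interior to both bars is a proper crossing, unless the bars are collinear; then
    they overlap and an end of one lies on the other. *)
Lemma simple_touch G C k m z : good_graph G -> simple_conf G C ->
  (k < nE G)%nat -> (m < nE G)%nat -> k <> m ->
  on_seg (C (src G k)) (C (tgt G k)) z -> on_seg (C (src G m)) (C (tgt G m)) z ->
  (z = C (src G k) \/ z = C (tgt G k)) /\ (z = C (src G m) \/ z = C (tgt G m)).
Proof.
  intros HG HC Hk Hm Hn Zk Zm.
  pose proof HC as [H1 [H2 H3]].
  pose proof (g_src G HG k Hk) as Va. pose proof (g_tgt G HG k Hk) as Vb.
  pose proof (g_src G HG m Hm) as Vc. pose proof (g_tgt G HG m Hm) as Vd.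
  assert (Hk' : forall v, (v < nV G)%nat -> on_seg (C (src G k)) (C (tgt G k)) (C v) ->
    v = src G k \/ v = tgt G k).
  { intros v Hv Hs. apply NNPP; intros N. apply (H2 k v Hk Hv); auto. }
  assert (Hm' : forall v, (v < nV G)%nat -> on_seg (C (src G m)) (C (tgt G m)) (C v) ->
    v = src G m \/ v = tgt G m).
  { intros v Hv Hs. apply NNPP; intros N. apply (H2 m v Hm Hv); auto. }
  destruct (classic (z = C (src G k))) as [E|E1].
  { split; auto. rewrite E in Zm. destruct (Hm' _ Va Zm) as [<-|<-]; auto. }
  destruct (classic (z = C (tgt G k))) as [E|E2].
  { split; auto. rewrite E in Zm. destruct (Hm' _ Vb Zm) as [<-|<-]; auto. }
  destruct (classic (z = C (src G m))) as [E|E3].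
  { split; auto. rewrite E in Zk. destruct (Hk' _ Vc Zk) as [<-|<-]; auto. }
  destruct (classic (z = C (tgt G m))) as [E|E4].
  { split; auto. rewrite E in Zk. destruct (Hk' _ Vd Zk) as [<-|<-]; auto. }
  exfalso.
  pose proof (H1 k Hk) as Nk. pose proof (H1 m Hm) as Nm.
  destruct Zk as [t [Ht Et]]. destruct Zm as [s [Hs Es]].
  pose proof (H3 k m Hk Hm) as HP.
  pose proof (g_simple G HG k m Hk Hm Hn) as HS.
  set (a := C (src G k)) in *. set (b := C (tgt G k)) in *.
  set (c := C (src G m)) in *. set (d := C (tgt G m)) in *.
  assert (Ht' : 0 < t < 1).
  { split; apply Rnot_le_lt; intros D.
    - apply E1. rewrite Et. replace t with 0 by lra. apply pt_eq; simpl; ring.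
    - apply E2. rewrite Et. replace t with 1 by lra. apply pt_eq; simpl; ring. }
  assert (Hs' : 0 < s < 1).
  { split; apply Rnot_le_lt; intros D.
    - apply E3. rewrite Es. replace s with 0 by lra. apply pt_eq; simpl; ring.
    - apply E4. rewrite Es. replace s with 1 by lra. apply pt_eq; simpl; ring. }
  rewrite Et in Es. injection Es as X1 X2.
  assert (O1 : (1 - s) * orient a b c + s * orient a b d = 0).
  { transitivity ((fst b - fst a) * ((snd c + s * (snd d - snd c)) - snd a) -
      (snd b - snd a) * ((fst c + s * (fst d - fst c)) - fst a)); [unfold orient; ring|].
    rewrite <- X1, <- X2. ring. }
  assert (O2 : (1 - t) * orient c d a + t * orient c d b = 0).
  { transitivity ((fst d - fst c) * ((snd a + t * (snd b - snd a)) - snd c) -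
      (snd d - snd c) * ((fst a + t * (fst b - fst a)) - fst c)); [unfold orient; ring|].
    rewrite X1, X2. ring. }
  assert (Hcol : orient a b c = 0 -> False).
  { intros Z. assert (Z' : orient a b d = 0).
    { rewrite Z in O1. apply Rmult_eq_reg_l with s; lra. }
    destruct (orient_param a b c Nk Z) as [g Eg]. destruct (orient_param a b d Nk Z') as [e Ee].
    assert (Hgt : t = g + s * (e - g)).
    { rewrite Eg, Ee in X1, X2. simpl in X1, X2. destruct (pt_neq a b Nk) as [D|D].
      - apply Rmult_eq_reg_r with (fst b - fst a); lra.
      - apply Rmult_eq_reg_r with (snd b - snd a); lra. }
    assert (Hge : g <> e).
    { intros ->. apply Nm. rewrite Eg, Ee. reflexivity. }
    destruct (Rlt_dec g e) as [L|L].
    - apply (simple_no_overlap G C k (src G m) (tgt G m) HC Hk m Hm (or_introl (conj eq_refl eq_refl))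
        Va Vb Vc Vd HS g t e); [split; nra|exact Ht'|exact Eg|exact Ee].
    - apply (simple_no_overlap G C k (tgt G m) (src G m) HC Hk m Hm (or_intror (conj eq_refl eq_refl))
        Va Vb Vd Vc ltac:(tauto) e t g); [split; nra|exact Ht'|exact Ee|exact Eg]. }
  apply HP. split.
  - assert (L : orient a b c <> 0) by tauto. apply Rnot_le_lt. intros D.
    assert (0 < orient a b c * orient a b c) by nra.
    assert (orient a b c * ((1 - s) * orient a b c + s * orient a b d) = 0) by (rewrite O1; ring).
    nra.
  - destruct (Req_dec (orient c d a) 0) as [L|L].
    2: { apply Rnot_le_lt. intros D.
      assert (0 < orient c d a * orient c d a) by nra.
      assert (orient c d a * ((1 - t) * orient c d a + t * orient c d b) = 0) by (rewrite O2; ring).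
      nra. }
    exfalso. apply Hcol. assert (Z' : orient c d b = 0).
    { rewrite L in O2. apply Rmult_eq_reg_l with t; lra. }
    destruct (orient_param c d a Nm L) as [g Eg]. destruct (orient_param c d b Nm Z') as [e Ee].
    unfold orient. rewrite Eg, Ee. simpl. ring.
Qed.

Lemma avoid_finite n (g : nat -> nat -> R) (a b : R) :
  exists l, l <> a /\ l <> b /\ forall i j, (i < n)%nat -> (j < n)%nat -> l <> g i j.
Proof.
  assert (H : forall i, exists B, 0 <= B /\ forall j, (j < n)%nat -> g i j <= B)
    by (intros; apply finite_max).
  destruct (choice _ _ _ H) as [h Hh].
  destruct (finite_max n h) as [B [HB HB']].
  exists (B + Rabs a + Rabs b + 1).
  pose proof (Rle_abs a). pose proof (Rle_abs b). pose proof (Rabs_pos a). pose proof (Rabs_pos b).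
  split; [lra|]. split; [lra|]. intros i j Hi Hj.
  pose proof (HB' i Hi). destruct (Hh i) as [_ A]. specialize (A j Hj). lra.
Qed.

(** The shear taking (x,y) to (x + l y, y) makes the abscissas distinct and [d0], [d] nonvertical,
    and it preserves equilibrium and orientation. The sign of [fst d + l * snd d] decides whether
    the side lemmas are used from above or from below. *)
Theorem stress_hull G C nu : good_graph G -> simple_conf G C ->
  (forall i j, nu i j = nu j i) ->
  (forall i, (i < nV G)%nat -> Rsum (nV G) (fun j => nu i j * (fst (C j) - fst (C i))) = 0) ->
  (forall i, (i < nV G)%nat -> Rsum (nV G) (fun j => nu i j * (snd (C j) - snd (C i))) = 0) ->
  (forall i j, (i < nV G)%nat -> (j < nV G)%nat -> i <> j -> ~ bar G i j -> 0 < nu i j) ->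
  forall v, (v < nV G)%nat ->
  forall d0, d0 <> (0, 0) -> (forall j, (j < nV G)%nat -> det d0 (C v) (C j) <= 0) ->
  forall d, d <> (0, 0) -> (forall j, (j < nV G)%nat -> bar G v j -> det d (C v) (C j) <= 0) ->
  forall j, (j < nV G)%nat -> det d (C v) (C j) <= 0.
Proof.
  intros HG HC Hsym E1 E2 Hpos v Hv d0 Hd0 Hhull d Hd Hbar.
  (* [l] avoids the values at which two vertices would get the same abscissa or one of the two
     directions would become vertical. *)
  destruct (avoid_finite (nV G) (fun i j => - (fst (C i) - fst (C j)) / (snd (C i) - snd (C j)))
    (- fst d0 / snd d0) (- fst d / snd d)) as [l [L1 [L2 L3]]].
  set (X := fun i => fst (C i) + l * snd (C i)). set (Y := fun i => snd (C i)).
  assert (NZ : forall u w, (u, w) <> (0, 0) -> l <> - u / w -> u + l * w <> 0).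
  { intros u w Huw Hl E. destruct (Req_dec w 0) as [->|Hw].
    - apply Huw. f_equal. lra.
    - apply Hl. field_simplify; auto. apply Rmult_eq_reg_r with w; auto.
      replace (- u / w * w) with (- u) by (field; auto). lra. }
  assert (Xinj : forall i j, (i < nV G)%nat -> (j < nV G)%nat -> i <> j -> X i <> X j).
  { intros i j Hi Hj Hn E. apply (NZ (fst (C i) - fst (C j)) (snd (C i) - snd (C j))).
    - intros F. injection F as F1 F2. apply Hn. apply (simple_inj G C HG HC); auto.
      apply pt_eq; lra.
    - now apply L3.
    - unfold X in E. lra. }
  assert (eqX : forall i, (i < nV G)%nat -> Rsum (nV G) (fun j => nu i j * (X j - X i)) = 0).
  { intros i Hi. rewrite (Rsum_ext _ _ (fun j => nu i j * (fst (C j) - fst (C i)) +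
      l * (nu i j * (snd (C j) - snd (C i))))).
    - rewrite Rsum_plus, Rsum_scal, E1, E2 by auto. lra.
    - intros. unfold X. ring. }
  assert (bsym : forall i j, bar G i j -> bar G j i).
  { intros i j [k [Hk H]]. exists k. tauto. }
  assert (deg2 : forall i, (i < nV G)%nat -> exists a b, (a < nV G)%nat /\ (b < nV G)%nat /\
     forall j, bar G i j -> j = a \/ j = b).
  { intros i Hi. destruct (g_deg2 G HG i Hi) as [a [b [Ha [Hb Hab]]]]. exists a, b.
    split; auto. split; auto. intros j [k [Hk [[A B]|[A B]]]]; subst;
      destruct (Hab k Hk); auto. }
  assert (Hseg : forall i j x y, X i < x < X j -> area2 X Y i j x y = 0 ->
     on_seg (C i) (C j) (x - l * y, y)).
  { intros i j x y Hx HA. set (t := (x - X i) / (X j - X i)).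
    assert (Ht : t * (X j - X i) = x - X i) by (unfold t; field; lra).
    assert (HY : t * (Y j - Y i) = y - Y i).
    { apply Rmult_eq_reg_r with (X j - X i); [|lra].
      replace (t * (Y j - Y i) * (X j - X i)) with ((x - X i) * (Y j - Y i)).
      - unfold area2 in HA. lra.
      - rewrite <- Ht. ring. }
    exists t. split.
    - split.
      + apply Rmult_le_pos; [lra|]. left. apply Rinv_0_lt_compat. lra.
      + apply Rmult_le_reg_r with (X j - X i); lra.
    - apply pt_eq; simpl; fold (Y i) (Y j).
      + replace x with (X i + t * (X j - X i)) by lra.
        replace y with (Y i + t * (Y j - Y i)) by lra. unfold X. fold (Y i) (Y j). ring.
      + lra. }
  assert (boff : forall i j k, (i < nV G)%nat -> (j < nV G)%nat -> (k < nV G)%nat -> bar G i j ->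
     X i < X k < X j -> area2 X Y i j (X k) (Y k) <> 0).
  { intros i j k Hi Hj Hk [e [He Hij]] Hx HA. apply Hseg in HA; auto.
    assert (Ek : (X k - l * Y k, Y k) = C k) by (apply pt_eq; unfold X, Y; simpl; ring).
    rewrite Ek in HA. destruct HC as [_ [H2 _]].
    destruct Hij as [[A B]|[A B]]; apply (H2 e k He Hk); rewrite ?A, ?B; auto; 
      try (intros ->; lra). now apply on_seg_sym. }
  assert (bdis : forall i j k m x y,
    (i < nV G)%nat -> (j < nV G)%nat -> (k < nV G)%nat -> (m < nV G)%nat -> bar G i j -> bar G k m ->
    X i < x < X j -> X k < x < X m -> area2 X Y i j x y = 0 -> area2 X Y k m x y = 0 -> i = k /\ j = m).
  { intros i j k m x y Hi Hj Hk Hm [e [He Hij]] [f [Hf Hkm]] Hx Hx' HA HA'.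
    apply Hseg in HA; auto. apply Hseg in HA'; auto.
    destruct (Nat.eq_dec e f) as [->|Hef].
    - destruct Hij as [[A B]|[A B]], Hkm as [[A' B']|[A' B']]; subst; auto; lra.
    - exfalso. set (z := (x - l * y, y)) in *.
      assert (T : z = C i \/ z = C j).
      { destruct (simple_touch G C e f z HG HC He Hf Hef) as [T _].
        - destruct Hij as [[A B]|[A B]]; rewrite A, B; auto. now apply on_seg_sym.
        - destruct Hkm as [[A B]|[A B]]; rewrite A, B; auto. now apply on_seg_sym.
        - destruct Hij as [[A B]|[A B]]; rewrite A, B in T; tauto. }
      assert (Zx : fst z + l * snd z = x) by (unfold z; simpl; ring).
      destruct T as [T|T]; rewrite T in Zx; [fold (X i) in Zx|fold (X j) in Zx]; lra. }
  assert (S : forall e j, fst e + l * snd e <> 0 ->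
     det e (C v) (C j) = (fst e + l * snd e) * side X Y v (snd e / (fst e + l * snd e)) j).
  { intros e j He. unfold det, side, X, Y. field. auto. }
  assert (K0 : fst d0 + l * snd d0 <> 0).
  { apply NZ; auto. rewrite <- surjective_pairing. auto. }
  assert (K1 : fst d + l * snd d <> 0).
  { apply NZ; auto. rewrite <- surjective_pairing. auto. }
  assert (HL : lift (nV G) X Y nu (X v) (Y v) = 0).
  { destruct (Rlt_dec 0 (fst d0 + l * snd d0)).
    - apply lift_hull_le with (snd d0 / (fst d0 + l * snd d0)).
      intros j Hj. specialize (Hhull j Hj). rewrite S in Hhull by auto. nra.
    - apply lift_hull_ge with (snd d0 / (fst d0 + l * snd d0)); auto.
      intros j Hj. specialize (Hhull j Hj). rewrite S in Hhull by auto.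
      assert (fst d0 + l * snd d0 < 0) by lra. nra. }
  intros j Hj. rewrite S by auto.
  destruct (Rlt_dec 0 (fst d + l * snd d)).
  - enough (side X Y v (snd d / (fst d + l * snd d)) j <= 0) by nra.
    apply (hull_side_le (nV G) X Y nu (bar G)); auto.
    intros i Hi B. specialize (Hbar i Hi B). rewrite S in Hbar by auto. nra.
  - enough (0 <= side X Y v (snd d / (fst d + l * snd d)) j) by nra.
    apply (hull_side_ge (nV G) X Y nu (bar G)); auto.
    intros i Hi B. specialize (Hbar i Hi B). rewrite S in Hbar by auto.
    assert (fst d + l * snd d < 0) by lra. nra.
Qed.

(** * Continuity of the order function *)

Lemma dist_arg_nonneg (p q : pt) : 0 <= (fst p - fst q) ^ 2 + (snd p - snd q) ^ 2.
Proof. pose proof (pow2_ge_0 (fst p - fst q)). pose proof (pow2_ge_0 (snd p - snd q)). lra. Qed.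

Lemma dist_nonneg p q : 0 <= dist p q.
Proof. apply sqrt_pos. Qed.

Lemma dist_sq p q : dist p q * dist p q = (fst p - fst q) ^ 2 + (snd p - snd q) ^ 2.
Proof. apply sqrt_sqrt, dist_arg_nonneg. Qed.

Lemma dist_eq0 p q : dist p q = 0 -> p = q.
Proof.
  intros H. pose proof (dist_sq p q) as E. rewrite H in E.
  pose proof (pow2_ge_0 (fst p - fst q)). pose proof (pow2_ge_0 (snd p - snd q)).
  apply pt_eq; apply Rminus_diag_uniq, Rsqr_0_uniq; rewrite Rsqr_pow2; lra.
Qed.

Lemma dist_self p : dist p p = 0.
Proof.
  apply Rsqr_0_uniq. unfold Rsqr. rewrite dist_sq. ring.
Qed.

Lemma dist_pos p q : p <> q -> 0 < dist p q.
Proof.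
  intros H. destruct (dist_nonneg p q) as [|E]; auto. exfalso. apply H. now apply dist_eq0.
Qed.

Lemma dist_sym p q : dist p q = dist q p.
Proof. unfold dist. f_equal. ring. Qed.

Definition ptcv (u : nat -> pt) (l : pt) : Prop :=
  Un_cv (fun k => fst (u k)) (fst l) /\ Un_cv (fun k => snd (u k)) (snd l).

Lemma cv_dist u v p q : ptcv u p -> ptcv v q -> Un_cv (fun k => dist (u k) (v k)) (dist p q).
Proof.
  intros [U1 U2] [V1 V2]. unfold dist. apply (cv_sqrt (fun k => (fst (u k) - fst (v k)) ^ 2 +
    (snd (u k) - snd (v k)) ^ 2)); [apply dist_arg_nonneg|]. simpl. cvt.
Qed.

Definition diffs (S : R -> Prop) (r : R) : Prop := r = 0 \/ exists x y, S x /\ S y /\ r = x - y.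

(** The differences of a bounded set have a least upper bound, so the [epsilon] in [len] really
    picks it. *)
Lemma len_lub S l : (forall x, S x -> 0 <= x <= l) -> is_lub (diffs S) (len S).
Proof.
  intros H. apply (epsilon_spec (inhabits 0) (fun d => is_lub (diffs S) d)).
  destruct (completeness (diffs S)) as [d Hd]; [| |now exists d].
  - exists (Rabs l). intros r [->|[x [y [Hx [Hy ->]]]]]; [apply Rabs_pos|].
    apply H in Hx, Hy. pose proof (Rle_abs l). lra.
  - exists 0. now left.
Qed.

Definition shade (sgn : R) (p q a b : pt) (x : R) : Prop :=
  0 <= x <= dist p q /\
  exists z, on_seg a b z /\ xcoord p q z = x /\ 0 <= sgn * ycoord p q z.

Lemma dpm_lub sgn p q a b : is_lub (diffs (shade sgn p q a b)) (dpm sgn p q a b).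
Proof. apply len_lub with (dist p q). intros x [H _]. exact H. Qed.

Lemma dpm_nonneg sgn p q a b : 0 <= dpm sgn p q a b.
Proof. apply (dpm_lub sgn p q a b). now left. Qed.

Lemma dpm_ge sgn p q a b x y : shade sgn p q a b x -> shade sgn p q a b y -> x - y <= dpm sgn p q a b.
Proof. intros Hx Hy. apply (dpm_lub sgn p q a b). right. now exists x, y. Qed.

Lemma dpm_le sgn p q a b c : 0 <= c ->
  (forall x y, shade sgn p q a b x -> shade sgn p q a b y -> x - y <= c) -> dpm sgn p q a b <= c.
Proof.
  intros Hc H. apply (dpm_lub sgn p q a b). intros r [->|[x [y [Hx [Hy ->]]]]]; auto.
Qed.

Lemma dpm_le_dist sgn p q a b : dpm sgn p q a b <= dist p q.
Proof.
  apply dpm_le; [apply dist_nonneg|]. intros x y [Hx _] [Hy _]. lra.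
Qed.

Lemma Ord_bound p q a b : Rabs (Ord p q a b) <= dist p q.
Proof.
  unfold Ord. destruct (Req_EM_T (dist p q) 0) as [E|E].
  - rewrite Rabs_R0. apply dist_nonneg.
  - pose proof (dpm_nonneg 1 p q a b). pose proof (dpm_nonneg (-1) p q a b).
    pose proof (dpm_le_dist 1 p q a b). pose proof (dpm_le_dist (-1) p q a b).
    apply Rabs_le. lra.
Qed.

Lemma shade_iff sgn p q a b x : dist p q <> 0 ->
  (shade sgn p q a b x <-> 0 <= x <= dist p q /\ exists t, 0 <= t <= 1 /\
     x = xcoord p q a + t * (xcoord p q b - xcoord p q a) /\
     0 <= sgn * (ycoord p q a + t * (ycoord p q b - ycoord p q a))).
Proof.
  intros Hd. split.
  - intros [Hx [z [[t [Ht ->]] [E Hs]]]]. split; auto. exists t. split; auto.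
    rewrite <- E. split.
    + unfold xcoord. simpl. field. auto.
    + replace (ycoord p q a + t * (ycoord p q b - ycoord p q a)) with
        (ycoord p q (fst a + t * (fst b - fst a), snd a + t * (snd b - snd a))); auto.
      unfold ycoord. simpl. field. auto.
  - intros [Hx [t [Ht [E Hs]]]]. split; auto.
    exists (fst a + t * (fst b - fst a), snd a + t * (snd b - snd a)). split; [|split].
    + now exists t.
    + rewrite E. unfold xcoord. simpl. field. auto.
    + replace (ycoord p q (fst a + t * (fst b - fst a), snd a + t * (snd b - snd a))) with
        (ycoord p q a + t * (ycoord p q b - ycoord p q a)); auto.
      unfold ycoord. simpl. field. auto.
Qed.

Section OrdLimit.

Variables (pk qk ak bk : nat -> pt) (p q a b : pt).
Hypothesis Hp : ptcv pk p.
Hypothesis Hq : ptcv qk q.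
Hypothesis Ha : ptcv ak a.
Hypothesis Hb : ptcv bk b.

Lemma coord_cv (u : nat -> pt) z : ptcv u z -> 0 < dist p q ->
  Un_cv (fun k => xcoord (pk k) (qk k) (u k)) (xcoord p q z) /\
  Un_cv (fun k => ycoord (pk k) (qk k) (u k)) (ycoord p q z).
Proof.
  intros [U1 U2] Hd. destruct Hp as [P1 P2], Hq as [Q1 Q2].
  assert (D : Un_cv (fun k => / dist (pk k) (qk k)) (/ dist p q)).
  { apply cv_inv; [lra|]. now apply cv_dist. }
  split; unfold xcoord, ycoord, Rdiv; cvt.
Qed.

(** Upper semicontinuity by compactness: pairs of shaded points that are [e] too far apart
    subconverge to a pair that is still shaded, since the shade is given by closed conditions. *)
Lemma dpm_usc sgn e : 0 < dist p q -> 0 < e ->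
  ev (fun k => dpm sgn (pk k) (qk k) (ak k) (bk k) <= dpm sgn p q a b + e).
Proof.
  intros Hd He. apply NNPP. intros Hne.
  assert (Hdk : ev (fun k => dist (pk k) (qk k) > 0)).
  { apply (cv_ev_gt _ (dist p q)); auto. now apply cv_dist. }
  assert (Hne2 : ~ ev (fun k => dist (pk k) (qk k) > 0 ->
     dpm sgn (pk k) (qk k) (ak k) (bk k) <= dpm sgn p q a b + e)).
  { intros H. apply Hne. generalize (ev_and _ _ Hdk H). apply ev_mono. tauto. }
  destruct (not_ev_extr _ Hne2) as [phi [Hphi H]].
  set (P := fun k => pk (phi k)). set (Q := fun k => qk (phi k)).
  set (A := fun k => ak (phi k)). set (B := fun k => bk (phi k)).
  (* Two shaded abscissas [x], [y] with their parameters [t], [s] on the second segment. *)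
  assert (Hw : forall k, exists w : (R * R) * (R * R),
     let '((x, t), (y, s)) := w in
     (0 <= x <= dist (P k) (Q k) /\ 0 <= y <= dist (P k) (Q k)) /\ (0 <= t <= 1 /\ 0 <= s <= 1) /\
     (x = xcoord (P k) (Q k) (A k) + t * (xcoord (P k) (Q k) (B k) - xcoord (P k) (Q k) (A k)) /\
      y = xcoord (P k) (Q k) (A k) + s * (xcoord (P k) (Q k) (B k) - xcoord (P k) (Q k) (A k))) /\
     (0 <= sgn * (ycoord (P k) (Q k) (A k) + t * (ycoord (P k) (Q k) (B k) - ycoord (P k) (Q k) (A k))) /\
      0 <= sgn * (ycoord (P k) (Q k) (A k) + s * (ycoord (P k) (Q k) (B k) - ycoord (P k) (Q k) (A k)))) /\
     dpm sgn p q a b + e <= x - y).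
  { intros k. specialize (H k). apply imply_to_and in H. destruct H as [Hk1 Hk2].
    apply Rnot_le_lt in Hk2. apply NNPP. intros C.
    apply (Rlt_not_le _ _ Hk2). apply dpm_le; [pose proof (dpm_nonneg sgn p q a b); lra|].
    intros x y Hx Hy. apply Rnot_lt_le. intros D. apply C.
    apply shade_iff in Hx; [|lra]. apply shade_iff in Hy; [|lra].
    destruct Hx as [X1 [t [X2 [X3 X4]]]], Hy as [Y1 [s [Y2 [Y3 Y4]]]].
    exists ((x, t), (y, s)). repeat split; try tauto; try lra; assumption. }
  destruct (choice _ _ _ Hw) as [w Hw'].
  destruct (BW_family 2 (fun k i => if Nat.eq_dec i 0 then snd (fst (w k)) else snd (snd (w k))) 1)
    as [psi [L [Hpsi HL]]].
  { intros k i _. specialize (Hw' k). destruct (w k) as [[x t] [y s]]. simpl.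
    destruct Hw' as [_ [[T1 T2] _]]. destruct (Nat.eq_dec i 0); apply Rabs_le; lra. }
  assert (C1 := HL 0%nat ltac:(lia)). assert (C2 := HL 1%nat ltac:(lia)). simpl in C1, C2.
  set (t := L 0%nat) in *. set (s := L 1%nat) in *.
  assert (Hc : extr (fun k => phi (psi k))) by now apply extr_comp.
  destruct (coord_cv ak a Ha Hd) as [XA YA]. destruct (coord_cv bk b Hb Hd) as [XB YB].
  apply (cv_subseq _ _ _ Hc) in XA, YA, XB, YB.
  assert (DD : Un_cv (fun k => dist (pk (phi (psi k))) (qk (phi (psi k)))) (dist p q)).
  { apply (cv_subseq (fun k => dist (pk k) (qk k)) _ (fun k => phi (psi k)) Hc). now apply cv_dist. }
  assert (W : forall k, 0 <= snd (fst (w (psi k))) <= 1 /\ 0 <= snd (snd (w (psi k))) <= 1).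
  { intros k. specialize (Hw' (psi k)). destruct (w (psi k)) as [[x t'] [y s']]. simpl. tauto. }
  assert (Ht : 0 <= t <= 1).
  { split; [apply (cv_le (fun _ => 0) _ _ _ (cv_const _) C1)|
            apply (cv_le _ (fun _ => 1) _ _ C1 (cv_const _))]; apply W. }
  assert (Hs : 0 <= s <= 1).
  { split; [apply (cv_le (fun _ => 0) _ _ _ (cv_const _) C2)|
            apply (cv_le _ (fun _ => 1) _ _ C2 (cv_const _))]; apply W. }
  set (x := xcoord p q a + t * (xcoord p q b - xcoord p q a)).
  set (y := xcoord p q a + s * (xcoord p q b - xcoord p q a)).
  assert (CX : Un_cv (fun k => fst (fst (w (psi k)))) x).
  { apply (cv_ext (fun k => xcoord (P (psi k)) (Q (psi k)) (A (psi k)) + snd (fst (w (psi k))) *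
      (xcoord (P (psi k)) (Q (psi k)) (B (psi k)) - xcoord (P (psi k)) (Q (psi k)) (A (psi k))))).
    - intros k. specialize (Hw' (psi k)). destruct (w (psi k)) as [[x' t'] [y' s']]. simpl.
      destruct Hw' as [_ [_ [[E _] _]]]. now rewrite E.
    - unfold x, P, Q, A, B. cvt. }
  assert (CY : Un_cv (fun k => fst (snd (w (psi k)))) y).
  { apply (cv_ext (fun k => xcoord (P (psi k)) (Q (psi k)) (A (psi k)) + snd (snd (w (psi k))) *
      (xcoord (P (psi k)) (Q (psi k)) (B (psi k)) - xcoord (P (psi k)) (Q (psi k)) (A (psi k))))).
    - intros k. specialize (Hw' (psi k)). destruct (w (psi k)) as [[x' t'] [y' s']]. simpl.
      destruct Hw' as [_ [_ [[_ E] _]]]. now rewrite E.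
    - unfold y, P, Q, A, B. cvt. }
  assert (Sx : shade sgn p q a b x).
  { apply shade_iff; [lra|]. split.
    - split; [apply (cv_le (fun _ => 0) _ _ _ (cv_const _) CX)|
              apply (cv_le _ _ _ _ CX DD)]; intros k; specialize (Hw' (psi k));
        destruct (w (psi k)) as [[x' t'] [y' s']]; simpl; apply Hw'.
    - exists t. split; auto. split; auto.
      apply (cv_le (fun _ => 0) (fun k => sgn * (ycoord (P (psi k)) (Q (psi k)) (A (psi k)) +
        snd (fst (w (psi k))) * (ycoord (P (psi k)) (Q (psi k)) (B (psi k)) -
         ycoord (P (psi k)) (Q (psi k)) (A (psi k)))))); [apply cv_const| |].
      + unfold P, Q, A, B. cvt.
      + intros k; specialize (Hw' (psi k)).
        destruct (w (psi k)) as [[x' t'] [y' s']]; simpl; apply Hw'. }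
  assert (Sy : shade sgn p q a b y).
  { apply shade_iff; [lra|]. split.
    - split; [apply (cv_le (fun _ => 0) _ _ _ (cv_const _) CY)|
              apply (cv_le _ _ _ _ CY DD)]; intros k; specialize (Hw' (psi k));
        destruct (w (psi k)) as [[x' t'] [y' s']]; simpl; apply Hw'.
    - exists s. split; auto. split; auto.
      apply (cv_le (fun _ => 0) (fun k => sgn * (ycoord (P (psi k)) (Q (psi k)) (A (psi k)) +
        snd (snd (w (psi k))) * (ycoord (P (psi k)) (Q (psi k)) (B (psi k)) -
         ycoord (P (psi k)) (Q (psi k)) (A (psi k)))))); [apply cv_const| |].
      + unfold P, Q, A, B. cvt.
      + intros k; specialize (Hw' (psi k)).
        destruct (w (psi k)) as [[x' t'] [y' s']]; simpl; apply Hw'. }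
  pose proof (dpm_ge _ _ _ _ _ _ _ Sx Sy) as F1.
  assert (F2 : dpm sgn p q a b + e <= x - y).
  { apply (cv_le (fun _ => dpm sgn p q a b + e) (fun k => fst (fst (w (psi k))) - fst (snd (w (psi k)))));
      [apply cv_const|cvt|].
    intros k; specialize (Hw' (psi k)). destruct (w (psi k)) as [[x' t'] [y' s']]; simpl; apply Hw'. }
  lra.
Qed.

End OrdLimit.

(* Length of the part of [0,l] covered by the shadow [X0,X1] of the other segment. *)
Definition shadow (l X0 X1 : R) : R := Rmax 0 (Rmin l (Rmax X0 X1) - Rmax 0 (Rmin X0 X1)).

Lemma affine_hit X0 X1 x : Rmin X0 X1 <= x <= Rmax X0 X1 ->
  exists t, 0 <= t <= 1 /\ x = X0 + t * (X1 - X0).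
Proof.
  intros H. destruct (Req_dec X0 X1) as [E|E].
  - subst. rewrite Rmin_left, Rmax_left in H by lra. exists 0. lra.
  - exists ((x - X0) / (X1 - X0)). split; [|field; lra].
    unfold Rmin, Rmax in H. destruct (Rle_dec X0 X1).
    + split; [apply Rmult_le_pos; [lra|left; apply Rinv_0_lt_compat; lra]|].
      apply Rmult_le_reg_r with (X1 - X0); [lra|].
      replace ((x - X0) / (X1 - X0) * (X1 - X0)) with (x - X0) by (field; lra). lra.
    + replace ((x - X0) / (X1 - X0)) with ((X0 - x) / (X0 - X1)) by (field; lra).
      split; [apply Rmult_le_pos; [lra|left; apply Rinv_0_lt_compat; lra]|].
      apply Rmult_le_reg_r with (X0 - X1); [lra|].
      replace ((X0 - x) / (X0 - X1) * (X0 - X1)) with (X0 - x) by (field; lra). lra.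
Qed.

(** The two shades together cover the shadow: if the second segment changes side over it, the shadow
    is cut where the height is zero. *)
Lemma shadow_ge p q a b : dist p q <> 0 ->
  shadow (dist p q) (xcoord p q a) (xcoord p q b) <= dpm 1 p q a b + dpm (-1) p q a b.
Proof.
  intros Hd. set (X0 := xcoord p q a). set (X1 := xcoord p q b).
  set (Y0 := ycoord p q a). set (Y1 := ycoord p q b).
  pose proof (dpm_nonneg 1 p q a b). pose proof (dpm_nonneg (-1) p q a b).
  unfold shadow. apply Rmax_lub; [lra|].
  set (be := Rmin (dist p q) (Rmax X0 X1)). set (al := Rmax 0 (Rmin X0 X1)).
  destruct (Rle_dec be al); [lra|].
  assert (B : 0 <= al /\ Rmin X0 X1 <= al /\ be <= dist p q /\ be <= Rmax X0 X1).
  { unfold al, be. repeat split; auto using Rmax_l, Rmax_r, Rmin_l, Rmin_r. }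
  destruct (affine_hit X0 X1 al) as [s [Hs Es]]; [lra|].
  destruct (affine_hit X0 X1 be) as [t [Ht Et]]; [lra|].
  assert (Sh : forall sgn u x, 0 <= u <= 1 -> x = X0 + u * (X1 - X0) -> al <= x <= be ->
     0 <= sgn * (Y0 + u * (Y1 - Y0)) -> shade sgn p q a b x).
  { intros sgn u x Hu Ex Hx Hy. apply shade_iff; auto. split; [lra|]. exists u. auto. }
  set (ys := Y0 + s * (Y1 - Y0)). set (yt := Y0 + t * (Y1 - Y0)).
  assert (CR : forall sgn sgn', sgn' = - sgn -> 0 <= sgn * ys -> 0 < sgn' * yt ->
     be - al <= dpm sgn p q a b + dpm sgn' p q a b).
  { intros sgn sgn' -> S1 S2.
    assert (Hden : 0 < sgn * ys + - sgn * yt) by lra.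
    (* Fraction of the way from [al] to [be] at which the height vanishes, by linear
       interpolation. *)
    set (w := sgn * ys / (sgn * ys + - sgn * yt)).
    assert (Hw : 0 <= w <= 1).
    { split; [apply Rmult_le_pos; [lra|left; apply Rinv_0_lt_compat; lra]|].
      apply Rmult_le_reg_r with (sgn * ys + - sgn * yt); [lra|].
      unfold w. replace (sgn * ys / (sgn * ys + - sgn * yt) * (sgn * ys + - sgn * yt))
        with (sgn * ys) by (field; lra). lra. }
    set (u := s + w * (t - s)). set (x := X0 + u * (X1 - X0)).
    assert (Hu : 0 <= u <= 1).
    { replace u with ((1 - w) * s + w * t) by (unfold u; ring). split; nra. }
    assert (Hx : x = al + w * (be - al)) by (unfold x, u; rewrite Es, Et; ring).
    assert (Hxx : al <= x <= be) by (rewrite Hx; split; nra).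
    assert (Hy : sgn * (Y0 + u * (Y1 - Y0)) = 0).
    { replace (sgn * (Y0 + u * (Y1 - Y0))) with (sgn * ys - w * (sgn * ys + - sgn * yt))
        by (unfold u, ys, yt; ring).
      unfold w. field. lra. }
    assert (D1 : x - al <= dpm sgn p q a b).
    { apply dpm_ge; [apply (Sh sgn u); auto; lra|]. apply (Sh sgn s); auto; lra. }
    assert (D2 : be - x <= dpm (- sgn) p q a b).
    { apply dpm_ge; [apply (Sh (- sgn) t); auto; [lra|fold yt; lra]|]. apply (Sh (- sgn) u); auto; lra. }
    lra. }
  destruct (Rle_dec 0 ys) as [S|S], (Rle_dec 0 yt) as [T|T].
  - assert (be - al <= dpm 1 p q a b); [|lra].
    apply dpm_ge; [apply (Sh 1 t)|apply (Sh 1 s)]; auto; fold yt ys; lra.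
  - apply CR; lra.
  - destruct (Req_dec yt 0) as [Z|Z].
    + assert (be - al <= dpm (-1) p q a b); [|lra].
      apply dpm_ge; [apply (Sh (-1) t)|apply (Sh (-1) s)]; auto; fold yt ys; lra.
    + rewrite Rplus_comm. apply CR; lra.
  - assert (be - al <= dpm (-1) p q a b); [|lra].
    apply dpm_ge; [apply (Sh (-1) t)|apply (Sh (-1) s)]; auto; fold yt ys; lra.
Qed.

Lemma shade_convex sgn p q a b x y z : dist p q <> 0 ->
  shade sgn p q a b x -> shade sgn p q a b y -> x <= z <= y -> shade sgn p q a b z.
Proof.
  intros Hd Hx Hy Hz. apply shade_iff in Hx; auto. apply shade_iff in Hy; auto.
  destruct Hx as [X1 [t [X2 [X3 X4]]]], Hy as [Y1 [s [Y2 [Y3 Y4]]]].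
  apply shade_iff; auto. split; [lra|].
  destruct (Req_dec x y) as [E|E].
  - exists t. split; auto. split; auto. lra.
  - set (w := (z - x) / (y - x)).
    assert (Hw1 : w * (y - x) = z - x) by (unfold w; field; lra).
    assert (Hw : 0 <= w <= 1).
    { split; [apply Rmult_le_pos; [lra|left; apply Rinv_0_lt_compat; lra]|].
      apply Rmult_le_reg_r with (y - x); lra. }
    exists (t + w * (s - t)). split; [split; nra|]. split.
    + replace z with (x + w * (y - x)) by lra. rewrite X3, Y3. ring.
    + replace (sgn * (ycoord p q a + (t + w * (s - t)) * (ycoord p q b - ycoord p q a))) with
        ((1 - w) * (sgn * (ycoord p q a + t * (ycoord p q b - ycoord p q a))) +
         w * (sgn * (ycoord p q a + s * (ycoord p q b - ycoord p q a)))) by ring.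
      apply Rplus_le_le_0_compat; apply Rmult_le_pos; lra.
Qed.

Lemma on_axis p q z : dist p q <> 0 -> ycoord p q z = 0 -> 0 <= xcoord p q z <= dist p q ->
  on_seg p q z.
Proof.
  intros Hd Hy Hx. pose proof (dist_nonneg p q).
  exists (xcoord p q z / dist p q). split.
  - split; [apply Rmult_le_pos; [lra|left; apply Rinv_0_lt_compat; lra]|].
    apply Rmult_le_reg_r with (dist p q); [lra|].
    replace (xcoord p q z / dist p q * dist p q) with (xcoord p q z) by (field; lra). lra.
  - pose proof (dist_sq p q) as E. unfold ycoord in Hy.
    assert (Hy' : (fst q - fst p) * (snd z - snd p) - (snd q - snd p) * (fst z - fst p) = 0).
    { apply Rmult_eq_reg_r with (/ dist p q); [|now apply Rinv_neq_0_compat]. unfold Rdiv in Hy. lra. }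
    assert (U : xcoord p q z / dist p q =
      ((fst z - fst p) * (fst q - fst p) + (snd z - snd p) * (snd q - snd p)) /
      (dist p q * dist p q)) by (unfold xcoord; field; auto).
    rewrite U, E.
    set (S := (fst p - fst q) ^ 2 + (snd p - snd q) ^ 2) in *.
    assert (Hs : S <> 0) by (rewrite <- E; nra).
    set (n := (fst z - fst p) * (fst q - fst p) + (snd z - snd p) * (snd q - snd p)).
    assert (F1 : (fst z - fst p) * S = n * (fst q - fst p)).
    { apply Rminus_diag_uniq. transitivity (- (snd q - snd p) *
        ((fst q - fst p) * (snd z - snd p) - (snd q - snd p) * (fst z - fst p))).
      - unfold S, n. ring.
      - rewrite Hy'. ring. }
    assert (F2 : (snd z - snd p) * S = n * (snd q - snd p)).
    { apply Rminus_diag_uniq. transitivity ((fst q - fst p) *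
        ((fst q - fst p) * (snd z - snd p) - (snd q - snd p) * (fst z - fst p))).
      - unfold S, n. ring.
      - rewrite Hy'. ring. }
    apply pt_eq; simpl.
    + replace (n / S * (fst q - fst p)) with ((n * (fst q - fst p)) / S) by (field; auto).
      rewrite <- F1. field. auto.
    + replace (n / S * (snd q - snd p)) with ((n * (snd q - snd p)) / S) by (field; auto).
      rewrite <- F2. field. auto.
Qed.

(** Upper and lower shades overlapping in two abscissas would give two common points of the
    segments; so they overlap in at most one, and their lengths add up within the shadow. *)
Lemma shadow_le p q a b : dist p q <> 0 ->
  (forall z w, on_seg p q z -> on_seg a b z -> on_seg p q w -> on_seg a b w -> z = w) ->
  dpm 1 p q a b + dpm (-1) p q a b <= shadow (dist p q) (xcoord p q a) (xcoord p q b).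
Proof.
  intros Hd Hone. set (X0 := xcoord p q a). set (X1 := xcoord p q b).
  set (T := shadow (dist p q) X0 X1).
  assert (HT : 0 <= T) by apply Rmax_l.
  assert (Hbd : forall sgn x y, shade sgn p q a b x -> shade sgn p q a b y -> x - y <= T).
  { intros sgn x y Hx Hy. unfold T, shadow. eapply Rle_trans; [|apply Rmax_r].
    destruct Hx as [Hx1 Hx2], Hy as [Hy1 Hy2].
    assert (Hx : Rmin X0 X1 <= x <= Rmax X0 X1 /\ Rmin X0 X1 <= y <= Rmax X0 X1).
    { destruct (proj1 (shade_iff sgn p q a b x Hd) (conj Hx1 Hx2)) as [_ [t [Ht [-> _]]]].
      destruct (proj1 (shade_iff sgn p q a b y Hd) (conj Hy1 Hy2)) as [_ [s [Hs [-> _]]]].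
      fold X0 X1. unfold Rmin, Rmax. destruct (Rle_dec X0 X1); nra. }
    assert (x <= Rmin (dist p q) (Rmax X0 X1)) by (apply Rmin_glb; lra).
    assert (Rmax 0 (Rmin X0 X1) <= y) by (apply Rmax_lub; lra). lra. }
  assert (Hpair : forall x1 y1 x2 y2, shade 1 p q a b x1 -> shade 1 p q a b y1 ->
     shade (-1) p q a b x2 -> shade (-1) p q a b y2 -> y1 < x1 -> y2 < x2 ->
     (x1 - y1) + (x2 - y2) <= T).
  { intros x1 y1 x2 y2 S1 S2 S3 S4 L1 L2.
    assert (Hcom : forall x, shade 1 p q a b x -> shade (-1) p q a b x -> X0 <> X1 ->
       exists z, on_seg p q z /\ on_seg a b z /\ xcoord p q z = x).
    { intros x Sa Sb HX. apply shade_iff in Sa; auto. apply shade_iff in Sb; auto.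
      destruct Sa as [A1 [t [A2 [A3 A4]]]], Sb as [B1 [s [B2 [B3 B4]]]].
      assert (t = s).
      { rewrite A3 in B3. fold X0 X1 in B3. apply Rmult_eq_reg_r with (X1 - X0); lra. }
      subst s. set (z := (fst a + t * (fst b - fst a), snd a + t * (snd b - snd a))).
      assert (Ex : xcoord p q z = x).
      { rewrite A3. unfold xcoord, z. simpl. field. auto. }
      assert (Ey : ycoord p q z = ycoord p q a + t * (ycoord p q b - ycoord p q a)).
      { unfold ycoord, z. simpl. field. auto. }
      exists z. split; [|split]; auto.
      - apply on_axis; auto; [lra|]. rewrite Ex. lra.
      - now exists t. }
    destruct (Req_dec X0 X1) as [HX|HX].
    - exfalso. apply shade_iff in S1; auto. apply shade_iff in S2; auto.
      destruct S1 as [_ [t [_ [E1 _]]]], S2 as [_ [s [_ [E2 _]]]].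
      fold X0 X1 in E1, E2. rewrite HX in E1, E2. nra.
    - destruct (Rle_dec x1 y2) as [C|C].
      { assert (x2 - y1 <= T); [|lra].
        pose proof S3 as S3'. pose proof S2 as S2'. destruct S3' as [D1 D2], S2' as [D3 D4].
        assert (G : x2 <= Rmin (dist p q) (Rmax X0 X1) /\ Rmax 0 (Rmin X0 X1) <= y1).
        { destruct (proj1 (shade_iff _ p q a b x2 Hd) S3) as [_ [t [Ht [E _]]]].
          destruct (proj1 (shade_iff _ p q a b y1 Hd) S2) as [_ [s [Hs [E' _]]]].
          fold X0 X1 in E, E'. split; [apply Rmin_glb|apply Rmax_lub]; try lra; rewrite ?E, ?E';
          unfold Rmin, Rmax; destruct (Rle_dec X0 X1); nra. }
        unfold T, shadow. eapply Rle_trans; [|apply Rmax_r]. lra. }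
      destruct (Rle_dec x2 y1) as [C'|C'].
      { assert (x1 - y2 <= T); [|lra].
        pose proof S1 as S3'. pose proof S4 as S2'. destruct S3' as [D1 D2], S2' as [D3 D4].
        assert (G : x1 <= Rmin (dist p q) (Rmax X0 X1) /\ Rmax 0 (Rmin X0 X1) <= y2).
        { destruct (proj1 (shade_iff _ p q a b x1 Hd) S1) as [_ [t [Ht [E _]]]].
          destruct (proj1 (shade_iff _ p q a b y2 Hd) S4) as [_ [s [Hs [E' _]]]].
          fold X0 X1 in E, E'. split; [apply Rmin_glb|apply Rmax_lub]; try lra; rewrite ?E, ?E';
          unfold Rmin, Rmax; destruct (Rle_dec X0 X1); nra. }
        unfold T, shadow. eapply Rle_trans; [|apply Rmax_r]. lra. }
      exfalso. set (u := Rmax y1 y2). set (v := Rmin x1 x2).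
      assert (Huv : u < v).
      { unfold u, v. apply Rmax_lub_lt; apply Rmin_glb_lt; lra. }
      assert (B : y1 <= u /\ y2 <= u /\ v <= x1 /\ v <= x2).
      { unfold u, v. auto using Rmax_l, Rmax_r, Rmin_l, Rmin_r. }
      destruct (Hcom u) as [z [Z1 [Z2 Z3]]]; auto.
      { apply (shade_convex 1 p q a b y1 x1); auto; lra. }
      { apply (shade_convex (-1) p q a b y2 x2); auto; lra. }
      destruct (Hcom v) as [w [W1 [W2 W3]]]; auto.
      { apply (shade_convex 1 p q a b y1 x1); auto; lra. }
      { apply (shade_convex (-1) p q a b y2 x2); auto; lra. }
      assert (z = w) by (apply Hone; auto). subst w. lra. }
  assert (Hm : forall sgn, dpm sgn p q a b <= T) by (intros; apply dpm_le; eauto).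
  assert (Hlow : forall x1 y1, shade 1 p q a b x1 -> shade 1 p q a b y1 -> y1 < x1 ->
     dpm (-1) p q a b <= T - (x1 - y1)).
  { intros x1 y1 S1 S2 L. apply dpm_le; [specialize (Hbd 1 x1 y1 S1 S2); lra|].
    intros x2 y2 S3 S4. destruct (Rlt_dec y2 x2).
    - specialize (Hpair x1 y1 x2 y2 S1 S2 S3 S4 L r). lra.
    - specialize (Hbd 1 x1 y1 S1 S2). lra. }
  assert (dpm 1 p q a b <= T - dpm (-1) p q a b); [|lra].
  apply dpm_le; [specialize (Hm (-1)); lra|].
  intros x y S1 S2. destruct (Rlt_dec y x) as [L|L].
  - specialize (Hlow x y S1 S2 L). lra.
  - specialize (Hm (-1)). lra.
Qed.

(** Both [dpm] are upper semicontinuous and their sum is at least the continuous [shadow], with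
    equality in the limit; hence each of them converges. For a degenerate limit bar [Ord_bound]
    suffices. *)
Lemma Ord_cv pk qk ak bk p q a b : ptcv pk p -> ptcv qk q -> ptcv ak a -> ptcv bk b ->
  (dist p q <> 0 ->
   forall z w, on_seg p q z -> on_seg a b z -> on_seg p q w -> on_seg a b w -> z = w) ->
  Un_cv (fun k => Ord (pk k) (qk k) (ak k) (bk k)) (Ord p q a b).
Proof.
  intros Hp Hq Ha Hb Hone.
  assert (HD : Un_cv (fun k => dist (pk k) (qk k)) (dist p q)) by now apply cv_dist.
  destruct (Req_dec (dist p q) 0) as [E|E].
  - assert (E' : Ord p q a b = 0) by (unfold Ord; destruct (Req_EM_T (dist p q) 0); tauto).
    rewrite E'. apply (cv_squeeze0 _ (fun k => dist (pk k) (qk k))); [now rewrite <- E|].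
    exists O. intros k _. rewrite Rminus_0_r. apply Ord_bound.
  - assert (Hd : 0 < dist p q) by (pose proof (dist_nonneg p q); lra).
    destruct (coord_cv pk qk p q Hp Hq ak a Ha Hd) as [XA _].
    destruct (coord_cv pk qk p q Hp Hq bk b Hb Hd) as [XB _].
    assert (HT : Un_cv (fun k => shadow (dist (pk k) (qk k)) (xcoord (pk k) (qk k) (ak k))
       (xcoord (pk k) (qk k) (bk k))) (shadow (dist p q) (xcoord p q a) (xcoord p q b)))
      by (unfold shadow; cvt).
    pose proof (shadow_le p q a b E (Hone E)) as Hle.
    apply cv_intro. intros e He.
    generalize (ev_and _ _ (cv_ev_gt _ _ 0 HD Hd) (ev_and _ _ (cv_ev _ _ (e / 6) HT ltac:(lra))
      (ev_and _ _ (dpm_usc pk qk ak bk p q a b Hp Hq Ha Hb 1 (e / 6) Hd ltac:(lra))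
      (dpm_usc pk qk ak bk p q a b Hp Hq Ha Hb (-1) (e / 6) Hd ltac:(lra))))).
    apply ev_mono. intros k [A [B [C D]]].
    pose proof (shadow_ge (pk k) (qk k) (ak k) (bk k) ltac:(lra)) as Hge.
    apply Rabs_def2 in B. unfold Ord.
    destruct (Req_EM_T (dist (pk k) (qk k)) 0); [lra|].
    destruct (Req_EM_T (dist p q) 0); [lra|]. apply Rabs_def1; lra.
Qed.

(** A segment lies on its own axis, so both shades coincide. This covers the diagonal entries, to
    which [Ord_cv] does not apply. *)
Lemma Ord_self p q : Ord p q p q = 0.
Proof.
  unfold Ord. destruct (Req_EM_T (dist p q) 0) as [E|E]; auto.
  assert (H : forall s s', dpm s p q p q <= dpm s' p q p q).
  { intros s s'. apply dpm_le; [apply dpm_nonneg|].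
    assert (S : forall x, shade s p q p q x -> shade s' p q p q x).
    { intros x [Hx [z [Hz [Ex _]]]]. split; auto. exists z. split; auto. split; auto.
      destruct Hz as [t [Ht ->]]. right. unfold ycoord. simpl. field. auto. }
    intros x y Hx Hy. apply dpm_ge; auto. }
  pose proof (H 1 (-1)). pose proof (H (-1) 1). lra.
Qed.

(** * Limits of configurations and chains *)

(** Excess in the triangle inequality: it vanishes exactly when [v] lies on the segment [ab], and
    its reciprocal is the barrier term. *)
Definition slack (C : nat -> pt) (a b v : nat) : R :=
  dist (C v) (C a) + dist (C v) (C b) - dist (C a) (C b).

Lemma Rsq_eq0 x : x * x = 0 -> x = 0.
Proof. apply Rsqr_0_uniq. Qed.

Lemma Rsq_inj_nonneg x y : 0 <= x -> 0 <= y -> x * x = y * y -> x = y.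
Proof. intros. apply Rsqr_inj; auto. Qed.

Lemma dist_on_seg a b t : 0 <= t ->
  dist (fst a + t * (fst b - fst a), snd a + t * (snd b - snd a)) a = t * dist a b.
Proof.
  intros Ht. apply Rsq_inj_nonneg; [apply dist_nonneg| |].
  - apply Rmult_le_pos; auto. apply dist_nonneg.
  - rewrite dist_sq. simpl.
    replace (t * dist a b * (t * dist a b)) with (t * t * (dist a b * dist a b)) by ring.
    rewrite dist_sq. ring.
Qed.

Lemma on_seg_slack a b v : on_seg a b v -> dist v a + dist v b - dist a b = 0.
Proof.
  intros [t [Ht ->]]. rewrite dist_on_seg by lra.
  replace (fst a + t * (fst b - fst a), snd a + t * (snd b - snd a)) with
    (fst b + (1 - t) * (fst a - fst b), snd b + (1 - t) * (snd a - snd b))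
    by (apply pt_eq; simpl; ring).
  rewrite dist_on_seg, (dist_sym b a) by lra. ring.
Qed.

(** Equality case of the triangle inequality, through equality in Cauchy-Schwarz: the vectors from
    [a] to [v] and from [v] to [b], scaled by each other's length, coincide. *)
Lemma slack_on_seg a b v : dist v a + dist v b - dist a b <= 0 -> on_seg a b v.
Proof.
  intros H. set (d1 := dist v a) in *. set (d2 := dist v b) in *. set (d3 := dist a b) in *.
  set (ux := fst v - fst a). set (uy := snd v - snd a).
  set (wx := fst b - fst v). set (wy := snd b - snd v).
  assert (P1 : 0 <= d1) by apply dist_nonneg. assert (P2 : 0 <= d2) by apply dist_nonneg.
  assert (P3 : 0 <= d3) by apply dist_nonneg.
  assert (E1 : d1 * d1 = ux * ux + uy * uy) by (unfold d1, ux, uy; rewrite dist_sq; ring).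
  assert (E2 : d2 * d2 = wx * wx + wy * wy) by (unfold d2, wx, wy; rewrite dist_sq; ring).
  assert (E3 : d3 * d3 = (ux + wx) * (ux + wx) + (uy + wy) * (uy + wy))
    by (unfold d3, ux, uy, wx, wy; rewrite dist_sq; ring).
  assert (Hd : d1 * d2 <= ux * wx + uy * wy).
  { assert ((d1 + d2) * (d1 + d2) <= d3 * d3) by (apply Rmult_le_compat; lra). nra. }
  assert (Z : (d2 * ux - d1 * wx) * (d2 * ux - d1 * wx) +
     (d2 * uy - d1 * wy) * (d2 * uy - d1 * wy) <= 0).
  { replace ((d2 * ux - d1 * wx) * (d2 * ux - d1 * wx) + (d2 * uy - d1 * wy) * (d2 * uy - d1 * wy))
      with ((d2 * d2) * (ux * ux + uy * uy) + (d1 * d1) * (wx * wx + wy * wy)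
       - 2 * (d1 * d2) * (ux * wx + uy * wy)) by ring.
    rewrite <- E1, <- E2.
    assert (0 <= d1 * d2) by now apply Rmult_le_pos.
    assert (d1 * d2 * (d1 * d2) <= d1 * d2 * (ux * wx + uy * wy)) by (apply Rmult_le_compat_l; auto).
    lra. }
  pose proof (Rle_0_sqr (d2 * ux - d1 * wx)) as S1. pose proof (Rle_0_sqr (d2 * uy - d1 * wy)) as S2.
  unfold Rsqr in S1, S2.
  assert (Z1 : d2 * ux - d1 * wx = 0) by (apply Rsq_eq0; lra).
  assert (Z2 : d2 * uy - d1 * wy = 0) by (apply Rsq_eq0; lra).
  destruct (Req_dec (d1 + d2) 0) as [D|D].
  - assert (d1 = 0) by lra. apply dist_eq0 in H0. subst v. apply on_seg_src.
  - exists (d1 / (d1 + d2)). split.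
    + split; [apply Rmult_le_pos; [lra|left; apply Rinv_0_lt_compat; lra]|].
      apply Rmult_le_reg_r with (d1 + d2); [lra|].
      replace (d1 / (d1 + d2) * (d1 + d2)) with d1 by (field; lra). lra.
    + apply pt_eq; simpl.
      * apply Rmult_eq_reg_r with (d1 + d2); auto.
        replace ((fst a + d1 / (d1 + d2) * (fst b - fst a)) * (d1 + d2)) with
          (fst a * (d1 + d2) + d1 * (fst b - fst a)) by (field; auto).
        unfold ux, wx in Z1. lra.
      * apply Rmult_eq_reg_r with (d1 + d2); auto.
        replace ((snd a + d1 / (d1 + d2) * (snd b - snd a)) * (d1 + d2)) with
          (snd a * (d1 + d2) + d1 * (snd b - snd a)) by (field; auto).
        unfold uy, wy in Z2. lra.
Qed.

(** The orientations at the ends of a segment are proportional to the signed distances from the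
    other line, so the meeting point divides the segment in their ratio. *)
Lemma proper_cross_meet a b c d : proper_cross a b c d -> exists t s, 0 < t < 1 /\ 0 < s < 1 /\
  fst a + t * (fst b - fst a) = fst c + s * (fst d - fst c) /\
  snd a + t * (snd b - snd a) = snd c + s * (snd d - snd c).
Proof.
  intros [H1 H2].
  set (p := orient a b c) in *. set (q := orient a b d) in *.
  set (r := orient c d a) in *. set (u := orient c d b) in *.
  set (D := (fst b - fst a) * (snd d - snd c) - (snd b - snd a) * (fst d - fst c)).
  assert (E1 : p - q = - D) by (unfold p, q, D, orient; ring).
  assert (E2 : r - u = D) by (unfold r, u, D, orient; ring).
  assert (F : forall x y, x * y < 0 -> 0 < x / (x - y) < 1).
  { intros x y Hxy. assert (x - y <> 0) by (intros E; nra).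
    assert (Hx : x / (x - y) = x * (x - y) / ((x - y) * (x - y))) by (field; auto).
    assert (0 < (x - y) * (x - y)) by nra.
    rewrite Hx. split.
    - apply Rdiv_lt_0_compat; nra.
    - apply Rmult_lt_reg_r with ((x - y) * (x - y)); auto.
      replace (x * (x - y) / ((x - y) * (x - y)) * ((x - y) * (x - y))) with (x * (x - y))
        by (field; auto). nra. }
  assert (HD : D <> 0).
  { intros E. assert (p = q) by lra. nra. }
  exists (r / (r - u)), (p / (p - q)). split; [auto|]. split; [auto|].
  rewrite E1, E2. split.
  - apply Rmult_eq_reg_r with D; auto.
    replace ((fst a + r / D * (fst b - fst a)) * D) with (fst a * D + r * (fst b - fst a)) by (field; auto).
    replace ((fst c + p / - D * (fst d - fst c)) * D) with (fst c * D - p * (fst d - fst c)) by (field; auto).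
    unfold D, r, p, orient. ring.
  - apply Rmult_eq_reg_r with D; auto.
    replace ((snd a + r / D * (snd b - snd a)) * D) with (snd a * D + r * (snd b - snd a)) by (field; auto).
    replace ((snd c + p / - D * (snd d - snd c)) * D) with (snd c * D - p * (snd d - snd c)) by (field; auto).
    unfold D, r, p, orient. ring.
Qed.

Definition touch_at_ends (G : lgraph) (C : nat -> pt) : Prop :=
  forall k m, (k < nE G)%nat -> (m < nE G)%nat -> k <> m ->
     forall z, on_seg (C (src G k)) (C (tgt G k)) z ->
               on_seg (C (src G m)) (C (tgt G m)) z ->
       (z = C (src G k) \/ z = C (tgt G k)) /\
       (z = C (src G m) \/ z = C (tgt G m)).

(** The midpoint of two distinct common points would be a third common point, but a bar has only two
    ends. *)
Lemma touch_one G C k m : touch_at_ends G C -> (k < nE G)%nat -> (m < nE G)%nat -> k <> m ->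
  forall z w, on_seg (C (src G k)) (C (tgt G k)) z -> on_seg (C (src G m)) (C (tgt G m)) z ->
    on_seg (C (src G k)) (C (tgt G k)) w -> on_seg (C (src G m)) (C (tgt G m)) w -> z = w.
Proof.
  intros H Hk Hm Hn z w Z1 Z2 W1 W2. apply NNPP. intros N.
  assert (Mid : forall a b, on_seg a b z -> on_seg a b w ->
    on_seg a b ((fst z + fst w) / 2, (snd z + snd w) / 2)).
  { intros a b [t [Ht ->]] [s [Hs ->]]. exists ((t + s) / 2). split; [lra|].
    apply pt_eq; simpl; field. }
  destruct (H k m Hk Hm Hn z Z1 Z2) as [A _]. destruct (H k m Hk Hm Hn w W1 W2) as [B _].
  destruct (H k m Hk Hm Hn _ (Mid _ _ Z1 W1) (Mid _ _ Z2 W2)) as [D _].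
  assert (M1 : ((fst z + fst w) / 2, (snd z + snd w) / 2) <> z).
  { intros E. apply N. assert (F := f_equal fst E). assert (F' := f_equal snd E). simpl in *.
    apply pt_eq; lra. }
  assert (M2 : ((fst z + fst w) / 2, (snd z + snd w) / 2) <> w).
  { intros E. apply N. assert (F := f_equal fst E). assert (F' := f_equal snd E). simpl in *.
    apply pt_eq; lra. }
  destruct A as [A|A], B as [B|B], D as [D|D]; congruence.
Qed.

Lemma simple_touch_at_ends G C : good_graph G -> simple_conf G C -> touch_at_ends G C.
Proof. intros HG HC k m Hk Hm Hn z Z1 Z2. apply simple_touch; auto. Qed.

Definition confcv (G : lgraph) (u : nat -> nat -> pt) (C : nat -> pt) : Prop :=
  forall i, (i < nV G)%nat -> ptcv (fun k => u k i) (C i).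

Lemma confcv_subseq G u C phi : extr phi -> confcv G u C -> confcv G (fun k => u (phi k)) C.
Proof.
  intros Hp H i Hi. destruct (H i Hi) as [A B].
  split; [apply (cv_subseq (fun k => fst (u k i)))|apply (cv_subseq (fun k => snd (u k i)))]; auto.
Qed.

Lemma slack_cv G u C a b v : confcv G u C -> (a < nV G)%nat -> (b < nV G)%nat -> (v < nV G)%nat ->
  Un_cv (fun k => slack (u k) a b v) (slack C a b v).
Proof.
  intros H Ha Hb Hv. unfold slack.
  apply CV_minus; [apply CV_plus|]; apply (cv_dist (fun k => u k _) (fun k => u k _)); auto.
Qed.

Lemma orient_cv u v w a b c : ptcv u a -> ptcv v b -> ptcv w c ->
  Un_cv (fun k => orient (u k) (v k) (w k)) (orient a b c).
Proof. intros [A1 A2] [B1 B2] [C1 C2]. unfold orient. cvt. Qed.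

Lemma simple_slack G C k v : good_graph G -> simple_conf G C -> (k < nE G)%nat -> (v < nV G)%nat ->
  v <> src G k -> v <> tgt G k -> 0 < slack C (src G k) (tgt G k) v.
Proof.
  intros HG [H1 [H2 _]] Hk Hv N1 N2. apply Rnot_le_lt. intros D.
  apply (H2 k v Hk Hv N1 N2). now apply slack_on_seg.
Qed.

(** A proper crossing in the limit would already occur in the sequence. The bound on the slack will
    come from the energy. *)
Lemma simple_limit G u C : good_graph G -> confcv G u C -> (forall n, simple_conf G (u n)) ->
  (forall k, (k < nE G)%nat -> C (src G k) <> C (tgt G k)) ->
  (forall k v, (k < nE G)%nat -> (v < nV G)%nat -> v <> src G k -> v <> tgt G k ->
     0 < slack C (src G k) (tgt G k) v) ->
  simple_conf G C.
Proof.
  intros HG Hcv Hs H1 H2. split; [auto|]. split.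
  - intros k v Hk Hv N1 N2 Ho. apply on_seg_slack in Ho. specialize (H2 k v Hk Hv N1 N2).
    unfold slack in H2. lra.
  - intros k m Hk Hm [P1 P2].
    pose proof (Hcv _ (g_src G HG k Hk)) as A. pose proof (Hcv _ (g_tgt G HG k Hk)) as B.
    pose proof (Hcv _ (g_src G HG m Hm)) as D. pose proof (Hcv _ (g_tgt G HG m Hm)) as E.
    pose proof (CV_mult _ _ _ _ (orient_cv _ _ _ _ _ _ A B D) (orient_cv _ _ _ _ _ _ A B E)) as Q1.
    pose proof (CV_mult _ _ _ _ (orient_cv _ _ _ _ _ _ D E A) (orient_cv _ _ _ _ _ _ D E B)) as Q2.
    destruct (ev_exists _ (ev_and _ _ (cv_ev_lt _ _ _ Q1 P1) (cv_ev_lt _ _ _ Q2 P2))) as [n [R1 R2]].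
    destruct (Hs n) as [_ [_ H3]]. apply (H3 k m Hk Hm). split; auto.
Qed.

(** Crossings persisting along a subsequence converge to a common point of two bars of [C], which
    must be a common vertex; but bars sharing a vertex never cross properly. *)
Lemma simple_open G u C : good_graph G -> confcv G u C -> simple_conf G C ->
  ev (fun n => simple_conf G (u n)).
Proof.
  intros HG Hcv HC. pose proof HC as [H1 [H2 H3]].
  assert (E1 : ev (fun n => forall k, (k < nE G)%nat -> u n (src G k) <> u n (tgt G k))).
  { apply (ev_forall (nE G) (fun k n => u n (src G k) <> u n (tgt G k))). intros k Hk.
    assert (D : Un_cv (fun n => dist (u n (src G k)) (u n (tgt G k))) (dist (C (src G k)) (C (tgt G k)))).
    { apply (cv_dist (fun n => u n _) (fun n => u n _)); apply Hcv; [apply g_src|apply g_tgt]; auto. }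
    generalize (cv_ev_gt _ _ 0 D (dist_pos _ _ (H1 k Hk))). apply ev_mono.
    intros n Hn E. rewrite E, dist_self in Hn. lra. }
  assert (E2 : ev (fun n => forall k, (k < nE G)%nat -> forall v, (v < nV G)%nat ->
     v <> src G k -> v <> tgt G k -> ~ on_seg (u n (src G k)) (u n (tgt G k)) (u n v))).
  { apply (ev_forall (nE G) (fun k n => forall v, (v < nV G)%nat ->
     v <> src G k -> v <> tgt G k -> ~ on_seg (u n (src G k)) (u n (tgt G k)) (u n v))). intros k Hk.
    apply (ev_forall (nV G) (fun v n =>
     v <> src G k -> v <> tgt G k -> ~ on_seg (u n (src G k)) (u n (tgt G k)) (u n v))). intros v Hv.
    destruct (Nat.eq_dec v (src G k)) as [E|N1]; [exists O; tauto|].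
    destruct (Nat.eq_dec v (tgt G k)) as [E|N2]; [exists O; tauto|].
    pose proof (slack_cv G u C _ _ v Hcv (g_src G HG k Hk) (g_tgt G HG k Hk) Hv) as D.
    generalize (cv_ev_gt _ _ 0 D (simple_slack G C k v HG HC Hk Hv N1 N2)). apply ev_mono.
    intros n Hn _ _ E. apply on_seg_slack in E. unfold slack in Hn. lra. }
  assert (E3 : ev (fun n => forall k, (k < nE G)%nat -> forall m, (m < nE G)%nat ->
     ~ proper_cross (u n (src G k)) (u n (tgt G k)) (u n (src G m)) (u n (tgt G m)))).
  { apply (ev_forall (nE G) (fun k n => forall m, (m < nE G)%nat ->
     ~ proper_cross (u n (src G k)) (u n (tgt G k)) (u n (src G m)) (u n (tgt G m)))). intros k Hk.
    apply (ev_forall (nE G) (fun m n =>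
     ~ proper_cross (u n (src G k)) (u n (tgt G k)) (u n (src G m)) (u n (tgt G m)))). intros m Hm.
    apply NNPP. intros Hne. destruct (not_ev_extr _ Hne) as [phi [Hphi Hpc]].
    assert (Hpc' : forall n, proper_cross (u (phi n) (src G k)) (u (phi n) (tgt G k))
       (u (phi n) (src G m)) (u (phi n) (tgt G m))) by (intros n; apply NNPP, Hpc).
    assert (Hshare : ~ (src G k = src G m \/ src G k = tgt G m \/ tgt G k = src G m \/ tgt G k = tgt G m)).
    { intros Hsh. destruct (Hpc' O) as [Q1 Q2]. unfold orient in Q1, Q2.
      destruct Hsh as [E|[E|[E|E]]]; rewrite E in Q1, Q2; nra. }
    assert (Hkm : k <> m) by (intros ->; tauto).
    assert (Hw : forall n, exists w : R * R, (0 < fst w < 1 /\ 0 < snd w < 1) /\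
      fst (u (phi n) (src G k)) + fst w * (fst (u (phi n) (tgt G k)) - fst (u (phi n) (src G k))) =
      fst (u (phi n) (src G m)) + snd w * (fst (u (phi n) (tgt G m)) - fst (u (phi n) (src G m))) /\
      snd (u (phi n) (src G k)) + fst w * (snd (u (phi n) (tgt G k)) - snd (u (phi n) (src G k))) =
      snd (u (phi n) (src G m)) + snd w * (snd (u (phi n) (tgt G m)) - snd (u (phi n) (src G m)))).
    { intros n. destruct (proper_cross_meet _ _ _ _ (Hpc' n)) as [t [s [T [S [X Y]]]]].
      exists (t, s). auto. }
    destruct (choice _ _ _ Hw) as [w Hw'].
    destruct (BW_family 2 (fun n i => if Nat.eq_dec i 0 then fst (w n) else snd (w n)) 1)
      as [psi [L [Hpsi HL]]].
    { intros n i _. destruct (Hw' n) as [[T1 T2] _]. destruct (Nat.eq_dec i 0); apply Rabs_le; lra. }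
    assert (C1 := HL 0%nat ltac:(lia)). assert (C2 := HL 1%nat ltac:(lia)). simpl in C1, C2.
    set (t := L 0%nat) in *. set (s := L 1%nat) in *.
    assert (Ht : 0 <= t <= 1).
    { split; [apply (cv_le (fun _ => 0) _ _ _ (cv_const _) C1)|
              apply (cv_le _ (fun _ => 1) _ _ C1 (cv_const _))]; intros n; destruct (Hw' (psi n)); lra. }
    assert (Hs : 0 <= s <= 1).
    { split; [apply (cv_le (fun _ => 0) _ _ _ (cv_const _) C2)|
              apply (cv_le _ (fun _ => 1) _ _ C2 (cv_const _))]; intros n; destruct (Hw' (psi n)); lra. }
    assert (Hcv' : confcv G (fun n => u (phi (psi n))) C).
    { apply (confcv_subseq G u C (fun n => phi (psi n))); auto. now apply extr_comp. }
    destruct (Hcv' _ (g_src G HG k Hk)) as [A1 A2]. destruct (Hcv' _ (g_tgt G HG k Hk)) as [B1 B2].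
    destruct (Hcv' _ (g_src G HG m Hm)) as [D1 D2]. destruct (Hcv' _ (g_tgt G HG m Hm)) as [F1 F2].
    set (a := C (src G k)) in *. set (b := C (tgt G k)) in *.
    set (c := C (src G m)) in *. set (d := C (tgt G m)) in *.
    assert (X : fst a + t * (fst b - fst a) = fst c + s * (fst d - fst c)).
    { apply (UL_sequence (fun n => fst (u (phi (psi n)) (src G k)) + fst (w (psi n)) * (fst (u (phi (psi n)) (tgt G k)) - fst (u (phi (psi n)) (src G k))))); [cvt|].
      apply (cv_ext (fun n => fst (u (phi (psi n)) (src G m)) + snd (w (psi n)) * (fst (u (phi (psi n)) (tgt G m)) - fst (u (phi (psi n)) (src G m))))); [|cvt].
      intros n. symmetry. apply (proj1 (proj2 (Hw' (psi n)))). }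
    assert (Y : snd a + t * (snd b - snd a) = snd c + s * (snd d - snd c)).
    { apply (UL_sequence (fun n => snd (u (phi (psi n)) (src G k)) + fst (w (psi n)) * (snd (u (phi (psi n)) (tgt G k)) - snd (u (phi (psi n)) (src G k))))); [cvt|].
      apply (cv_ext (fun n => snd (u (phi (psi n)) (src G m)) + snd (w (psi n)) * (snd (u (phi (psi n)) (tgt G m)) - snd (u (phi (psi n)) (src G m))))); [|cvt].
      intros n. symmetry. apply (proj2 (proj2 (Hw' (psi n)))). }
    destruct (simple_touch G C k m (fst a + t * (fst b - fst a), snd a + t * (snd b - snd a))
      HG HC Hk Hm Hkm) as [T1 T2].
    - now exists t.
    - exists s. split; auto. now rewrite X, Y.
    - apply Hshare.
      destruct T1 as [T1|T1], T2 as [T2|T2]; rewrite T1 in T2; apply (simple_inj G C HG HC) in T2;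
        auto using g_src, g_tgt. }
  generalize (ev_and _ _ E1 (ev_and _ _ E2 E3)). apply ev_mono.
  intros n [A [B D]]. split; [exact A|]. split.
  - intros k v Hk Hv. apply B; auto.
  - intros k m Hk Hm. apply D; auto.
Qed.

Lemma annot_snd G C k m : (k < nE G)%nat -> (m < nE G)%nat ->
  snd (Annot G C) k m = Ord (C (src G k)) (C (tgt G k)) (C (src G m)) (C (tgt G m)).
Proof.
  intros Hk Hm. unfold Annot. simpl. apply Nat.ltb_lt in Hk, Hm. now rewrite Hk, Hm.
Qed.

Lemma annot_cv G u C : good_graph G -> confcv G u C -> touch_at_ends G C ->
  forall k m, (k < nE G)%nat -> (m < nE G)%nat ->
  Un_cv (fun n => snd (Annot G (u n)) k m) (snd (Annot G C) k m).
Proof.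
  intros HG Hcv HT k m Hk Hm. rewrite annot_snd by auto.
  apply (cv_ext (fun n => Ord (u n (src G k)) (u n (tgt G k)) (u n (src G m)) (u n (tgt G m)))).
  { intros n. now rewrite annot_snd. }
  destruct (Nat.eq_dec k m) as [->|Hn].
  - rewrite Ord_self. apply (cv_ext (fun _ => 0)); [|apply cv_const]. intros n. now rewrite Ord_self.
  - apply (Ord_cv (fun n => u n _) (fun n => u n _) (fun n => u n _) (fun n => u n _));
      try (apply Hcv; auto using g_src, g_tgt).
    intros _ z w Z1 Z2 W1 W2. now apply (touch_one G C k m HT Hk Hm Hn).
Qed.

(** * Annotated convergence and chains of small steps *)

Definition spcv (G : lgraph) (P : nat -> space) (Q : space) : Prop :=
  confcv G (fun n => fst (P n)) (fst Q) /\
  forall k m, (k < nE G)%nat -> (m < nE G)%nat -> Un_cv (fun n => snd (P n) k m) (snd Q k m).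

Lemma near_sym G e P Q : near G e P Q -> near G e Q P.
Proof.
  intros [A B]. split.
  - intros i Hi. destruct (A i Hi). split; now rewrite Rabs_minus_sym.
  - intros k m Hk Hm. rewrite Rabs_minus_sym. now apply B.
Qed.

Lemma near_mono G e e' P Q : e <= e' -> near G e P Q -> near G e' P Q.
Proof.
  intros He [A B]. split.
  - intros i Hi. destruct (A i Hi). split; lra.
  - intros k m Hk Hm. specialize (B k m Hk Hm). lra.
Qed.

Lemma near_trans G e f P Q S : near G e P Q -> near G f Q S -> near G (e + f) P S.
Proof.
  intros [A1 B1] [A2 B2].
  assert (T : forall x y z, Rabs (x - y) < e -> Rabs (y - z) < f -> Rabs (x - z) < e + f).
  { intros x y z H1 H2. replace (x - z) with ((x - y) + (y - z)) by ring.
    eapply Rle_lt_trans; [apply Rabs_triang|]. lra. }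
  split.
  - intros i Hi. destruct (A1 i Hi), (A2 i Hi). split; eauto.
  - intros k m Hk Hm. eauto.
Qed.

Lemma spcv_near G P Q e : spcv G P Q -> 0 < e -> ev (fun n => near G e (P n) Q).
Proof.
  intros [A B] He.
  assert (E1 : ev (fun n => forall i, (i < nV G)%nat ->
    Rabs (fst (fst (P n) i) - fst (fst Q i)) < e /\ Rabs (snd (fst (P n) i) - snd (fst Q i)) < e)).
  { apply (ev_forall (nV G) (fun i n => Rabs (fst (fst (P n) i) - fst (fst Q i)) < e /\
      Rabs (snd (fst (P n) i) - snd (fst Q i)) < e)). intros i Hi. destruct (A i Hi) as [X Y].
    apply ev_and; [apply (cv_ev _ _ _ X He)|apply (cv_ev _ _ _ Y He)]. }
  assert (E2 : ev (fun n => forall k, (k < nE G)%nat -> forall m, (m < nE G)%nat ->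
    Rabs (snd (P n) k m - snd Q k m) < e)).
  { apply (ev_forall (nE G) (fun k n => forall m, (m < nE G)%nat ->
      Rabs (snd (P n) k m - snd Q k m) < e)). intros k Hk.
    apply (ev_forall (nE G) (fun m n => Rabs (snd (P n) k m - snd Q k m) < e)). intros m Hm.
    apply (cv_ev _ _ _ (B k m Hk Hm) He). }
  generalize (ev_and _ _ E1 E2). apply ev_mono. intros n [X Y]. split; auto.
Qed.

Lemma annot_spcv G u C : good_graph G -> confcv G u C -> touch_at_ends G C ->
  spcv G (fun n => Annot G (u n)) (Annot G C).
Proof. intros HG Hcv HT. split; [exact Hcv|]. now apply annot_cv. Qed.

(** [B] bounds vertex 0, which removes the translations and makes the admissible configurations
    bounded. *)
Definition adm (G : lgraph) (l : nat -> R) (e B : R) (C : nat -> pt) : Prop :=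
  simple_conf G C /\ (forall i, (nV G <= i)%nat -> C i = (0, 0)) /\
  (forall k, (k < nE G)%nat -> Rabs (dist (C (src G k)) (C (tgt G k)) - l k) <= e) /\
  Rabs (fst (C O)) <= B /\ Rabs (snd (C O)) <= B.

Definition step (G : lgraph) (l : nat -> R) (e B : R) (C C' : nat -> pt) : Prop :=
  adm G l e B C /\ adm G l e B C' /\ near G e (Annot G C) (Annot G C').

Definition chain G l e B := clos_refl_trans _ (step G l e B).

Lemma adm_mono G l e e' B B' C : e <= e' -> B <= B' -> adm G l e B C -> adm G l e' B' C.
Proof.
  intros He HB [A [D [E [F H]]]]. split; [auto|]. split; [auto|]. split; [|lra].
  intros k Hk. specialize (E k Hk). lra.
Qed.

Lemma chain_mono G l e e' B B' C C' : e <= e' -> B <= B' -> chain G l e B C C' -> chain G l e' B' C C'.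
Proof.
  intros He HB H. induction H as [x y [A [D E]]|x|x y z _ IH1 _ IH2].
  - apply rt_step. split; [|split]; eauto using adm_mono, near_mono.
  - apply rt_refl.
  - eapply rt_trans; eauto.
Qed.

Lemma chain_sym G l e B C C' : chain G l e B C C' -> chain G l e B C' C.
Proof.
  intros H. induction H as [x y [A [D E]]|x|x y z _ IH1 _ IH2].
  - apply rt_step. split; [|split]; auto using near_sym.
  - apply rt_refl.
  - eapply rt_trans; eauto.
Qed.

Lemma chain_adm G l e B C C' : chain G l e B C C' -> adm G l e B C -> adm G l e B C'.
Proof. intros H. induction H as [x y [A [D E]]|x|x y z _ IH1 _ IH2]; auto. Qed.

(** The annotation is continuous at simple configurations, so around each time the annotated path
    moves by less than [e]; [interval_chain] does the rest. *)
Lemma path_chain G l e B (c : R -> nat -> pt) : good_graph G -> 0 < e ->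
  (forall t, 0 <= t <= 1 -> adm G l e B (c t)) ->
  (forall u t, (forall k, 0 <= u k <= 1) -> 0 <= t <= 1 -> Un_cv u t -> confcv G (fun k => c (u k)) (c t)) ->
  chain G l e B (c 0) (c 1).
Proof.
  intros HG He Hadm Hcont.
  apply (interval_chain (fun s t => chain G l e B (c s) (c t))).
  - intros. apply rt_refl.
  - intros. eapply rt_trans; eauto.
  - intros t Ht. apply NNPP. intros C.
    assert (H : forall k, exists s, 0 <= s <= 1 /\ Rabs (s - t) < / INR (S k) /\
      ~ near G e (Annot G (c s)) (Annot G (c t))).
    { intros k. apply NNPP. intros D. apply C. exists (/ INR (S k)).
      split; [apply Rinv_0_lt_compat, lt_0_INR; lia|]. intros s Hs Hst.
      assert (Hn : near G e (Annot G (c s)) (Annot G (c t))).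
      { apply NNPP. intros F. apply D. exists s. auto. }
      split; apply rt_step; (split; [|split]); auto using near_sym. }
    destruct (choice _ _ _ H) as [u Hu].
    assert (Hc : Un_cv u t).
    { apply (cv_squeeze0 _ (fun k => / INR (S k))); [apply cv_inv_S|].
      exists O. intros n _. left. apply Hu. }
    assert (Hcc : confcv G (fun k => c (u k)) (c t)) by (apply Hcont; auto; apply Hu).
    destruct (Hadm t Ht) as [Hs _].
    pose proof (annot_spcv G _ _ HG Hcc (simple_touch_at_ends G _ HG Hs)) as Hsp.
    destruct (ev_exists _ (spcv_near G _ _ e Hsp He)) as [n Hn].
    destruct (Hu n) as [_ [_ F]]. auto.
Qed.

(** * The energy and its critical points *)

Lemma conf_compact G (u : nat -> nat -> pt) M :
  (forall n i, (i < nV G)%nat -> Rabs (fst (u n i)) <= M /\ Rabs (snd (u n i)) <= M) ->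
  exists phi C, extr phi /\ confcv G (fun n => u (phi n)) C /\
    forall i, (nV G <= i)%nat -> C i = (0, 0).
Proof.
  intros H.
  destruct (BW_family (nV G) (fun n i => fst (u n i)) M) as [phi [X [Hphi HX]]].
  { intros; now apply H. }
  destruct (BW_family (nV G) (fun n i => snd (u (phi n) i)) M) as [psi [Y [Hpsi HY]]].
  { intros; now apply H. }
  exists (fun n => phi (psi n)), (fun i => if lt_dec i (nV G) then (X i, Y i) else (0, 0)).
  split; [now apply extr_comp|]. split.
  - intros i Hi. destruct (lt_dec i (nV G)); [|lia]. split; simpl; auto.
    apply (cv_subseq (fun n => fst (u (phi n) i))); auto.
  - intros i Hi. destruct (lt_dec i (nV G)); [lia|auto].
Qed.

Lemma coord_le_dist p q : Rabs (fst p - fst q) <= dist p q /\ Rabs (snd p - snd q) <= dist p q.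
Proof.
  pose proof (dist_sq p q). pose proof (dist_nonneg p q).
  pose proof (pow2_ge_0 (fst p - fst q)). pose proof (pow2_ge_0 (snd p - snd q)).
  split; apply Rsqr_incr_0; auto using Rabs_pos; rewrite <- Rsqr_abs, Rsqr_pow2; unfold Rsqr; lra.
Qed.

Lemma adm_bound G l e B : good_graph G -> exists M, forall C, adm G l e B C ->
  (forall i, (i < nV G)%nat -> Rabs (fst (C i)) <= M /\ Rabs (snd (C i)) <= M) /\
  (forall k, (k < nE G)%nat -> dist (C (src G k)) (C (tgt G k)) <= M).
Proof.
  intros HG. destruct (finite_max (nE G) l) as [L [HL HL']].
  set (D := L + Rabs e). exists (Rabs B + INR (nV G) * D + D).
  assert (HD : 0 <= D) by (unfold D; pose proof (Rabs_pos e); lra).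
  assert (HN : 0 <= INR (nV G)) by apply pos_INR.
  intros C [_ [_ [Hl [H1 H2]]]].
  assert (HE : forall k, (k < nE G)%nat -> dist (C (src G k)) (C (tgt G k)) <= D).
  { intros k Hk. specialize (Hl k Hk). specialize (HL' k Hk). pose proof (Rle_abs e).
    unfold D. pose proof (Rle_abs (dist (C (src G k)) (C (tgt G k)) - l k)). lra. }
  split.
  - assert (HI : forall i, (i < nV G)%nat -> Rabs (fst (C i)) <= Rabs B + INR i * D /\
       Rabs (snd (C i)) <= Rabs B + INR i * D).
    { induction i as [|i IH]; intros Hi.
      - simpl. pose proof (Rle_abs B). lra.
      - destruct IH as [I1 I2]; [lia|]. destruct (g_path G HG i Hi) as [k [Hk [A1 A2]]].
        specialize (HE k Hk). rewrite A1, A2 in HE.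
        destruct (coord_le_dist (C i) (C (S i))) as [D1 D2].
        rewrite S_INR. split.
        + replace (fst (C (S i))) with (fst (C i) - (fst (C i) - fst (C (S i)))) by ring.
          eapply Rle_trans; [apply Rabs_triang|]. rewrite Rabs_Ropp. lra.
        + replace (snd (C (S i))) with (snd (C i) - (snd (C i) - snd (C (S i)))) by ring.
          eapply Rle_trans; [apply Rabs_triang|]. rewrite Rabs_Ropp. lra. }
    intros i Hi. destruct (HI i Hi) as [I1 I2].
    assert (INR i * D <= INR (nV G) * D) by (apply Rmult_le_compat_r; auto; apply le_INR; lia). lra.
  - intros k Hk. specialize (HE k Hk). pose proof (Rabs_pos B).
    assert (0 <= INR (nV G) * D) by now apply Rmult_le_pos. lra.
Qed.

Lemma dpl_ext f g x l : (forall t, f t = g t) -> derivable_pt_lim f x l -> derivable_pt_lim g x l.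
Proof.
  intros E H e He. destruct (H e He) as [d Hd]. exists d. intros h H1 H2. rewrite <- !E. auto.
Qed.

(** For squared distances, which are quadratic in the parameter of [shift], and later for the
    arguments of [ln] in [potential]. *)
Lemma dpl_quadratic c0 c1 c2 : derivable_pt_lim (fun t => c0 + c1 * t + c2 * (t * t)) 0 c1.
Proof.
  intros e He. pose proof (Rabs_pos c2) as P.
  assert (Hd : 0 < e / (1 + Rabs c2)) by (apply Rdiv_lt_0_compat; lra).
  exists (mkposreal _ Hd). intros h Hh Hs. simpl in Hs.
  replace ((c0 + c1 * (0 + h) + c2 * ((0 + h) * (0 + h)) - (c0 + c1 * 0 + c2 * (0 * 0))) / h - c1)
    with (c2 * h) by (field; auto).
  rewrite Rabs_mult. apply Rle_lt_trans with ((1 + Rabs c2) * Rabs h).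
  - pose proof (Rabs_pos h). nra.
  - apply (Rmult_lt_compat_l (1 + Rabs c2)) in Hs; [|lra].
    replace ((1 + Rabs c2) * (e / (1 + Rabs c2))) with e in Hs by (field; lra). exact Hs.
Qed.

Definition shift (C W : nat -> pt) (t : R) (i : nat) : pt :=
  (fst (C i) + t * fst (W i), snd (C i) + t * snd (W i)).

(* First variation of the distance between vertices [i] and [j] in the direction [W]. *)
Definition dvar (C W : nat -> pt) (i j : nat) : R :=
  ((fst (C i) - fst (C j)) * (fst (W i) - fst (W j)) +
   (snd (C i) - snd (C j)) * (snd (W i) - snd (W j))) / dist (C i) (C j).

Lemma shift_0 C W i : shift C W 0 i = C i.
Proof. apply pt_eq; simpl; ring. Qed.

Lemma dist_dpl C W i j : C i <> C j ->
  derivable_pt_lim (fun t => dist (shift C W t i) (shift C W t j)) 0 (dvar C W i j).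
Proof.
  intros H. pose proof (dist_pos _ _ H) as Hd. pose proof (dist_sq (C i) (C j)) as Hs.
  set (dx := fst (C i) - fst (C j)) in *. set (dy := snd (C i) - snd (C j)) in *.
  set (wx := fst (W i) - fst (W j)). set (wy := snd (W i) - snd (W j)).
  set (f := fun t => (dx ^ 2 + dy ^ 2) + (2 * (dx * wx + dy * wy)) * t + (wx ^ 2 + wy ^ 2) * (t * t)).
  apply (dpl_ext (fun t => sqrt (f t))).
  { intros t. unfold dist, f, shift, dx, dy, wx, wy. simpl. f_equal. ring. }
  assert (F0 : f 0 = dist (C i) (C j) * dist (C i) (C j)) by (unfold f; rewrite Hs; ring).
  assert (E : dvar C W i j = / (2 * sqrt (f 0)) * (2 * (dx * wx + dy * wy))).
  { rewrite F0, sqrt_square by lra. unfold dvar. fold dx dy wx wy. field. lra. }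
  rewrite E. apply (derivable_pt_lim_comp f sqrt).
  - apply dpl_quadratic.
  - apply derivable_pt_lim_sqrt. rewrite F0. nra.
Qed.

Lemma dpl_inv f x l : f x <> 0 -> derivable_pt_lim f x l ->
  derivable_pt_lim (fun t => / f t) x (- / (f x * f x) * l).
Proof.
  intros Hn H.
  apply (dpl_ext (fun t => 1 / f t)); [intros; unfold Rdiv; ring|].
  replace (- / (f x * f x) * l) with ((0 * f x - l * 1) / Rsqr (f x)) by (unfold Rsqr; field; auto).
  apply (derivable_pt_lim_div (fun _ => 1) f); auto. apply derivable_pt_lim_const.
Qed.

Lemma dpl_local_min f d r : 0 < r -> derivable_pt_lim f 0 d ->
  (forall t, Rabs t < r -> f 0 <= f t) -> d = 0.
Proof.
  intros Hr H Hm.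
  apply (deriv_minimum f (- r) r 0 (exist _ d H)); try lra.
  intros x H1 H2. apply Hm. now apply Rabs_def1.
Qed.

Section Energy.

Variable G : lgraph.
Hypothesis HG : good_graph G.
Variable m : nat -> R.
Variable K : R.

Definition offb (k v : nat) : bool := negb (Nat.eqb v (src G k) || Nat.eqb v (tgt G k)).

Lemma offb_true k v : offb k v = true <-> v <> src G k /\ v <> tgt G k.
Proof using G.
  unfold offb. rewrite Bool.negb_true_iff, Bool.orb_false_iff, !Nat.eqb_neq. reflexivity.
Qed.

Definition barrier (C : nat -> pt) : R :=
  Rsum (nE G) (fun k => Rsum (nV G) (fun v =>
    if offb k v then / slack C (src G k) (tgt G k) v else 0)).

Definition stretch (C : nat -> pt) : R :=
  Rsum (nE G) (fun k => (dist (C (src G k)) (C (tgt G k)) - m k) ^ 2).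

Definition energy (C : nat -> pt) : R := barrier C + K * stretch C.

Definition pos_slack (C : nat -> pt) : Prop :=
  forall k v, (k < nE G)%nat -> (v < nV G)%nat -> offb k v = true ->
    0 < slack C (src G k) (tgt G k) v.

Lemma simple_pos_slack C : simple_conf G C -> pos_slack C.
Proof using HG. intros H k v Hk Hv Ho. apply offb_true in Ho.
  exact (simple_slack G C k v HG H Hk Hv (proj1 Ho) (proj2 Ho)). Qed.

Lemma barrier_terms C : pos_slack C -> forall k v, (k < nE G)%nat -> (v < nV G)%nat ->
  0 <= (if offb k v then / slack C (src G k) (tgt G k) v else 0).
Proof.
  intros H k v Hk Hv. destruct (offb k v) eqn:E; [|lra].
  left. apply Rinv_0_lt_compat. auto.
Qed.

Lemma barrier_nonneg C : pos_slack C -> 0 <= barrier C.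
Proof.
  intros H. apply Rsum_nonneg. intros k Hk. apply Rsum_nonneg. intros v Hv. now apply barrier_terms.
Qed.

Lemma stretch_nonneg C : 0 <= stretch C.
Proof. apply Rsum_nonneg. intros. apply pow2_ge_0. Qed.

(** All terms of the energy are nonnegative, so each reciprocal slack is below [c]. *)
Lemma energy_slack C c : 0 < K -> pos_slack C -> energy C < c -> 0 < c ->
  forall k v, (k < nE G)%nat -> (v < nV G)%nat -> offb k v = true ->
    / c <= slack C (src G k) (tgt G k) v.
Proof.
  intros HK HC HE Hc k v Hk Hv Ho.
  assert (H1 : / slack C (src G k) (tgt G k) v <= barrier C).
  { eapply Rle_trans; [|apply (Rsum_term_le (nE G) _ k); auto].
    - pose proof (Rsum_term_le (nV G) (fun v => if offb k v then / slack C (src G k) (tgt G k) v else 0) v)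
        as T. cbv beta in T. rewrite Ho in T. apply T; auto. intros. now apply barrier_terms.
    - intros i Hi. apply Rsum_nonneg. intros. now apply barrier_terms. }
  assert (Hs := HC k v Hk Hv Ho).
  assert (0 <= K * stretch C) by (apply Rmult_le_pos; [lra|apply stretch_nonneg]).
  unfold energy in HE. rewrite <- (Rinv_inv (slack C (src G k) (tgt G k) v)).
  apply Rinv_le_contravar; [now apply Rinv_0_lt_compat|lra].
Qed.

Lemma energy_stretch C c : 0 < K -> pos_slack C -> energy C < c ->
  forall k, (k < nE G)%nat -> K * (dist (C (src G k)) (C (tgt G k)) - m k) ^ 2 < c.
Proof.
  intros HK HC HE k Hk. pose proof (barrier_nonneg C HC).
  assert (H1 : (dist (C (src G k)) (C (tgt G k)) - m k) ^ 2 <= stretch C).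
  { apply (Rsum_term_le (nE G) (fun k => (dist (C (src G k)) (C (tgt G k)) - m k) ^ 2)); auto.
    intros. apply pow2_ge_0. }
  unfold energy in HE. nra.
Qed.

Lemma energy_cv u C : confcv G u C -> pos_slack C -> Un_cv (fun n => energy (u n)) (energy C).
Proof.
  intros Hcv HC. unfold energy. apply CV_plus; [|apply CV_mult; [apply cv_const|]].
  - apply (Rsum_cv (nE G) (fun n k => Rsum (nV G) (fun v =>
      if offb k v then / slack (u n) (src G k) (tgt G k) v else 0))). intros k Hk.
    apply (Rsum_cv (nV G) (fun n v => if offb k v then / slack (u n) (src G k) (tgt G k) v else 0)).
    intros v Hv. destruct (offb k v) eqn:E; [|apply cv_const].
    apply (cv_inv (fun n => slack (u n) (src G k) (tgt G k) v)).
    + specialize (HC k v Hk Hv E). lra.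
    + apply (slack_cv G); auto using g_src, g_tgt.
  - apply (Rsum_cv (nE G) (fun n k => (dist (u n (src G k)) (u n (tgt G k)) - m k) ^ 2)). intros k Hk.
    assert (D : Un_cv (fun n => dist (u n (src G k)) (u n (tgt G k)) - m k)
      (dist (C (src G k)) (C (tgt G k)) - m k)).
    { apply CV_minus; [|apply cv_const].
      apply (cv_dist (fun n => u n _) (fun n => u n _)); apply Hcv; auto using g_src, g_tgt. }
    simpl. cvt.
Qed.

Variable C : nat -> pt.
Hypothesis HC : simple_conf G C.

(** [wslack] and [wlen] are the derivatives of the energy with respect to the slacks, through the
    barrier, and the bar lengths, through the stretch. *)
Definition wslack (k v : nat) : R :=
  if offb k v then - / (slack C (src G k) (tgt G k) v * slack C (src G k) (tgt G k) v) else 0.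
Definition wlen (k : nat) : R := K * (2 * (dist (C (src G k)) (C (tgt G k)) - m k)).

(** The differential of the energy as a linear form in the first variations [rho i j] of the
    distances. *)
Definition functional (rho : nat -> nat -> R) : R :=
  Rsum (nE G) (fun k => Rsum (nV G) (fun v =>
     wslack k v * (rho v (src G k) + rho v (tgt G k) - rho (src G k) (tgt G k)))
     + wlen k * rho (src G k) (tgt G k)).

Lemma energy_dpl W : derivable_pt_lim (fun t => energy (shift C W t)) 0 (functional (dvar C W)).
Proof.
  assert (Hne : forall i j, (i < nV G)%nat -> (j < nV G)%nat -> i <> j -> C i <> C j).
  { intros i j Hi Hj N E. apply N. now apply (simple_inj G C). }
  apply (dpl_ext (fun t => Rsum (nE G) (fun k => Rsum (nV G) (fun v =>
     if offb k v then / slack (shift C W t) (src G k) (tgt G k) v else 0) +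
     K * (dist (shift C W t (src G k)) (shift C W t (tgt G k)) - m k) ^ 2))).
  { intros t. unfold energy, barrier, stretch. rewrite <- Rsum_scal, <- Rsum_plus. reflexivity. }
  apply (Rsum_derivable (nE G) (fun k t => Rsum (nV G) (fun v =>
     if offb k v then / slack (shift C W t) (src G k) (tgt G k) v else 0) +
     K * (dist (shift C W t (src G k)) (shift C W t (tgt G k)) - m k) ^ 2)).
  intros k Hk. pose proof (g_src G HG k Hk) as Ha. pose proof (g_tgt G HG k Hk) as Hb.
  pose proof (g_ne G HG k Hk) as Hab.
  pose proof (dist_dpl C W _ _ (Hne _ _ Ha Hb Hab)) as Dab.
  apply (derivable_pt_lim_plus (fun t => Rsum (nV G) (fun v =>
     if offb k v then / slack (shift C W t) (src G k) (tgt G k) v else 0))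
     (fun t => K * (dist (shift C W t (src G k)) (shift C W t (tgt G k)) - m k) ^ 2)).
  - apply (Rsum_derivable (nV G) (fun v t =>
      if offb k v then / slack (shift C W t) (src G k) (tgt G k) v else 0)).
    intros v Hv. unfold wslack. destruct (offb k v) eqn:Eo.
    + apply offb_true in Eo. destruct Eo as [N1 N2].
      assert (E0 : slack (shift C W 0) (src G k) (tgt G k) v = slack C (src G k) (tgt G k) v)
        by (unfold slack; now rewrite !shift_0).
      rewrite <- E0. apply (dpl_inv (fun t => slack (shift C W t) (src G k) (tgt G k) v)).
      * rewrite E0. pose proof (simple_slack G C k v HG HC Hk Hv N1 N2). lra.
      * unfold slack.
        apply (derivable_pt_lim_minus
          (fun t => dist (shift C W t v) (shift C W t (src G k)) + dist (shift C W t v) (shift C W t (tgt G k)))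
          (fun t => dist (shift C W t (src G k)) (shift C W t (tgt G k)))); auto.
        apply (derivable_pt_lim_plus (fun t => dist (shift C W t v) (shift C W t (src G k)))
          (fun t => dist (shift C W t v) (shift C W t (tgt G k)))); apply dist_dpl; auto.
    + rewrite Rmult_0_l. apply derivable_pt_lim_const.
  - set (f := fun t => dist (shift C W t (src G k)) (shift C W t (tgt G k)) - m k).
    assert (Df : derivable_pt_lim f 0 (dvar C W (src G k) (tgt G k))).
    { rewrite <- (Rminus_0_r (dvar C W (src G k) (tgt G k))).
      apply (derivable_pt_lim_minus (fun t => dist (shift C W t (src G k)) (shift C W t (tgt G k)))
        (fun _ => m k)); auto. apply derivable_pt_lim_const. }
    apply (dpl_ext (fun t => K * (f t * f t))); [intros; unfold f; ring|].
    unfold wlen. rewrite Rmult_assoc. apply (derivable_pt_lim_scal (fun t => f t * f t)).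
    replace (2 * (dist (C (src G k)) (C (tgt G k)) - m k) * dvar C W (src G k) (tgt G k)) with
      (dvar C W (src G k) (tgt G k) * f 0 + f 0 * dvar C W (src G k) (tgt G k))
      by (unfold f; rewrite !shift_0; ring).
    apply (derivable_pt_lim_mult f f); auto.
Qed.

Lemma functional_ext r1 r2 : (forall i j, (i < nV G)%nat -> (j < nV G)%nat -> r1 i j = r2 i j) ->
  functional r1 = functional r2.
Proof.
  intros H. apply Rsum_ext. intros k Hk.
  pose proof (g_src G HG k Hk). pose proof (g_tgt G HG k Hk).
  rewrite (H (src G k) (tgt G k)) by auto. f_equal. apply Rsum_ext. intros v Hv.
  now rewrite !H by auto.
Qed.

Lemma functional_plus r1 r2 : functional (fun i j => r1 i j + r2 i j) = functional r1 + functional r2.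
Proof.
  unfold functional. rewrite <- Rsum_plus. apply Rsum_ext. intros k _.
  rewrite (Rsum_ext (nV G) _ (fun v =>
    wslack k v * (r1 v (src G k) + r1 v (tgt G k) - r1 (src G k) (tgt G k)) +
    wslack k v * (r2 v (src G k) + r2 v (tgt G k) - r2 (src G k) (tgt G k)))) by (intros; ring).
  rewrite Rsum_plus. ring.
Qed.

Lemma functional_scal c r : functional (fun i j => c * r i j) = c * functional r.
Proof.
  unfold functional. rewrite <- Rsum_scal. apply Rsum_ext. intros k _.
  rewrite (Rsum_ext (nV G) _ (fun v => c * (
    wslack k v * (r v (src G k) + r v (tgt G k) - r (src G k) (tgt G k))))) by (intros; ring).
  rewrite Rsum_scal. ring.
Qed.

Lemma functional_sum n (r : nat -> nat -> nat -> R) :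
  functional (fun i j => Rsum n (fun a => r a i j)) = Rsum n (fun a => functional (r a)).
Proof.
  induction n as [|n IH]; simpl.
  - replace (functional (fun _ _ => 0)) with (functional (fun i j => 0 * 0)).
    + rewrite (functional_scal 0 (fun _ _ => 0)). ring.
    + apply functional_ext. intros; ring.
  - rewrite functional_plus, IH. reflexivity.
Qed.

Definition delta (a b i j : nat) : R := if Nat.eq_dec i a then if Nat.eq_dec j b then 1 else 0 else 0.

Lemma functional_expand r : functional r =
  Rsum (nV G) (fun a => Rsum (nV G) (fun b => r a b * functional (delta a b))).
Proof.
  rewrite (functional_ext r (fun i j => Rsum (nV G) (fun a => Rsum (nV G) (fun b => r a b * delta a b i j)))).
  - rewrite (functional_sum (nV G) (fun a i j => Rsum (nV G) (fun b => r a b * delta a b i j))).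
    apply Rsum_ext. intros a _.
    rewrite (functional_sum (nV G) (fun b i j => r a b * delta a b i j)).
    apply Rsum_ext. intros b _. apply functional_scal.
  - intros i j Hi Hj. rewrite (Rsum_single _ _ i); auto.
    + rewrite (Rsum_single _ _ j); auto.
      * unfold delta. destruct (Nat.eq_dec i i), (Nat.eq_dec j j); tauto || lra.
      * intros b _ Hb. unfold delta. destruct (Nat.eq_dec i i), (Nat.eq_dec j b); subst; tauto || lra.
    + intros a _ Ha. apply Rsum_0. intros b _. unfold delta.
      destruct (Nat.eq_dec i a); subst; tauto || lra.
Qed.

(** Minus the derivative of the energy with respect to the distance of [i] and [j], divided by that
    distance. Both ordered pairs are added because [functional] uses either order. Positive values
    push the vertices apart. *)
Definition stress (i j : nat) : R :=
  - (functional (delta i j) + functional (delta j i)) / dist (C i) (C j).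

Lemma stress_sym i j : stress i j = stress j i.
Proof. unfold stress. rewrite (dist_sym (C j)). f_equal. ring. Qed.

(** Off the bars a distance enters the energy only through slacks, which grow with it, so every
    contribution repels. There is at least one: [j] ends some bar [k], and [i] is not an end of
    [k]. *)
Lemma stress_pos i j : (i < nV G)%nat -> (j < nV G)%nat -> i <> j -> ~ bar G i j -> 0 < stress i j.
Proof.
  intros Hi Hj Hn Hb.
  assert (Hd : 0 < dist (C i) (C j)).
  { apply dist_pos. intros E. apply Hn. now apply (simple_inj G C). }
  unfold stress. apply Rdiv_lt_0_compat; auto.
  assert (Hw : forall k v, (k < nE G)%nat -> (v < nV G)%nat -> wslack k v <= 0).
  { intros k v Hk Hv. unfold wslack. destruct (offb k v) eqn:E; [|lra].
    pose proof (simple_pos_slack C HC k v Hk Hv E).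
    assert (0 < / (slack C (src G k) (tgt G k) v * slack C (src G k) (tgt G k) v)).
    { apply Rinv_0_lt_compat. nra. } lra. }
  assert (Z : forall k, (k < nE G)%nat -> delta i j (src G k) (tgt G k) = 0 /\
      delta j i (src G k) (tgt G k) = 0).
  { intros k Hk. unfold delta. split.
    - destruct (Nat.eq_dec (src G k) i), (Nat.eq_dec (tgt G k) j); auto.
      exfalso. apply Hb. exists k. auto.
    - destruct (Nat.eq_dec (src G k) j), (Nat.eq_dec (tgt G k) i); auto.
      exfalso. apply Hb. exists k. auto. }
  assert (Dp : forall a b x y, 0 <= delta a b x y).
  { intros. unfold delta. destruct (Nat.eq_dec x a), (Nat.eq_dec y b); lra. }
  rewrite <- functional_plus.
  replace (- functional (fun x y => delta i j x y + delta j i x y)) with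
    (Rsum (nE G) (fun k => Rsum (nV G) (fun v => - wslack k v *
      (delta i j v (src G k) + delta j i v (src G k) + delta i j v (tgt G k) + delta j i v (tgt G k))))).
  2: { replace (- functional (fun x y => delta i j x y + delta j i x y)) with
         ((-1) * functional (fun x y => delta i j x y + delta j i x y)) by ring.
       unfold functional. rewrite <- Rsum_scal. apply Rsum_ext. intros k Hk.
       destruct (Z k Hk) as [Z1 Z2]. rewrite Z1, Z2, Rmult_plus_distr_l, <- Rsum_scal.
       replace (-1 * (wlen k * (0 + 0))) with 0 by ring. rewrite Rplus_0_r.
       apply Rsum_ext. intros v _. ring. }
  assert (Tm : forall k v, (k < nE G)%nat -> (v < nV G)%nat -> 0 <= - wslack k v *
      (delta i j v (src G k) + delta j i v (src G k) + delta i j v (tgt G k) + delta j i v (tgt G k))).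
  { intros k v Hk Hv. apply Rmult_le_pos; [specialize (Hw k v Hk Hv); lra|].
    pose proof (Dp i j v (src G k)). pose proof (Dp j i v (src G k)).
    pose proof (Dp i j v (tgt G k)). pose proof (Dp j i v (tgt G k)). lra. }
  destruct (g_inc G HG j Hj) as [D|[k [Hk Hinc]]]; [lia|].
  apply (Rsum_pos _ _ k); auto.
  { intros k' Hk'. apply Rsum_nonneg. auto. }
  apply (Rsum_pos _ _ i); auto.
  assert (Ho : offb k i = true).
  { apply offb_true. split; intros E; apply Hb.
    - exists k. split; auto. destruct Hinc as [A|A]; [congruence|]. left. auto.
    - exists k. split; auto. destruct Hinc as [A|A]; [|congruence]. right. auto. }
  assert (Hw' : 0 < - wslack k i).
  { unfold wslack. rewrite Ho. pose proof (simple_pos_slack C HC k i Hk Hi Ho).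
    rewrite Ropp_involutive. apply Rinv_0_lt_compat. nra. }
  apply Rmult_lt_0_compat; auto.
  pose proof (Dp i j i (src G k)). pose proof (Dp j i i (src G k)).
  pose proof (Dp i j i (tgt G k)). pose proof (Dp j i i (tgt G k)).
  assert (delta i j i j = 1).
  { unfold delta. destruct (Nat.eq_dec i i), (Nat.eq_dec j j); tauto. }
  destruct Hinc as [A|A]; rewrite A in *; lra.
Qed.

Lemma functional_stress W : functional (dvar C W) =
  / 2 * Rsum (nV G) (fun i => Rsum (nV G) (fun j => stress i j *
    ((fst (C j) - fst (C i)) * (fst (W i) - fst (W j)) +
     (snd (C j) - snd (C i)) * (snd (W i) - snd (W j))))).
Proof.
  rewrite functional_expand.
  set (A := Rsum (nV G) (fun a => Rsum (nV G) (fun b => dvar C W a b * functional (delta a b)))).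
  assert (EA : A = Rsum (nV G) (fun a => Rsum (nV G) (fun b => dvar C W a b * functional (delta b a)))).
  { unfold A. rewrite Rsum_swap. apply Rsum_ext. intros a _. apply Rsum_ext. intros b _.
    f_equal. unfold dvar. rewrite (dist_sym (C b)). f_equal. ring. }
  assert (E2 : 2 * A = A + Rsum (nV G) (fun a => Rsum (nV G) (fun b => dvar C W a b * functional (delta b a))))
    by lra.
  apply Rmult_eq_reg_l with 2; [|lra]. rewrite E2. rewrite <- Rmult_assoc.
  replace (2 * / 2) with 1 by field. rewrite Rmult_1_l. unfold A.
  rewrite <- Rsum_plus. apply Rsum_ext. intros a _. rewrite <- Rsum_plus. apply Rsum_ext. intros b _.
  unfold dvar, stress, Rdiv. ring.
Qed.

(** The variations fix vertex 0. Moving one other vertex along a coordinate axis gives its balance;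
    the balance at vertex 0 follows because internal forces add up to zero. *)
Lemma stress_balance (f : pt -> R) :
  (forall W, (W O = (0, 0)) -> functional (dvar C W) = 0) ->
  (f = fst \/ f = snd) ->
  forall i, (i < nV G)%nat -> Rsum (nV G) (fun j => stress i j * (f (C j) - f (C i))) = 0.
Proof.
  intros H Hf.
  assert (Hi : forall i, (i < nV G)%nat -> i <> O ->
     Rsum (nV G) (fun j => stress i j * (f (C j) - f (C i))) = 0).
  { intros i Hi Hi0.
    set (W := fun k => if Nat.eq_dec k i then (if excluded_middle_informative (f = fst) then (1, 0) else (0, 1))
      else (0, 0) : pt).
    assert (HW : W O = (0, 0)) by (unfold W; destruct (Nat.eq_dec 0 i); [lia|auto]).
    specialize (H W HW). rewrite functional_stress in H.
    rewrite (Rsum_ext (nV G) _ (fun a => Rsum (nV G) (fun b => stress a b * (f (C b) - f (C a)) *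
       ((if Nat.eq_dec a i then 1 else 0) - (if Nat.eq_dec b i then 1 else 0))))) in H.
    2: { intros a _. apply Rsum_ext. intros b _. unfold W.
         destruct (excluded_middle_informative (f = fst)) as [->|N].
         - destruct (Nat.eq_dec a i), (Nat.eq_dec b i); simpl; ring.
         - destruct Hf as [|Hf]; [tauto|subst f]. destruct (Nat.eq_dec a i), (Nat.eq_dec b i); simpl; ring. }
    rewrite (Rsum2_cross (nV G) i) in H; auto.
    - rewrite (Rsum_ext (nV G) _ (fun j => 2 * (stress i j * (f (C j) - f (C i))))) in H.
      + rewrite Rsum_scal in H. lra.
      + intros j _. rewrite (stress_sym j i).
        destruct (Nat.eq_dec i i); [|tauto]. destruct (Nat.eq_dec j i) as [->|]; ring.
    - destruct (Nat.eq_dec i i); ring.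
    - intros a b _ _ Ha Hb. destruct (Nat.eq_dec a i), (Nat.eq_dec b i); tauto || ring. }
  intros i Hi'. destruct (Nat.eq_dec i 0) as [->|N]; auto.
  rewrite <- (Rsum_single (nV G) (fun i => Rsum (nV G) (fun j => stress i j * (f (C j) - f (C i)))) 0); auto.
  apply Rsum_antisym. intros a b _ _. rewrite (stress_sym b a). ring.
Qed.

End Energy.

Definition in_equilibrium (G : lgraph) (C : nat -> pt) : Prop :=
  exists nu : nat -> nat -> R,
  (forall i j, nu i j = nu j i) /\
  (forall i, (i < nV G)%nat -> Rsum (nV G) (fun j => nu i j * (fst (C j) - fst (C i))) = 0) /\
  (forall i, (i < nV G)%nat -> Rsum (nV G) (fun j => nu i j * (snd (C j) - snd (C i))) = 0) /\
  (forall i j, (i < nV G)%nat -> (j < nV G)%nat -> i <> j -> ~ bar G i j -> 0 < nu i j).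

Lemma shift_cv G C W (t : nat -> R) : Un_cv t 0 -> confcv G (fun n => shift C W (t n)) C.
Proof.
  intros Ht i Hi. split; simpl.
  - replace (fst (C i)) with (fst (C i) + 0 * fst (W i)) at 1 by ring. cvt.
  - replace (snd (C i)) with (snd (C i) + 0 * snd (W i)) at 1 by ring. cvt.
Qed.

(* The minimiser of the energy within the class of [x] is critical. *)
Theorem chain_to_equilibrium G l e0 e B x : good_graph G -> 0 <= e0 < e -> (0 < nV G)%nat ->
  adm G l e0 B x -> exists y, chain G l e B x y /\ in_equilibrium G y.
Proof.
  intros HG He HV Hx. pose proof Hx as [Sx [Ox [Lx Bx]]].
  (* The rest lengths are those of [x], so the energy of [x] is its barrier alone. *)
  set (m := fun k => dist (x (src G k)) (x (tgt G k))).
  assert (Hm : forall k, (k < nE G)%nat -> 0 < m k) by (intros k Hk; apply dist_pos; now apply Sx).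
  destruct (finite_pos_min (nE G) m Hm) as [r [Hr Hrm]].
  (* Lengths that change by less than [d] stay at least [r / 2] and within [e] of [l]. *)
  set (d := Rmin (r / 2) (e - e0)).
  assert (Hd : 0 < d) by (apply Rmin_glb_lt; lra).
  assert (Hd1 : d <= r / 2) by apply Rmin_l. assert (Hd2 : d <= e - e0) by apply Rmin_r.
  set (c := barrier G x + 1).
  assert (Hc : 0 < c) by (pose proof (barrier_nonneg G x (simple_pos_slack G HG x Sx)); unfold c; lra).
  (* With this stiffness an energy below [c] keeps each length within [d] of its rest length. *)
  set (K := c / (d * d)).
  assert (HK : 0 < K) by (apply Rdiv_lt_0_compat; nra).
  assert (Ex : energy G m K x < c).
  { unfold energy, stretch. rewrite (Rsum_0 (nE G)); [unfold c; lra|].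
    intros k _. unfold m. ring. }
  assert (Hlen : forall C, pos_slack G C -> energy G m K C < c -> forall k, (k < nE G)%nat ->
     Rabs (dist (C (src G k)) (C (tgt G k)) - m k) < d).
  { intros C HC HE k Hk. pose proof (energy_stretch G m K C c HK HC HE k Hk) as H.
    assert (H' : (dist (C (src G k)) (C (tgt G k)) - m k) ^ 2 < d * d).
    { apply Rmult_lt_reg_l with K; auto.
      replace (K * (d * d)) with c by (unfold K; field; lra). exact H. }
    apply Rnot_le_lt. intros D.
    assert (d * d <= Rabs (dist (C (src G k)) (C (tgt G k)) - m k) * Rabs (dist (C (src G k)) (C (tgt G k)) - m k))
      by (apply Rmult_le_compat; lra).
    rewrite <- Rabs_mult, Rabs_pos_eq in H0 by apply Rle_0_sqr. lra. }
  (* Vertex 0 is fixed so that the bound [B] is never an active constraint; the strict energy bound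
     survives small perturbations. *)
  set (Cls := fun y => chain G l e B x y /\ adm G l e B y /\ y O = x O /\ energy G m K y < c).
  assert (Hadm : forall C, simple_conf G C -> (forall i, (nV G <= i)%nat -> C i = (0, 0)) -> C O = x O ->
     energy G m K C < c -> adm G l e B C).
  { intros C HC HO H0 HE. split; auto. split; auto. split; [|now rewrite H0].
    intros k Hk. pose proof (Hlen C (simple_pos_slack G HG C HC) HE k Hk) as H1. specialize (Lx k Hk).
    fold (m k) in Lx.
    replace (dist (C (src G k)) (C (tgt G k)) - l k) with
      ((dist (C (src G k)) (C (tgt G k)) - m k) + (m k - l k)) by ring.
    eapply Rle_trans; [apply Rabs_triang|]. lra. }
  assert (Cx : Cls x).
  { split; [apply rt_refl|]. split; auto. }
  (* The class is closed: a simple limit is one step away from a late member of the sequence. *)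
  assert (Hcl : forall u y, (forall n, Cls (u n)) -> confcv G u y ->
     (forall i, (nV G <= i)%nat -> y i = (0, 0)) -> simple_conf G y -> energy G m K y < c -> Cls y).
  { intros u y Hu Hcv HO Hs HE.
    assert (H0 : y O = x O).
    { destruct (Hcv O HV) as [C1 C2]. apply pt_eq.
      - eapply UL_sequence; [exact C1|]. apply (cv_ext (fun _ => fst (x O))); [|apply cv_const].
        intros n. destruct (Hu n) as [_ [_ [-> _]]]. reflexivity.
      - eapply UL_sequence; [exact C2|]. apply (cv_ext (fun _ => snd (x O))); [|apply cv_const].
        intros n. destruct (Hu n) as [_ [_ [-> _]]]. reflexivity. }
    assert (Ay : adm G l e B y) by (apply Hadm; auto).
    split; [|auto].
    pose proof (annot_spcv G u y HG Hcv (simple_touch_at_ends G y HG Hs)) as Hsp.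
    destruct (ev_exists _ (spcv_near G _ _ e Hsp ltac:(lra))) as [n Hn].
    destruct (Hu n) as [Ch [An _]]. apply rt_trans with (u n); auto. apply rt_step. split; auto. }
  (* [- s] is the infimum of the energy over the class. *)
  destruct (completeness (fun v => exists y, Cls y /\ v = - energy G m K y)) as [s [Hs1 Hs2]].
  { exists 0. intros v [y [[_ [[Sy _] _]] ->]].
    pose proof (barrier_nonneg G y (simple_pos_slack G HG y Sy)).
    pose proof (stretch_nonneg G m y). unfold energy. nra. }
  { exists (- energy G m K x), x. auto. }
  assert (Hseq : forall n, exists y, Cls y /\ energy G m K y < - s + / INR (S n)).
  { intros n. apply NNPP. intros D.
    assert (0 < / INR (S n)) by (apply Rinv_0_lt_compat, lt_0_INR; lia).
    assert (s <= s - / INR (S n)); [|lra]. apply Hs2. intros v [y [Hy ->]].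
    apply Rnot_lt_le. intros F. apply D. exists y. split; auto. lra. }
  destruct (choice _ _ _ Hseq) as [u Hu].
  destruct (adm_bound G l e B HG) as [M HM].
  destruct (conf_compact G u M) as [phi [y [Hphi [Hcv HO]]]].
  { intros n i Hi. destruct (Hu n) as [[_ [An _]] _]. now apply (HM (u n) An). }
  assert (Sl : forall k v, (k < nE G)%nat -> (v < nV G)%nat -> offb G k v = true ->
     / c <= slack y (src G k) (tgt G k) v).
  { intros k v Hk Hv Ho.
    apply (cv_le (fun _ => / c) (fun n => slack (u (phi n)) (src G k) (tgt G k) v)); [apply cv_const| |].
    - apply (slack_cv G (fun n => u (phi n))); auto using g_src, g_tgt.
    - intros n. destruct (Hu (phi n)) as [[_ [[Sn _] [_ En]]] _].
      apply (energy_slack G m K); auto. now apply simple_pos_slack. }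
  assert (Py : pos_slack G y).
  { intros k v Hk Hv Ho. pose proof (Sl k v Hk Hv Ho). pose proof (Rinv_0_lt_compat c Hc). lra. }
  assert (Sy : simple_conf G y).
  { apply (simple_limit G (fun n => u (phi n))); auto.
    - intros n. destruct (Hu (phi n)) as [[_ [[Sn _] _]] _]. auto.
    - intros k Hk E.
      assert (D : Un_cv (fun n => dist (u (phi n) (src G k)) (u (phi n) (tgt G k)))
        (dist (y (src G k)) (y (tgt G k)))).
      { apply (cv_dist (fun n => u (phi n) _) (fun n => u (phi n) _)); apply Hcv; auto using g_src, g_tgt. }
      rewrite E, dist_self in D.
      assert (r / 2 <= 0); [|lra].
      apply (cv_le (fun _ => r / 2) _ _ _ (cv_const _) D). intros n.
      destruct (Hu (phi n)) as [[_ [[Sn _] [_ En]]] _].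
      pose proof (Hlen _ (simple_pos_slack G HG _ Sn) En k Hk) as A. apply Rabs_def2 in A.
      specialize (Hrm k Hk). lra.
    - intros k v Hk Hv N1 N2. apply Py; auto. apply offb_true. auto. }
  pose proof (energy_cv G HG m K _ _ Hcv Py) as CE.
  assert (Ey : energy G m K y <= - s).
  { apply (cv_le _ (fun n => - s + / INR (S (phi n))) _ _ CE).
    - replace (- s) with (- s + 0) at 1 by ring. apply CV_plus; [apply cv_const|].
      apply (cv_subseq (fun n => / INR (S n)) 0 phi Hphi cv_inv_S).
    - intros n. left. apply Hu. }
  assert (Hsx : - s <= energy G m K x).
  { assert (- energy G m K x <= s); [|lra]. apply Hs1. exists x. auto. }
  assert (Cy : Cls y).
  { apply (Hcl (fun n => u (phi n))); auto; [|lra]. intros n. apply Hu. }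
  assert (Hmin : forall z, Cls z -> energy G m K y <= energy G m K z).
  { intros z Hz. assert (- energy G m K z <= s); [|lra]. apply Hs1. exists z. auto. }
  exists y. split; [apply Cy|].
  assert (Hcrit : forall W, W O = (0, 0) -> functional G m K y (dvar y W) = 0).
  { intros W HW.
    set (W' := fun i => if lt_dec i (nV G) then W i else (0, 0) : pt).
    assert (HW' : W' O = (0, 0)) by (unfold W'; destruct (lt_dec 0 (nV G)); auto).
    rewrite (functional_ext G HG m K y (dvar y W) (dvar y W')).
    2: { intros i j Hi Hj. unfold dvar, W'. destruct (lt_dec i (nV G)), (lt_dec j (nV G)); tauto. }
    (* Small shifts of the minimiser stay in the class, so the energy along them has an interior
       minimum at 0. *)
    assert (Hloc : exists r, 0 < r /\ forall t, Rabs t < r -> Cls (shift y W' t)).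
    { apply NNPP. intros D.
      assert (H : forall n, exists t, Rabs t < / INR (S n) /\ ~ Cls (shift y W' t)).
      { intros n. apply NNPP. intros F. apply D. exists (/ INR (S n)).
        split; [apply Rinv_0_lt_compat, lt_0_INR; lia|]. intros t Ht. apply NNPP. intros E.
        apply F. exists t. auto. }
      destruct (choice _ _ _ H) as [t Ht].
      assert (Ct : Un_cv t 0).
      { apply (cv_squeeze0 _ (fun k => / INR (S k))); [apply cv_inv_S|].
        exists O. intros n _. rewrite Rminus_0_r. left. apply Ht. }
      pose proof (shift_cv G y W' t Ct) as Cs.
      pose proof (simple_open G _ y HG Cs Sy) as E1.
      pose proof (cv_ev_lt _ _ c (energy_cv G HG m K _ _ Cs Py) ltac:(lra)) as E2.
      pose proof (spcv_near G _ _ e (annot_spcv G _ y HG Cs (simple_touch_at_ends G y HG Sy)) ltac:(lra))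
        as E3.
      destruct (ev_exists _ (ev_and _ _ E1 (ev_and _ _ E2 E3))) as [n [F1 [F2 F3]]].
      destruct (Ht n) as [_ F4]. apply F4.
      destruct Cy as [Ch [Ay [Y0 _]]].
      assert (O' : forall i, (nV G <= i)%nat -> shift y W' (t n) i = (0, 0)).
      { intros i Hi. unfold shift. rewrite HO by auto. unfold W'. destruct (lt_dec i (nV G)); [lia|].
        apply pt_eq; simpl; ring. }
      assert (Z' : shift y W' (t n) 0%nat = x 0%nat).
      { rewrite <- Y0. unfold shift. rewrite HW'. apply pt_eq; simpl; ring. }
      assert (A' : adm G l e B (shift y W' (t n))) by (apply Hadm; auto).
      split; auto. apply rt_trans with y; auto. apply rt_step. split; auto. split; auto.
      now apply near_sym. }
    destruct Hloc as [r' [Hr' Hloc]].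
    apply (dpl_local_min (fun t => energy G m K (shift y W' t)) _ r' Hr').
    - now apply energy_dpl.
    - intros t Ht.
      assert (E0 : energy G m K (shift y W' 0) = energy G m K y).
      { unfold energy, barrier, stretch, slack. f_equal; [|f_equal]; apply Rsum_ext; intros k _.
        - apply Rsum_ext. intros v _. now rewrite !shift_0.
        - now rewrite !shift_0. }
      rewrite E0. apply Hmin, Hloc, Ht. }
  exists (stress G m K y). split; [|split; [|split]].
  - apply stress_sym.
  - apply (stress_balance G HG m K y fst); auto.
  - apply (stress_balance G HG m K y snd); auto.
  - intros. now apply stress_pos.
Qed.

(** * Open chains *)

Lemma Rabs_le_inv a b : Rabs a <= b -> - b <= a <= b.
Proof. unfold Rabs. destruct (Rcase_abs a); lra. Qed.

Lemma unit_angle x y : x * x + y * y = 1 -> exists phi, x = cos phi /\ y = sin phi.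
Proof.
  intros H. assert (Hx : -1 <= x <= 1) by (split; nra).
  destruct (Rle_dec 0 y) as [Hy|Hy].
  - exists (acos x). rewrite cos_acos, sin_acos by auto. split; auto.
    replace (1 - Rsqr x) with (y * y) by (unfold Rsqr; lra). now rewrite sqrt_square.
  - exists (- acos x). rewrite cos_neg, sin_neg, cos_acos, sin_acos by auto. split; auto.
    replace (1 - Rsqr x) with ((- y) * (- y)) by (unfold Rsqr; lra).
    rewrite sqrt_square by lra. ring.
Qed.

Lemma cos_sin_sq t : cos t * cos t + sin t * sin t = 1.
Proof. pose proof (sin2_cos2 t) as H. unfold Rsqr in H. lra. Qed.

Lemma cv_cos u l : Un_cv u l -> Un_cv (fun k => cos (u k)) (cos l).
Proof. intros. apply (continuity_seq cos); auto. apply continuity_cos. Qed.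

Lemma cv_sin u l : Un_cv u l -> Un_cv (fun k => sin (u k)) (sin l).
Proof. intros. apply (continuity_seq sin); auto. apply continuity_sin. Qed.

Definition trace (p : pt) (len : nat -> R) (dir : nat -> pt) (i : nat) : pt :=
  (fst p + Rsum i (fun j => len j * fst (dir j)), snd p + Rsum i (fun j => len j * snd (dir j))).

Lemma trace_cv pk lenk dirk p len dir i :
  ptcv pk p -> (forall j, (j < i)%nat -> Un_cv (fun k => lenk k j) (len j)) ->
  (forall j, (j < i)%nat -> ptcv (fun k => dirk k j) (dir j)) ->
  ptcv (fun k => trace (pk k) (lenk k) (dirk k) i) (trace p len dir i).
Proof.
  intros [H1 H2] Hl Hd. split; simpl; (apply CV_plus; [assumption|]).
  - apply (Rsum_cv i (fun k j => lenk k j * fst (dirk k j))). intros j Hj.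
    destruct (Hd j Hj). apply CV_mult; auto.
  - apply (Rsum_cv i (fun k j => lenk k j * snd (dirk k j))). intros j Hj.
    destruct (Hd j Hj). apply CV_mult; auto.
Qed.

Lemma trace_S p len dir i : trace p len dir (S i) =
  (fst (trace p len dir i) + len i * fst (dir i), snd (trace p len dir i) + len i * snd (dir i)).
Proof. unfold trace. simpl. apply pt_eq; simpl; ring. Qed.

Lemma trace_0 p len dir : trace p len dir 0 = p.
Proof. apply pt_eq; simpl; ring. Qed.

Lemma det_diff d a b j : det d b j = det d a j - det d a b.
Proof. unfold det. ring. Qed.

Lemma argmax_nat n (f : nat -> R) : (0 < n)%nat ->
  exists v, (v < n)%nat /\ forall j, (j < n)%nat -> f j <= f v.
Proof.
  induction n as [|n IH]; intros H; [lia|].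
  destruct (Nat.eq_dec n 0) as [->|N].
  - exists 0%nat. split; [lia|]. intros j Hj. replace j with 0%nat by lia. lra.
  - destruct IH as [v [Hv Hm]]; [lia|]. destruct (Rle_dec (f v) (f n)).
    + exists n. split; [lia|]. intros j Hj. destruct (Nat.eq_dec j n) as [->|]; [lra|].
      specialize (Hm j ltac:(lia)). lra.
    + exists v. split; [lia|]. intros j Hj. destruct (Nat.eq_dec j n) as [->|]; [lra|].
      apply Hm; lia.
Qed.

(** A supporting line of the configuration passes through the vertex. *)
Definition hull_vertex (G : lgraph) (C : nat -> pt) (v : nat) : Prop :=
  exists d, d <> (0, 0) /\ forall j, (j < nV G)%nat -> det d (C v) (C j) <= 0.

Lemma hull_vertex_exists G C : (0 < nV G)%nat -> exists v, (v < nV G)%nat /\ hull_vertex G C v.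
Proof.
  intros H. destruct (argmax_nat (nV G) (fun i => snd (C i)) H) as [v [Hv Hm]].
  exists v. split; auto. exists (1, 0). split.
  - intros E. injection E. lra.
  - intros j Hj. specialize (Hm j Hj). unfold det. simpl. lra.
Qed.

Definition vec (a b : pt) : pt := (fst b - fst a, snd b - snd a).

Lemma vec_neq0 a b : a <> b -> vec a b <> (0, 0).
Proof. intros H E. apply H. injection E as E1 E2. apply pt_eq; lra. Qed.

Definition neg (d : pt) : pt := (- fst d, - snd d).

Lemma neg_neq0 d : d <> (0, 0) -> neg d <> (0, 0).
Proof. intros H E. apply H. injection E as E1 E2. apply pt_eq; simpl; lra. Qed.

Lemma det_neg d a b : det (neg d) a b = - det d a b.
Proof. unfold det, neg. simpl. ring. Qed.

(* At a hull vertex of an equilibrium configuration a line through the vertex either separates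
   its neighbours or leaves all vertices on one side. *)
Lemma equilibrium_hull G C v : good_graph G -> simple_conf G C -> in_equilibrium G C ->
  (v < nV G)%nat -> hull_vertex G C v -> forall d, d <> (0, 0) ->
  (forall j, (j < nV G)%nat -> bar G v j -> det d (C v) (C j) <= 0) ->
  forall j, (j < nV G)%nat -> det d (C v) (C j) <= 0.
Proof.
  intros HG HC [nu [N1 [N2 [N3 N4]]]] Hv [d0 [D1 D2]] d Hd H j Hj.
  apply (stress_hull G C nu HG HC N1 N2 N3 N4 v Hv d0); auto.
Qed.

Lemma equilibrium_hull_ge G C v : good_graph G -> simple_conf G C -> in_equilibrium G C ->
  (v < nV G)%nat -> hull_vertex G C v -> forall d, d <> (0, 0) ->
  (forall j, (j < nV G)%nat -> bar G v j -> 0 <= det d (C v) (C j)) ->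
  forall j, (j < nV G)%nat -> 0 <= det d (C v) (C j).
Proof.
  intros HG HC HE Hv Hh d Hd H j Hj.
  assert (det (neg d) (C v) (C j) <= 0); [|rewrite det_neg in *; lra].
  apply (equilibrium_hull G C v); auto using neg_neq0.
  intros i Hi B. specialize (H i Hi B). rewrite det_neg. lra.
Qed.

Section Open.

Variable n : nat.
Let G := open_chain n.

Lemma open_good : good_graph G.
Proof.
  unfold G. constructor; simpl; intros; try lia.
  - exists i. lia.
  - exists (if Nat.eq_dec v n then n - 1 else S v)%nat,
      (if Nat.eq_dec v 0 then (if Nat.eq_dec n 0 then 0 else 1) else v - 1)%nat.
    destruct (Nat.eq_dec v n), (Nat.eq_dec v 0), (Nat.eq_dec n 0);
      repeat split; intros; lia.
Qed.

Lemma open_bar v j : bar G v j -> (v < n /\ j = S v)%nat \/ (0 < v /\ j = v - 1)%nat.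
Proof. intros [k [Hk [[A B]|[A B]]]]; simpl in *; lia. Qed.

(** The line of the bar joining [S v] and [v] has the other neighbour of [S v] on one side, hence by
    equilibrium all vertices; so it supports the configuration at [v] too. *)
Lemma open_hull_pred C v : simple_conf G C -> in_equilibrium G C -> (S v <= n)%nat ->
  hull_vertex G C (S v) -> hull_vertex G C v.
Proof.
  intros HC HE Hv Hh. set (d := vec (C (S v)) (C v)).
  assert (Hd : d <> (0, 0)).
  { apply vec_neq0. intros E. apply (simple_inj G C open_good HC) in E; simpl; lia. }
  assert (Hz : det d (C (S v)) (C v) = 0) by (unfold det, d, vec; simpl; ring).
  destruct (classic ((S (S v) <= n)%nat /\ 0 < det d (C (S v)) (C (S (S v))))) as [[H1 H2]|H].
  - exists (neg d). split; [now apply neg_neq0|]. intros j Hj. rewrite det_neg, (det_diff d (C (S v))), Hz.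
    enough (0 <= det d (C (S v)) (C j)) by lra.
    apply (equilibrium_hull_ge G C (S v)); auto; [apply open_good|simpl; lia|].
    intros i Hi B. apply open_bar in B. destruct B as [[B1 ->]|[B1 ->]]; [lra|].
    replace (S v - 1)%nat with v by lia. lra.
  - exists d. split; auto. intros j Hj. rewrite (det_diff d (C (S v))), Hz.
    enough (det d (C (S v)) (C j) <= 0) by lra.
    apply (equilibrium_hull G C (S v)); auto; [apply open_good|simpl; lia|].
    intros i Hi B. apply open_bar in B. destruct B as [[B1 ->]|[B1 ->]].
    + apply Rnot_lt_le. intros F. apply H. split; [lia|auto].
    + replace (S v - 1)%nat with v by lia. lra.
Qed.

(** Descending from any hull vertex reaches vertex 0. Its only neighbour lies on the line of its
    bar, so both hull inequalities hold and force all vertices onto that line. *)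
Lemma open_collinear C : simple_conf G C -> in_equilibrium G C ->
  exists d, d <> (0, 0) /\ forall j, (j <= n)%nat -> det d (C O) (C j) = 0.
Proof.
  intros HC HE. destruct (Nat.eq_dec n 0) as [E|N].
  - exists (1, 0). split; [intros F; injection F; lra|]. intros j Hj.
    replace j with 0%nat by lia. unfold det. simpl. ring.
  - destruct (hull_vertex_exists G C) as [v [Hv Hh]]; [simpl; lia|].
    assert (H0 : hull_vertex G C O).
    { simpl in Hv. clear N. induction v as [|v IH]; auto. apply IH; [lia|].
      apply open_hull_pred; auto. lia. }
    exists (vec (C O) (C 1%nat)).
    assert (Hd : vec (C O) (C 1%nat) <> (0, 0)).
    { apply vec_neq0. intros E. apply (simple_inj G C open_good HC) in E; simpl; lia. }
    split; auto. intros j Hj.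
    assert (Hz : forall i, (i < nV G)%nat -> bar G 0 i -> det (vec (C O) (C 1%nat)) (C O) (C i) = 0).
    { intros i _ B. apply open_bar in B. destruct B as [[_ ->]|B]; [|lia]. unfold det, vec. simpl. ring. }
    apply Rle_antisym.
    + apply (equilibrium_hull G C O); auto; [apply open_good|simpl; lia| |simpl; lia].
      intros i Hi B. rewrite Hz; auto; lra.
    + apply (equilibrium_hull_ge G C O); auto; [apply open_good|simpl; lia| |simpl; lia].
      intros i Hi B. rewrite Hz; auto; lra.
Qed.

Definition straight (C : nat -> pt) : Prop :=
  exists phi len, (forall k, (k < n)%nat -> 0 < len k) /\
  forall i, (i <= n)%nat -> C i = trace (C O) len (fun _ => (cos phi, sin phi)) i.

(** On a line consecutive bars cannot fold back, since the far end of the shorter one would lie on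
    the longer one. So all bars point the same way. *)
Lemma open_equilibrium_straight C : simple_conf G C -> in_equilibrium G C -> straight C.
Proof.
  intros HC HE. destruct (open_collinear C HC HE) as [d [Hd Hc]].
  set (D := fst d * fst d + snd d * snd d).
  assert (HD : 0 < D).
  { unfold D. destruct (pt_neq d (0,0) Hd) as [E|E]; simpl in E;
      [pose proof (Rsqr_pos_lt _ E); pose proof (Rle_0_sqr (snd d))|
       pose proof (Rsqr_pos_lt _ E); pose proof (Rle_0_sqr (fst d))]; unfold Rsqr in *; lra. }
  set (lam := fun i => ((fst (C (S i)) - fst (C i)) * fst d + (snd (C (S i)) - snd (C i)) * snd d) / D).
  assert (HL : forall i, (i < n)%nat ->
     C (S i) = (fst (C i) + lam i * fst d, snd (C i) + lam i * snd d)).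
  { intros i Hi. pose proof (Hc i ltac:(lia)) as H1. pose proof (Hc (S i) ltac:(lia)) as H2.
    assert (H3 : fst d * (snd (C (S i)) - snd (C i)) - snd d * (fst (C (S i)) - fst (C i)) = 0)
      by (unfold det in *; lra).
    apply pt_eq; simpl; unfold lam; apply Rmult_eq_reg_r with D; try lra.
    - replace ((fst (C i) + ((fst (C (S i)) - fst (C i)) * fst d + (snd (C (S i)) - snd (C i)) * snd d) / D *
        fst d) * D) with (fst (C i) * D + ((fst (C (S i)) - fst (C i)) * fst d +
        (snd (C (S i)) - snd (C i)) * snd d) * fst d) by (field; lra).
      unfold D. apply Rminus_diag_uniq.
      transitivity (- snd d * (fst d * (snd (C (S i)) - snd (C i)) - snd d * (fst (C (S i)) - fst (C i)))); [ring|].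
      rewrite H3. ring.
    - replace ((snd (C i) + ((fst (C (S i)) - fst (C i)) * fst d + (snd (C (S i)) - snd (C i)) * snd d) / D *
        snd d) * D) with (snd (C i) * D + ((fst (C (S i)) - fst (C i)) * fst d +
        (snd (C (S i)) - snd (C i)) * snd d) * snd d) by (field; lra).
      unfold D. apply Rminus_diag_uniq.
      transitivity (fst d * (fst d * (snd (C (S i)) - snd (C i)) - snd d * (fst (C (S i)) - fst (C i)))); [ring|].
      rewrite H3. ring. }
  pose proof HC as [H1 [H2 _]].
  assert (Hne : forall i, (i < n)%nat -> lam i <> 0).
  { intros i Hi E. apply (H1 i Hi). simpl. rewrite (HL i Hi), E. apply pt_eq; simpl; ring. }
  assert (Hsg : forall i, (S i < n)%nat -> 0 < lam i * lam (S i)).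
  { intros i Hi. pose proof (Hne i ltac:(lia)) as L1. pose proof (Hne (S i) ltac:(lia)) as L2.
    pose proof (HL i ltac:(lia)) as E1. pose proof (HL (S i) ltac:(lia)) as E2.
    apply Rnot_le_lt. intros Hneg.
    destruct (Rle_dec (Rabs (lam i)) (Rabs (lam (S i)))) as [HA|HA].
    - apply (H2 (S i) i); simpl; try lia. exists (- lam i / lam (S i)). split.
      + assert (Hq : - lam i / lam (S i) * lam (S i) = - lam i) by (field; auto).
        unfold Rabs in HA. destruct (Rcase_abs (lam i)), (Rcase_abs (lam (S i))); split; nra.
      + rewrite E2. apply pt_eq; simpl; rewrite E1; simpl; field; auto.
    - apply (H2 i (S (S i))); simpl; try lia. exists (1 + lam (S i) / lam i). split.
      + assert (Hq : lam (S i) / lam i * lam i = lam (S i)) by (field; auto).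
        unfold Rabs in HA. destruct (Rcase_abs (lam i)), (Rcase_abs (lam (S i))); split; nra.
      + rewrite E2. apply pt_eq; simpl; rewrite E1; simpl; field; auto. }
  (* Reverses [d] if the first bar points against it. *)
  set (sg := if Rlt_dec (lam O) 0 then -1 else 1).
  assert (Hall : forall i, (i < n)%nat -> 0 < sg * lam i).
  { induction i as [|i IH]; intros Hi.
    - pose proof (Hne O Hi). unfold sg. destruct (Rlt_dec (lam O) 0); lra.
    - specialize (IH ltac:(lia)). specialize (Hsg i Hi).
      unfold sg in *. destruct (Rlt_dec (lam O) 0); nra. }
  assert (Hsg1 : sg * sg = 1) by (unfold sg; destruct (Rlt_dec (lam O) 0); ring).
  pose proof (sqrt_lt_R0 D HD) as Hq. pose proof (sqrt_sqrt D ltac:(lra)) as Hqq.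
  destruct (unit_angle (sg * fst d / sqrt D) (sg * snd d / sqrt D)) as [phi [P1 P2]].
  { replace (sg * fst d / sqrt D * (sg * fst d / sqrt D) + sg * snd d / sqrt D * (sg * snd d / sqrt D))
      with ((sg * sg) * (fst d * fst d + snd d * snd d) / (sqrt D * sqrt D)) by (field; lra).
    fold D. rewrite Hsg1, Hqq. field. lra. }
  exists phi, (fun i => sg * lam i * sqrt D). split.
  - intros k Hk. specialize (Hall k Hk). nra.
  - induction i as [|i IH]; intros Hi.
    + now rewrite trace_0.
    + rewrite trace_S, <- IH by lia. rewrite (HL i ltac:(lia)). simpl. rewrite <- P1, <- P2.
      apply pt_eq; simpl.
      * replace (sg * lam i * sqrt D * (sg * fst d / sqrt D)) with ((sg * sg) * lam i * fst d)
          by (field; lra). rewrite Hsg1. ring.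
      * replace (sg * lam i * sqrt D * (sg * snd d / sqrt D)) with ((sg * sg) * lam i * snd d)
          by (field; lra). rewrite Hsg1. ring.
Qed.

Lemma dist_dir a L u : 0 <= L -> fst u * fst u + snd u * snd u = 1 ->
  dist a (fst a + L * fst u, snd a + L * snd u) = L.
Proof.
  intros HL Hu. apply Rsq_inj_nonneg; auto using dist_nonneg.
  rewrite dist_sq. simpl.
  transitivity (L * L * (fst u * fst u + snd u * snd u)); [ring|]. rewrite Hu. ring.
Qed.

Lemma Rsum_mono_lt f a b : (a < b)%nat -> (forall k, (k < b)%nat -> 0 < f k) -> Rsum a f < Rsum b f.
Proof.
  intros Hab Hf. induction Hab as [|b Hab IH]; simpl.
  - specialize (Hf a ltac:(lia)). lra.
  - assert (Rsum a f < Rsum b f) by (apply IH; intros; apply Hf; lia).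
    specialize (Hf b ltac:(lia)). lra.
Qed.

Lemma trace_straight p len phi i :
  trace p len (fun _ => (cos phi, sin phi)) i = (fst p + Rsum i len * cos phi, snd p + Rsum i len * sin phi).
Proof.
  unfold trace. simpl. apply pt_eq; simpl; f_equal; rewrite (Rmult_comm (Rsum i len)), <- Rsum_scal;
    apply Rsum_ext; intros; ring.
Qed.

Lemma straight_simple C : straight C -> simple_conf G C.
Proof.
  intros [phi [len [Hl HC]]].
  pose proof (cos_sin_sq phi) as CS.
  assert (HC' : forall i, (i <= n)%nat ->
     C i = (fst (C O) + Rsum i len * cos phi, snd (C O) + Rsum i len * sin phi)).
  { intros i Hi. rewrite (HC i Hi). apply trace_straight. }
  assert (Hinj : forall x y, x * cos phi = y * cos phi -> x * sin phi = y * sin phi -> x = y).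
  { intros x y E1 E2. transitivity (x * (cos phi * cos phi + sin phi * sin phi)); [rewrite CS; ring|].
    transitivity (x * cos phi * cos phi + x * sin phi * sin phi); [ring|].
    rewrite E1, E2. transitivity (y * (cos phi * cos phi + sin phi * sin phi)); [ring|]. rewrite CS. ring. }
  split; [|split].
  - intros k Hk E. simpl in *. rewrite (HC' k), (HC' (S k)) in E by lia. simpl in E.
    injection E as E1 E2. specialize (Hl k Hk).
    assert (Rsum k len = Rsum k len + len k) by (apply Hinj; lra). lra.
  - intros k v Hk Hv N1 N2 [t [Ht E]]. simpl in *.
    rewrite (HC' k), (HC' (S k)), (HC' v) in E by lia. simpl in E. injection E as E1 E2.
    assert (Es : Rsum v len = Rsum k len + t * len k) by (apply Hinj; lra).
    pose proof (Hl k Hk).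
    destruct (lt_dec v k) as [L|L].
    + assert (Rsum v len < Rsum k len) by (apply Rsum_mono_lt; auto; intros; apply Hl; lia). nra.
    + assert (Rsum (S k) len < Rsum v len) by (apply Rsum_mono_lt; [lia|]; intros; apply Hl; lia).
      simpl in *. nra.
  - intros k m Hk Hm [P _]. simpl in *.
    assert (Z : orient (C k) (C (S k)) (C m) = 0).
    { rewrite (HC' k), (HC' (S k)), (HC' m) by lia. unfold orient. simpl. ring. }
    rewrite Z in P. lra.
Qed.

(** Start, angle and lengths are interpolated linearly. The tolerances on lengths and start are
    convex conditions, and a straight chain is always simple. *)
Lemma straight_chain l e B C C' : 0 < e -> adm G l e B C -> adm G l e B C' ->
  straight C -> straight C' -> chain G l e B C C'.
Proof.
  intros He A A' [phi [len [Hl HC]]] [phi' [len' [Hl' HC']]].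
  destruct A as [_ [O1 [L1 [X1 Y1]]]]. destruct A' as [_ [O2 [L2 [X2 Y2]]]].
  set (p := fun t => (fst (C O) + t * (fst (C' O) - fst (C O)), snd (C O) + t * (snd (C' O) - snd (C O))) : pt).
  set (L := fun t k => len k + t * (len' k - len k)).
  set (ph := fun t => phi + t * (phi' - phi)).
  set (c := fun t i => if le_dec i n then trace (p t) (L t) (fun _ => (cos (ph t), sin (ph t))) i else (0, 0)).
  assert (HL : forall t k, 0 <= t <= 1 -> (k < n)%nat -> 0 < L t k).
  { intros t k Ht Hk. specialize (Hl k Hk). specialize (Hl' k Hk). unfold L.
    replace (len k + t * (len' k - len k)) with ((1 - t) * len k + t * len' k) by ring.
    destruct (Req_dec t 0) as [->|]; nra. }
  assert (Hlen : forall (D : nat -> pt) dl ps k, (k < n)%nat -> (forall k, (k < n)%nat -> 0 < dl k) ->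
     (forall i, (i <= n)%nat -> D i = trace (D O) dl (fun _ => (cos ps, sin ps)) i) ->
     dist (D k) (D (S k)) = dl k).
  { intros D dl ps k Hk Hdl HD. rewrite (HD (S k)), trace_S, <- (HD k) by lia.
    apply (dist_dir (D k) (dl k) (cos ps, sin ps)); [left; auto|apply cos_sin_sq]. }
  assert (E0 : C = c 0).
  { apply FunctionalExtensionality.functional_extensionality. intros i. unfold c.
    destruct (le_dec i n) as [Hi|Hi].
    - rewrite (HC i Hi). replace (ph 0) with phi by (unfold ph; ring).
      replace (p 0) with (C O) by (unfold p; apply pt_eq; simpl; ring).
      unfold trace. f_equal; f_equal; apply Rsum_ext; intros; unfold L; simpl; ring.
    - apply O1. simpl. lia. }
  assert (E1 : C' = c 1).
  { apply FunctionalExtensionality.functional_extensionality. intros i. unfold c.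
    destruct (le_dec i n) as [Hi|Hi].
    - rewrite (HC' i Hi). replace (ph 1) with phi' by (unfold ph; ring).
      replace (p 1) with (C' O) by (unfold p; apply pt_eq; simpl; ring).
      unfold trace. f_equal; f_equal; apply Rsum_ext; intros; unfold L; simpl; ring.
    - apply O2. simpl. lia. }
  rewrite E0, E1. apply path_chain; auto; [apply open_good| |].
  - intros t Ht.
    assert (St : straight (c t)).
    { exists (ph t), (L t). split; [intros; now apply HL|]. intros i Hi. unfold c.
      destruct (le_dec i n), (le_dec 0 n); try lia. now rewrite trace_0. }
    split; [now apply straight_simple|]. split.
    { intros i Hi. unfold c. simpl in Hi. destruct (le_dec i n); [lia|auto]. }
    split.
    + intros k Hk. simpl in Hk |- *.
      rewrite (Hlen (c t) (L t) (ph t) k); auto.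
      2: { intros i Hi. unfold c. destruct (le_dec i n), (le_dec 0 n); try lia. now rewrite trace_0. }
      specialize (L1 k Hk). specialize (L2 k Hk). simpl in L1, L2.
      rewrite (Hlen C len phi k) in L1 by auto. rewrite (Hlen C' len' phi' k) in L2 by auto.
      unfold L. apply Rabs_le. apply Rabs_le_inv in L1. apply Rabs_le_inv in L2. split; nra.
    + unfold c. destruct (le_dec 0 n); [|lia]. rewrite trace_0. unfold p. simpl.
      apply Rabs_le_inv in X1. apply Rabs_le_inv in X2. apply Rabs_le_inv in Y1. apply Rabs_le_inv in Y2.
      split; apply Rabs_le; split; nra.
  - intros u t Hu Ht Hcv i Hi. unfold c. simpl in Hi. destruct (le_dec i n); [|lia].
    apply (trace_cv (fun k => p (u k)) (fun k => L (u k)) (fun k _ => (cos (ph (u k)), sin (ph (u k))))).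
    + split; unfold p; simpl; cvt.
    + intros j _. unfold L. cvt.
    + intros j _. split; simpl; [apply cv_cos|apply cv_sin]; unfold ph; cvt.
Qed.

End Open.

(** * Closed chains: equilibria are convex *)

Section Closed.

Variable n : nat.
Hypothesis Hn : (3 <= n)%nat.
Let G := closed_chain n.

(** Cyclic successor, and below the predecessor, by cases instead of [mod], so that [lia] settles
    the index arithmetic. *)
Definition nx (k : nat) : nat := if Nat.eq_dec (S k) n then 0%nat else S k.
Definition pv (k : nat) : nat := if Nat.eq_dec k 0 then (n - 1)%nat else (k - 1)%nat.

Lemma tgt_nx k : (k < n)%nat -> tgt G k = nx k.
Proof.
  intros Hk. change (tgt G k) with (S k mod n). unfold nx.
  destruct (Nat.eq_dec (S k) n) as [E|N].
  - rewrite E. apply Nat.Div0.mod_same.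
  - apply Nat.mod_small. lia.
Qed.

Lemma nx_lt k : (k < n)%nat -> (nx k < n)%nat.
Proof. unfold nx. destruct (Nat.eq_dec (S k) n); lia. Qed.
Lemma pv_lt k : (k < n)%nat -> (pv k < n)%nat.
Proof. unfold pv. destruct (Nat.eq_dec k 0); lia. Qed.
Lemma nx_pv k : (k < n)%nat -> nx (pv k) = k.
Proof.
  intros. unfold nx, pv. destruct (Nat.eq_dec k 0); destruct (Nat.eq_dec (S _) n); lia.
Qed.
Lemma pv_nx k : (k < n)%nat -> pv (nx k) = k.
Proof.
  intros. unfold nx, pv. destruct (Nat.eq_dec (S k) n); destruct (Nat.eq_dec _ 0); lia.
Qed.
Lemma nx_neq k : (k < n)%nat -> nx k <> k.
Proof. unfold nx. destruct (Nat.eq_dec (S k) n); lia. Qed.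
Lemma pv_neq k : (k < n)%nat -> pv k <> k.
Proof. unfold pv. destruct (Nat.eq_dec k 0); lia. Qed.
Lemma nx_neq_pv k : (k < n)%nat -> nx k <> pv k.
Proof. unfold nx, pv. destruct (Nat.eq_dec (S k) n), (Nat.eq_dec k 0); lia. Qed.

Lemma closed_good : good_graph G.
Proof.
  constructor.
  - simpl. auto.
  - intros k Hk. rewrite tgt_nx by auto. now apply nx_lt.
  - intros k Hk. rewrite tgt_nx by auto. simpl. intros E. now apply (nx_neq k Hk).
  - intros i Hi. simpl in Hi. exists i. split; [simpl; lia|]. split; auto. rewrite tgt_nx by lia.
    unfold nx. destruct (Nat.eq_dec (S i) n); lia.
  - intros k m Hk Hm N. simpl in Hk, Hm. rewrite !tgt_nx by auto. simpl.
    unfold nx. destruct (Nat.eq_dec (S k) n), (Nat.eq_dec (S m) n); lia.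
  - intros v Hv. exists (nx v), (pv v). split; [now apply nx_lt|]. split; [now apply pv_lt|].
    intros k Hk. simpl in Hk. rewrite tgt_nx by auto. simpl. split.
    + intros ->. auto.
    + intros E. right. rewrite <- E. now rewrite pv_nx.
Qed.

Lemma closed_bar v j : bar G v j -> j = nx v \/ j = pv v.
Proof.
  intros [k [Hk [[A B]|[A B]]]]; simpl in Hk; rewrite tgt_nx in B by auto; simpl in A; subst.
  - auto.
  - right. now rewrite pv_nx.
Qed.

(** Induction around the cycle: from [v] up to [n - 1], then through 0 to all indices. *)
Lemma nx_ind (P : nat -> Prop) v : (v < n)%nat -> P v -> (forall k, (k < n)%nat -> P k -> P (nx k)) ->
  forall j, (j < n)%nat -> P j.
Proof.
  intros Hv HP HS.
  assert (H1 : forall k, (v + k < n)%nat -> P (v + k)%nat).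
  { induction k as [|k IH]; intros Hk; [now rewrite Nat.add_0_r|].
    specialize (HS (v + k)%nat ltac:(lia) (IH ltac:(lia))). unfold nx in HS.
    destruct (Nat.eq_dec (S (v + k)) n); [lia|]. now replace (v + S k)%nat with (S (v + k)) by lia. }
  assert (H0 : P 0%nat).
  { specialize (H1 (n - 1 - v)%nat ltac:(lia)). apply HS in H1; [|lia]. unfold nx in H1.
    destruct (Nat.eq_dec (S (v + (n - 1 - v))) n); [auto|lia]. }
  induction j as [|j IH]; intros Hj; auto.
  specialize (HS j ltac:(lia) (IH ltac:(lia))). unfold nx in HS.
  destruct (Nat.eq_dec (S j) n); [lia|auto].
Qed.

(** The vertex furthest along the line has both neighbours on the same side, so the nearer neighbour
    lies on the bar to the other one. *)
Lemma closed_not_collinear C p q : simple_conf G C -> p <> q ->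
  ~ (forall j, (j < n)%nat -> orient p q (C j) = 0).
Proof.
  intros HC Hpq H.
  assert (Hs : forall j, exists s, (j < n)%nat ->
    C j = (fst p + s * (fst q - fst p), snd p + s * (snd q - snd p))).
  { intros j. destruct (lt_dec j n) as [Hj|Hj]; [|exists 0; tauto].
    destruct (orient_param p q (C j) Hpq (H j Hj)) as [s Es]. exists s. auto. }
  destruct (choice _ _ _ Hs) as [s Es].
  destruct (argmax_nat n s ltac:(lia)) as [v [Hv Hm]].
  pose proof (nx_lt v Hv) as Ha. pose proof (pv_lt v Hv) as Hb.
  assert (Hlt : forall w, (w < n)%nat -> w <> v -> s w < s v).
  { intros w Hw N. destruct (Hm w Hw) as [L|E]; auto. exfalso. apply N.
    apply (simple_inj G C closed_good HC); auto. rewrite (Es w), (Es v), E; auto. }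
  pose proof (Hlt _ Ha (nx_neq v Hv)) as La. pose proof (Hlt _ Hb (pv_neq v Hv)) as Lb.
  destruct HC as [_ [H2 _]]. destruct (Rle_dec (s (pv v)) (s (nx v))) as [L|L].
  - apply (H2 (pv v) (nx v)); auto; rewrite ?tgt_nx, ?nx_pv; simpl; auto using nx_neq, nx_neq_pv.
    rewrite (Es (nx v) Ha).
    apply (between_on_seg p q _ _ (s (pv v)) (s v)); auto; try lra.
  - apply (H2 v (pv v)); auto; rewrite ?tgt_nx; simpl; auto using pv_neq.
    { intros E. now apply (nx_neq_pv v Hv). }
    apply on_seg_sym. rewrite (Es (pv v) Hb).
    apply (between_on_seg p q _ _ (s (nx v)) (s v)); auto; try lra.
Qed.

(** Strictly convex polygons, counterclockwise for [sg = 1] and clockwise for [sg = -1]. *)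
Definition convex (sg : R) (C : nat -> pt) : Prop :=
  forall v j, (v < n)%nat -> (j < n)%nat -> j <> v -> j <> nx v ->
    0 < sg * orient (C v) (C (nx v)) (C j).

Lemma convex_simple sg C : convex sg C -> simple_conf G C.
Proof.
  intros HC.
  assert (Hsg : forall v j, (v < n)%nat -> (j < n)%nat -> 0 <= sg * orient (C v) (C (nx v)) (C j)).
  { intros v j Hv Hj. destruct (Nat.eq_dec j v) as [->|N1]; [right; unfold orient; ring|].
    destruct (Nat.eq_dec j (nx v)) as [->|N2]; [right; unfold orient; ring|].
    left. now apply HC. }
  split; [|split].
  - intros k Hk E. simpl in Hk. rewrite tgt_nx in E by auto. simpl in E.
    pose proof (HC k (pv k) Hk (pv_lt k Hk) (pv_neq k Hk) (not_eq_sym (nx_neq_pv k Hk))) as H.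
    rewrite <- E in H. unfold orient in H. lra.
  - intros k v Hk Hv N1 N2 [t [Ht E]]. simpl in Hk, Hv. rewrite tgt_nx in * by auto. simpl in N1, E.
    pose proof (HC k v Hk Hv N1 N2) as H. rewrite E in H. unfold orient in H. simpl in H. lra.
  - intros k m Hk Hm [P _]. simpl in Hk, Hm. rewrite !tgt_nx in P by auto. simpl in P.
    pose proof (Hsg k m Hk Hm) as A. pose proof (Hsg k (nx m) Hk (nx_lt m Hm)) as B.
    pose proof (HC k (pv k) Hk (pv_lt k Hk) (pv_neq k Hk) (not_eq_sym (nx_neq_pv k Hk))) as D.
    assert (sg <> 0) by (intros ->; lra).
    pose proof (Rmult_le_pos _ _ A B). pose proof (Rsqr_pos_lt sg H) as S. unfold Rsqr in S. nra.
Qed.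

Section Equilibrium.

Variable C : nat -> pt.
Hypothesis HC : simple_conf G C.
Hypothesis HE : in_equilibrium G C.

(** Twice the signed area of the triangle formed by [v] and its neighbours; positive for a left
    turn. *)
Definition turn (v : nat) : R := det (vec (C v) (C (nx v))) (C v) (C (pv v)).

Lemma closed_inj v w : (v < n)%nat -> (w < n)%nat -> C v = C w -> v = w.
Proof. apply (simple_inj G C closed_good HC). Qed.

(** For the line of the bar from [v] to [nx v], one neighbour of [v] lies on it and the other on the
    side given by [turn v]; equilibrium extends this to all vertices. *)
Lemma hull_side_next v sg : (v < n)%nat -> hull_vertex G C v -> sg = 1 \/ sg = -1 ->
  0 <= sg * turn v ->
  forall j, (j < n)%nat -> 0 <= sg * det (vec (C v) (C (nx v))) (C v) (C j).
Proof.
  intros Hv Hh Hsg Ht j Hj.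
  assert (Hd : vec (C v) (C (nx v)) <> (0, 0)).
  { apply vec_neq0. intros E. apply closed_inj in E; auto using nx_lt. now apply (nx_neq v Hv). }
  assert (Z : det (vec (C v) (C (nx v))) (C v) (C (nx v)) = 0) by (unfold det, vec; simpl; ring).
  destruct Hsg as [-> | ->].
  - rewrite Rmult_1_l. apply (equilibrium_hull_ge G C v closed_good HC HE Hv Hh _ Hd); auto.
    intros i Hi B. apply closed_bar in B. destruct B as [-> | ->]; [lra|]. unfold turn in Ht. lra.
  - enough (det (vec (C v) (C (nx v))) (C v) (C j) <= 0) by lra.
    apply (equilibrium_hull G C v closed_good HC HE Hv Hh _ Hd); auto.
    intros i Hi B. apply closed_bar in B. destruct B as [-> | ->]; [lra|]. unfold turn in Ht. lra.
Qed.

Lemma hull_side_prev v sg : (v < n)%nat -> hull_vertex G C v -> sg = 1 \/ sg = -1 ->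
  0 <= sg * turn v ->
  forall j, (j < n)%nat -> sg * det (vec (C v) (C (pv v))) (C v) (C j) <= 0.
Proof.
  intros Hv Hh Hsg Ht j Hj.
  assert (Hd : vec (C v) (C (pv v)) <> (0, 0)).
  { apply vec_neq0. intros E. apply closed_inj in E; auto using pv_lt. now apply (pv_neq v Hv). }
  assert (Z : det (vec (C v) (C (pv v))) (C v) (C (pv v)) = 0) by (unfold det, vec; simpl; ring).
  assert (Z' : det (vec (C v) (C (pv v))) (C v) (C (nx v)) = - turn v)
    by (unfold turn, det, vec; simpl; ring).
  destruct Hsg as [-> | ->].
  - rewrite Rmult_1_l. apply (equilibrium_hull G C v closed_good HC HE Hv Hh _ Hd); auto.
    intros i Hi B. apply closed_bar in B. destruct B as [-> | ->]; lra.
  - enough (0 <= det (vec (C v) (C (pv v))) (C v) (C j)) by lra.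
    apply (equilibrium_hull_ge G C v closed_good HC HE Hv Hh _ Hd); auto.
    intros i Hi B. apply closed_bar in B. destruct B as [-> | ->]; lra.
Qed.

(** Without a turn both signs apply in [hull_side_next], so all vertices would be collinear. *)
Lemma hull_turn v : (v < n)%nat -> hull_vertex G C v -> turn v <> 0.
Proof.
  intros Hv Hh E. apply (closed_not_collinear C (C v) (C (nx v)) HC).
  - intros F. apply closed_inj in F; auto using nx_lt. now apply (nx_neq v Hv).
  - intros j Hj.
    pose proof (hull_side_next v 1 Hv Hh (or_introl eq_refl) ltac:(lra) j Hj) as A.
    pose proof (hull_side_next v (-1) Hv Hh (or_intror eq_refl) ltac:(lra) j Hj) as B.
    unfold orient. unfold det, vec in A, B. simpl in A, B. lra.
Qed.

Lemma hull_turn_sign v : (v < n)%nat -> hull_vertex G C v ->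
  exists sg, (sg = 1 \/ sg = -1) /\ 0 < sg * turn v.
Proof.
  intros Hv Hh. pose proof (hull_turn v Hv Hh).
  destruct (Rlt_dec 0 (turn v)); [exists 1|exists (-1)]; split; auto; lra.
Qed.

(** The line of the bar from [v] to [nx v] supports the configuration, and it also passes through
    [nx v]. *)
Lemma hull_next v : (v < n)%nat -> hull_vertex G C v -> hull_vertex G C (nx v).
Proof.
  intros Hv Hh. destruct (hull_turn_sign v Hv Hh) as [sg [Hsg Ht]].
  pose proof (hull_side_next v sg Hv Hh Hsg (Rlt_le _ _ Ht)) as H.
  assert (Hd : vec (C v) (C (nx v)) <> (0, 0)).
  { apply vec_neq0. intros E. apply closed_inj in E; auto using nx_lt. now apply (nx_neq v Hv). }
  assert (Z : forall j, det (vec (C v) (C (nx v))) (C (nx v)) (C j) = det (vec (C v) (C (nx v))) (C v) (C j))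
    by (intros; unfold det, vec; simpl; ring).
  destruct Hsg as [-> | ->].
  - exists (neg (vec (C v) (C (nx v)))). split; [now apply neg_neq0|].
    intros j Hj. specialize (H j Hj). rewrite det_neg, Z. lra.
  - exists (vec (C v) (C (nx v))). split; auto. intros j Hj. specialize (H j Hj). rewrite Z. lra.
Qed.

Lemma all_hull v : (v < n)%nat -> hull_vertex G C v.
Proof.
  destruct (hull_vertex_exists G C) as [w [Hw Hh]]; [simpl; lia|].
  revert v. apply (nx_ind (hull_vertex G C) w); auto using hull_next.
Qed.

(** The turn keeps its sign from vertex to vertex because [nx (nx k)] lies on the same side of the
    bar at [k] as all other vertices. A further vertex on the line of a bar would lie in the angles
    at both ends, hence on the bar itself. *)
Lemma closed_equilibrium_convex : exists sg, (sg = 1 \/ sg = -1) /\ convex sg C.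
Proof.
  destruct (hull_turn_sign O ltac:(lia) (all_hull O ltac:(lia))) as [sg [Hsg H0]].
  assert (Ht : forall v, (v < n)%nat -> 0 < sg * turn v).
  { apply (nx_ind (fun v => 0 < sg * turn v) O); auto; [lia|]. intros k Hk H.
    pose proof (hull_side_next k sg Hk (all_hull k Hk) Hsg (Rlt_le _ _ H) (nx (nx k))
      (nx_lt _ (nx_lt k Hk))) as A.
    pose proof (hull_turn (nx k) (nx_lt k Hk) (all_hull _ (nx_lt k Hk))) as B.
    assert (E : turn (nx k) = det (vec (C k) (C (nx k))) (C k) (C (nx (nx k)))).
    { unfold turn. rewrite pv_nx by auto. unfold det, vec. simpl. ring. }
    rewrite <- E in A. destruct Hsg as [-> | ->]; lra. }
  exists sg. split; auto. intros v j Hv Hj N1 N2.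
  assert (E : orient (C v) (C (nx v)) (C j) = det (vec (C v) (C (nx v))) (C v) (C j))
    by (unfold orient, det, vec; simpl; ring).
  destruct (hull_side_next v sg Hv (all_hull v Hv) Hsg (Rlt_le _ _ (Ht v Hv)) j Hj) as [L|Z];
    [now rewrite E|].
  exfalso. assert (Z' : orient (C v) (C (nx v)) (C j) = 0) by (rewrite E; destruct Hsg as [-> | ->]; lra).
  assert (Hne : C v <> C (nx v)).
  { intros F. apply closed_inj in F; auto using nx_lt. now apply (nx_neq v Hv). }
  destruct (orient_param _ _ _ Hne Z') as [s Es].
  pose proof (nx_lt v Hv) as Ha.
  pose proof (hull_side_prev v sg Hv (all_hull v Hv) Hsg (Rlt_le _ _ (Ht v Hv)) j Hj) as P1.
  pose proof (hull_side_next (nx v) sg Ha (all_hull _ Ha) Hsg (Rlt_le _ _ (Ht _ Ha)) j Hj) as P2.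
  assert (E1 : det (vec (C v) (C (pv v))) (C v) (C j) = - s * turn v).
  { rewrite Es. unfold turn, det, vec. simpl. ring. }
  assert (E2 : det (vec (C (nx v)) (C (nx (nx v)))) (C (nx v)) (C j) = - (s - 1) * turn (nx v)).
  { rewrite Es. unfold turn. rewrite pv_nx by auto. unfold det, vec. simpl. ring. }
  rewrite E1 in P1. rewrite E2 in P2.
  pose proof (Ht v Hv) as T1. pose proof (Ht _ Ha) as T2.
  assert (S0 : 0 <= s).
  { apply Rnot_lt_le. intros F. assert (0 < - s * (sg * turn v)) by (apply Rmult_lt_0_compat; lra). lra. }
  assert (S1 : s <= 1).
  { apply Rnot_lt_le. intros F.
    assert (0 < (s - 1) * (sg * turn (nx v))) by (apply Rmult_lt_0_compat; lra). lra. }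
  destruct HC as [_ [H2 _]]. apply (H2 v j); auto; rewrite ?tgt_nx; auto.
  simpl. exists s. split; [lra|]. exact Es.
Qed.

End Equilibrium.

End Closed.

(** * Convex polygons in stereographic coordinates *)

(* Edge directions of a convex polygon as points of the unit circle in stereographic coordinates:
   the first edge has parameter infinity, the others decreasing parameters [tau 1 > tau 2 > ..]. *)
Definition stereo (t : R) : pt := ((t * t - 1) / (t * t + 1), 2 * t / (t * t + 1)).
Definition sdir (tau : nat -> R) (i : nat) : pt := if Nat.eq_dec i 0 then (1, 0) else stereo (tau i).
Definition rot (phi : R) (u : pt) : pt :=
  (cos phi * fst u - sin phi * snd u, sin phi * fst u + cos phi * snd u).
Definition cr (u v : pt) : R := fst u * snd v - snd u * fst v.

Lemma stereo_unit t : fst (stereo t) * fst (stereo t) + snd (stereo t) * snd (stereo t) = 1.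
Proof. unfold stereo. simpl. field. nra. Qed.

Lemma sdir_unit tau i : fst (sdir tau i) * fst (sdir tau i) + snd (sdir tau i) * snd (sdir tau i) = 1.
Proof. unfold sdir. destruct (Nat.eq_dec i 0); [simpl; ring|apply stereo_unit]. Qed.

Lemma rot_unit phi u : fst u * fst u + snd u * snd u = 1 ->
  fst (rot phi u) * fst (rot phi u) + snd (rot phi u) * snd (rot phi u) = 1.
Proof.
  intros H. unfold rot. simpl.
  transitivity ((cos phi * cos phi + sin phi * sin phi) * (fst u * fst u + snd u * snd u)); [ring|].
  rewrite H, cos_sin_sq. ring.
Qed.

Lemma cr_rot phi u v : cr (rot phi u) (rot phi v) = cr u v.
Proof.
  unfold cr, rot. simpl. transitivity ((cos phi * cos phi + sin phi * sin phi) * (fst u * snd v - snd u * fst v));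
    [ring|]. rewrite cos_sin_sq. ring.
Qed.

Lemma rot_zero phi x y : cos phi * x - sin phi * y = 0 -> sin phi * x + cos phi * y = 0 -> x = 0 /\ y = 0.
Proof.
  intros H1 H2. split.
  - transitivity ((cos phi * cos phi + sin phi * sin phi) * x); [rewrite cos_sin_sq; ring|].
    transitivity (cos phi * (cos phi * x - sin phi * y) + sin phi * (sin phi * x + cos phi * y)); [ring|].
    rewrite H1, H2. ring.
  - transitivity ((cos phi * cos phi + sin phi * sin phi) * y); [rewrite cos_sin_sq; ring|].
    transitivity (cos phi * (sin phi * x + cos phi * y) - sin phi * (cos phi * x - sin phi * y)); [ring|].
    rewrite H1, H2. ring.
Qed.

Lemma mul_pos_le a b : 0 < a -> a * b <= 0 -> b <= 0.
Proof. intros H1 H2. apply Rnot_lt_le. intros H3. pose proof (Rmult_lt_0_compat a b H1 H3). lra. Qed.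

Lemma mul_pos_lt a b : 0 < a -> b < 0 -> a * b < 0.
Proof. intros H1 H2. pose proof (Rmult_lt_0_compat a (- b) H1 ltac:(lra)). lra. Qed.

Lemma mul_pos_cancel a b : 0 < b -> 0 < a * b -> 0 < a.
Proof. intros H1 H2. apply Rnot_le_lt. intros H3. pose proof (Rmult_le_pos (- a) b ltac:(lra) ltac:(lra)). lra. Qed.

(** * Convex polygons as closed walks with decreasing stereographic parameters *)

Section Turtle.

Variable n : nat.
Hypothesis Hn : (3 <= n)%nat.
Notation next := (nx n).

Definition decr (tau : nat -> R) : Prop :=
  forall a b, (1 <= a)%nat -> (a < b)%nat -> (b < n)%nat -> tau b < tau a.

Definition walks (C : nat -> pt) (phi : R) (len tau : nat -> R) : Prop :=
  forall i, (i < n)%nat -> C (next i) =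
    (fst (C i) + len i * fst (rot phi (sdir tau i)), snd (C i) + len i * snd (rot phi (sdir tau i))).

Definition closes (len tau : nat -> R) : Prop :=
  Rsum n (fun i => len i * fst (sdir tau i)) = 0 /\ Rsum n (fun i => len i * snd (sdir tau i)) = 0.

(** The cross product of the directions of edges [i] and [k] up to a positive factor, as a
    polynomial in the parameters. *)
Definition sgn_cr (tau : nat -> R) (i k : nat) : R :=
  if Nat.eq_dec i 0 then tau k else if Nat.eq_dec k 0 then - tau i
  else (tau i - tau k) * (tau i * tau k + 1).

Lemma cr_sdir tau i k : i <> k ->
  exists c, 0 < c /\ cr (sdir tau i) (sdir tau k) = c * sgn_cr tau i k.
Proof.
  intros N. unfold sgn_cr, sdir, cr, stereo.
  assert (P : forall t, 0 < t * t + 1) by (intros; nra).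
  pose proof (P (tau i)) as Pi. pose proof (P (tau k)) as Pk.
  destruct (Nat.eq_dec i 0) as [Ei|Ni], (Nat.eq_dec k 0) as [Ek|Nk]; simpl.
  - lia.
  - exists (2 / (tau k * tau k + 1)). split; [apply Rdiv_lt_0_compat; lra|]. field. lra.
  - exists (2 / (tau i * tau i + 1)). split; [apply Rdiv_lt_0_compat; lra|]. field. lra.
  - exists (2 / ((tau i * tau i + 1) * (tau k * tau k + 1))).
    split; [apply Rdiv_lt_0_compat; [lra|now apply Rmult_lt_0_compat]|]. field. lra.
Qed.

Definition cyc (i r : nat) : nat := if lt_dec (i + r) n then (i + r)%nat else (i + r - n)%nat.

(** Seen from edge [i], the following edges first point to the left and, once they have reached the
    opposite direction, point to the right until the circuit is complete. *)
Lemma sgn_cr_unimodal tau i r r' : decr tau -> (i < n)%nat -> (1 <= r)%nat -> (r < r')%nat ->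
  (r' < n)%nat -> sgn_cr tau i (cyc i r) <= 0 -> sgn_cr tau i (cyc i r') < 0.
Proof.
  intros Hd Hi H1 H2 H3 H.
  unfold sgn_cr, cyc in *.
  destruct (Nat.eq_dec i 0) as [Ei|Ni].
  - subst i. simpl in *. destruct (lt_dec r n); [|lia]. destruct (lt_dec r' n); [|lia].
    pose proof (Hd r r' H1 H2 H3). lra.
  - destruct (lt_dec (i + r) n) as [L|L].
    + destruct (Nat.eq_dec (i + r) 0); [lia|].
      pose proof (Hd i (i + r)%nat ltac:(lia) ltac:(lia) ltac:(lia)) as D1.
      assert (K : tau i * tau (i + r)%nat + 1 <= 0) by (apply (mul_pos_le (tau i - tau (i + r)%nat)); lra).
      assert (Kp : 0 < tau i) by nra.
      destruct (lt_dec (i + r') n) as [L'|L'].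
      * destruct (Nat.eq_dec (i + r') 0); [lia|].
        pose proof (Hd (i + r)%nat (i + r')%nat ltac:(lia) ltac:(lia) ltac:(lia)) as D2.
        apply mul_pos_lt; [lra|]. nra.
      * destruct (Nat.eq_dec (i + r' - n) 0); [lra|].
        pose proof (Hd (i + r' - n)%nat i ltac:(lia) ltac:(lia) ltac:(lia)) as D2.
        rewrite Rmult_comm. apply mul_pos_lt; nra.
    + destruct (lt_dec (i + r') n) as [L'|L']; [lia|].
      destruct (Nat.eq_dec (i + r' - n) 0); [lia|].
      pose proof (Hd (i + r' - n)%nat i ltac:(lia) ltac:(lia) ltac:(lia)) as D2.
      rewrite Rmult_comm. apply mul_pos_lt; [|lra].
      destruct (Nat.eq_dec (i + r - n) 0).
      * nra.
      * pose proof (Hd (i + r - n)%nat (i + r' - n)%nat ltac:(lia) ltac:(lia) ltac:(lia)) as D3.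
        assert (K : - (tau i * tau (i + r - n)%nat + 1) <= 0).
        { apply (mul_pos_le (tau (i + r - n)%nat - tau i)); lra. }
        destruct (Rle_dec 0 (tau i)); nra.
Qed.

Lemma cyc_S i r : (i < n)%nat -> (r < n)%nat -> cyc i (S r) = next (cyc i r).
Proof.
  intros. unfold cyc, nx. destruct (lt_dec (i + r) n), (lt_dec (i + S r) n);
    destruct (Nat.eq_dec (S _) n); lia.
Qed.

(** The height of the vertices over the line of edge [i] first rises and then falls, by unimodality
    of the cross products. Being 0 at both ends of the circuit, it is positive in between. *)
Lemma walks_convex C phi len tau : decr tau -> (forall i, (i < n)%nat -> 0 < len i) ->
  walks C phi len tau -> convex n 1 C.
Proof.
  intros Hd Hl HW i j Hi Hj N1 N2. rewrite Rmult_1_l.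
  set (F := fun r => orient (C i) (C (next i)) (C (cyc i r))).
  set (x := fun r => cr (sdir tau i) (sdir tau (cyc i r))).
  assert (Hcl : forall r, (r < n)%nat -> (cyc i r < n)%nat).
  { intros r Hr. unfold cyc. destruct (lt_dec (i + r) n); lia. }
  assert (FS : forall r, (r < n)%nat -> F (S r) = F r + (len i * len (cyc i r)) * x r).
  { intros r Hr. unfold F, x. rewrite cyc_S by auto. rewrite <- (cr_rot phi).
    rewrite (HW (cyc i r) (Hcl r Hr)), (HW i Hi). unfold orient, cr. simpl. ring. }
  assert (F1 : F 1%nat = 0).
  { unfold F. rewrite cyc_S by lia.
    replace (cyc i 0) with i; [unfold orient; ring|]. unfold cyc. destruct (lt_dec (i + 0) n); lia. }
  assert (Fn : F n = 0).
  { unfold F. replace (cyc i n) with i; [unfold orient; ring|]. unfold cyc. destruct (lt_dec (i + n) n); lia. }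
  assert (Hx : forall r, (1 <= r)%nat -> (r < n)%nat -> exists c, 0 < c /\ F (S r) = F r + c * sgn_cr tau i (cyc i r)).
  { intros r H1 H2. destruct (cr_sdir tau i (cyc i r)) as [c [Hc E]].
    { unfold cyc. destruct (lt_dec (i + r) n); lia. }
    exists (len i * len (cyc i r) * c). split.
    - pose proof (Hl i Hi). pose proof (Hl _ (Hcl r H2)).
      apply Rmult_lt_0_compat; auto. now apply Rmult_lt_0_compat.
    - rewrite FS by auto. unfold x. rewrite E. ring. }
  set (r := if le_dec i j then (j - i)%nat else (j + n - i)%nat).
  assert (Er : cyc i r = j) by (unfold cyc, r; destruct (le_dec i j); destruct (lt_dec _ n); lia).
  assert (Hr : (2 <= r)%nat /\ (r < n)%nat).
  { unfold r, nx in *. destruct (le_dec i j), (Nat.eq_dec (S i) n); lia. }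
  rewrite <- Er. fold (F r). apply Rnot_le_lt. intros HF.
  (* If the height at offset [r] is not positive, some earlier edge failed to rise; from then on the
     height keeps falling and cannot return to 0. *)
  assert (Hex : exists q, (1 <= q)%nat /\ (q < r)%nat /\ sgn_cr tau i (cyc i q) <= 0).
  { apply NNPP. intros Hno.
    assert (Hup : forall q, (1 <= q)%nat -> (q <= r)%nat -> 0 <= F q /\ ((1 < q)%nat -> 0 < F q)).
    { induction q as [|q IH]; intros Q1 Q2; [lia|].
      destruct (Nat.eq_dec q 0) as [->|Nq]; [split; [lra|lia]|].
      destruct (IH ltac:(lia) ltac:(lia)) as [I1 _].
      destruct (Hx q ltac:(lia) ltac:(lia)) as [c [Hc E]].
      assert (0 < sgn_cr tau i (cyc i q)).
      { apply Rnot_le_lt. intros D. apply Hno. exists q. split; [lia|]. split; [lia|auto]. }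
      assert (0 < c * sgn_cr tau i (cyc i q)) by now apply Rmult_lt_0_compat.
      split; [lra|intros; lra]. }
    destruct (Hup r) as [_ H]; [lia|lia|]. specialize (H ltac:(lia)). lra. }
  destruct Hex as [q [Q1 [Q2 Q3]]].
  assert (Hdn : forall k, (r + k <= n)%nat -> F (r + k)%nat <= 0 /\ ((0 < k)%nat -> F (r + k)%nat < 0)).
  { induction k as [|k IH]; intros Hk; [rewrite Nat.add_0_r; split; [auto|lia]|].
    destruct (IH ltac:(lia)) as [I1 _].
    destruct (Hx (r + k)%nat ltac:(lia) ltac:(lia)) as [c [Hc E]].
    pose proof (sgn_cr_unimodal tau i q (r + k) Hd Hi Q1 ltac:(lia) ltac:(lia) Q3) as Sg.
    replace (r + S k)%nat with (S (r + k)) by lia.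
    assert (c * sgn_cr tau i (cyc i (r + k)) < 0) by nra. split; [lra|intros; lra]. }
  destruct (Hdn (n - r)%nat) as [_ H]; [lia|]. specialize (H ltac:(lia)).
  replace (r + (n - r))%nat with n in H by lia. lra.
Qed.

Lemma walks_trace C phi len tau : walks C phi len tau ->
  forall i, (i < n)%nat -> C i = trace (C O) len (fun j => rot phi (sdir tau j)) i.
Proof.
  intros HW. induction i as [|i IH]; intros Hi; [now rewrite trace_0|].
  rewrite trace_S, <- IH by lia. rewrite <- (HW i) by lia. f_equal.
  unfold nx. destruct (Nat.eq_dec (S i) n); lia.
Qed.

Lemma trace_rot_closed p len tau phi : 
  trace p len (fun j => rot phi (sdir tau j)) n =
  (fst p + (cos phi * Rsum n (fun i => len i * fst (sdir tau i)) - sin phi * Rsum n (fun i => len i * snd (sdir tau i))),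
   snd p + (sin phi * Rsum n (fun i => len i * fst (sdir tau i)) + cos phi * Rsum n (fun i => len i * snd (sdir tau i)))).
Proof.
  rewrite <- !Rsum_scal, <- Rsum_minus, <- Rsum_plus. unfold trace.
  apply pt_eq; simpl; f_equal; apply Rsum_ext; intros; ring.
Qed.

Lemma walks_closes C phi len tau : walks C phi len tau -> closes len tau.
Proof.
  intros HW. pose proof (HW (n - 1)%nat ltac:(lia)) as H.
  rewrite (walks_trace C phi len tau HW (n - 1)) in H at 2 by lia.
  rewrite (walks_trace C phi len tau HW (n - 1)) in H at 1 by lia.
  assert (E : next (n - 1) = 0%nat) by (unfold nx; destruct (Nat.eq_dec (S (n - 1)) n); lia).
  rewrite E in H.
  pose proof (trace_S (C O) len (fun j => rot phi (sdir tau j)) (n - 1)) as T. cbv beta in T.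
  rewrite <- T in H. replace (S (n - 1)) with n in H by lia. rewrite trace_rot_closed in H.
  assert (H1 := f_equal fst H). assert (H2 := f_equal snd H). simpl in H1, H2.
  apply (rot_zero phi); lra.
Qed.

(** The closing equations account for the last edge, from [n - 1] back to 0. *)
Lemma trace_walks p phi len tau C : closes len tau ->
  (forall i, (i < n)%nat -> C i = trace p len (fun j => rot phi (sdir tau j)) i) ->
  walks C phi len tau.
Proof.
  intros [H1 H2] HC i Hi. unfold nx. destruct (Nat.eq_dec (S i) n) as [E|N].
  - rewrite (HC O), (HC i), trace_0 by lia.
    pose proof (trace_S p len (fun j => rot phi (sdir tau j)) i) as T. cbv beta in T.
    rewrite <- T, E, trace_rot_closed, H1, H2. apply pt_eq; simpl; ring.
  - rewrite (HC (S i)), trace_S, <- (HC i) by lia. reflexivity.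
Qed.

(** After rotating the first edge direction to (1,0), no other edge has that direction, so each has
    a stereographic parameter, the cotangent of half its angle; convexity makes these decrease. *)
Lemma convex_walks C : convex n 1 C -> exists phi len tau, decr tau /\
  (forall i, (i < n)%nat -> 0 < len i) /\ walks C phi len tau.
Proof.
  intros HC.
  assert (HC' : forall v j, (v < n)%nat -> (j < n)%nat -> j <> v -> j <> next v ->
     0 < orient (C v) (C (next v)) (C j)).
  { intros v j Hv Hj A B. specialize (HC v j Hv Hj A B). lra. }
  assert (HC0 : forall v j, (v < n)%nat -> (j < n)%nat -> 0 <= orient (C v) (C (next v)) (C j)).
  { intros v j Hv Hj. destruct (Nat.eq_dec j v) as [->|N1]; [right; unfold orient; ring|].
    destruct (Nat.eq_dec j (next v)) as [->|N2]; [right; unfold orient; ring|]. left. auto. }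
  set (len := fun i => dist (C i) (C (next i))).
  assert (Hl : forall i, (i < n)%nat -> 0 < len i).
  { intros i Hi. apply dist_pos. intros E.
    pose proof (HC' i (pv n i) Hi (pv_lt n Hn i Hi) (pv_neq n Hn i Hi) (not_eq_sym (nx_neq_pv n Hn i Hi))) as H.
    rewrite <- E in H. unfold orient in H. lra. }
  set (ex := fun i => (fst (C (next i)) - fst (C i)) / len i).
  set (ey := fun i => (snd (C (next i)) - snd (C i)) / len i).
  assert (Ex : forall i, (i < n)%nat -> fst (C (next i)) = fst (C i) + len i * ex i).
  { intros i Hi. specialize (Hl i Hi). unfold ex. field. lra. }
  assert (Ey : forall i, (i < n)%nat -> snd (C (next i)) = snd (C i) + len i * ey i).
  { intros i Hi. specialize (Hl i Hi). unfold ey. field. lra. }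
  assert (Eu : forall i, (i < n)%nat -> ex i * ex i + ey i * ey i = 1).
  { intros i Hi. specialize (Hl i Hi). pose proof (dist_sq (C i) (C (next i))) as E. fold (len i) in E.
    unfold ex, ey. transitivity (((fst (C i) - fst (C (next i))) ^ 2 + (snd (C i) - snd (C (next i))) ^ 2) /
      (len i * len i)); [field; lra|]. rewrite <- E. field. lra. }
  destruct (unit_angle (ex O) (ey O) (Eu O ltac:(lia))) as [phi [P1 P2]].
  set (X := fun i => ex O * ex i + ey O * ey i). set (Y := fun i => ex O * ey i - ey O * ex i).
  assert (EXY : forall i, (i < n)%nat -> X i * X i + Y i * Y i = 1).
  { intros i Hi. unfold X, Y. transitivity ((ex O * ex O + ey O * ey O) * (ex i * ex i + ey i * ey i)); [ring|].
    rewrite !Eu by lia. ring. }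
  assert (nx0 : next 0 = 1%nat) by (unfold nx; destruct (Nat.eq_dec 1 n); lia).
  (* Height over the line of the first edge, times [len O]. *)
  set (H := fun i => orient (C O) (C 1%nat) (C i)).
  assert (Hpos : forall i, (2 <= i)%nat -> (i < n)%nat -> 0 < H i).
  { intros i H1 H2. unfold H. rewrite <- nx0. apply HC'; try lia. }
  assert (Hstep : forall i, (i < n)%nat -> H (next i) = H i + len O * len i * Y i).
  { intros i Hi. unfold H. rewrite <- nx0. unfold orient, Y.
    rewrite (Ex i Hi), (Ey i Hi), (Ex O), (Ey O) by lia. ring. }
  assert (Hor : forall i j, (i < n)%nat -> orient (C i) (C (next i)) (C j) =
     len i * (ex i * (snd (C j) - snd (C i)) - ey i * (fst (C j) - fst (C i)))).
  { intros i j Hi. unfold orient. rewrite (Ex i Hi), (Ey i Hi). ring. }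
  assert (Xlt : forall i, (1 <= i)%nat -> (i < n)%nat -> X i < 1).
  { intros i H1 H2. pose proof (EXY i H2) as E.
    destruct (Rlt_dec (X i) 1) as [|NX]; auto. exfalso.
    assert (X i = 1) by nra. assert (Y0 : Y i = 0) by nra.
    (* parallel to the first edge: its supporting line cannot have [C 0] on its left *)
    assert (HI : 0 < H i \/ i = 1%nat).
    { destruct (Nat.eq_dec i 1); [now right|left; apply Hpos; lia]. }
    assert (exi : ex i = ex O /\ ey i = ey O).
    { assert (Q1 : ex i = (ex O * ex O + ey O * ey O) * ex i) by (rewrite Eu by lia; ring).
      assert (Q2 : ey i = (ex O * ex O + ey O * ey O) * ey i) by (rewrite Eu by lia; ring).
      split.
      - rewrite Q1. transitivity (ex O * X i - ey O * Y i); [unfold X, Y; ring|]. rewrite H0, Y0. ring.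
      - rewrite Q2. transitivity (ey O * X i + ex O * Y i); [unfold X, Y; ring|]. rewrite H0, Y0. ring. }
    destruct exi as [X1 Y1].
    destruct HI as [HI| ->].
    - pose proof (HC0 i O H2 ltac:(lia)) as A. rewrite Hor, X1, Y1 in A by auto.
      unfold H, orient in HI. rewrite <- nx0, (Ex O), (Ey O) in HI by lia.
      pose proof (Hl O ltac:(lia)). pose proof (Hl i H2).
      set (w := ex 0%nat * (snd (C 0%nat) - snd (C i)) - ey 0%nat * (fst (C 0%nat) - fst (C i))) in *.
      replace (_ - _) with (- (len O * w)) in HI by (unfold w; ring). nra.
    - pose proof (Hstep 1%nat H2) as HS. rewrite Y0, Rmult_0_r, Rplus_0_r in HS.
      assert (N1 : next 1 = 2%nat) by (unfold nx; destruct (Nat.eq_dec 2 n); lia).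
      rewrite N1 in HS. pose proof (Hpos 2%nat ltac:(lia) ltac:(lia)) as P.
      rewrite HS in P. unfold H, orient in P. lra. }
  (* Inverse of [stereo]: projection of the unit circle from (1,0). *)
  set (tau := fun i => Y i / (1 - X i)).
  assert (Hst : forall i, (1 <= i)%nat -> (i < n)%nat -> stereo (tau i) = (X i, Y i)).
  { intros i H1 H2. pose proof (Xlt i H1 H2) as L. pose proof (EXY i H2) as E.
    assert (Q : tau i * tau i + 1 = 2 / (1 - X i)).
    { unfold tau. transitivity ((Y i * Y i + (1 - X i) * (1 - X i)) / ((1 - X i) * (1 - X i))); [field; lra|].
      replace (Y i * Y i) with (1 - X i * X i) by lra. field. lra. }
    unfold stereo. rewrite Q. apply pt_eq; simpl.
    - replace (tau i * tau i - 1) with (2 / (1 - X i) - 2) by lra. field. lra.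
    - unfold tau. field. lra. }
  assert (Hdet : forall i j, ex i * ey j - ey i * ex j = X i * Y j - Y i * X j).
  { intros i j. transitivity ((ex O * ex O + ey O * ey O) * (ex i * ey j - ey i * ex j)).
    - rewrite Eu by lia. ring.
    - unfold X, Y. ring. }
  assert (Hdec1 : forall i, (1 <= i)%nat -> (S i < n)%nat -> tau (S i) < tau i).
  { intros i H1 H2.
    assert (Ni : next i = S i) by (unfold nx; destruct (Nat.eq_dec (S i) n); lia).
    assert (D : 0 < ex i * ey (S i) - ey i * ex (S i)).
    { pose proof (HC' i (next (S i)) ltac:(lia) (nx_lt n Hn (S i) H2)) as A.
      assert (B : next (S i) <> i /\ next (S i) <> next i).
      { rewrite Ni. unfold nx. destruct (Nat.eq_dec (S (S i)) n); lia. }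
      specialize (A (proj1 B) (proj2 B)). rewrite Hor, (Ex (S i)), (Ey (S i)), <- Ni, (Ex i), (Ey i) in A by lia.
      rewrite Ni in A.
      replace (_ * _) with (len i * len (S i) * (ex i * ey (S i) - ey i * ex (S i))) in A by ring.
      pose proof (Hl i ltac:(lia)). pose proof (Hl (S i) H2).
      assert (0 < len i * len (S i)) by now apply Rmult_lt_0_compat. nra. }
    pose proof D as D0. rewrite Hdet in D.
    pose proof (Hst i H1 ltac:(lia)) as S1. pose proof (Hst (S i) ltac:(lia) H2) as S2.
    pose proof (f_equal fst S1) as S1x. pose proof (f_equal snd S1) as S1y.
    pose proof (f_equal fst S2) as S2x. pose proof (f_equal snd S2) as S2y. simpl in S1x, S1y, S2x, S2y.
    set (a := tau i) in *. set (b := tau (S i)) in *.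
    assert (Q : X i * Y (S i) - Y i * X (S i) = 2 / ((a * a + 1) * (b * b + 1)) * ((a - b) * (a * b + 1))).
    { rewrite <- S1x, <- S1y, <- S2x, <- S2y. field. nra. }
    assert (Q' : 0 < (a - b) * (a * b + 1)).
    { rewrite Q in D. assert (0 < 2 / ((a * a + 1) * (b * b + 1))).
      { apply Rdiv_lt_0_compat; [lra|]. apply Rmult_lt_0_compat; nra. } nra. }
    (* A left turn gives [b < a] unless [a * b + 1] is nonpositive; the only case left to refute is
       [a <= 0 < b]. *)
    assert (Q'' : 0 < a * b + 1 -> b < a).
    { intros F. pose proof (mul_pos_cancel _ _ F Q'). lra. }
    destruct (Rlt_dec 0 a) as [A|A]; [destruct (Rlt_dec 0 b); [apply Q''; nra|lra]|].
    destruct (Rlt_dec 0 b) as [B|B]; [|apply Q''; nra].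
    exfalso.
    (* the height over the first edge would have a local minimum at [C (S i)] *)
    assert (Yi : Y i <= 0).
    { rewrite <- S1y. replace (2 * a / (a * a + 1)) with (- (2 * - a / (a * a + 1))) by (field; nra).
      enough (0 <= 2 * - a / (a * a + 1)) by lra. apply Rmult_le_pos; [lra|].
      left. apply Rinv_0_lt_compat. nra. }
    assert (Yj : 0 < Y (S i)) by (rewrite <- S2y; apply Rdiv_lt_0_compat; nra).
    pose proof (Hpos (S i) ltac:(lia) H2) as HP.
    pose proof (HC0 i O ltac:(lia) ltac:(lia)) as A1. pose proof (HC0 (S i) O H2 ltac:(lia)) as A2.
    assert (A1' : orient (C i) (C (next i)) (C O) = len i * (ex i * (snd (C O) - snd (C (S i))) -
       ey i * (fst (C O) - fst (C (S i))))).
    { unfold orient. rewrite <- Ni. rewrite (Ex i), (Ey i) by lia. ring. }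
    rewrite A1' in A1. rewrite Hor in A2 by auto.
    unfold H, orient in HP. rewrite <- nx0, (Ex O), (Ey O) in HP by lia.
    set (wx := fst (C O) - fst (C (S i))) in *. set (wy := snd (C O) - snd (C (S i))) in *.
    pose proof (Hl O ltac:(lia)) as L0. pose proof (Hl i ltac:(lia)) as Li. pose proof (Hl (S i) H2) as Lj.
    assert (W0 : ex O * wy - ey O * wx < 0).
    { replace (_ - _) with (- (len O * (ex O * wy - ey O * wx))) in HP by (unfold wx, wy; ring). nra. }
    assert (W1 : 0 <= ex i * wy - ey i * wx) by nra.
    assert (W2 : 0 <= ex (S i) * wy - ey (S i) * wx) by nra.
    (* Three-term Pluecker relation among the directions of the edges 0, [i], [S i] and the vector
       (wx,wy) from [C (S i)] to [C O]. *)
    assert (PL : (ex i * ey (S i) - ey i * ex (S i)) * (ex O * wy - ey O * wx) =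
      Y (S i) * (ex i * wy - ey i * wx) - Y i * (ex (S i) * wy - ey (S i) * wx)) by (unfold Y; ring).
    assert (0 <= Y (S i) * (ex i * wy - ey i * wx)) by (apply Rmult_le_pos; lra).
    assert (0 <= - Y i * (ex (S i) * wy - ey (S i) * wx)) by (apply Rmult_le_pos; lra).
    nra. }
  exists phi, len, tau. split; [|split]; auto.
  - intros a b Ha Hab Hb. induction Hab as [|b Hab IH]; [now apply Hdec1|].
    apply Rlt_trans with (tau b); [apply Hdec1; lia|apply IH; lia].
  - intros i Hi.
    assert (Er : rot phi (sdir tau i) = (ex i, ey i)).
    { assert (Es : sdir tau i = (X i, Y i)).
      { unfold sdir. destruct (Nat.eq_dec i 0) as [->|N]; [|apply Hst; lia].
        apply pt_eq; simpl; unfold X, Y; [rewrite Eu by lia; auto|ring]. }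
      rewrite Es. unfold rot. simpl. rewrite <- P1, <- P2. unfold X, Y. apply pt_eq; simpl.
      - transitivity ((ex O * ex O + ey O * ey O) * ex i); [ring|]. rewrite Eu by lia. ring.
      - transitivity ((ex O * ex O + ey O * ey O) * ey i); [ring|]. rewrite Eu by lia. ring. }
    rewrite Er. simpl. apply pt_eq; simpl; auto.
Qed.

End Turtle.

(** * Polygons with prescribed edge lengths *)

Lemma cv_ln u l : 0 < l -> Un_cv u l -> Un_cv (fun k => ln (u k)) (ln l).
Proof.
  intros Hl H. apply (continuity_seq ln); auto.
  apply derivable_continuous_pt. exists (/ l). now apply derivable_pt_lim_ln.
Qed.

(** One-sided derivative test, for a maximum on a rectangle that may sit on its boundary. *)
Lemma dpl_right_max f d r : 0 < r -> derivable_pt_lim f 0 d ->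
  (forall h, 0 < h < r -> f h <= f 0) -> d <= 0.
Proof.
  intros Hr H Hm. apply Rnot_lt_le. intros Hd. destruct (H (d / 2) ltac:(lra)) as [e He].
  set (h := Rmin (r / 2) (e / 2)). pose proof (cond_pos e).
  assert (Hh : 0 < h) by (apply Rmin_glb_lt; lra).
  assert (h <= r / 2) by apply Rmin_l. assert (h <= e / 2) by apply Rmin_r.
  specialize (He h ltac:(lra)). rewrite Rabs_pos_eq in He by lra. specialize (He ltac:(lra)).
  rewrite Rplus_0_l in He. apply Rabs_def2 in He. specialize (Hm h ltac:(lra)).
  assert ((f h - f 0) / h <= 0).
  { apply Rmult_le_reg_r with h; auto. replace ((f h - f 0) / h * h) with (f h - f 0) by (field; lra). lra. }
  lra.
Qed.

Lemma dpl_left_max f d r : 0 < r -> derivable_pt_lim f 0 d ->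
  (forall h, - r < h < 0 -> f h <= f 0) -> 0 <= d.
Proof.
  intros Hr H Hm. apply Rnot_lt_le. intros Hd. destruct (H (- d / 2) ltac:(lra)) as [e He].
  set (h := Rmin (r / 2) (e / 2)). pose proof (cond_pos e).
  assert (Hh : 0 < h) by (apply Rmin_glb_lt; lra).
  assert (h <= r / 2) by apply Rmin_l. assert (h <= e / 2) by apply Rmin_r.
  specialize (He (- h) ltac:(lra)). rewrite Rabs_Ropp, Rabs_pos_eq in He by lra. specialize (He ltac:(lra)).
  rewrite Rplus_0_l in He. apply Rabs_def2 in He. specialize (Hm (- h) ltac:(lra)).
  assert (0 <= (f (- h) - f 0) / - h).
  { apply Rmult_le_reg_r with h; auto. replace ((f (- h) - f 0) / - h * h) with (- (f (- h) - f 0)) by (field; lra). lra. }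
  lra.
Qed.

Section Solver.

Variable n : nat.
Hypothesis Hn : (3 <= n)%nat.

Definition tm (t : nat -> R) (x y : R) (i : nat) : R := (t i - x) / y.
(** The direction of edge [i] is [(1 - 2 * qf, 2 * pf)], with both equal to 0 for the first edge, so
    the closing equations are linear in these quantities. *)
Definition qf (t : nat -> R) (x y : R) (i : nat) : R :=
  if Nat.eq_dec i 0 then 0 else y * y / ((t i - x) * (t i - x) + y * y).
Definition pf (t : nat -> R) (x y : R) (i : nat) : R :=
  if Nat.eq_dec i 0 then 0 else (t i - x) * y / ((t i - x) * (t i - x) + y * y).

Lemma sq_sum_pos a y : 0 < y -> 0 < a * a + y * y.
Proof. intros. nra. Qed.

Lemma sdir_tm t x y i : 0 < y -> sdir (tm t x y) i = (1 - 2 * qf t x y i, 2 * pf t x y i).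
Proof.
  intros Hy. unfold sdir, qf, pf, stereo, tm. destruct (Nat.eq_dec i 0); [apply pt_eq; simpl; ring|].
  pose proof (sq_sum_pos (t i - x) y Hy).
  apply pt_eq; simpl; field; split; try lra;
    intros E; nra.
Qed.

Lemma closes_iff len t x y : 0 < y -> (closes n len (tm t x y) <->
  Rsum n len = 2 * Rsum n (fun i => len i * qf t x y i) /\ Rsum n (fun i => len i * pf t x y i) = 0).
Proof.
  intros Hy. unfold closes.
  assert (E1 : Rsum n (fun i => len i * fst (sdir (tm t x y) i)) =
     Rsum n len - 2 * Rsum n (fun i => len i * qf t x y i)).
  { rewrite <- Rsum_scal, <- Rsum_minus. apply Rsum_ext. intros i _. rewrite sdir_tm by auto. simpl. ring. }
  assert (E2 : Rsum n (fun i => len i * snd (sdir (tm t x y) i)) =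
     2 * Rsum n (fun i => len i * pf t x y i)).
  { rewrite <- Rsum_scal. apply Rsum_ext. intros i _. rewrite sdir_tm by auto. simpl. ring. }
  rewrite E1, E2. split; intros [A B]; split; lra.
Qed.

Lemma decr_tm t x y : 0 < y -> decr n t -> decr n (tm t x y).
Proof.
  intros Hy H a b Ha Hab Hb. specialize (H a b Ha Hab Hb). unfold tm, Rdiv.
  apply Rmult_lt_compat_r; [now apply Rinv_0_lt_compat|lra].
Qed.

(** A fixed linear combination of the four closing sums equals the sum of [len i * E i], where every
    [E i] is a square or a square over a positive number; so all [E i] vanish. The first edge gives
    [c = 0], and two distinct parameters then give [r = 1]. *)
Lemma closes_unique len t x y x' y' : (forall i, (i < n)%nat -> 0 < len i) -> decr n t ->
  0 < y -> 0 < y' -> closes n len (tm t x y) -> closes n len (tm t x' y') -> x = x' /\ y = y'.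
Proof.
  intros Hl Hd Hy Hy' [A1 A2] [B1 B2].
  (* The second solution in coordinates where the first one is (0,1). *)
  set (c := (x' - x) / y). set (r := y' / y).
  assert (Hr : 0 < r) by now apply Rdiv_lt_0_compat.
  assert (Ht : forall i, tm t x' y' i = (tm t x y i - c) / r).
  { intros i. unfold tm, c, r. field. lra. }
  set (Q := fun tt => c * (tt * tt) - (c * c + r * r - 1) * tt - c).
  set (E := fun i => if Nat.eq_dec i 0 then c * c else
     Q (tm t x y i) * Q (tm t x y i) / ((tm t x y i * tm t x y i + 1) *
      ((tm t x y i - c) * (tm t x y i - c) + r * r))).
  assert (HE : forall i, (c * c + r * r - 1) / 2 * fst (sdir (tm t x y) i) + c * snd (sdir (tm t x y) i) -
     ((r * r - c * c - 1) / 2 * fst (sdir (tm t x' y') i) + c * r * snd (sdir (tm t x' y') i)) = E i).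
  { intros i. unfold E, sdir. destruct (Nat.eq_dec i 0); [simpl; field|].
    rewrite Ht. unfold stereo. simpl. unfold Q. set (u := tm t x y i).
    assert (0 < u * u + 1) by nra.
    pose proof (sq_sum_pos (u - c) r Hr).
    field. repeat split; nra. }
  assert (HE0 : forall i, (i < n)%nat -> 0 <= len i * E i).
  { intros i Hi. apply Rmult_le_pos; [left; auto|]. unfold E. destruct (Nat.eq_dec i 0); [apply Rle_0_sqr|].
    apply Rmult_le_pos; [apply Rle_0_sqr|]. left. apply Rinv_0_lt_compat.
    apply Rmult_lt_0_compat; [nra|now apply sq_sum_pos]. }
  assert (Z : Rsum n (fun i => len i * E i) = 0).
  { rewrite (Rsum_ext n _ (fun i => (c * c + r * r - 1) / 2 * (len i * fst (sdir (tm t x y) i)) +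
      c * (len i * snd (sdir (tm t x y) i)) -
      ((r * r - c * c - 1) / 2 * (len i * fst (sdir (tm t x' y') i)) +
       c * r * (len i * snd (sdir (tm t x' y') i))))).
    - rewrite Rsum_minus, !Rsum_plus, !Rsum_scal, A1, A2, B1, B2. ring.
    - intros i _. rewrite <- HE. ring. }
  assert (HZ : forall i, (i < n)%nat -> E i = 0).
  { intros i Hi. pose proof (Rsum_term_le n _ i HE0 Hi) as T. cbv beta in T.
    pose proof (HE0 i Hi). specialize (Hl i Hi). apply Rmult_eq_reg_l with (len i); lra. }
  assert (c0 : c = 0).
  { pose proof (HZ O ltac:(lia)) as H. unfold E in H. simpl in H. now apply Rsq_eq0. }
  assert (Hx : x = x').
  { unfold c in c0. assert (x' - x = 0); [|lra].
    replace (x' - x) with ((x' - x) / y * y) by (field; lra). rewrite c0. ring. }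
  split; auto.
  assert (HQ : forall i, (1 <= i)%nat -> (i < n)%nat -> (r * r - 1) * tm t x y i = 0).
  { intros i H1 H2. pose proof (HZ i H2) as H. unfold E in H. destruct (Nat.eq_dec i 0); [lia|].
    set (u := tm t x y i) in *.
    assert (Pd : 0 < (u * u + 1) * ((u - c) * (u - c) + r * r)).
    { apply Rmult_lt_0_compat; [nra|now apply sq_sum_pos]. }
    assert (QQ : Q u * Q u = 0).
    { replace (Q u * Q u) with (Q u * Q u / ((u * u + 1) * ((u - c) * (u - c) + r * r)) *
        ((u * u + 1) * ((u - c) * (u - c) + r * r))) by (field; split; nra). rewrite H. ring. }
    apply Rsq_eq0 in QQ. unfold Q in QQ. rewrite c0 in QQ. lra. }
  pose proof (decr_tm t x y Hy Hd 1%nat 2%nat ltac:(lia) ltac:(lia) ltac:(lia)) as D.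
  pose proof (HQ 1%nat ltac:(lia) ltac:(lia)) as Q1. pose proof (HQ 2%nat ltac:(lia) ltac:(lia)) as Q2.
  assert (r * r - 1 = 0).
  { apply Rmult_eq_reg_r with (tm t x y 1 - tm t x y 2); lra. }
  assert (r = 1) by nra. unfold r in H0.
  replace y' with (y' / y * y) by (field; lra). rewrite H0. ring.
Qed.

Lemma stereo_inj s t : stereo s = stereo t -> s = t.
Proof.
  intros H. assert (H1 := f_equal fst H). assert (H2 := f_equal snd H). unfold stereo in *. simpl in *.
  assert (Ps : 0 < s * s + 1) by nra. assert (Pt : 0 < t * t + 1) by nra.
  assert (E : s * s + 1 = t * t + 1).
  { assert (F : forall u, (u * u - 1) / (u * u + 1) = 1 - 2 * / (u * u + 1)) by (intros; field; nra).
    rewrite !F in H1. apply Rinv_eq_reg. lra. }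
  rewrite E in H2. apply Rmult_eq_reg_r with (/ (t * t + 1)); [|apply Rinv_neq_0_compat; lra].
  unfold Rdiv in H2. lra.
Qed.

Lemma stereo_neq s : stereo s <> (1, 0).
Proof.
  intros H. assert (H1 := f_equal fst H). unfold stereo in H1. simpl in H1.
  assert (Ps : 0 < s * s + 1) by nra.
  assert (s * s - 1 = s * s + 1); [|lra].
  replace (s * s - 1) with ((s * s - 1) / (s * s + 1) * (s * s + 1)) by (field; lra). rewrite H1. ring.
Qed.

Lemma sdir_inj tau i j : decr n tau -> (i < n)%nat -> (j < n)%nat -> i <> j -> sdir tau i <> sdir tau j.
Proof.
  intros Hd Hi Hj N E. unfold sdir in E.
  destruct (Nat.eq_dec i 0), (Nat.eq_dec j 0); [lia| | |].
  - now apply (stereo_neq (tau j)).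
  - now apply (stereo_neq (tau i)).
  - apply stereo_inj in E. destruct (lt_dec i j).
    + specialize (Hd i j ltac:(lia) l Hj). lra.
    + specialize (Hd j i ltac:(lia) ltac:(lia) Hi). lra.
Qed.

Lemma Rsum_two n' f i j : (forall k, (k < n')%nat -> 0 <= f k) -> (i < n')%nat -> (j < n')%nat -> i <> j ->
  f i + f j <= Rsum n' f.
Proof.
  intros H Hi Hj N.
  set (g := fun k => if Nat.eq_dec k i then 0 else f k).
  set (h := fun k => if Nat.eq_dec k i then f k else 0).
  rewrite (Rsum_ext n' f (fun k => g k + h k)).
  - rewrite Rsum_plus. rewrite (Rsum_single n' h i); auto.
    + pose proof (Rsum_term_le n' g j) as T.
      assert (g j <= Rsum n' g).
      { apply T; auto. intros k Hk. unfold g. destruct (Nat.eq_dec k i); [lra|auto]. }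
      unfold g at 1 in H0. unfold h. destruct (Nat.eq_dec j i); [lia|]. destruct (Nat.eq_dec i i); [lra|tauto].
    + intros k Hk Nk. unfold h. destruct (Nat.eq_dec k i); tauto.
  - intros k _. unfold g, h. destruct (Nat.eq_dec k i); lra.
Qed.

(** Project the closed polygon onto the direction of edge [i]: [Rsum n f] is the perimeter, the term
    of [i] is [2 * len i], and some other term is positive because at most one edge points in the
    opposite direction. *)
Lemma closes_ineq len tau : (forall i, (i < n)%nat -> 0 < len i) -> decr n tau -> closes n len tau ->
  forall i, (i < n)%nat -> 2 * len i < Rsum n len.
Proof.
  intros Hl Hd [H1 H2] i Hi.
  set (w := sdir tau). set (f := fun j => len j * (1 + (fst (w j) * fst (w i) + snd (w j) * snd (w i)))).
  assert (Ef : Rsum n f = Rsum n len).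
  { rewrite (Rsum_ext n f (fun j => len j + (fst (w i) * (len j * fst (w j)) + snd (w i) * (len j * snd (w j))))).
    - rewrite !Rsum_plus, !Rsum_scal. unfold w at 2 4. rewrite H1, H2. ring.
    - intros j _. unfold f. ring. }
  assert (Hdot : forall j, 1 + (fst (w j) * fst (w i) + snd (w j) * snd (w i)) =
     / 2 * ((fst (w j) + fst (w i)) * (fst (w j) + fst (w i)) + (snd (w j) + snd (w i)) * (snd (w j) + snd (w i)))).
  { intros j. pose proof (sdir_unit tau i). pose proof (sdir_unit tau j). fold (w i) (w j) in *.
    transitivity (/ 2 * ((fst (w j) * fst (w j) + snd (w j) * snd (w j)) +
      (fst (w i) * fst (w i) + snd (w i) * snd (w i))) + (fst (w j) * fst (w i) + snd (w j) * snd (w i))).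
    - fold w in H, H0. rewrite H, H0. field.
    - field. }
  assert (Hf : forall j, (j < n)%nat -> 0 <= f j).
  { intros j Hj. apply Rmult_le_pos; [left; auto|]. rewrite Hdot.
    pose proof (Rle_0_sqr (fst (w j) + fst (w i))). pose proof (Rle_0_sqr (snd (w j) + snd (w i))).
    unfold Rsqr in *. lra. }
  assert (Hfi : f i = 2 * len i).
  { unfold f. pose proof (sdir_unit tau i) as U. fold (w i) in U. fold w in U. rewrite U. ring. }
  assert (Hj : exists j, (j < n)%nat /\ j <> i /\ w j <> neg (w i)).
  (* Two indices other than [i]; their directions differ, so one of them is not opposite to that of
     [i]. *)
  { set (a := if Nat.eq_dec i 0 then 1%nat else 0%nat).
    set (b := if Nat.eq_dec i 2 then 1%nat else 2%nat).
    assert (Hab : (a < n /\ b < n /\ a <> i /\ b <> i /\ a <> b)%nat).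
    { unfold a, b. destruct (Nat.eq_dec i 0), (Nat.eq_dec i 2); lia. }
    destruct Hab as [Ha [Hb [Na [Nb Nab]]]].
    destruct (classic (w a = neg (w i))) as [Ea|Ea]; [|exists a; auto].
    exists b. split; auto. split; auto. intros Eb. apply (sdir_inj tau a b Hd Ha Hb Nab).
    fold w. congruence. }
  destruct Hj as [j [Hj [Nj Ej]]].
  assert (Hfj : 0 < f j).
  { apply Rmult_lt_0_compat; auto. rewrite Hdot.
    pose proof (Rle_0_sqr (fst (w j) + fst (w i))) as S1. pose proof (Rle_0_sqr (snd (w j) + snd (w i))) as S2.
    unfold Rsqr in *.
    destruct (pt_neq _ _ Ej) as [F|F]; simpl in F.
    - assert (G : fst (w j) + fst (w i) <> 0) by lra. apply Rsqr_pos_lt in G. unfold Rsqr in G. lra.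
    - assert (G : snd (w j) + snd (w i) <> 0) by lra. apply Rsqr_pos_lt in G. unfold Rsqr in G. lra. }
  pose proof (Rsum_two n f i j Hf Hi Hj (not_eq_sym Nj)) as T. rewrite Ef, Hfi in T. lra.
Qed.

(** If [x] left the interval from [-T] to [T], all [pf] with positive index would have the same
    strict sign. Otherwise [t i - x] is at most [2 * T] in absolute value, so these [qf] are at
    least [q0], and the closing equation bounds [y]. *)
Lemma closes_bounds len t x y T : (forall i, (i < n)%nat -> 0 < len i) -> 0 < y ->
  (forall i, (1 <= i)%nat -> (i < n)%nat -> Rabs (t i) <= T) -> closes n len (tm t x y) ->
  Rabs x <= T /\ (Rsum n len - 2 * len O) * (y * y) <= 4 * (T * T) * Rsum n len.
Proof.
  intros Hl Hy HT HC. apply closes_iff in HC; auto. destruct HC as [H1 H2].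
  assert (Hx : Rabs x <= T).
  { apply Rnot_lt_le. intros F.
    assert (C : (forall i, (1 <= i)%nat -> (i < n)%nat -> t i - x < 0) \/
                (forall i, (1 <= i)%nat -> (i < n)%nat -> 0 < t i - x)).
    { unfold Rabs in F. destruct (Rcase_abs x); [right|left]; intros i A B; specialize (HT i A B);
        apply Rabs_le_inv in HT; lra. }
    assert (Pd : forall i, 0 < (t i - x) * (t i - x) + y * y) by (intros; now apply sq_sum_pos).
    destruct C as [C|C].
    - assert (0 < Rsum n (fun i => - (len i * pf t x y i))).
      { apply (Rsum_pos _ _ 1%nat); [|lia|].
        - intros i Hi. unfold pf. destruct (Nat.eq_dec i 0); [lra|].
          specialize (C i ltac:(lia) Hi). specialize (Hl i Hi).
          replace (- (len i * ((t i - x) * y / ((t i - x) * (t i - x) + y * y)))) with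
            (len i * ((- (t i - x)) * y) / ((t i - x) * (t i - x) + y * y)) by (field; specialize (Pd i); lra).
          left. apply Rdiv_lt_0_compat; auto. apply Rmult_lt_0_compat; auto. apply Rmult_lt_0_compat; lra.
        - unfold pf. simpl. specialize (C 1%nat ltac:(lia) ltac:(lia)). specialize (Hl 1%nat ltac:(lia)).
          replace (- (len 1%nat * ((t 1%nat - x) * y / ((t 1%nat - x) * (t 1%nat - x) + y * y)))) with
            (len 1%nat * ((- (t 1%nat - x)) * y) / ((t 1%nat - x) * (t 1%nat - x) + y * y))
            by (field; specialize (Pd 1%nat); lra).
          apply Rdiv_lt_0_compat; auto. apply Rmult_lt_0_compat; auto. apply Rmult_lt_0_compat; lra. }
      rewrite (Rsum_ext n _ (fun i => (-1) * (len i * pf t x y i))) in H by (intros; ring).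
      rewrite Rsum_scal in H. lra.
    - assert (0 < Rsum n (fun i => len i * pf t x y i)); [|lra].
      apply (Rsum_pos _ _ 1%nat); [|lia|].
      + intros i Hi. unfold pf. destruct (Nat.eq_dec i 0); [lra|].
        specialize (C i ltac:(lia) Hi). specialize (Hl i Hi). left.
        apply Rmult_lt_0_compat; auto. apply Rdiv_lt_0_compat; auto. apply Rmult_lt_0_compat; lra.
      + unfold pf. simpl. specialize (C 1%nat ltac:(lia) ltac:(lia)). specialize (Hl 1%nat ltac:(lia)).
        apply Rmult_lt_0_compat; auto. apply Rdiv_lt_0_compat; auto. apply Rmult_lt_0_compat; lra. }
  split; auto.
  assert (HT0 : 0 <= T) by (pose proof (Rabs_pos x); lra).
  set (q0 := y * y / (4 * (T * T) + y * y)).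
  assert (Pq : 0 < 4 * (T * T) + y * y) by nra.
  assert (Hq : q0 * (Rsum n len - len O) <= Rsum n (fun i => len i * qf t x y i)).
  { replace (q0 * (Rsum n len - len O)) with (Rsum n (fun i => if Nat.eq_dec i 0 then 0 else q0 * len i)).
    - apply Rsum_le. intros i Hi. unfold qf. destruct (Nat.eq_dec i 0); [lra|].
      rewrite Rmult_comm. apply Rmult_le_compat_l; [left; auto|]. unfold q0, Rdiv.
      apply Rmult_le_compat_l; [nra|]. apply Rinv_le_contravar; [now apply sq_sum_pos|].
      specialize (HT i ltac:(lia) Hi). apply Rabs_le_inv in HT. apply Rabs_le_inv in Hx.
      enough ((t i - x) * (t i - x) <= (2 * T) * (2 * T)) by lra.
      assert (0 <= (2 * T - (t i - x)) * (2 * T + (t i - x))) by (apply Rmult_le_pos; lra). lra.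
    - rewrite (Rsum_ext n _ (fun i => q0 * len i - (if Nat.eq_dec i 0 then q0 * len i else 0))).
      + rewrite Rsum_minus, Rsum_scal, (Rsum_single n (fun i => if Nat.eq_dec i 0 then q0 * len i else 0) 0%nat); [|lia|].
        * simpl. ring.
        * intros i _ N. destruct (Nat.eq_dec i 0); tauto.
      + intros i _. destruct (Nat.eq_dec i 0); ring. }
  assert (F : 2 * (y * y) * (Rsum n len - len O) <= Rsum n len * (4 * (T * T) + y * y)).
  { replace (2 * (y * y) * (Rsum n len - len O)) with
      (2 * (q0 * (Rsum n len - len O)) * (4 * (T * T) + y * y)) by (unfold q0; field; lra).
    apply Rmult_le_compat_r; lra. }
  lra.
Qed.

End Solver.

Section Exists.

Variable n : nat.
Hypothesis Hn : (3 <= n)%nat.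
Variables len t : nat -> R.
Hypothesis Hl : forall i, (i < n)%nat -> 0 < len i.
Hypothesis Hd : decr n t.
Let L := Rsum n len.
Hypothesis Hineq : forall i, (i < n)%nat -> 2 * len i < L.

(** Sum of the logarithms of the Poisson kernels of the upper half plane at the boundary points
    [t i], weighted by the lengths, the first edge standing for the point at infinity. Critical
    points are conformal barycentres, where the polygon closes up. *)
Definition potential (x y : R) : R :=
  L * ln y - Rsum n (fun i => if Nat.eq_dec i 0 then 0 else
    len i * ln ((t i - x) * (t i - x) + y * y)).

Lemma potential_dx x y : 0 < y ->
  derivable_pt_lim (fun h => potential (x + h) y) 0 (2 / y * Rsum n (fun i => len i * pf t x y i)).
Proof.
  intros Hy. unfold potential.
  replace (2 / y * Rsum n (fun i => len i * pf t x y i)) with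
    (0 - Rsum n (fun i => - (2 / y) * (len i * pf t x y i))) by (rewrite Rsum_scal; ring).
  apply (derivable_pt_lim_minus (fun _ => L * ln y)
    (fun h => Rsum n (fun i => if Nat.eq_dec i 0 then 0 else
      len i * ln ((t i - (x + h)) * (t i - (x + h)) + y * y)))); [apply derivable_pt_lim_const|].
  apply (Rsum_derivable n (fun i h => if Nat.eq_dec i 0 then 0 else
      len i * ln ((t i - (x + h)) * (t i - (x + h)) + y * y))).
  intros i _. unfold pf. destruct (Nat.eq_dec i 0).
  - rewrite !Rmult_0_r. apply derivable_pt_lim_const.
  - pose proof (sq_sum_pos (t i - x) y Hy) as P.
    set (f := fun h => (t i - x) * (t i - x) + y * y + (- 2 * (t i - x)) * h + 1 * (h * h)).
    apply (dpl_ext (fun h => len i * ln (f h))); [intros h; unfold f; do 2 f_equal; ring|].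
    assert (F0 : f 0 = (t i - x) * (t i - x) + y * y) by (unfold f; ring).
    replace (- (2 / y) * (len i * ((t i - x) * y / ((t i - x) * (t i - x) + y * y)))) with
      (len i * (/ f 0 * (- 2 * (t i - x)))) by (rewrite F0; field; split; lra).
    apply (derivable_pt_lim_scal (fun h => ln (f h))).
    apply (derivable_pt_lim_comp f ln); [apply dpl_quadratic|].
    apply derivable_pt_lim_ln. rewrite F0. exact P.
Qed.

Lemma potential_dy x y : 0 < y ->
  derivable_pt_lim (fun h => potential x (y + h)) 0
    (/ y * (L - 2 * Rsum n (fun i => len i * qf t x y i))).
Proof.
  intros Hy. unfold potential.
  replace (/ y * (L - 2 * Rsum n (fun i => len i * qf t x y i))) with
    (L * (/ y) - Rsum n (fun i => (2 / y) * (len i * qf t x y i))) by (rewrite Rsum_scal; field; lra).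
  apply (derivable_pt_lim_minus (fun h => L * ln (y + h))
    (fun h => Rsum n (fun i => if Nat.eq_dec i 0 then 0 else
      len i * ln ((t i - x) * (t i - x) + (y + h) * (y + h))))).
  - apply (derivable_pt_lim_scal (fun h => ln (y + h))).
    apply (dpl_ext (fun h => ln (y + 1 * h + 0 * (h * h)))); [intros h; f_equal; ring|].
    replace (/ y) with (/ (y + 1 * 0 + 0 * (0 * 0)) * 1) by (field; lra).
    apply (derivable_pt_lim_comp (fun h => y + 1 * h + 0 * (h * h)) ln); [apply dpl_quadratic|].
    apply derivable_pt_lim_ln. lra.
  - apply (Rsum_derivable n (fun i h => if Nat.eq_dec i 0 then 0 else
      len i * ln ((t i - x) * (t i - x) + (y + h) * (y + h)))).
    intros i _. unfold qf. destruct (Nat.eq_dec i 0).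
    + rewrite !Rmult_0_r. apply derivable_pt_lim_const.
    + pose proof (sq_sum_pos (t i - x) y Hy) as P.
      set (f := fun h => (t i - x) * (t i - x) + y * y + (2 * y) * h + 1 * (h * h)).
      apply (dpl_ext (fun h => len i * ln (f h))); [intros h; unfold f; do 2 f_equal; ring|].
      assert (F0 : f 0 = (t i - x) * (t i - x) + y * y) by (unfold f; ring).
      replace (2 / y * (len i * (y * y / ((t i - x) * (t i - x) + y * y)))) with
        (len i * (/ f 0 * (2 * y))) by (rewrite F0; field; split; lra).
      apply (derivable_pt_lim_scal (fun h => ln (f h))).
      apply (derivable_pt_lim_comp f ln); [apply dpl_quadratic|].
      apply derivable_pt_lim_ln. rewrite F0. exact P.
Qed.

Lemma potential_cv u v x y : 0 < y -> Un_cv u x -> Un_cv v y ->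
  Un_cv (fun k => potential (u k) (v k)) (potential x y).
Proof.
  intros Hy Hu Hv. unfold potential. apply CV_minus.
  - apply CV_mult; [apply cv_const|now apply cv_ln].
  - apply (Rsum_cv n (fun k i => if Nat.eq_dec i 0 then 0 else
      len i * ln ((t i - u k) * (t i - u k) + v k * v k))).
    intros i _. destruct (Nat.eq_dec i 0); [apply cv_const|].
    apply CV_mult; [apply cv_const|].
    apply (cv_ln (fun k => (t i - u k) * (t i - u k) + v k * v k)); [now apply sq_sum_pos|]. cvt.
Qed.

Lemma len_total : 0 < L.
Proof. pose proof (Hl O ltac:(lia)). specialize (Hineq O ltac:(lia)). lra. Qed.

Lemma decr_range i : (1 <= i)%nat -> (i < n)%nat -> t (n - 1)%nat <= t i <= t 1%nat.
Proof.
  intros H1 H2. split.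
  - destruct (Nat.eq_dec i (n - 1)) as [->|N]; [lra|]. left. apply Hd; lia.
  - destruct (Nat.eq_dec i 1) as [->|N]; [lra|]. left. apply Hd; lia.
Qed.

(** For large [y] all [qf] except the first are near 1, and the first edge is shorter than half of
    the perimeter; so the potential decreases in [y]. *)
Lemma qsum_high x y : t (n - 1)%nat <= x <= t 1%nat ->
  0 < y -> L * ((t 1%nat - t (n - 1)%nat) * (t 1%nat - t (n - 1)%nat)) < (L - 2 * len O) * (y * y) ->
  L < 2 * Rsum n (fun i => len i * qf t x y i).
Proof.
  intros Hx Hy H. set (W := t 1%nat - t (n - 1)%nat) in *.
  set (q0 := y * y / (W * W + y * y)).
  pose proof (sq_sum_pos W y Hy) as Pq.
  assert (Hq : Rsum n (fun i => q0 * len i - (if Nat.eq_dec i 0 then q0 * len i else 0)) <=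
    Rsum n (fun i => len i * qf t x y i)).
  { apply Rsum_le. intros i Hi. unfold qf. destruct (Nat.eq_dec i 0); [lra|].
    rewrite Rminus_0_r, Rmult_comm. apply Rmult_le_compat_l; [left; auto|]. unfold q0, Rdiv.
    apply Rmult_le_compat_l; [nra|]. apply Rinv_le_contravar; [now apply sq_sum_pos|].
    pose proof (decr_range i ltac:(lia) Hi).
    assert (0 <= (W - (t i - x)) * (W + (t i - x))) by (apply Rmult_le_pos; unfold W; lra). lra. }
  rewrite Rsum_minus, Rsum_scal in Hq.
  rewrite (Rsum_single n (fun i => if Nat.eq_dec i 0 then q0 * len i else 0) 0%nat) in Hq; [|lia|].
  2: { intros i _ N. destruct (Nat.eq_dec i 0); tauto. }
  simpl in Hq. fold L in Hq.
  assert (F : L < 2 * (q0 * (L - len O))); [|lra].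
  apply Rmult_lt_reg_r with (W * W + y * y); auto.
  replace (2 * (q0 * (L - len O)) * (W * W + y * y)) with (2 * (y * y) * (L - len O))
    by (unfold q0; field; lra). lra.
Qed.

(** For small [y] only a parameter [t j] near [x] can have [qf] away from 0, and [len j] is less
    than half of the perimeter; so the potential increases in [y]. *)
Lemma qsum_low x y de g j : 0 < de -> 0 < y -> 0 < g -> (j < n)%nat -> 2 * len j <= L - g ->
  (forall i, (1 <= i)%nat -> (i < n)%nat -> i <> j -> de <= Rabs (t i - x)) ->
  2 * L * (y * y) < g * (de * de) ->
  2 * Rsum n (fun i => len i * qf t x y i) < L.
Proof.
  intros Hde Hy Hg Hj HL Hfar H. set (c := y * y / (de * de)).
  assert (Hc : 0 <= c) by (apply Rmult_le_pos; [nra|]; left; apply Rinv_0_lt_compat; nra).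
  assert (Hq : Rsum n (fun i => len i * qf t x y i) <=
    Rsum n (fun i => c * len i + (if Nat.eq_dec i j then len i else 0))).
  { apply Rsum_le. intros i Hi. pose proof (Hl i Hi) as Li. unfold qf.
    assert (0 <= c * len i) by (apply Rmult_le_pos; lra).
    destruct (Nat.eq_dec i 0); [destruct (Nat.eq_dec i j); lra|].
    pose proof (sq_sum_pos (t i - x) y Hy) as P. pose proof (Rle_0_sqr (t i - x)) as Sq. unfold Rsqr in Sq.
    destruct (Nat.eq_dec i j) as [->|N].
    - assert (y * y / ((t j - x) * (t j - x) + y * y) <= 1).
      { apply Rmult_le_reg_r with ((t j - x) * (t j - x) + y * y); auto.
        replace (y * y / ((t j - x) * (t j - x) + y * y) * ((t j - x) * (t j - x) + y * y)) with (y * y)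
          by (field; lra). lra. }
      assert (len j * (y * y / ((t j - x) * (t j - x) + y * y)) <= len j * 1)
        by (apply Rmult_le_compat_l; lra). lra.
    - rewrite Rplus_0_r, (Rmult_comm c). apply Rmult_le_compat_l; [lra|]. unfold c, Rdiv.
      apply Rmult_le_compat_l; [nra|]. apply Rinv_le_contravar; [nra|].
      specialize (Hfar i ltac:(lia) Hi N).
      assert (de * de <= Rabs (t i - x) * Rabs (t i - x)) by (apply Rmult_le_compat; lra).
      rewrite <- Rabs_mult, Rabs_pos_eq in H1 by auto. nra. }
  rewrite Rsum_plus, Rsum_scal in Hq.
  rewrite (Rsum_single n (fun i => if Nat.eq_dec i j then len i else 0) j) in Hq; auto.
  2: { intros i _ N. destruct (Nat.eq_dec i j); tauto. }
  destruct (Nat.eq_dec j j); [|tauto]. change (Rsum n len) with L in Hq.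
  assert (F : 2 * (c * L) < g); [|clear - Hq F HL; clearbody L c; lra].
  apply Rmult_lt_reg_r with (de * de); [now apply Rmult_lt_0_compat|].
  replace (2 * (c * L) * (de * de)) with (2 * L * (y * y)) by (unfold c; field; lra). exact H.
Qed.

(** Hence at most one parameter is closer than [de / 2] to a given [x]. *)
Lemma gap : exists de, 0 < de /\ forall i j, (1 <= i)%nat -> (i < n)%nat -> (1 <= j)%nat -> (j < n)%nat ->
  i <> j -> de <= Rabs (t i - t j).
Proof.
  destruct (finite_pos_min n (fun i => if le_dec 2 i then t (i - 1)%nat - t i else 1)) as [de [H1 H2]].
  { intros i Hi. destruct (le_dec 2 i); [|lra]. specialize (Hd (i - 1)%nat i ltac:(lia) ltac:(lia) Hi). lra. }
  assert (Hlt : forall i j, (1 <= i)%nat -> (i < j)%nat -> (j < n)%nat -> de <= t i - t j).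
  { intros i j Hi Hij Hj. specialize (H2 j Hj). cbv beta in H2. destruct (le_dec 2 j); [|lia].
    destruct (Nat.eq_dec i (j - 1)) as [->|N]; [lra|].
    specialize (Hd i (j - 1)%nat ltac:(lia) ltac:(lia) ltac:(lia)). lra. }
  exists de. split; auto. intros i j Hi1 Hi2 Hj1 Hj2 N. destruct (lt_dec i j).
  - specialize (Hlt i j Hi1 l Hj2). rewrite Rabs_pos_eq; lra.
  - specialize (Hlt j i Hj1 ltac:(lia) Hi2). rewrite Rabs_minus_sym, Rabs_pos_eq; lra.
Qed.

(** Maximise the potential on a rectangle. On each side its normal derivative points inwards, so the
    maximum is an interior critical point. *)
Lemma closes_exists : exists x y, 0 < y /\ closes n len (tm t x y).
Proof.
  pose proof len_total as L0.
  set (a := t (n - 1)%nat). set (b := t 1%nat). set (W := b - a).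
  assert (Hab : a < b) by (apply Hd; lia).
  destruct gap as [de [Hde Hgap]].
  destruct (finite_pos_min n (fun j => L - 2 * len j)) as [g [Hg Hgj]].
  { intros i Hi. specialize (Hineq i Hi). lra. }
  (* Makes [2 * L * ylo^2] smaller than [g * (de / 2)^2], as [qsum_low] requires. *)
  set (ylo := Rmin 1 (g * ((de / 2) * (de / 2)) / (4 * L))).
  assert (Hylo : 0 < ylo).
  { apply Rmin_glb_lt; [lra|]. apply Rdiv_lt_0_compat; [|lra]. apply Rmult_lt_0_compat; nra. }
  assert (Hylo1 : ylo <= 1) by apply Rmin_l.
  assert (Hylo2 : ylo <= g * ((de / 2) * (de / 2)) / (4 * L)) by apply Rmin_r.
  pose proof (Hineq O ltac:(lia)) as H0.
  (* Makes [L * W^2] smaller than [(L - 2 * len O) * yhi^2], as [qsum_high] requires, and exceeds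
     [ylo]. *)
  set (yhi := 2 + L * (W * W) / (L - 2 * len O)).
  assert (Hq0 : 0 <= L * (W * W) / (L - 2 * len O)).
  { apply Rmult_le_pos; [nra|]. left. apply Rinv_0_lt_compat. lra. }
  destruct (rect_max potential a b ylo yhi) as [x [y [Hx [Hy Hmax]]]]; [lra|unfold yhi; lra| |].
  { intros u v x y Huv Hu Hv. apply potential_cv; auto.
    assert (ylo <= y); [|lra]. apply (cv_le (fun _ => ylo) v ylo y (cv_const _) Hv). intros k. apply Huv. }
  assert (Hy0 : 0 < y) by lra.
  exists x, y. split; auto. apply closes_iff; auto. fold L.
  pose proof (potential_dx x y Hy0) as Dx. pose proof (potential_dy x y Hy0) as Dy.
  set (P := Rsum n (fun i => len i * pf t x y i)) in *.
  set (Q := Rsum n (fun i => len i * qf t x y i)) in *.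
  assert (Hinv : 0 < / y) by now apply Rinv_0_lt_compat.
  assert (Pd : forall i, 0 < (t i - x) * (t i - x) + y * y) by (intros; now apply sq_sum_pos).
  assert (Px1 : x < b -> P <= 0).
  { intros F. assert (2 / y * P <= 0).
    { apply (dpl_right_max _ _ (b - x) ltac:(lra) Dx). intros h Hh. rewrite Rplus_0_r. apply Hmax; lra. }
    apply (mul_pos_le (2 / y)); auto. unfold Rdiv. lra. }
  assert (Px2 : a < x -> 0 <= P).
  { intros F. assert (0 <= 2 / y * P).
    { apply (dpl_left_max _ _ (x - a) ltac:(lra) Dx). intros h Hh. rewrite Rplus_0_r. apply Hmax; lra. }
    assert (- P <= 0); [|lra]. apply (mul_pos_le (2 / y)); [unfold Rdiv; lra|lra]. }
  assert (Py1 : y < yhi -> L - 2 * Q <= 0).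
  { intros F. apply (mul_pos_le (/ y)); auto.
    apply (dpl_right_max _ _ (yhi - y) ltac:(lra) Dy). intros h Hh. rewrite Rplus_0_r. apply Hmax; lra. }
  assert (Py2 : ylo < y -> 0 <= L - 2 * Q).
  { intros F. assert (0 <= / y * (L - 2 * Q)).
    { apply (dpl_left_max _ _ (y - ylo) ltac:(lra) Dy). intros h Hh. rewrite Rplus_0_r. apply Hmax; lra. }
    assert (- (L - 2 * Q) <= 0); [|lra]. apply (mul_pos_le (/ y)); auto. lra. }
  split.
  - destruct (Req_dec y yhi) as [E|N].
    + exfalso. assert (L < 2 * Q).
      { apply qsum_high; auto. fold a b W. rewrite E.
        assert (L * (W * W) < (L - 2 * len O) * yhi).
        { unfold yhi. rewrite Rmult_plus_distr_l.
          replace ((L - 2 * len O) * (L * (W * W) / (L - 2 * len O))) with (L * (W * W)) by (field; lra). lra. }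
        assert (1 <= yhi) by (unfold yhi; lra).
        assert ((L - 2 * len O) * yhi <= (L - 2 * len O) * (yhi * yhi)) by (apply Rmult_le_compat_l; nra).
        lra. }
      assert (G : ylo < y) by (rewrite E; unfold yhi; lra). specialize (Py2 G). lra.
    + destruct (Req_dec y ylo) as [E|N'].
      * exfalso.
        assert (Hj : exists j, (1 <= j)%nat /\ (j < n)%nat /\
          forall i, (1 <= i)%nat -> (i < n)%nat -> i <> j -> de / 2 <= Rabs (t i - x)).
        { destruct (classic (exists j, (1 <= j)%nat /\ (j < n)%nat /\ Rabs (t j - x) < de / 2))
            as [[j [J1 [J2 J3]]]|Hno].
          - exists j. split; auto. split; auto. intros i I1 I2 Nij.
            specialize (Hgap i j I1 I2 J1 J2 Nij). apply Rnot_lt_le. intros F.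
            assert (Rabs (t i - t j) < de); [|lra].
            replace (t i - t j) with ((t i - x) - (t j - x)) by ring.
            eapply Rle_lt_trans; [apply Rabs_triang|]. rewrite Rabs_Ropp. lra.
          - exists 1%nat. split; [lia|]. split; [lia|]. intros i I1 I2 _. apply Rnot_lt_le. intros F.
            apply Hno. exists i. auto. }
        destruct Hj as [j [J1 [J2 J3]]].
        assert (2 * Q < L).
        { apply (qsum_low x y (de / 2) g j); auto; [lra| |].
          - specialize (Hgj j J2). lra.
          - rewrite E. assert (G1 : 2 * L * (ylo * ylo) <= 2 * L * ylo) by (apply Rmult_le_compat_l; nra).
            assert (G2 : 2 * L * ylo <= 2 * L * (g * ((de / 2) * (de / 2)) / (4 * L)))
              by (apply Rmult_le_compat_l; lra).
            replace (2 * L * (g * ((de / 2) * (de / 2)) / (4 * L))) with (g * ((de / 2) * (de / 2)) / 2) in G2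
              by (field; lra).
            assert (0 < g * ((de / 2) * (de / 2))) by (apply Rmult_lt_0_compat; nra). lra. }
        assert (G : y < yhi) by (rewrite E; unfold yhi; lra). specialize (Py1 G). lra.
      * specialize (Py1 ltac:(lra)). specialize (Py2 ltac:(lra)). lra.
  - destruct (Req_dec x b) as [E|N].
    (* At the largest parameter no term of [P] is positive, and that of edge 2 is negative. *)
    + exfalso. specialize (Px2 ltac:(lra)).
      assert (0 < - P); [|lra]. unfold P.
      replace (- Rsum n (fun i => len i * pf t x y i)) with (Rsum n (fun i => (-1) * (len i * pf t x y i)))
        by (rewrite Rsum_scal; ring).
      assert (Ei : forall i, i <> 0%nat -> -1 * (len i * pf t x y i) =
         len i * ((x - t i) * y) / ((t i - x) * (t i - x) + y * y)).
      { intros i Ni. unfold pf. destruct (Nat.eq_dec i 0); [lia|]. field. specialize (Pd i). lra. }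
      apply (Rsum_pos _ _ 2%nat); [|lia|].
      * intros i Hi. destruct (Nat.eq_dec i 0) as [->|Ni]; [unfold pf; simpl; lra|]. rewrite Ei by auto.
        pose proof (decr_range i ltac:(lia) Hi). fold b in H. specialize (Hl i Hi).
        apply Rmult_le_pos; [|left; apply Rinv_0_lt_compat, Pd].
        apply Rmult_le_pos; [lra|]. apply Rmult_le_pos; lra.
      * rewrite Ei by lia. assert (t 2%nat < b) by (apply Hd; lia). specialize (Hl 2%nat ltac:(lia)).
        apply Rdiv_lt_0_compat; [|apply Pd]. apply Rmult_lt_0_compat; auto. apply Rmult_lt_0_compat; lra.
    + destruct (Req_dec x a) as [E|N'].
      * exfalso. specialize (Px1 ltac:(lra)).
        assert (0 < P); [|lra]. unfold P.
        assert (Ei : forall i, i <> 0%nat -> len i * pf t x y i =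
           len i * ((t i - x) * y) / ((t i - x) * (t i - x) + y * y)).
        { intros i Ni. unfold pf. destruct (Nat.eq_dec i 0); [lia|]. field. specialize (Pd i). lra. }
        apply (Rsum_pos _ _ 1%nat); [|lia|].
        -- intros i Hi. destruct (Nat.eq_dec i 0) as [->|Ni]; [unfold pf; simpl; lra|]. rewrite Ei by auto.
           pose proof (decr_range i ltac:(lia) Hi). fold a in H. specialize (Hl i Hi).
           apply Rmult_le_pos; [|left; apply Rinv_0_lt_compat, Pd].
           apply Rmult_le_pos; [lra|]. apply Rmult_le_pos; lra.
        -- rewrite Ei by lia. specialize (Hl 1%nat ltac:(lia)). fold b.
           apply Rdiv_lt_0_compat; [|apply Pd]. apply Rmult_lt_0_compat; auto. apply Rmult_lt_0_compat; lra.
      * specialize (Px1 ltac:(lra)). specialize (Px2 ltac:(lra)). lra.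
Qed.

(** Bounded solutions subconverge. A limit with positive second coordinate solves the limit
    equations, so it is the given solution by uniqueness. A limit with second coordinate 0 would
    leave at most one edge with [qf] away from 0, and that edge would be at least half of the
    perimeter. *)
Lemma closes_cv lenk tk xk yk x y M :
  (forall i, (i < n)%nat -> Un_cv (fun k => lenk k i) (len i)) ->
  (forall i, (i < n)%nat -> Un_cv (fun k => tk k i) (t i)) ->
  (forall k i, (i < n)%nat -> 0 < lenk k i) ->
  (forall k, 0 < yk k /\ closes n (lenk k) (tm (tk k) (xk k) (yk k))) ->
  (forall k, Rabs (xk k) <= M /\ yk k <= M) ->
  0 < y -> closes n len (tm t x y) -> Un_cv xk x /\ Un_cv yk y.
Proof.
  intros Cl Ct Lk HC HM Hy Hxy.
  assert (Hboth : forall e, 0 < e -> ev (fun k => Rabs (xk k - x) < e /\ Rabs (yk k - y) < e)).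
  2: { split; apply cv_intro; intros e He; generalize (Hboth e He); apply ev_mono; tauto. }
  intros e He. apply NNPP. intros Hne. destruct (not_ev_extr _ Hne) as [phi [Hphi Hn']].
  destruct (BW_family 2 (fun k i => if Nat.eq_dec i 0 then xk (phi k) else yk (phi k)) M)
    as [psi [Lm [Hpsi HL]]].
  { intros k i _. destruct (HM (phi k)) as [M1 M2]. destruct (HC (phi k)) as [C1 _].
    destruct (Nat.eq_dec i 0); [exact M1|]. apply Rabs_le. lra. }
  assert (C1 := HL 0%nat ltac:(lia)). assert (C2 := HL 1%nat ltac:(lia)). simpl in C1, C2.
  set (xs := Lm 0%nat) in *. set (ys := Lm 1%nat) in *.
  set (s := fun k => phi (psi k)). assert (Hs : extr s) by exact (extr_comp phi psi Hphi Hpsi).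
  change (fun n0 => xk (phi (psi n0))) with (fun k => xk (s k)) in C1.
  change (fun n0 => yk (phi (psi n0))) with (fun k => yk (s k)) in C2.
  assert (Cl' : forall i, (i < n)%nat -> Un_cv (fun k => lenk (s k) i) (len i))
    by (intros i Hi; apply (cv_subseq (fun k => lenk k i) (len i) s Hs); auto).
  assert (Ct' : forall i, (i < n)%nat -> Un_cv (fun k => tk (s k) i) (t i))
    by (intros i Hi; apply (cv_subseq (fun k => tk k i) (t i) s Hs); auto).
  assert (CL : Un_cv (fun k => Rsum n (lenk (s k))) L) by (apply (Rsum_cv n (fun k => lenk (s k)) len); auto).
  assert (Ys : 0 <= ys).
  { apply (cv_le (fun _ => 0) (fun k => yk (s k)) _ _ (cv_const _) C2). intros k. left. apply HC. }
  destruct Ys as [Ys|Ys].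
  - assert (Cq : Un_cv (fun k => Rsum n (fun i => lenk (s k) i * qf (tk (s k)) (xk (s k)) (yk (s k)) i))
       (Rsum n (fun i => len i * qf t xs ys i))).
    { apply (Rsum_cv n (fun k i => lenk (s k) i * qf (tk (s k)) (xk (s k)) (yk (s k)) i)).
      intros i Hi. apply CV_mult; auto. unfold qf. destruct (Nat.eq_dec i 0); [apply cv_const|].
      pose proof (sq_sum_pos (t i - xs) ys Ys). specialize (Ct' i Hi). unfold Rdiv.
      apply CV_mult; [cvt|]. apply (cv_inv (fun k => (tk (s k) i - xk (s k)) * (tk (s k) i - xk (s k)) +
        yk (s k) * yk (s k))); [lra|]. cvt. }
    assert (Cp : Un_cv (fun k => Rsum n (fun i => lenk (s k) i * pf (tk (s k)) (xk (s k)) (yk (s k)) i))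
       (Rsum n (fun i => len i * pf t xs ys i))).
    { apply (Rsum_cv n (fun k i => lenk (s k) i * pf (tk (s k)) (xk (s k)) (yk (s k)) i)).
      intros i Hi. apply CV_mult; auto. unfold pf. destruct (Nat.eq_dec i 0); [apply cv_const|].
      pose proof (sq_sum_pos (t i - xs) ys Ys). specialize (Ct' i Hi). unfold Rdiv.
      apply CV_mult; [cvt|]. apply (cv_inv (fun k => (tk (s k) i - xk (s k)) * (tk (s k) i - xk (s k)) +
        yk (s k) * yk (s k))); [lra|]. cvt. }
    assert (Hcs : closes n len (tm t xs ys)).
    { apply closes_iff; auto. fold L. split.
      - apply (UL_sequence (fun k => Rsum n (lenk (s k)))); auto.
        apply (cv_ext (fun k => 2 * Rsum n (fun i => lenk (s k) i * qf (tk (s k)) (xk (s k)) (yk (s k)) i))).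
        + intros k. destruct (HC (s k)) as [A B]. apply closes_iff in B; auto. destruct B as [B _]. now rewrite B.
        + apply CV_mult; [apply cv_const|exact Cq].
      - apply (UL_sequence (fun k => Rsum n (fun i => lenk (s k) i * pf (tk (s k)) (xk (s k)) (yk (s k)) i))); auto.
        apply (cv_ext (fun _ => 0)); [|apply cv_const].
        intros k. destruct (HC (s k)) as [A B]. apply closes_iff in B; auto. destruct B as [_ B]. now rewrite B. }
    destruct (closes_unique n Hn len t x y xs ys Hl Hd Hy Ys Hxy Hcs) as [-> ->].
    destruct (ev_exists _ (ev_and _ _ (cv_ev _ _ e C1 He) (cv_ev _ _ e C2 He))) as [k Hk].
    apply (Hn' (psi k)). exact Hk.
  - assert (Hj : exists j, (1 <= j)%nat /\ (j < n)%nat /\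
      forall i, (1 <= i)%nat -> (i < n)%nat -> i <> j -> t i <> xs).
    { destruct (classic (exists j, (1 <= j)%nat /\ (j < n)%nat /\ t j = xs)) as [[j [J1 [J2 J3]]]|Hno].
      - exists j. split; auto. split; auto. intros i I1 I2 Nij E.
        destruct (lt_dec i j); [specialize (Hd i j I1 l J2)|specialize (Hd j i J1 ltac:(lia) I2)]; lra.
      - exists 1%nat. split; [lia|]. split; [lia|]. intros i I1 I2 _ E. apply Hno. exists i. auto. }
    destruct Hj as [j [J1 [J2 J3]]].
    set (q := fun k i => qf (tk (s k)) (xk (s k)) (yk (s k)) i).
    (* Upper bound for [q]: the term of [j] is replaced by 1, and all others tend to 0. *)
    set (r := fun k i => if Nat.eq_dec i j then 1 else q k i).
    assert (Cr : Un_cv (fun k => Rsum n (fun i => lenk (s k) i * r k i))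
       (Rsum n (fun i => len i * (if Nat.eq_dec i j then 1 else 0)))).
    { apply (Rsum_cv n (fun k i => lenk (s k) i * r k i)). intros i Hi. apply CV_mult; auto.
      unfold r, q. destruct (Nat.eq_dec i j); [apply cv_const|]. unfold qf.
      destruct (Nat.eq_dec i 0); [apply cv_const|].
      assert (Hne' : t i - xs <> 0) by (specialize (J3 i ltac:(lia) Hi n0); lra).
      apply Rsqr_pos_lt in Hne'. unfold Rsqr in Hne'. specialize (Ct' i Hi).
      replace 0 with (ys * ys * / ((t i - xs) * (t i - xs) + ys * ys)) by (rewrite <- Ys; ring).
      unfold Rdiv. apply CV_mult; [cvt|].
      apply (cv_inv (fun k => (tk (s k) i - xk (s k)) * (tk (s k) i - xk (s k)) +
        yk (s k) * yk (s k))); [rewrite <- Ys; lra|]. cvt. }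
    rewrite (Rsum_single n (fun i => len i * (if Nat.eq_dec i j then 1 else 0)) j) in Cr; auto.
    2: { intros i _ N. destruct (Nat.eq_dec i j); [tauto|ring]. }
    destruct (Nat.eq_dec j j); [|tauto].
    assert (L <= 2 * (len j * 1)); [|specialize (Hineq j J2); lra].
    apply (cv_le (fun k => Rsum n (lenk (s k))) (fun k => 2 * Rsum n (fun i => lenk (s k) i * r k i))); auto.
    + apply CV_mult; [apply cv_const|exact Cr].
    + intros k. destruct (HC (s k)) as [A B]. apply closes_iff in B; auto. destruct B as [B _]. rewrite B.
      apply Rmult_le_compat_l; [lra|]. apply Rsum_le. intros i Hi.
      apply Rmult_le_compat_l; [left; auto|]. unfold r, q. destruct (Nat.eq_dec i j); [|lra].
      unfold qf. destruct (Nat.eq_dec i 0); [lra|].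
      pose proof (sq_sum_pos (tk (s k) i - xk (s k)) (yk (s k)) A) as P.
      pose proof (Rle_0_sqr (tk (s k) i - xk (s k))) as Sq. unfold Rsqr in Sq.
      apply Rmult_le_reg_r with ((tk (s k) i - xk (s k)) * (tk (s k) i - xk (s k)) + yk (s k) * yk (s k)); auto.
      unfold Rdiv. rewrite Rmult_assoc, Rinv_l by lra. lra.
Qed.

End Exists.

(** * Paths of convex polygons *)

Section Path.

Variable n : nat.
Hypothesis Hn : (3 <= n)%nat.
Let G := closed_chain n.
Notation next := (nx n).

Lemma sdir_ext tau tau' i : tau i = tau' i -> sdir tau i = sdir tau' i.
Proof. intros E. unfold sdir. now rewrite E. Qed.

Lemma tm_01 t i : tm t 0 1 i = t i.
Proof. unfold tm. field. Qed.

Lemma closes_tm_01 len tau : closes n len tau -> closes n len (tm tau 0 1).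
Proof.
  intros [H1 H2]. split; [eapply eq_trans; [|exact H1]|eapply eq_trans; [|exact H2]];
    apply Rsum_ext; intros i _; now rewrite (sdir_ext (tm tau 0 1) tau i) by apply tm_01.
Qed.

Lemma stereo_cv u l : Un_cv u l -> ptcv (fun k => stereo (u k)) (stereo l).
Proof.
  intros H. assert (0 < l * l + 1) by nra.
  split; unfold stereo; simpl; unfold Rdiv; apply CV_mult; try cvt;
    (apply (cv_inv (fun k => u k * u k + 1)); [lra|cvt]).
Qed.

(** Start, rotation, lengths and stereographic parameters are interpolated linearly: positive
    lengths, decreasing parameters, the half-perimeter inequality and the tolerances are all convex
    conditions. At both ends the affine map is the identity by uniqueness, so the path joins [C] to
    [C']. *)
Lemma convex_path l e B C C' : adm G l e B C -> adm G l e B C' -> convex n 1 C -> convex n 1 C' ->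
  exists c : R -> nat -> pt, c 0 = C /\ c 1 = C' /\
  (forall t, 0 <= t <= 1 -> adm G l e B (c t) /\ convex n 1 (c t)) /\
  (forall u t, (forall k, 0 <= u k <= 1) -> 0 <= t <= 1 -> Un_cv u t -> confcv G (fun k => c (u k)) (c t)).
Proof.
  intros A A' K K'.
  destruct (convex_walks n Hn C K) as [phi [len [tau [Hd [Hl HW]]]]].
  destruct (convex_walks n Hn C' K') as [phi' [len' [tau' [Hd' [Hl' HW']]]]].
  pose proof (walks_closes n Hn C phi len tau HW) as Hc.
  pose proof (walks_closes n Hn C' phi' len' tau' HW') as Hc'.
  pose proof (closes_ineq n Hn len tau Hl Hd Hc) as Hi.
  pose proof (closes_ineq n Hn len' tau' Hl' Hd' Hc') as Hi'.
  destruct A as [_ [O1 [L1 [X1 Y1]]]]. destruct A' as [_ [O2 [L2 [X2 Y2]]]].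
  set (p := fun t => (fst (C O) + t * (fst (C' O) - fst (C O)), snd (C O) + t * (snd (C' O) - snd (C O))) : pt).
  set (Ls := fun s i => len i + s * (len' i - len i)).
  set (ts := fun s i => tau i + s * (tau' i - tau i)).
  set (ph := fun t => phi + t * (phi' - phi)).
  assert (Mix : forall s a b, 0 <= s <= 1 -> 0 < a -> 0 < b -> 0 < a + s * (b - a)).
  { intros s a b Hs Ha Hb. replace (a + s * (b - a)) with ((1 - s) * a + s * b) by ring.
    destruct (Req_dec s 0) as [->|]; nra. }
  assert (HLs : forall s i, 0 <= s <= 1 -> (i < n)%nat -> 0 < Ls s i) by (intros; apply Mix; auto).
  assert (Hts : forall s, 0 <= s <= 1 -> decr n (ts s)).
  { intros s Hs a b Ha Hab Hb. specialize (Hd a b Ha Hab Hb). specialize (Hd' a b Ha Hab Hb).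
    pose proof (Mix s (tau a - tau b) (tau' a - tau' b) Hs ltac:(lra) ltac:(lra)). unfold ts. lra. }
  assert (Htot : forall s, Rsum n (Ls s) = Rsum n len + s * (Rsum n len' - Rsum n len)).
  { intros s. unfold Ls. rewrite Rsum_plus, Rsum_scal, Rsum_minus. reflexivity. }
  assert (His : forall s i, 0 <= s <= 1 -> (i < n)%nat -> 2 * Ls s i < Rsum n (Ls s)).
  { intros s i Hs Hin. rewrite Htot. specialize (Hi i Hin). specialize (Hi' i Hin).
    pose proof (Mix s (Rsum n len - 2 * len i) (Rsum n len' - 2 * len' i) Hs ltac:(lra) ltac:(lra)).
    unfold Ls. lra. }
  assert (Hsol : forall s, exists xy : R * R, 0 <= s <= 1 ->
     0 < snd xy /\ closes n (Ls s) (tm (ts s) (fst xy) (snd xy))).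
  { intros s. destruct (classic (0 <= s <= 1)) as [Hs|Hs]; [|exists (0, 0); tauto].
    destruct (closes_exists n Hn (Ls s) (ts s)) as [x [y [Hy Hxy]]]; auto.
    exists (x, y). auto. }
  destruct (choice _ _ _ Hsol) as [sol Hsol'].
  set (dirs := fun s i => rot (ph s) (sdir (tm (ts s) (fst (sol s)) (snd (sol s))) i)).
  set (c := fun s i => if lt_dec i n then trace (p s) (Ls s) (dirs s) i else (0, 0)).
  assert (Hend : forall s (D : nat -> pt) dphi dlen dtau, 0 <= s <= 1 ->
     (forall i, (n <= i)%nat -> D i = (0, 0)) -> walks n D dphi dlen dtau -> decr n dtau ->
     (forall i, (i < n)%nat -> 0 < dlen i) ->
     p s = D O -> ph s = dphi -> (forall i, Ls s i = dlen i) -> (forall i, ts s i = dtau i) -> c s = D).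
  { intros s D dphi dlen dtau Hs HO HWd Hdd Hld E1 E2 E3 E4.
    pose proof (walks_closes n Hn D dphi dlen dtau HWd) as HcD.
    destruct (Hsol' s Hs) as [S1 S2].
    assert (Et : ts s = dtau) by (apply FunctionalExtensionality.functional_extensionality; auto).
    assert (El : Ls s = dlen) by (apply FunctionalExtensionality.functional_extensionality; auto).
    rewrite Et, El in S2.
    destruct (closes_unique n Hn dlen dtau 0 1 (fst (sol s)) (snd (sol s)) Hld Hdd ltac:(lra) S1
      (closes_tm_01 _ _ HcD) S2) as [Ex Ey].
    apply FunctionalExtensionality.functional_extensionality. intros i. unfold c.
    destruct (lt_dec i n) as [Hin|Hin]; [|rewrite HO; auto; lia].
    rewrite (walks_trace n Hn D dphi dlen dtau HWd i Hin), E1, El.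
    unfold dirs. rewrite E2, Et, <- Ex, <- Ey. unfold trace.
    f_equal; f_equal; apply Rsum_ext; intros j _; now rewrite (sdir_ext _ dtau j) by apply tm_01. }
  assert (Hwk : forall s, 0 <= s <= 1 -> walks n (c s) (ph s) (Ls s) (tm (ts s) (fst (sol s)) (snd (sol s)))).
  { intros s Hs. destruct (Hsol' s Hs) as [S1 S2]. apply (trace_walks n Hn (p s)); auto.
    intros i Hin. unfold c. destruct (lt_dec i n); [reflexivity|lia]. }
  assert (Hcv : forall s, 0 <= s <= 1 -> convex n 1 (c s)).
  { intros s Hs. destruct (Hsol' s Hs) as [S1 S2].
    apply (walks_convex n Hn (c s) (ph s) (Ls s) (tm (ts s) (fst (sol s)) (snd (sol s)))); auto.
    apply decr_tm; auto. }
  assert (Hlen : forall (D : nat -> pt) dphi dlen dtau k, (k < n)%nat -> walks n D dphi dlen dtau ->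
     0 < dlen k -> dist (D k) (D (tgt G k)) = dlen k).
  { intros D dphi dlen dtau k Hk HWd Hdk. unfold G. rewrite (tgt_nx n Hn) by auto. rewrite (HWd k Hk).
    apply dist_dir; [lra|]. apply rot_unit, sdir_unit. }
  exists c. split; [|split; [|split]].
  - apply (Hend 0 C phi len tau); auto; try lra.
    + unfold p. apply pt_eq; simpl; ring.
    + unfold ph. ring.
    + intros. unfold Ls. ring.
    + intros. unfold ts. ring.
  - apply (Hend 1 C' phi' len' tau'); auto; try lra.
    + unfold p. apply pt_eq; simpl; ring.
    + unfold ph. ring.
    + intros. unfold Ls. ring.
    + intros. unfold ts. ring.
  - intros s Hs. split; [|auto]. split; [apply (convex_simple n Hn 1); auto|]. split; [|split].
    + intros i Hin. unfold c. change (n <= i)%nat in Hin. destruct (lt_dec i n); [lia|auto].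
    + intros k Hk. change (k < n)%nat in Hk. change (src G k) with k.
      rewrite (Hlen (c s) _ _ _ k Hk (Hwk s Hs)) by auto.
      specialize (L1 k Hk). specialize (L2 k Hk). change (src G k) with k in L1, L2.
      rewrite (Hlen C _ _ _ k Hk HW) in L1 by auto. rewrite (Hlen C' _ _ _ k Hk HW') in L2 by auto.
      unfold Ls. apply Rabs_le. apply Rabs_le_inv in L1. apply Rabs_le_inv in L2. split; nra.
    + unfold c. destruct (lt_dec 0 n); [|lia]. rewrite trace_0. unfold p. simpl.
      apply Rabs_le_inv in X1. apply Rabs_le_inv in X2. apply Rabs_le_inv in Y1. apply Rabs_le_inv in Y2.
      split; apply Rabs_le; split; nra.
  - intros u t Hu Ht Hut.
    destruct (finite_max n (fun i => Rabs (tau i) + Rabs (tau' i))) as [T [HT0 HT]].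
    set (g := Rmin (Rsum n len - 2 * len O) (Rsum n len' - 2 * len' O)).
    assert (Hg : 0 < g).
    { specialize (Hi O ltac:(lia)). specialize (Hi' O ltac:(lia)). apply Rmin_glb_lt; lra. }
    set (Lm := Rsum n len + Rsum n len').
    (* Bounds uniform in [s], as [closes_cv] requires; [g] is the smaller of the two half-perimeter
       gaps at the first edge. *)
    assert (Hbd : forall s, 0 <= s <= 1 -> Rabs (fst (sol s)) <= T + (1 + 4 * (T * T) * Lm / g) /\
       snd (sol s) <= T + (1 + 4 * (T * T) * Lm / g)).
    { intros s Hs. destruct (Hsol' s Hs) as [S1 S2].
      destruct (closes_bounds n Hn (Ls s) (ts s) (fst (sol s)) (snd (sol s)) T) as [B1 B2]; auto.
      { intros i _ Hin. specialize (HT i Hin). unfold ts.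
        pose proof (Rabs_pos (tau i)). pose proof (Rabs_pos (tau' i)).
        pose proof (Rabs_le_inv (tau i) (Rabs (tau i)) ltac:(lra)).
        pose proof (Rabs_le_inv (tau' i) (Rabs (tau' i)) ltac:(lra)).
        apply Rabs_le. split; nra. }
      assert (HL1 : 0 < Rsum n len) by (specialize (Hi O ltac:(lia)); specialize (Hl O ltac:(lia)); lra).
      assert (HL2 : 0 < Rsum n len') by (specialize (Hi' O ltac:(lia)); specialize (Hl' O ltac:(lia)); lra).
      assert (HLm : Rsum n (Ls s) <= Lm) by (rewrite Htot; unfold Lm; nra).
      assert (Hgs : g <= Rsum n (Ls s) - 2 * Ls s O).
      { assert (G1 : g <= Rsum n len - 2 * len O) by apply Rmin_l.
        assert (G2 : g <= Rsum n len' - 2 * len' O) by apply Rmin_r.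
        rewrite Htot. unfold Ls.
        assert (0 <= (1 - s) * ((Rsum n len - 2 * len O) - g)) by (apply Rmult_le_pos; lra).
        assert (0 <= s * ((Rsum n len' - 2 * len' O) - g)) by (apply Rmult_le_pos; lra). lra. }
      assert (TT : 0 <= 4 * (T * T)) by nra.
      assert (Hq : 0 <= 4 * (T * T) * Lm / g).
      { apply Rmult_le_pos; [apply Rmult_le_pos; unfold Lm; lra|]. left. now apply Rinv_0_lt_compat. }
      split; [lra|].
      set (y := snd (sol s)) in *.
      assert (Y : g * (y * y) <= 4 * (T * T) * Lm).
      { apply Rle_trans with ((Rsum n (Ls s) - 2 * Ls s O) * (y * y)).
        - apply Rmult_le_compat_r; nra.
        - eapply Rle_trans; [exact B2|]. apply Rmult_le_compat_l; auto. }
      assert (Y' : y * y <= 4 * (T * T) * Lm / g).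
      { apply Rmult_le_reg_l with g; auto.
        replace (g * (4 * (T * T) * Lm / g)) with (4 * (T * T) * Lm) by (field; lra). exact Y. }
      destruct (Rle_dec y 1); [lra|]. assert (y <= y * y) by nra. lra. }
    destruct (Hsol' t Ht) as [T1 T2].
    destruct (closes_cv n Hn (Ls t) (ts t) ltac:(auto) ltac:(auto) ltac:(auto)
      (fun k => Ls (u k)) (fun k => ts (u k)) (fun k => fst (sol (u k))) (fun k => snd (sol (u k)))
      (fst (sol t)) (snd (sol t)) (T + (1 + 4 * (T * T) * Lm / g))) as [Cx Cy]; auto.
    + intros i _. unfold Ls. cvt.
    + intros i _. unfold ts. cvt.
    + intros i Hin. change (i < n)%nat in Hin. unfold c. destruct (lt_dec i n); [|lia].
      apply (trace_cv (fun k => p (u k)) (fun k => Ls (u k)) (fun k => dirs (u k))).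
      * split; unfold p; simpl; cvt.
      * intros j _. unfold Ls. cvt.
      * intros j _. unfold dirs.
        assert (Cph : Un_cv (fun k => ph (u k)) (ph t)) by (unfold ph; cvt).
        pose proof (cv_cos _ _ Cph) as Cc. pose proof (cv_sin _ _ Cph) as Cs.
        assert (CS : ptcv (fun k => sdir (tm (ts (u k)) (fst (sol (u k))) (snd (sol (u k)))) j)
          (sdir (tm (ts t) (fst (sol t)) (snd (sol t))) j)).
        { unfold sdir. destruct (Nat.eq_dec j 0); [split; apply cv_const|].
          apply (stereo_cv (fun k => tm (ts (u k)) (fst (sol (u k))) (snd (sol (u k))) j)).
          unfold tm, Rdiv. apply CV_mult; [unfold ts; cvt|].
          apply (cv_inv (fun k => snd (sol (u k)))); [lra|exact Cy]. }
        destruct CS as [CS1 CS2]. split; unfold rot; simpl; cvt.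
Qed.

(** Reflection exchanges the orientations and preserves lengths, which reduces clockwise polygons to
    counterclockwise ones. *)
Definition mirror (C : nat -> pt) (i : nat) : pt := (fst (C i), - snd (C i)).

Lemma mirror_mirror C : mirror (mirror C) = C.
Proof.
  apply FunctionalExtensionality.functional_extensionality. intros i. unfold mirror.
  apply pt_eq; simpl; ring.
Qed.

Lemma convex_mirror C : convex n (-1) C -> convex n 1 (mirror C).
Proof.
  intros H v j Hv Hj N1 N2. specialize (H v j Hv Hj N1 N2).
  unfold orient, mirror in *. simpl in *. lra.
Qed.

Lemma mirror_convex C : convex n 1 C -> convex n (-1) (mirror C).
Proof.
  intros H v j Hv Hj N1 N2. specialize (H v j Hv Hj N1 N2).
  unfold orient, mirror in *. simpl in *. lra.
Qed.

Lemma dist_mirror C i j : dist (mirror C i) (mirror C j) = dist (C i) (C j).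
Proof. unfold dist, mirror. simpl. f_equal. ring. Qed.

Lemma adm_mirror l e B C : simple_conf G (mirror C) -> adm G l e B C -> adm G l e B (mirror C).
Proof.
  intros HS [_ [HO [HL [HX HY]]]]. split; auto. split; [|split].
  - intros i Hi. unfold mirror. rewrite HO by auto. apply pt_eq; simpl; ring.
  - intros k Hk. rewrite dist_mirror. auto.
  - unfold mirror. simpl. rewrite Rabs_Ropp. auto.
Qed.

Lemma convex_chain sg l e B C C' : 0 < e -> sg = 1 \/ sg = -1 -> adm G l e B C -> adm G l e B C' ->
  convex n sg C -> convex n sg C' -> chain G l e B C C'.
Proof.
  intros He Hsg A A' K K'. destruct Hsg as [-> | ->].
  - destruct (convex_path l e B C C' A A' K K') as [c [<- [<- [H1 H2]]]].
    apply path_chain; auto; [apply (closed_good n Hn)|]. intros t Ht. now apply H1.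
  - pose proof (convex_mirror C K) as M. pose proof (convex_mirror C' K') as M'.
    destruct (convex_path l e B (mirror C) (mirror C')) as [c [E0 [E1 [H1 H2]]]]; auto.
    { apply adm_mirror; auto. now apply (convex_simple n Hn 1). }
    { apply adm_mirror; auto. now apply (convex_simple n Hn 1). }
    rewrite <- (mirror_mirror C), <- (mirror_mirror C'), <- E0, <- E1.
    apply (path_chain G l e B (fun t => mirror (c t))); auto; [apply (closed_good n Hn)| |].
    + intros t Ht. destruct (H1 t Ht) as [P1 P2]. apply adm_mirror; auto.
      apply (convex_simple n Hn (-1)). now apply mirror_convex.
    + intros u t Hu Ht Hut i Hi. destruct (H2 u t Hu Ht Hut i Hi) as [Q1 Q2].
      split; simpl; [exact Q1|]. now apply CV_opp.
Qed.

End Path.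

(** * Splitting merged vertices *)

Definition ends (G : lgraph) (k a b : nat) : Prop :=
  (src G k = a /\ tgt G k = b) \/ (src G k = b /\ tgt G k = a).

Definition merged (G : lgraph) (C : nat -> pt) : relation nat :=
  clos_refl_trans nat (fun v w => exists k, (k < nE G)%nat /\ C (src G k) = C (tgt G k) /\ ends G k v w).

(** [nontouching] read off the configuration alone, with its own zero bars in place of a length
    function. *)
Definition tidy (G : lgraph) (C : nat -> pt) : Prop :=
  touch_at_ends G C /\
  forall v w, (v < nV G)%nat -> (w < nV G)%nat -> C v = C w -> merged G C v w.

Lemma nontouching_tidy G l C : Conf0 G l C -> nontouching G l C -> tidy G C.
Proof.
  intros [_ HL] [H1 H2]. split; [exact H1|].
  intros v w Hv Hw E. apply H2 in E; auto. clear Hv Hw.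
  induction E as [x y [k [Hk [Hl H]]]|x|x y z _ IH1 _ IH2].
  - apply rt_step. exists k. split; auto. split; [|exact H]. apply dist_eq0. rewrite HL; auto.
  - apply rt_refl.
  - eapply rt_trans; eauto.
Qed.

Lemma tidy_simple G C : good_graph G -> tidy G C ->
  (forall k, (k < nE G)%nat -> C (src G k) <> C (tgt G k)) -> simple_conf G C.
Proof.
  intros HG [HT HM] Hne.
  assert (Hinj : forall v w, (v < nV G)%nat -> (w < nV G)%nat -> C v = C w -> v = w).
  { intros v w Hv Hw E. apply HM in E; auto. clear Hv Hw.
    induction E as [x y [k [Hk [El _]]]|x|x y z _ IH1 _ IH2]; auto; [|congruence].
    exfalso. now apply (Hne k). }
  split; [auto|split].
  - intros k v Hk Hv N1 N2 Ho.
    destruct (g_inc G HG v Hv) as [E|[m [Hm Hi]]].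
    { pose proof (g_src G HG k Hk). pose proof (g_tgt G HG k Hk). lia. }
    assert (Nkm : k <> m) by (intros ->; destruct Hi; congruence).
    destruct (HT k m Hk Hm Nkm (C v) Ho) as [[E|E] _].
    { destruct Hi as [<-|<-]; [apply on_seg_src|apply on_seg_tgt]. }
    + apply Hinj in E; auto using g_src.
    + apply Hinj in E; auto using g_tgt.
  - intros k m Hk Hm Hp. assert (Nkm : k <> m).
    { intros ->. destruct Hp as [Q _]. unfold orient in Q. lra. }
    destruct (proper_cross_meet _ _ _ _ Hp) as [t [s [Ht [Hs [X Y]]]]].
    set (a := C (src G k)) in *. set (b := C (tgt G k)) in *.
    assert (Hab : a <> b) by now apply Hne.
    destruct (HT k m Hk Hm Nkm (fst a + t * (fst b - fst a), snd a + t * (snd b - snd a))) as [[E|E] _].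
    + exists t. split; [lra|auto].
    + exists s. split; [lra|]. now rewrite X, Y.
    + fold a in E. assert (E1 := f_equal fst E). assert (E2 := f_equal snd E). simpl in E1, E2.
      destruct (pt_neq _ _ Hab) as [F|F]; apply F.
      * assert (t * (fst b - fst a) = 0) by lra. apply Rmult_integral in H. lra.
      * assert (t * (snd b - snd a) = 0) by lra. apply Rmult_integral in H. lra.
    + fold b in E. assert (E1 := f_equal fst E). assert (E2 := f_equal snd E). simpl in E1, E2.
      destruct (pt_neq _ _ Hab) as [F|F]; apply F.
      * assert ((1 - t) * (fst b - fst a) = 0) by lra. apply Rmult_integral in H. lra.
      * assert ((1 - t) * (snd b - snd a) = 0) by lra. apply Rmult_integral in H. lra.
Qed.

Definition along (P Q : pt) (s : R) : pt := (fst P + s * (fst Q - fst P), snd P + s * (snd Q - snd P)).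

Lemma along_inj P Q s t : P <> Q -> along P Q s = along P Q t -> s = t.
Proof.
  intros H E. assert (E1 := f_equal fst E). assert (E2 := f_equal snd E). simpl in E1, E2.
  destruct (pt_neq P Q H) as [D|D].
  - apply Rmult_eq_reg_r with (fst Q - fst P); lra.
  - apply Rmult_eq_reg_r with (snd Q - snd P); lra.
Qed.

Lemma along_0 P Q : along P Q 0 = P.
Proof. apply pt_eq; simpl; ring. Qed.
Lemma along_1 P Q : along P Q 1 = Q.
Proof. apply pt_eq; simpl; ring. Qed.

Lemma on_seg_along P Q a b z : a <= b -> on_seg (along P Q a) (along P Q b) z ->
  exists s, a <= s <= b /\ z = along P Q s.
Proof.
  intros H [t [Ht ->]]. exists (a + t * (b - a)). split; [split; nra|]. apply pt_eq; simpl; ring.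
Qed.

Section Unmerge.

Variable G : lgraph.
Hypothesis HG : good_graph G.
Variable C : nat -> pt.
Hypothesis HC : tidy G C.
Variables k k' u v w : nat.
Hypothesis Hk : (k < nE G)%nat.
Hypothesis Hk' : (k' < nE G)%nat.
Hypothesis Hkk : k <> k'.
Hypothesis Ek : ends G k u v.
Hypothesis Ek' : ends G k' v w.
Hypothesis Honly : forall m, (m < nE G)%nat -> src G m = v \/ tgt G m = v -> m = k \/ m = k'.
Hypothesis Huv : C u = C v.
Hypothesis Hvw : C v <> C w.
Variable tau : R.
Hypothesis Htau : 0 < tau < 1.

(* Vertex [v], merged with [u], slides a little along the nondegenerate edge [k'] towards [w]. *)
Definition slide (i : nat) : pt := if Nat.eq_dec i v then along (C v) (C w) tau else C i.

Lemma slide_v : slide v = along (C v) (C w) tau.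
Proof. unfold slide. destruct (Nat.eq_dec v v); tauto. Qed.

Lemma slide_other i : i <> v -> slide i = C i.
Proof. intros. unfold slide. destruct (Nat.eq_dec i v); tauto. Qed.

Lemma u_neq_v : u <> v.
Proof. pose proof (g_ne G HG k Hk). destruct Ek as [[A B]|[A B]]; congruence. Qed.
Lemma w_neq_v : w <> v.
Proof. pose proof (g_ne G HG k' Hk'). destruct Ek' as [[A B]|[A B]]; congruence. Qed.

Lemma slide_edge m : (m < nE G)%nat -> m <> k -> m <> k' ->
  slide (src G m) = C (src G m) /\ slide (tgt G m) = C (tgt G m).
Proof.
  intros Hm N1 N2. split; apply slide_other; intros E; destruct (Honly m Hm); auto.
Qed.

Lemma slide_k z : on_seg (slide (src G k)) (slide (tgt G k)) z ->
  exists s, 0 <= s <= tau /\ z = along (C v) (C w) s.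
Proof.
  intros H. assert (H' : on_seg (slide u) (slide v) z).
  { destruct Ek as [[A B]|[A B]]; rewrite A, B in H; auto. now apply on_seg_sym. }
  rewrite slide_v, slide_other, Huv in H' by apply u_neq_v.
  rewrite <- (along_0 (C v) (C w)) in H' at 1. apply on_seg_along in H'; auto. lra.
Qed.

Lemma slide_k' z : on_seg (slide (src G k')) (slide (tgt G k')) z ->
  exists s, tau <= s <= 1 /\ z = along (C v) (C w) s.
Proof.
  intros H. assert (H' : on_seg (slide v) (slide w) z).
  { destruct Ek' as [[A B]|[A B]]; rewrite A, B in H; auto. now apply on_seg_sym. }
  rewrite slide_v, (slide_other w) in H' by apply w_neq_v.
  rewrite <- (along_1 (C v) (C w)) in H' at 2. apply on_seg_along in H'; auto. lra.
Qed.

Lemma old_k' s : 0 <= s <= 1 -> on_seg (C (src G k')) (C (tgt G k')) (along (C v) (C w) s).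
Proof.
  intros Hs. assert (on_seg (C v) (C w) (along (C v) (C w) s)) by now exists s.
  destruct Ek' as [[A B]|[A B]]; rewrite A, B; auto. now apply on_seg_sym.
Qed.

Lemma end_k' z : z = C (src G k') \/ z = C (tgt G k') -> z = C v \/ z = C w.
Proof. destruct Ek' as [[A B]|[A B]]; rewrite A, B; tauto. Qed.

Lemma is_end_k z : z = C v \/ z = slide v -> z = slide (src G k) \/ z = slide (tgt G k).
Proof.
  rewrite <- Huv, <- (slide_other u) by apply u_neq_v.
  destruct Ek as [[A B]|[A B]]; rewrite A, B; tauto.
Qed.

Lemma is_end_k' z : z = C w \/ z = slide v -> z = slide (src G k') \/ z = slide (tgt G k').
Proof.
  rewrite <- (slide_other w) by apply w_neq_v.
  destruct Ek' as [[A B]|[A B]]; rewrite A, B; tauto.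
Qed.

(** Together the new bars [k] and [k'] cover the old [k'], so contacts with other bars come from old
    contacts, and the two meet each other only at the new position of [v]. *)
Lemma slide_touch m1 m2 z : (m1 < nE G)%nat -> (m2 < nE G)%nat -> m1 <> m2 ->
  on_seg (slide (src G m1)) (slide (tgt G m1)) z -> on_seg (slide (src G m2)) (slide (tgt G m2)) z ->
  z = slide (src G m1) \/ z = slide (tgt G m1).
Proof.
  intros H1 H2 N Z1 Z2. destruct HC as [HT _].
  destruct (Nat.eq_dec m1 k) as [->|N1]; [|destruct (Nat.eq_dec m1 k') as [->|N1']].
  - destruct (slide_k z Z1) as [s [Hs Es]].
    destruct (Nat.eq_dec m2 k') as [->|N2].
    + destruct (slide_k' z Z2) as [s' [Hs' Es']].
      assert (s = s') by (apply (along_inj (C v) (C w)); auto; congruence).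
      apply is_end_k. right. rewrite slide_v, Es. f_equal. lra.
    + destruct (slide_edge m2 H2 ltac:(auto) N2) as [S1 S2]. rewrite S1, S2 in Z2.
      assert (Z1' : on_seg (C (src G k')) (C (tgt G k')) z) by (rewrite Es; apply old_k'; lra).
      destruct (HT k' m2 Hk' H2 (not_eq_sym N2) z Z1' Z2) as [E _]. apply end_k' in E.
      destruct E as [E|E]; [apply is_end_k; auto|]. exfalso.
      assert (s = 1); [|lra]. apply (along_inj (C v) (C w)); auto. rewrite along_1. congruence.
  - destruct (slide_k' z Z1) as [s [Hs Es]].
    destruct (Nat.eq_dec m2 k) as [->|N2].
    + destruct (slide_k z Z2) as [s' [Hs' Es']].
      assert (s = s') by (apply (along_inj (C v) (C w)); auto; congruence).
      apply is_end_k'. right. rewrite slide_v, Es. f_equal. lra.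
    + destruct (slide_edge m2 H2 N2 ltac:(auto)) as [S1 S2]. rewrite S1, S2 in Z2.
      assert (Z1' : on_seg (C (src G k')) (C (tgt G k')) z) by (rewrite Es; apply old_k'; lra).
      destruct (HT k' m2 Hk' H2 N z Z1' Z2) as [E _]. apply end_k' in E.
      destruct E as [E|E]; [|apply is_end_k'; auto]. exfalso.
      assert (s = 0); [|lra]. apply (along_inj (C v) (C w)); auto. rewrite along_0. congruence.
  - destruct (slide_edge m1 H1 N1 N1') as [S1 S2]. rewrite S1, S2 in *.
    assert (Hold : forall s, 0 <= s <= 1 -> z = along (C v) (C w) s -> z = C (src G m1) \/ z = C (tgt G m1)).
    { intros s Hs Es. apply (HT m1 k' H1 Hk' N1' z Z1). rewrite Es. now apply old_k'. }
    destruct (Nat.eq_dec m2 k) as [->|N2]; [|destruct (Nat.eq_dec m2 k') as [->|N2']].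
    + destruct (slide_k z Z2) as [s [Hs Es]]. apply (Hold s); auto; lra.
    + destruct (slide_k' z Z2) as [s [Hs Es]]. apply (Hold s); auto; lra.
    + destruct (slide_edge m2 H2 N2 N2') as [S3 S4]. rewrite S3, S4 in Z2.
      now apply (HT m1 m2 H1 H2 N z).
Qed.

Lemma ends_lt m a b : (m < nE G)%nat -> ends G m a b -> (a < nV G)%nat /\ (b < nV G)%nat.
Proof.
  intros Hm H. pose proof (g_src G HG m Hm). pose proof (g_tgt G HG m Hm).
  destruct H as [[<- <-]|[<- <-]]; auto.
Qed.

(** The new position is interior to the old bar [k'], where no vertex lies since bars meet only at
    ends. *)
Lemma slide_new b : (b < nV G)%nat -> b <> v -> slide v <> slide b.
Proof.
  intros Hb N E. rewrite slide_v, (slide_other b N) in E. destruct HC as [HT _].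
  destruct (ends_lt k u v Hk Ek) as [Lu Lv].
  assert (E0 : along (C v) (C w) tau = C v \/ along (C v) (C w) tau = C w -> False).
  { intros [F|F].
    - assert (tau = 0); [|lra]. apply (along_inj (C v) (C w)); auto. now rewrite along_0.
    - assert (tau = 1); [|lra]. apply (along_inj (C v) (C w)); auto. now rewrite along_1. }
  destruct (g_inc G HG b Hb) as [F|[m [Hm Hi]]].
  { pose proof u_neq_v. lia. }
  destruct (Nat.eq_dec m k') as [->|Nm].
  - apply E0. right. rewrite E. destruct Ek' as [[A B]|[A B]], Hi as [F|F]; congruence.
  - destruct (HT k' m Hk' Hm (not_eq_sym Nm) (C b)) as [F _].
    + rewrite <- E. apply old_k'. lra.
    + destruct Hi as [<-|<-]; [apply on_seg_src|apply on_seg_tgt].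
    + apply end_k' in F. apply E0. rewrite E. tauto.
Qed.

(** Paths of zero bars survive when [v] is replaced by [u]: the bar [k] becomes a trivial step, and
    no other zero bar ends at [v]. *)
Lemma slide_merged a b : merged G C a b ->
  merged G slide (if Nat.eq_dec a v then u else a) (if Nat.eq_dec b v then u else b).
Proof.
  intros H. induction H as [x y [m [Hm [El He]]]|x|x y z _ IH1 _ IH2].
  - destruct (Nat.eq_dec m k) as [->|N1].
    + pose proof u_neq_v.
      assert (Exy : (x = u /\ y = v) \/ (x = v /\ y = u)).
      { destruct Ek as [[A B]|[A B]], He as [[A' B']|[A' B']]; rewrite A, B in *; subst; tauto. }
      destruct Exy as [[-> ->]|[-> ->]]; destruct (Nat.eq_dec u v), (Nat.eq_dec v v);
        try tauto; apply rt_refl.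
    + destruct (Nat.eq_dec m k') as [->|N2].
      { exfalso. destruct Ek' as [[A B]|[A B]]; rewrite A, B in El; congruence. }
      assert (Nv : src G m <> v /\ tgt G m <> v) by (split; intros F; destruct (Honly m Hm); auto).
      destruct (slide_edge m Hm N1 N2) as [S1 S2].
      destruct He as [[A B]|[A B]]; rewrite A, B in Nv; destruct (Nat.eq_dec x v), (Nat.eq_dec y v);
        try tauto; apply rt_step; exists m; (split; [auto|]); (split; [congruence|]);
        [left|right]; auto.
  - apply rt_refl.
  - eapply rt_trans; eauto.
Qed.

Lemma slide_tidy : tidy G slide.
Proof.
  split.
  - intros m1 m2 H1 H2 N z Z1 Z2. split.
    + apply (slide_touch m1 m2); auto.
    + apply (slide_touch m2 m1); auto.
  - intros a b Ha Hb E. destruct (Nat.eq_dec a b) as [->|N]; [apply rt_refl|].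
    destruct (Nat.eq_dec a v) as [->|Na]; [exfalso; now apply (slide_new b)|].
    destruct (Nat.eq_dec b v) as [->|Nb]; [exfalso; now apply (slide_new a)|].
    rewrite (slide_other a), (slide_other b) in E by auto.
    destruct HC as [_ HM]. apply HM in E; auto. apply slide_merged in E.
    destruct (Nat.eq_dec a v), (Nat.eq_dec b v); tauto.
Qed.

Lemma slide_k_nonzero : slide (src G k) <> slide (tgt G k).
Proof.
  destruct (ends_lt k u v Hk Ek) as [Lu Lv]. pose proof (slide_new u Lu u_neq_v).
  destruct Ek as [[A B]|[A B]]; rewrite A, B; congruence.
Qed.

Lemma slide_zero m : (m < nE G)%nat -> slide (src G m) = slide (tgt G m) -> C (src G m) = C (tgt G m).
Proof.
  intros Hm E. destruct (Nat.eq_dec m k) as [->|N1].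
  - destruct Ek as [[A B]|[A B]]; rewrite A, B; congruence.
  - destruct (Nat.eq_dec m k') as [->|N2].
    + exfalso. destruct (ends_lt k' v w Hk' Ek') as [Lv Lw]. pose proof (slide_new w Lw w_neq_v).
      destruct Ek' as [[A B]|[A B]]; rewrite A, B in E; congruence.
    + destruct (slide_edge m Hm N1 N2) as [S1 S2]. congruence.
Qed.

End Unmerge.

(** Number of zero bars, the measure of the induction that splits merged vertices. *)
Definition zeros (G : lgraph) (C : nat -> pt) (n : nat) : nat :=
  length (List.filter (fun k => if excluded_middle_informative (C (src G k) = C (tgt G k))
    then true else false) (List.seq 0 n)).

Lemma zeros_S G C n : zeros G C (S n) =
  (zeros G C n + if excluded_middle_informative (C (src G n) = C (tgt G n)) then 1 else 0)%nat.
Proof.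
  unfold zeros. rewrite List.seq_S, List.filter_app, List.length_app. simpl.
  destruct (excluded_middle_informative (C (src G n) = C (tgt G n))); reflexivity.
Qed.

Lemma zeros_le G C C' n :
  (forall m, (m < n)%nat -> C' (src G m) = C' (tgt G m) -> C (src G m) = C (tgt G m)) ->
  (zeros G C' n <= zeros G C n)%nat /\
  ((exists k, (k < n)%nat /\ C (src G k) = C (tgt G k) /\ C' (src G k) <> C' (tgt G k)) ->
    zeros G C' n < zeros G C n)%nat.
Proof.
  induction n as [|n IH]; intros H.
  - split; [auto|]. intros [k [Hk _]]. lia.
  - destruct IH as [I1 I2]; [intros; apply H; auto; lia|]. rewrite !zeros_S.
    specialize (H n ltac:(lia)). split.
    + destruct (excluded_middle_informative (C (src G n) = C (tgt G n))),
        (excluded_middle_informative (C' (src G n) = C' (tgt G n))); tauto || lia.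
    + intros [k [Hk [A B]]]. destruct (Nat.eq_dec k n) as [->|N].
      * destruct (excluded_middle_informative (C (src G n) = C (tgt G n))),
          (excluded_middle_informative (C' (src G n) = C' (tgt G n))); tauto || lia.
      * assert (zeros G C' n < zeros G C n)%nat by (apply I2; exists k; split; [lia|auto]).
        destruct (excluded_middle_informative (C (src G n) = C (tgt G n))),
          (excluded_middle_informative (C' (src G n) = C' (tgt G n))); tauto || lia.
Qed.

Definition approximable (G : lgraph) : Prop :=
  forall C, tidy G C -> (forall i, (nV G <= i)%nat -> C i = (0, 0)) -> forall e, 0 < e ->
  exists D, simple_conf G D /\ (forall i, (nV G <= i)%nat -> D i = (0, 0)) /\
    near G e (Annot G D) (Annot G C).

(** The situation of [slide]: a zero bar next to a nonzero bar at a vertex without further bars. *)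
Definition has_joint (G : lgraph) : Prop := forall C : nat -> pt,
  (exists k, (k < nE G)%nat /\ C (src G k) = C (tgt G k)) ->
  (exists k, (k < nE G)%nat /\ C (src G k) <> C (tgt G k)) ->
  exists k k' u v w, (k < nE G)%nat /\ (k' < nE G)%nat /\ k <> k' /\ ends G k u v /\ ends G k' v w /\
    (forall m, (m < nE G)%nat -> src G m = v \/ tgt G m = v -> m = k \/ m = k') /\
    C u = C v /\ C v <> C w.

(** The index is shifted because [slide] needs a parameter strictly below 1. *)
Lemma tau_seq n : 0 < / INR (S (S n)) < 1.
Proof.
  assert (0 < INR (S n)) by (apply lt_0_INR; lia). rewrite (S_INR (S n)). split.
  - apply Rinv_0_lt_compat. lra.
  - rewrite <- Rinv_1. apply Rinv_lt_contravar; lra.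
Qed.

Lemma tau_seq_cv : Un_cv (fun n => / INR (S (S n))) 0.
Proof. apply (cv_subseq (fun n => / INR (S n)) 0 S); [intros n; lia|apply cv_inv_S]. Qed.

(** Each slide removes a zero bar at the cost of half of the remaining error. If all bars are zero,
    the whole chain sits at one point and is replaced by a small parabola. *)
Lemma unmerge_approximable G : good_graph G -> has_joint G ->
  (forall p tau, 0 < tau -> simple_conf G
     (fun i => (fst p + tau * INR i, snd p + tau * (INR i * INR i)))) ->
  approximable G.
Proof.
  intros HG HJ HS C. remember (zeros G C (nE G)) as z eqn:Ez. revert C Ez.
  induction z as [z IH] using (well_founded_induction lt_wf). intros C Ez HC HO e He.
  destruct (classic (exists k, (k < nE G)%nat /\ C (src G k) = C (tgt G k))) as [Hz|Hz].
  2: { exists C. split; [|split; auto].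
       - apply tidy_simple; auto. intros k Hk E. apply Hz. exists k. auto.
       - split; intros; [split|]; rewrite Rminus_diag, Rabs_R0; auto. }
  destruct (classic (exists k, (k < nE G)%nat /\ C (src G k) <> C (tgt G k))) as [Hnz|Hnz].
  - destruct (HJ C Hz Hnz) as [k [k' [u [v [w [Hk [Hk' [Hkk [Ek [Ek' [Ho [Huv Hvw]]]]]]]]]]]].
    set (D := fun n => slide C v w (/ INR (S (S n)))).
    assert (Hcv : confcv G D C).
    { intros i Hi. unfold D, slide. destruct (Nat.eq_dec i v) as [->|N]; [|split; apply cv_const].
      pose proof tau_seq_cv. split; simpl.
      - replace (fst (C v)) with (fst (C v) + 0 * (fst (C w) - fst (C v))) at 1 by ring. cvt.
      - replace (snd (C v)) with (snd (C v) + 0 * (snd (C w) - snd (C v))) at 1 by ring. cvt. }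
    pose proof (annot_spcv G D C HG Hcv (proj1 HC)) as Hsp.
    destruct (ev_exists _ (spcv_near G _ _ (e / 2) Hsp ltac:(lra))) as [n Hn].
    pose proof (tau_seq n) as Ht.
    destruct (zeros_le G C (D n) (nE G)) as [_ Hlt].
    { intros m Hm. eapply (slide_zero G HG C HC k k' u v w); eauto. }
    assert (Hlt' : (zeros G (D n) (nE G) < z)%nat).
    { rewrite Ez. apply Hlt. exists k. split; auto. split.
      - destruct Ek as [[A B]|[A B]]; rewrite A, B; auto.
      - eapply (slide_k_nonzero G HG C HC k k' u v w); eauto. }
    destruct (IH _ Hlt' (D n) eq_refl) with (e := e / 2) as [E [E1 [E2 E3]]]; [| |lra|].
    + eapply (slide_tidy G HG C HC k k' u v w); eauto.
    + intros i Hi. unfold D, slide. destruct (Nat.eq_dec i v) as [->|N]; auto.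
      exfalso. destruct (ends_lt G HG k u v Hk Ek). lia.
    + exists E. split; auto. split; auto. replace e with (e / 2 + e / 2) by field.
      apply near_trans with (Annot G (D n)); auto.
  - assert (Hall : forall i, (i < nV G)%nat -> C i = C O).
    { induction i as [|i IHi]; intros Hi; auto. rewrite <- IHi by lia.
      destruct (g_path G HG i Hi) as [k [Hk [A B]]]. symmetry. apply NNPP. intros F. apply Hnz.
      exists k. rewrite A, B. auto. }
    set (D := fun n i => if lt_dec i (nV G) then
      (fst (C O) + / INR (S (S n)) * INR i, snd (C O) + / INR (S (S n)) * (INR i * INR i)) else (0, 0) : pt).
    assert (Hcv : confcv G D C).
    { intros i Hi. rewrite (Hall i Hi). pose proof tau_seq_cv. unfold D. destruct (lt_dec i (nV G)); [|lia].
      split; simpl.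
      - replace (fst (C O)) with (fst (C O) + 0 * INR i) at 1 by ring. cvt.
      - replace (snd (C O)) with (snd (C O) + 0 * (INR i * INR i)) at 1 by ring. cvt. }
    pose proof (annot_spcv G D C HG Hcv (proj1 HC)) as Hsp.
    destruct (ev_exists _ (spcv_near G _ _ e Hsp He)) as [n Hn].
    exists (D n). split; [|split; auto].
    + pose proof (HS (C O) (/ INR (S (S n))) (proj1 (tau_seq n))) as S0.
      assert (Hsame : forall i, (i < nV G)%nat -> D n i =
        (fst (C O) + / INR (S (S n)) * INR i, snd (C O) + / INR (S (S n)) * (INR i * INR i))).
      { intros i Hi. unfold D. destruct (lt_dec i (nV G)); [reflexivity|lia]. }
      destruct S0 as [A1 [A2 A3]]. split; [|split].
      * intros k Hk. rewrite !Hsame by auto using g_src, g_tgt. now apply A1.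
      * intros k v Hk Hv N1 N2. rewrite !Hsame by auto using g_src, g_tgt. now apply A2.
      * intros k m Hk Hm. rewrite !Hsame by auto using g_src, g_tgt. now apply A3.
    + intros i Hi. unfold D. destruct (lt_dec i (nV G)); [lia|auto].
Qed.

(** Otherwise neighbouring bars would be both zero or both nonzero, and so all bars alike. *)
Lemma open_has_joint n : has_joint (open_chain n).
Proof.
  intros C [a [Ha Za]] [b [Hb Zb]]. simpl in *.
  assert (H : exists i, (S i < n)%nat /\
     ((C i = C (S i) /\ C (S i) <> C (S (S i))) \/ (C i <> C (S i) /\ C (S i) = C (S (S i))))).
  { apply NNPP. intros Hno.
    assert (Hiff : forall i, (S i < n)%nat -> (C i = C (S i) <-> C (S i) = C (S (S i)))).
    { intros i Hi. destruct (classic (C i = C (S i))), (classic (C (S i) = C (S (S i)))); try tauto;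
        exfalso; apply Hno; exists i; tauto. }
    assert (H0 : forall i, (i < n)%nat -> (C 0%nat = C 1%nat <-> C i = C (S i))).
    { induction i as [|i IH]; intros Hi; [tauto|]. rewrite IH by lia. apply Hiff. lia. }
    apply Zb. apply H0; auto. apply (H0 a); auto. }
  destruct H as [i [Hi [[A B]|[A B]]]].
  - exists i, (S i), i, (S i), (S (S i)). unfold ends. simpl. repeat split; auto; try lia.
  - exists (S i), i, (S (S i)), (S i), i. unfold ends. simpl. repeat split; auto; try lia.
Qed.

(** Going around the cycle from a zero bar, some zero bar is followed by a nonzero one. *)
Lemma closed_has_joint n : (3 <= n)%nat -> has_joint (closed_chain n).
Proof.
  intros Hn C [a [Ha Za]] [b [Hb Zb]].
  change (a < n)%nat in Ha. change (b < n)%nat in Hb.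
  rewrite (tgt_nx n Hn) in Za, Zb by auto. simpl in Za, Zb.
  assert (H : exists i, (i < n)%nat /\ C i = C (nx n i) /\ C (nx n i) <> C (nx n (nx n i))).
  { apply NNPP. intros Hno. apply Zb.
    apply (nx_ind n Hn (fun i => C i = C (nx n i)) a); auto.
    intros k Hk E. apply NNPP. intros F. apply Hno. exists k. auto. }
  destruct H as [i [Hi [A B]]]. pose proof (nx_lt n Hn i Hi) as Hj.
  exists i, (nx n i), i, (nx n i), (nx n (nx n i)).
  split; [exact Hi|]. split; [exact Hj|]. split; [apply not_eq_sym, nx_neq; auto|].
  split; [left; split; [reflexivity|now apply tgt_nx]|].
  split; [left; split; [reflexivity|now apply tgt_nx]|].
  split; [|auto]. intros m Hm [E|E].
  - right. exact E.
  - left. change (m < n)%nat in Hm. rewrite (tgt_nx n Hn) in E by auto.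
    rewrite <- (pv_nx n Hn m Hm), E. now apply pv_nx.
Qed.

(** A Vandermonde determinant: points of a parabola in the order of their indices are in convex
    position. *)
Lemma parabola_orient (p : pt) tau a b c :
  let q := fun i : nat => (fst p + tau * INR i, snd p + tau * (INR i * INR i)) : pt in
  orient (q a) (q b) (q c) = tau * tau * ((INR b - INR a) * (INR c - INR a) * (INR c - INR b)).
Proof. unfold orient. simpl. ring. Qed.

Lemma closed_parabola n p tau : (3 <= n)%nat -> 0 < tau -> simple_conf (closed_chain n)
  (fun i => (fst p + tau * INR i, snd p + tau * (INR i * INR i))).
Proof.
  intros Hn Ht. apply (convex_simple n Hn 1). intros v j Hv Hj N1 N2.
  rewrite (parabola_orient p tau v (nx n v) j), Rmult_1_l.
  apply Rmult_lt_0_compat; [nra|]. unfold nx in *. destruct (Nat.eq_dec (S v) n) as [E|N].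
  - assert (0 < INR j) by (apply lt_0_INR; lia). assert (INR j < INR v) by (apply lt_INR; lia).
    simpl. assert (0 < INR v * (INR v - INR j) * INR j); [|lra].
    apply Rmult_lt_0_compat; [apply Rmult_lt_0_compat|]; lra.
  - rewrite S_INR. destruct (lt_dec j v) as [L|L].
    + assert (INR j < INR v) by (apply lt_INR; lia). nra.
    + assert (INR (S v) < INR j) by (apply lt_INR; lia). rewrite S_INR in H. nra.
Qed.

Lemma open_parabola n p tau : 0 < tau -> simple_conf (open_chain n)
  (fun i => (fst p + tau * INR i, snd p + tau * (INR i * INR i))).
Proof.
  intros Ht. set (q := fun i : nat => (fst p + tau * INR i, snd p + tau * (INR i * INR i)) : pt).
  assert (Hpos : forall k j, 0 <= orient (q k) (q (S k)) (q j) /\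
    (j <> k -> j <> S k -> 0 < orient (q k) (q (S k)) (q j))).
  { intros k j. unfold q. rewrite (parabola_orient p tau k (S k) j), S_INR.
    assert (0 < tau * tau) by nra.
    destruct (Nat.eq_dec j k) as [->|N1]; [split; [nra|tauto]|].
    destruct (Nat.eq_dec j (S k)) as [->|N2]; [rewrite S_INR; split; [nra|tauto]|].
    assert (0 < (INR k + 1 - INR k) * (INR j - INR k) * (INR j - (INR k + 1))).
    { destruct (lt_dec j k) as [L|L].
      - assert (INR j < INR k) by (apply lt_INR; lia). nra.
      - assert (INR (S k) < INR j) by (apply lt_INR; lia). rewrite S_INR in *. nra. }
    split; [|intros _ _]; nra. }
  split; [|split].
  - intros k _ E. change (q k = q (S k)) in E. assert (F := f_equal fst E). unfold q in F. cbn [fst] in F.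
    rewrite S_INR in F. lra.
  - intros k v _ _ N1 N2 [t [_ E]]. change (v <> k) in N1. change (v <> S k) in N2.
    change (q v = (fst (q k) + t * (fst (q (S k)) - fst (q k)), snd (q k) + t * (snd (q (S k)) - snd (q k)))) in E.
    destruct (Hpos k v) as [_ P]. specialize (P N1 N2). rewrite E in P. unfold orient in P. cbn [fst snd] in P. lra.
  - intros k m _ _ [P _]. change (orient (q k) (q (S k)) (q m) * orient (q k) (q (S k)) (q (S m)) < 0) in P.
    destruct (Hpos k m) as [P1 _]. destruct (Hpos k (S m)) as [P2 _]. nra.
Qed.

Lemma open_approximable n : approximable (open_chain n).
Proof.
  apply unmerge_approximable; [apply open_good|apply open_has_joint|].
  intros; now apply open_parabola.
Qed.

Lemma closed_approximable n : (3 <= n)%nat -> approximable (closed_chain n).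
Proof.
  intros Hn. apply unmerge_approximable; [now apply closed_good|now apply closed_has_joint|].
  intros; now apply closed_parabola.
Qed.

(** * Connectedness *)

Lemma simple_nontouching G C : good_graph G -> simple_conf G C ->
  nontouching G (fun k => dist (C (src G k)) (C (tgt G k))) C.
Proof.
  intros HG HC. split; [now apply simple_touch_at_ends|].
  intros v w Hv Hw. split.
  - intros E. apply (simple_inj G C HG HC) in E; auto. subst. apply rt_refl.
  - intros H. clear Hv Hw. induction H as [x y [k [Hk [E _]]]|x|x y z _ I1 _ I2]; auto; [|congruence].
    exfalso. destruct HC as [H1 _]. apply (H1 k Hk). now apply dist_eq0.
Qed.

Lemma adm_NConf G l e B C : good_graph G -> e <= 1 -> adm G l e B C -> NConf 1 G l C.
Proof.
  intros HG He [HS [HO [HL _]]]. exists (fun k => dist (C (src G k)) (C (tgt G k))).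
  split; [|split; [split; auto|now apply simple_nontouching]].
  intros k Hk. split; [apply dist_nonneg|]. specialize (HL k Hk). lra.
Qed.

Definition zero_outside (G : lgraph) (P : space) : Prop :=
  (forall i, (nV G <= i)%nat -> fst P i = (0, 0)) /\
  (forall k m, (nE G <= k)%nat \/ (nE G <= m)%nat -> snd P k m = 0).

Lemma near_spcv G (P Q : nat -> space) W : (forall n, near G (/ INR (S n)) (P n) (Q n)) ->
  spcv G P W -> spcv G Q W.
Proof.
  intros Hn [A B].
  assert (Z : forall u v l, (forall n, Rabs (u n - v n) < / INR (S n)) -> Un_cv u l -> Un_cv v l).
  { intros u v l H Hu.
    apply (cv_ext (fun n => u n - (u n - v n))); [intros; ring|].
    replace l with (l - 0) by ring. apply CV_minus; auto.
    apply (cv_squeeze0 _ (fun n => / INR (S n))); [apply cv_inv_S|]. exists O. intros n _.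
    rewrite Rminus_0_r. left. auto. }
  split.
  - intros i Hi. destruct (A i Hi) as [A1 A2].
    split; [apply (Z (fun n => fst (fst (P n) i)))|apply (Z (fun n => snd (fst (P n) i)))]; auto;
      intros n; destruct (Hn n) as [H _]; apply (H i Hi).
  - intros k m Hk Hm. apply (Z (fun n => snd (P n) k m)); auto.
    intros n. destruct (Hn n) as [_ H]. auto.
Qed.

(** Annotations are bounded by bar lengths, so they subconverge too; the matrix is flattened to the
    single index [k * E + m] for [BW_family]. *)
Lemma adm_compact G l B u : good_graph G -> (forall n, adm G l 1 B (u n)) ->
  exists phi W, extr phi /\ spcv G (fun n => Annot G (u (phi n))) W /\ zero_outside G W.
Proof.
  intros HG Hu. destruct (adm_bound G l 1 B HG) as [M HM].
  destruct (conf_compact G u M) as [phi [C [Hphi [Hcv HO]]]].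
  { intros n i Hi. now apply (HM (u n) (Hu n)). }
  set (E := nE G).
  destruct (BW_family (E * E) (fun n i => snd (Annot G (u (phi n))) (i / E)%nat (i mod E)%nat) M)
    as [psi [A [Hpsi HA]]].
  { intros n i Hi. assert (HE : (0 < E)%nat) by nia.
    assert (H1 : (i / E < E)%nat) by (apply Nat.Div0.div_lt_upper_bound; lia).
    assert (H2 : (i mod E < E)%nat) by (apply Nat.mod_upper_bound; lia).
    rewrite annot_snd by auto. eapply Rle_trans; [apply Ord_bound|]. now apply (HM _ (Hu (phi n))). }
  exists (fun n => phi (psi n)),
    (C, fun k m => if lt_dec k E then if lt_dec m E then A (k * E + m)%nat else 0 else 0).
  split; [now apply extr_comp|]. split; [split|split]; simpl.
  - apply (confcv_subseq G (fun n => u (phi n)) C psi Hpsi Hcv).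
  - intros k m Hk Hm. fold E in Hk, Hm. destruct (lt_dec k E); [|lia]. destruct (lt_dec m E); [|lia].
    pose proof (HA (k * E + m)%nat ltac:(nia)) as H.
    assert (D1 : ((k * E + m) / E = k)%nat).
    { rewrite Nat.div_add_l by lia. rewrite Nat.div_small by lia. lia. }
    assert (D2 : ((k * E + m) mod E = m)%nat).
    { rewrite Nat.add_comm, Nat.Div0.mod_add. apply Nat.mod_small. lia. }
    rewrite D1, D2 in H. exact H.
  - exact HO.
  - intros k m H. fold E in H. destruct (lt_dec k E), (lt_dec m E); auto; lia.
Qed.

Lemma inv_S_small e : 0 < e -> exists N, forall n, (N <= n)%nat -> / INR (S n) <= e.
Proof.
  intros He. destruct (cv_ev _ _ e cv_inv_S He) as [N HN]. exists N. intros n Hn.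
  specialize (HN n Hn). apply Rabs_def2 in HN. lra.
Qed.

Lemma inv_S_pos n : 0 < / INR (S n).
Proof. apply Rinv_0_lt_compat, lt_0_INR. lia. Qed.

Lemma inv_S_mono n m : (n <= m)%nat -> / INR (S m) <= / INR (S n).
Proof. intros H. apply Rinv_le_contravar; [apply lt_0_INR; lia|apply le_INR; lia]. Qed.

Lemma inv_S_le1 n : / INR (S n) <= 1.
Proof. rewrite <- Rinv_1. apply Rinv_le_contravar; [lra|]. rewrite S_INR. pose proof (pos_INR n). lra. Qed.

Lemma near_third G e P Q R' S : near G (e / 3) P Q -> near G (e / 3) Q R' -> near G (e / 3) R' S -> near G e P S.
Proof.
  intros H1 H2 H3. replace e with (e / 3 + e / 3 + e / 3) by field. eapply near_trans; eauto.
  eapply near_trans; eauto.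
Qed.

Section Class.

Variable G : lgraph.
Hypothesis HG : good_graph G.
Hypothesis HV : (0 < nV G)%nat.
Variable l : nat -> R.
(** Instantiated with the straight chains and with the convex polygons of each orientation. *)
Variable goal : (nat -> pt) -> Prop.

Definition tame (e B : R) (x : nat -> pt) : Prop :=
  adm G l e B x /\ exists y, chain G l e B x y /\ goal y.

(* Limits of nontouching configurations that can be chained, with vanishing error, to [goal]. *)
Definition class_at (B : R) (P : space) : Prop :=
  NCConf0 G l P /\ forall e, 0 < e -> exists x, tame e B x /\ near G e (Annot G x) P.

Definition class (P : space) : Prop := exists B, class_at B P.

Lemma tame_mono e e' B B' x : e <= e' -> B <= B' -> tame e B x -> tame e' B' x.
Proof.
  intros He HB [A [y [Y1 Y2]]]. split; [eapply adm_mono; eauto|].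
  exists y. split; auto. eapply chain_mono; eauto.
Qed.

Lemma class_at_mono B B' P : B <= B' -> class_at B P -> class_at B' P.
Proof.
  intros HB [H1 H2]. split; auto. intros e He. destruct (H2 e He) as [x [X1 X2]].
  exists x. split; auto. apply (tame_mono e e B B'); auto. lra.
Qed.

(** The tolerances tend to 0, so the lengths are exact in the limit and every tolerance is
    eventually met. *)
Lemma class_limit B u W : (forall n, tame (/ INR (S n)) B (u n)) ->
  spcv G (fun n => Annot G (u n)) W -> zero_outside G W -> class_at B W.
Proof.
  intros Hu Hcv [HO1 HO2]. split; [split; [split|split]|]; auto.
  - intros k Hk. pose proof (g_src G HG k Hk) as Ha. pose proof (g_tgt G HG k Hk) as Hb.
    destruct Hcv as [Hc _].
    pose proof (cv_dist _ _ _ _ (Hc _ Ha) (Hc _ Hb)) as D. simpl in D.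
    eapply UL_sequence; [exact D|].
    apply (cv_squeeze0 _ (fun n => / INR (S n))); [apply cv_inv_S|]. exists O. intros n _.
    destruct (Hu n) as [[_ [_ [H _]]] _]. auto.
  - intros e He. destruct (ev_exists _ (spcv_near G _ _ e Hcv He)) as [n Hn].
    exists (Annot G (u n)). split; [|now apply near_sym].
    exists (u n). split; auto. destruct (Hu n) as [A _]. apply (adm_NConf G l (/ INR (S n)) B); auto.
    rewrite <- Rinv_1. apply Rinv_le_contravar; [lra|]. rewrite S_INR. pose proof (pos_INR n). lra.
  - intros e He. destruct (inv_S_small e He) as [N HN].
    destruct (spcv_near G _ _ e Hcv He) as [M HM].
    exists (u (max N M)). split; [|apply HM; lia].
    apply (tame_mono (/ INR (S (max N M))) e B B); [apply HN; lia|lra|auto].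
Qed.

Lemma tame_compact B u : (forall n, tame (/ INR (S n)) B (u n)) ->
  exists phi W, extr phi /\ spcv G (fun n => Annot G (u (phi n))) W /\ class_at B W.
Proof.
  intros Hu. destruct (adm_compact G l B u HG) as [phi [W [Hphi [Hcv HO]]]].
  { intros n. destruct (Hu n) as [A _]. apply (adm_mono G l (/ INR (S n)) 1 B B); auto; [apply inv_S_le1|lra]. }
  exists phi, W. split; auto. split; auto. apply (class_limit B (fun n => u (phi n))); auto.
  intros n. apply (tame_mono (/ INR (S (phi n))) _ B B); auto; [|lra].
  apply inv_S_mono. now apply extr_ge.
Qed.

Hypothesis goal_linked : forall e B y z, 0 < e -> adm G l e B y -> adm G l e B z -> goal y -> goal z ->
  chain G l e B y z.

(** For one bound [B] the class is compact, so the parts of a separation have a positive distance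
    [r]. Configurations of small tolerance lie within [r / 3] of the class, and the steps of a chain
    are at most [r / 3], so a chain cannot pass from one part to the other. *)
Lemma class_connected : connected G class.
Proof.
  intros [U [V [HU [HVo [Hcov [[P [CP UP]] [[Q [CQ VQ]] Hdis]]]]]]].
  destruct CP as [BP CP]. destruct CQ as [BQ CQ].
  (* A common bound puts both points into the same compact piece. *)
  set (B := Rmax BP BQ).
  apply (class_at_mono BP B) in CP; [|apply Rmax_l]. apply (class_at_mono BQ B) in CQ; [|apply Rmax_r].
  assert (HB : forall S, class_at B S -> class S) by (intros S H; now exists B).
  (* the two closed pieces are at positive distance *)
  assert (Hsep : exists r, 0 < r /\ forall p q, class_at B p -> U p -> class_at B q -> V q -> ~ near G r p q).
  { apply NNPP. intros Hno.
    assert (H : forall n, exists pq : space * space, (class_at B (fst pq) /\ U (fst pq)) /\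
      (class_at B (snd pq) /\ V (snd pq)) /\ near G (/ INR (S n)) (fst pq) (snd pq)).
    { intros n. apply NNPP. intros D. apply Hno. exists (/ INR (S n)). split; [apply inv_S_pos|].
      intros p q H1 H2 H3 H4 H5. apply D. exists (p, q). auto. }
    destruct (choice _ _ _ H) as [pq Hpq].
    assert (H' : forall n, exists x, tame (/ INR (S n)) B x /\ near G (/ INR (S n)) (Annot G x) (fst (pq n))).
    { intros n. destruct (Hpq n) as [[[_ A] _] _]. apply A, inv_S_pos. }
    destruct (choice _ _ _ H') as [x Hx].
    destruct (tame_compact B x) as [phi [W [Hphi [Hcv HW]]]]; [apply Hx|].
    assert (Sm : forall (F F' : nat -> space), (forall n, near G (/ INR (S n)) (F n) (F' n)) ->
       forall n, near G (/ INR (S n)) (F (phi n)) (F' (phi n))).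
    { intros F F' H1 n. apply (near_mono G (/ INR (S (phi n)))); auto. apply inv_S_mono. now apply extr_ge. }
    assert (Cp : spcv G (fun n => fst (pq (phi n))) W).
    { apply (near_spcv G (fun n => Annot G (x (phi n)))); auto.
      apply (Sm (fun n => Annot G (x n)) (fun n => fst (pq n))). apply Hx. }
    assert (Cq : spcv G (fun n => snd (pq (phi n))) W).
    { apply (near_spcv G (fun n => fst (pq (phi n)))); auto.
      apply (Sm (fun n => fst (pq n)) (fun n => snd (pq n))). apply Hpq. }
    destruct (Hcov W (HB W HW)) as [UW|VW].
    - destruct (HU W UW) as [e [He Hn]].
      destruct (ev_exists _ (spcv_near G _ _ e Cq He)) as [n Hn'].
      destruct (Hpq (phi n)) as [_ [[K1 K2] _]].
      apply (Hdis (snd (pq (phi n)))); auto. now apply Hn, near_sym.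
    - destruct (HVo W VW) as [e [He Hn]].
      destruct (ev_exists _ (spcv_near G _ _ e Cp He)) as [n Hn'].
      destruct (Hpq (phi n)) as [[K1 K2] _].
      apply (Hdis (fst (pq (phi n)))); auto. now apply Hn, near_sym. }
  destruct Hsep as [r [Hr Hsep]].
  assert (Hclose : exists e, 0 < e /\ forall z, tame e B z ->
     exists p, class_at B p /\ near G (r / 3) (Annot G z) p).
  { apply NNPP. intros Hno.
    assert (H : forall n, exists z, tame (/ INR (S n)) B z /\
      ~ exists p, class_at B p /\ near G (r / 3) (Annot G z) p).
    { intros n. apply NNPP. intros D. apply Hno. exists (/ INR (S n)). split; [apply inv_S_pos|].
      intros z Hz. apply NNPP. intros F. apply D. exists z. auto. }
    destruct (choice _ _ _ H) as [z Hz].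
    destruct (tame_compact B z) as [phi [W [Hphi [Hcv HW]]]]; [apply Hz|].
    destruct (ev_exists _ (spcv_near G _ _ (r / 3) Hcv ltac:(lra))) as [n Hn].
    destruct (Hz (phi n)) as [_ F]. apply F. exists W. auto. }
  destruct Hclose as [e1 [He1 Hclose]].
  set (e := Rmin e1 (r / 3)).
  assert (He : 0 < e) by (apply Rmin_glb_lt; lra).
  assert (Hee1 : e <= e1) by apply Rmin_l. assert (Her : e <= r / 3) by apply Rmin_r.
  destruct CP as [NP CP]. destruct CQ as [NQ CQ].
  destruct (CP e He) as [x [[Ax [x' [Cx Gx]]] Nx]].
  destruct (CQ e He) as [y [[Ay [y' [Cy Gy]]] Ny]].
  assert (Hch : chain G l e B x y).
  { apply rt_trans with x'; auto. apply rt_trans with y'.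
    - apply goal_linked; auto; eapply chain_adm; eauto.
    - now apply chain_sym. }
  (* Being near a point of the class in [U] is inherited along chains. *)
  assert (Hprop : forall z w, chain G l e B z w -> tame e B z ->
     (exists p, class_at B p /\ U p /\ near G (r / 3) (Annot G z) p) ->
     tame e B w /\ exists p, class_at B p /\ U p /\ near G (r / 3) (Annot G w) p).
  { intros z w H. induction H as [z w Hst|z|z w v _ I1 _ I2].
    - intros [Az [t [Ct Gt]]] [p [P1 [P2 P3]]].
      assert (Tw : tame e B w).
      { split; [apply Hst|]. exists t. split; auto. apply rt_trans with z; auto.
        apply chain_sym. now apply rt_step. }
      split; auto. destruct (Hclose w) as [q [Q1 Q2]].
      { apply (tame_mono e e1 B B); auto. lra. }
      destruct (Hcov q (HB q Q1)) as [Uq|Vq]; [exists q; auto|].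
      exfalso. apply (Hsep p q P1 P2 Q1 Vq).
      apply near_third with (Annot G z) (Annot G w); auto; [now apply near_sym|].
      apply near_mono with e; auto. apply Hst.
    - auto.
    - intros T H. destruct (I1 T H) as [T' H']. auto. }
  destruct (Hprop x y Hch) as [_ [p [P1 [P2 P3]]]].
  - split; auto. exists x'. auto.
  - exists P. split; [split; auto|]. split; auto. apply near_mono with e; auto.
  - apply (Hsep p Q P1 P2); [split; auto|auto|].
    apply near_mono with (r / 3 + e); [lra|]. apply near_trans with (Annot G y); auto. now apply near_sym.
Qed.

End Class.

(** The nontouching configurations from the closure are replaced by simple ones through
    [approximable]; each of the two approximations takes half of the error. *)
Lemma NCConf0_approx G l P : good_graph G -> approximable G -> NCConf0 G l P ->
  exists u, (forall n, simple_conf G (u n)) /\ (forall n i, (nV G <= i)%nat -> u n i = (0, 0)) /\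
    spcv G (fun n => Annot G (u n)) P.
Proof.
  intros HG HA [_ [_ HC]].
  assert (H : forall n, exists D, (simple_conf G D /\ (forall i, (nV G <= i)%nat -> D i = (0, 0))) /\
    near G (/ INR (S n)) P (Annot G D)).
  { intros n. pose proof (inv_S_pos n).
    destruct (HC (/ INR (S n) / 2) ltac:(lra)) as [Q [[C [[l' [_ [HCl HT]]] ->]] HN]].
    destruct (HA C (nontouching_tidy G l' C HCl HT) (proj1 HCl) (/ INR (S n) / 2) ltac:(lra)) as [D [D1 [D2 D3]]].
    exists D. split; auto. replace (/ INR (S n)) with (/ INR (S n) / 2 + / INR (S n) / 2) by lra.
    apply near_trans with (Annot G C); [exact HN|now apply near_sym]. }
  destruct (choice _ _ _ H) as [u Hu]. exists u. split; [apply Hu|]. split; [apply Hu|].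
  apply (near_spcv G (fun _ => P)); [apply Hu|]. split; [intros i Hi; split; apply cv_const|].
  intros. apply cv_const.
Qed.

(** For each tolerance one of the goals is reached; if the first fails for some tolerance, it fails
    for all smaller ones, where the second is then reached. *)
Lemma NCConf0_classes G l goal1 goal2 P : good_graph G -> (0 < nV G)%nat -> approximable G ->
  (forall y, simple_conf G y -> in_equilibrium G y -> goal1 y \/ goal2 y) ->
  NCConf0 G l P -> class G l goal1 P \/ class G l goal2 P.
Proof.
  intros HG HV HA Hgoal HP.
  destruct (NCConf0_approx G l P HG HA HP) as [u [U1 [U2 U3]]].
  pose proof HP as [[HO HL] _].
  (* The configurations used are within 1 of [P], hence the summand 1. *)
  set (B := Rmax (Rabs (fst (fst P O))) (Rabs (snd (fst P O))) + 1).
  assert (Hwork : forall e, 0 < e ->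
    (exists x, tame G l goal1 e B x /\ near G e (Annot G x) P) \/
    (exists x, tame G l goal2 e B x /\ near G e (Annot G x) P)).
  { intros e He.
    assert (E1 : ev (fun n => forall k, (k < nE G)%nat ->
       Rabs (dist (u n (src G k)) (u n (tgt G k)) - l k) <= e / 2)).
    { apply (ev_forall (nE G) (fun k n => Rabs (dist (u n (src G k)) (u n (tgt G k)) - l k) <= e / 2)).
      intros k Hk. destruct U3 as [Uc _].
      pose proof (cv_dist _ _ _ _ (Uc _ (g_src G HG k Hk)) (Uc _ (g_tgt G HG k Hk))) as D. simpl in D.
      rewrite (HL k Hk) in D. generalize (cv_ev _ _ (e / 2) D ltac:(lra)). apply ev_mono. intros; lra. }
    pose proof (spcv_near G _ _ e U3 He) as E2.
    pose proof (spcv_near G _ _ 1 U3 ltac:(lra)) as E3.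
    destruct (ev_exists _ (ev_and _ _ E1 (ev_and _ _ E2 E3))) as [n [F1 [F2 F3]]].
    (* Tolerance [e / 2] leaves [chain_to_equilibrium] room to change the lengths. *)
    assert (Ax : adm G l (e / 2) B (u n)).
    { split; auto. split; auto. split; auto. destruct F3 as [F3 _]. destruct (F3 O HV) as [X Y].
      simpl in X, Y. apply Rabs_def2 in X, Y.
      pose proof (Rmax_l (Rabs (fst (fst P O))) (Rabs (snd (fst P O)))).
      pose proof (Rmax_r (Rabs (fst (fst P O))) (Rabs (snd (fst P O)))).
      pose proof (Rabs_le_inv (fst (fst P O)) _ (Rle_refl _)).
      pose proof (Rabs_le_inv (snd (fst P O)) _ (Rle_refl _)).
      unfold B. split; apply Rabs_le; lra. }
    destruct (chain_to_equilibrium G l (e / 2) e B (u n) HG ltac:(lra) HV Ax) as [y [Cy Ey]].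
    assert (Ax' : adm G l e B (u n)) by (apply (adm_mono G l (e / 2) e B B); auto; lra).
    pose proof (chain_adm G l e B _ _ Cy Ax') as [Sy _].
    destruct (Hgoal y Sy Ey) as [G1|G2]; [left|right]; exists (u n); (split; [|auto]);
      (split; [auto|]); exists y; auto. }
  destruct (classic (forall e, 0 < e -> exists x, tame G l goal1 e B x /\ near G e (Annot G x) P)) as [H|H].
  - left. exists B. split; auto.
  - right. exists B. split; auto. intros e He. apply NNPP. intros F. apply H. intros e0 He0.
    set (e' := Rmin e e0). assert (He' : 0 < e') by (apply Rmin_glb_lt; auto).
    assert (M1 : e' <= e) by apply Rmin_l. assert (M2 : e' <= e0) by apply Rmin_r.
    destruct (Hwork e' He') as [[x [X1 X2]]|[x [X1 X2]]].
    + exists x. split; [apply (tame_mono G l goal1 e' e0 B B)|apply near_mono with e']; auto; lra.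
    + exfalso. apply F. exists x.
      split; [apply (tame_mono G l goal2 e' e B B)|apply near_mono with e']; auto; lra.
Qed.

Lemma connected_ext G (S T : space -> Prop) : (forall P, S P <-> T P) -> connected G S -> connected G T.
Proof.
  intros H HS [U [V [H1 [H2 [H3 [[P [P1 P2]] [[Q [Q1 Q2]] H4]]]]]]]. apply HS.
  exists U, V. split; auto. split; auto. split; [intros; apply H3, H; auto|].
  split; [exists P; split; auto; now apply H|]. split; [exists Q; split; auto; now apply H|].
  intros X HX. apply H4. now apply H.
Qed.

Theorem mainTheorem8 :
  (forall (n : nat) (l : nat -> R),
     (forall k, (k < n)%nat -> 0 <= l k) ->
     connected (open_chain n) (NCConf0 (open_chain n) l)) /\
  (forall (n : nat) (l : nat -> R),
     (3 <= n)%nat ->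
     (forall k, (k < n)%nat -> 0 <= l k) ->
     at_most_two_components (closed_chain n) (NCConf0 (closed_chain n) l)).
Proof.
  split.
  - intros n l _. apply (connected_ext _ (class (open_chain n) l (straight n))).
    + intros P. split; [intros [B [H _]]; exact H|]. intros HP.
      destruct (NCConf0_classes (open_chain n) l (straight n) (straight n) P (open_good n)
        (Nat.lt_0_succ n) (open_approximable n)); auto.
      intros y Hy He. left. now apply open_equilibrium_straight.
    + apply class_connected; [apply open_good|simpl; lia|].
      intros. now apply straight_chain.
  - intros n l Hn _ P1 P2 P3 H1 H2 H3.
    set (G := closed_chain n) in *. pose proof (closed_good n Hn) as HG. fold G in HG.
    assert (Hcl : forall P, NCConf0 G l P -> class G l (convex n 1) P \/ class G l (convex n (-1)) P).
    { intros P HP. apply NCConf0_classes; auto; [simpl; lia|now apply closed_approximable|].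
      intros y Hy He. destruct (closed_equilibrium_convex n Hn y Hy He) as [sg [[-> | ->] K]]; auto. }
    assert (Hcon : forall sg, sg = 1 \/ sg = -1 -> (forall P, class G l (convex n sg) P -> NCConf0 G l P) /\
      connected G (class G l (convex n sg))).
    { intros sg Hsg. split; [intros P [B [H _]]; exact H|]. apply class_connected; auto; [simpl; lia|].
      intros. now apply (convex_chain n Hn sg). }
    destruct (Hcon 1 (or_introl eq_refl)) as [S1 K1]. destruct (Hcon (-1) (or_intror eq_refl)) as [S2 K2].
    (* Two of the three points lie in the class of the same orientation. *)
    destruct (Hcl P1 H1) as [A1|A1], (Hcl P2 H2) as [A2|A2], (Hcl P3 H3) as [A3|A3];
      try (exists (class G l (convex n 1)); split; [exact S1|split; [exact K1|tauto]]);
      exists (class G l (convex n (-1))); (split; [exact S2|split; [exact K2|tauto]]).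
Qed.
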